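(* Let $q_j(n)=jn$ for $j=1,\dots,\ell$, and suppose that the setting and the standing assumptions described in the context hold and that Assumption (A) of the context is satisfied with $b=2$ and some $\alpha,\lambda\ge 1$. Let $\xi_N=\frac1{\sqrt N}\sum_{n=1}^N F(X(n),X(2n),\dots,X(\ell n))$ and $\sigma^2=\lim_{N\to\infty}\mathrm{Var}(\xi_N)$. Let $\{X^{(i)}(n)\}_{n\ge 0}$, $i=1,\dots,\ell$, be $\ell$ independent copies of the process $\{X(n)\}_{n\ge 0}$ and set $$Z_n=F\big(X^{(1)}(n),X^{(2)}(2n),\dots,X^{(\ell)}(\ell n)\big)\quad\text{and}\quad \Sigma_N=\sum_{n=1}^N Z_n .$$ Then the limit $s^2=\lim_{n\to\infty}\frac1n\mathrm{Var}(\Sigma_n)$ exists. Moreover, $\sigma^2>0$ if and only if $s^2>0$, and the latter holds if and only if there exists no representation of the form $$Z_n=V_{n+1}-V_n,\qquad n=0,1,2,\dots,$$ where $\{V_n\}_{n\ge 0}$ is a square integrable weakly (i.e. in the wide sense) stationary process. Furthermore, $s^2=0$ if and only if $\mathrm{Var}(\Sigma_N)$ is bounded in $N$, and in that case, for all $N\ge 2$, $$\mathrm{Var}(\xi_N)\le C N^{-1}\ln^2 N$$ for some $C>0$ independent of $N$.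
   Context: Setting. Let $\wp,\ell\ge 1$ be integers, $(\Omega,\mathcal F,P)$ a probability space, $\{X(n)\}_{n\ge 0}$ an $\mathbb R^{\wp}$-valued stochastic process on it, and $\mathcal F_{k,l}\subset\mathcal F$, $-\infty\le k\le l\le\infty$, a family of $\sigma$-algebras with $\mathcal F_{k,l}\subset\mathcal F_{k',l'}$ whenever $k'\le k$ and $l'\ge l$. Write $\|\cdot\|_q$ for the $L^q(\Omega,\mathcal F,P)$ norm. For sub-$\sigma$-algebras $\mathcal G,\mathcal H\subset\mathcal F$ put $$\varpi_{q,p}(\mathcal G,\mathcal H)=\sup\{\|E(g|\mathcal G)-Eg\|_p:\ g\in L^q(\Omega,\mathcal H,P),\ \|g\|_q\le 1\},\quad \varpi_{q,p}(n)=\sup_{k\ge 0}\varpi_{q,p}(\mathcal F_{-\infty,k},\mathcal F_{k+n,\infty}),$$ and $\beta(q,r)=\sup_{k\ge 0}\|X(k)-E(X(k)|\mathcal F_{k-r,k+r})\|_q$. Standing assumptions. (i) The distribution $\mu$ of $X(n)$ does not depend on $n$, and the joint distribution of $(X(n),X(n'))$ depends only on $n-n'$. (ii) $F:(\mathbb R^{\wp})^{\ell}\to\mathbb R$ and, for some $K,\iota>0$, $\kappa\in(0,1]$ and all $x=(x_1,\dots,x_\ell)$, $y=(y_1,\dots,y_\ell)$, $$|F(x)-F(y)|\le K\Big(1+\sum_{i=1}^\ell(|x_i|^\iota+|y_i|^\iota)\Big)\sum_{i=1}^\ell|x_i-y_i|^\kappa,\qquad |F(x)|\le K\Big(1+\sum_{i=1}^\ell|x_i|^\iota\Big).$$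 (iii) $\int F(x_1,\dots,x_\ell)\,d\mu(x_1)\cdots d\mu(x_\ell)=0$. For $\theta>0$ let $\gamma_\theta=\left(\int|x|^\theta d\mu\right)^{1/\theta}$. Assumption (A). With $d=(\ell-1)\wp$ there exist $1\le p,q<\infty$, $b\ge 2$, $\alpha,\lambda\ge 0$ and $\delta,m>0$ with $\delta<\kappa-\frac dp$ such that $$\sum_{n\ge 1}n^\alpha\varpi_{q,p}(n)<\infty,\quad \sum_{r=1}^\infty r^\lambda(\beta(q,r))^\delta<\infty,\quad \gamma_m<\infty,\ \gamma_{bq\iota}<\infty,\quad \frac1b\ge\frac1p+\frac{\iota+2}{m}+\frac\delta q .$$ It is known that under Assumption (A) (with $b=2$, $\alpha=\lambda=0$) the limits $\lim_N \mathrm{Var}(\xi_N)$ and $\lim_N E\xi_N^2$ exist and coincide; $\sigma^2$ is this number. *)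

(* Defs.v *)
From HB Require Import structures.
From mathcomp Require Import all_boot all_order all_algebra.
From mathcomp Require Import all_classical all_reals all_analysis.
From mathcomp Require Import measurable_realfun.

Set Implicit Arguments.
Unset Strict Implicit.
Unset Printing Implicit Defensive.

Import Order.TTheory GRing.Theory Num.Theory.
Import numFieldNormedType.Exports.

Local Open Scope classical_set_scope.
Local Open Scope ring_scope.

(* Points of R^n are n-tuples, which carry the product (= Borel) sigma-algebra;
   |.| is the Euclidean norm. *)
Definition enorm (R : realType) n (x : n.-tuple R) : R :=
  Num.sqrt (\sum_(i < n) tnth x i ^+ 2).

Definition edist (R : realType) n (x y : n.-tuple R) : R :=
  enorm [tuple tnth x i - tnth y i | i < n].

Section conditional_expectation.
Context d (T : measurableType d) (R : realType) (P : probability T R).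
Implicit Types (G : set (set T)) (f h : T -> R).

Definition sub_measurable G f :=
  forall B : set R, measurable B -> G (f @^-1` B).

Definition is_condexp G f h :=
  [/\ sub_measurable G h,
      P.-integrable setT (EFin \o h) &
      forall A, G A ->
        (\int[P]_(w in A) (h w)%:E = \int[P]_(w in A) (f w)%:E)%E].

(* An arbitrary version of E(f | G); versions exist for integrable f and agree
   almost surely. *)
Definition condexp G f : T -> R := xget (cst 0) [set h | is_condexp G f h].

End conditional_expectation.

Lemma is_condexp_exists d (T : measurableType d) (R : realType)
    (P : probability T R) (G : set (set T)) (f : T -> R) :
  sigma_algebra setT G -> G `<=` measurable ->
  P.-integrable setT (EFin \o f) ->
  exists h, is_condexp P G f h.
Proof.
move=> sG Gm intf.
have GE A : <<s G >> A = G A by rewrite sigma_algebra_id.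
pose S : measurableType _ := g_sigma_algebraType G.
have SE (A : set S) : measurable A = G A by exact: GE.
pose phi : T -> S := fun x => x.
have mphi : measurable_fun setT phi.
  by move=> _ A mA; rewrite setTI; apply: Gm; rewrite SE in mA.
pose phi' : {mfun T >-> S} :=
  HB.pack phi (isMeasurableFun.Build _ _ _ _ phi mphi).
pose mu : probability S R := distribution P phi'.
have mphi' : measurable_fun setT phi' by exact: mphi.
pose nu0 : {charge set S -> \bar R} := pushforward (induced_charge intf) phi'.
pose nu := nu0 mphi'.
have dom : nu `<< mu.
  apply/null_content_dominatesP => A mA muA0.
  have GA : G A by rewrite -SE.
  have mf := measurable_funS measurableT (@subsetT _ (A : set T))
    (measurable_int _ intf).
  exact: (null_set_integral (Gm _ GA) mf muA0).
pose rn := Radon_Nikodym nu mu.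
have rnf x : rn x \is a fin_num by exact: Radon_Nikodym_fin_num.
have rni : mu.-integrable setT rn by exact: Radon_Nikodym_integrable.
have mrn : measurable_fun setT rn by exact: measurable_int rni.
have rnE : EFin \o (fine \o rn) = rn by apply/funext => x /=; rewrite fineK.
have rnP : P.-integrable setT (rn \o phi').
  apply/integrableP; split; first exact: measurableT_comp mrn mphi.
  have /integrableP[_] := rni.
  by rewrite ge0_integral_pushforward//; exact: measurableT_comp.
exists (fine \o rn); split.
- move=> B mB; rewrite -SE -[X in measurable X]setTI.
  by apply: (measurableT_comp _ mrn) => //; exact: fine_measurable.
- by rewrite rnE.
- move=> A GA; have mA : measurable (A : set S) by rewrite SE.
  rewrite (eq_integral (rn \o phi')); last by move=> x _ /=; rewrite fineK.
  have -> : (\int[P]_(w in A) (f w)%:E = nu A)%E by [].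
  rewrite (Radon_Nikodym_integral dom mA) /mu
    (integral_pushforward mphi' mrn) //.
  by apply: (integrableS measurableT _ _ rnP) => //; exact: Gm.
Qed.

Section dependence_coefficients.
Context d (T : measurableType d) (R : realType) (P : probability T R).
Local Open Scope ereal_scope.

(* FF k l stands for F_{k,l}, -oo <= k <= l <= +oo. *)
Definition sigma_algebra_family (FF : \bar int -> \bar int -> set (set T)) :=
  (forall k l, k <= l ->
     sigma_algebra setT (FF k l) /\ FF k l `<=` measurable) /\
  (forall k l k' l', k <= l -> k' <= k -> l <= l' -> FF k l `<=` FF k' l').

Definition varpi_alg (q p : R) (G H : set (set T)) : \bar R :=
  ereal_sup
    [set 'N[P]_p%:E[(fun w => (condexp P G g w - fine 'E_P[g])%R%:E)]
       | g in [set g : T -> R | sub_measurable H g /\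
                                'N[P]_q%:E[EFin \o g] <= 1]].

Definition varpi (FF : \bar int -> \bar int -> set (set T)) (q p : R) (n : nat)
  : \bar R :=
  ereal_sup (range (fun k : nat =>
    varpi_alg q p (FF -oo k%:Z%:E) (FF (k + n)%N%:Z%:E +oo))).

(* The conditional expectation of a random vector is taken coordinatewise. *)
Definition condexp_vec wp (G : set (set T)) (Z : T -> wp.-tuple R) (w : T)
  : wp.-tuple R :=
  [tuple condexp P G (fun v => tnth (Z v) i) w | i < wp].

Definition beta_coef wp (X : nat -> T -> wp.-tuple R)
    (FF : \bar int -> \bar int -> set (set T)) (q : R) (r : nat) : \bar R :=
  ereal_sup (range (fun k : nat =>
    'N[P]_q%:E[(fun w =>
      (edist (X k w)
         (condexp_vec (FF (k%:Z - r%:Z)%R%:E (k%:Z + r%:Z)%R%:E) (X k) w))%:E)])).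

End dependence_coefficients.

Section standing_assumptions.
Context d (T : measurableType d) (R : realType) (P : probability T R).
Context (wp ell : nat) (X : nat -> {RV P >-> wp.-tuple R}).

Definition stationary_pairs :=
  (forall n (A : set (wp.-tuple R)), measurable A ->
     P (X n @^-1` A) = P (X 0%N @^-1` A)) /\
  (forall n n' m m' : nat, n%:Z - n'%:Z = m%:Z - m'%:Z ->
     forall A : set (wp.-tuple R * wp.-tuple R), measurable A ->
       P [set w | A (X n w, X n' w)] = P [set w | A (X m w, X m' w)]).

Definition growth_condition (F : ell.-tuple (wp.-tuple R) -> R)
    (K iota kappa : R) :=
  (forall x y, `|F x - F y| <=
     K * (1 + \sum_(i < ell)
                (enorm (tnth x i) `^ iota + enorm (tnth y i) `^ iota))
       * \sum_(i < ell) edist (tnth x i) (tnth y i) `^ kappa) /\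
  (forall x, `|F x| <=
     K * (1 + \sum_(i < ell) enorm (tnth x i) `^ iota)).

Definition mu0 := distribution P (X 0%N).

Definition gamma_ (theta : R) : \bar R :=
  'N[mu0]_theta%:E[(fun x => (enorm x)%:E)].

Definition assumption_A (FF : \bar int -> \bar int -> set (set T))
    (iota kappa b alpha lambda : R) :=
  [/\ 2 <= b, 0 <= alpha, 0 <= lambda &
    exists p q delta m : R,
    [/\ [/\ 1 <= p, 1 <= q, 0 < delta & 0 < m],
        delta < kappa - (ell.-1 * wp)%:R / p,
        (\sum_(1 <= n <oo) ((n%:R `^ alpha)%:E * varpi P FF q p n) < +oo)%E /\
        (\sum_(1 <= r <oo)
           ((r%:R `^ lambda)%:E * beta_coef P X FF q r `^ delta) < +oo)%E,
        (gamma_ m < +oo)%E /\ (gamma_ (b * q * iota) < +oo)%E &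
        p^-1 + (iota + 2) / m + delta / q <= b^-1]].

End standing_assumptions.

(* The integral of f(x_1, ..., x_n) against dmu(x_1) ... dmu(x_n). *)
Fixpoint iter_integral d (V : measurableType d) (R : realType)
    (mu : {measure set V -> \bar R}) n : (n.-tuple V -> \bar R) -> \bar R :=
  match n with
  | 0 => fun f => f [tuple]
  | n'.+1 => fun f =>
      (\int[mu]_x iter_integral mu (fun t => f [tuple of x :: t]))%E
  end.

Section copies.
Context d (T : measurableType d) d' (T' : measurableType d') (R : realType).
Context (P : probability T R) (P' : probability T' R) (wp ell : nat).

(* Equality of all finite-dimensional distributions. *)
Definition same_law (X : nat -> {RV P >-> wp.-tuple R})
    (Y : nat -> {RV P' >-> wp.-tuple R}) :=
  forall k (t : k.-tuple nat) (A : set (k.-tuple (wp.-tuple R))), measurable A ->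
    P' [set w | A [tuple Y (tnth t j) w | j < k]] =
    P [set w | A [tuple X (tnth t j) w | j < k]].

Definition process_sigma (Y : nat -> {RV P' >-> wp.-tuple R}) : set (set T') :=
  <<s \bigcup_n preimage_set_system setT (Y n) measurable >>.

(* Subfamilies need not be considered: take A i = setT outside of them. *)
Definition independent_processes
    (Y : 'I_ell -> nat -> {RV P' >-> wp.-tuple R}) :=
  forall A : 'I_ell -> set T', (forall i, process_sigma (Y i) (A i)) ->
    (P' (\bigcap_i A i) = \prod_(i < ell) P' (A i))%E.

Definition independent_copies (X : nat -> {RV P >-> wp.-tuple R})
    (Y : 'I_ell -> nat -> {RV P' >-> wp.-tuple R}) :=
  (forall i, same_law X (Y i)) /\ independent_processes Y.

End copies.

Section sums.
Context d (T : measurableType d) (R : realType) (P : probability T R).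
Context (wp ell : nat) (F : ell.-tuple (wp.-tuple R) -> R).

(* 'I_ell starts at 0: the argument of F with index i is the one at time
   q_(i.+1)(n) = i.+1 * n. *)
Definition xi (X : nat -> T -> wp.-tuple R) (N : nat) (w : T) : R :=
  (Num.sqrt N%:R)^-1 *
  \sum_(1 <= n < N.+1) F [tuple X (i.+1 * n)%N w | i < ell].

Definition Z_ (Y : 'I_ell -> nat -> T -> wp.-tuple R) (n : nat) (w : T) : R :=
  F [tuple Y i (i.+1 * n)%N w | i < ell].

Definition Sigma_ (Y : 'I_ell -> nat -> T -> wp.-tuple R) (N : nat) (w : T) : R :=
  \sum_(1 <= n < N.+1) Z_ Y n w.

(* Membership in Lfun P 2 includes measurability. *)
Definition L2_weakly_stationary (V : nat -> T -> R) :=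
  [/\ forall n, V n \in Lfun P 2%:E,
      forall n, 'E_P[V n]%E = 'E_P[V 0%N]%E &
      forall n m k, covariance P (V (n + k)%N) (V (m + k)%N) =
                    covariance P (V n) (V m)].

(* Equality of processes is almost sure for each n. *)
Definition coboundary (Z V : nat -> T -> R) :=
  forall n, {ae P, forall w, Z n w = V n.+1 w - V n w}.

End sums.

(* Main.v *)
(* Hoeffding's decomposition writes F as the sum of pieces F_i depending on the
   first i arguments and centered in the i-th one.  Chaining over dyadic cells
   and Young's inequality turn the mixing rate varpi(r) and the approximation
   rate beta(r)^delta into a bound, by the gap r, on the error made when the
   latest arguments of a product of two pieces are replaced by independent ones;
   the exponents of Assumption (A) are what makes the chaining sums converge.
   Consequently the covariances of F_i(X(n), ..., X(in)) and F_j(X(m), ..., X(jm))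
   decay in |in - jm| and converge along the rays in = jm, and for i = j, near
   the diagonal, they agree with those of the independent copies, for which
   different pieces are orthogonal and each piece is stationary with covariance
   r_i and sum_k k |r_i(k)| finite.

   Hence Var(Sigma_N) = N s^2 + O(1), where s^2 is the sum of the slopes
   s_i >= 0 of the pieces.  If all s_i vanish, every piece has bounded variance
   along X as well, so that N Var(xi_N) is bounded, and Z is the coboundary of
   the partial sums recentered by the L2 limit of their Cesaro means.  If s_i > 0
   for a largest i, the part n > (1 - 1/i) N of the i-th sum is almost
   uncorrelated with the sums of the lower pieces while those of the higher
   pieces stay bounded, so the variance along X grows linearly too. *)
Require Import Defs.
From HB Require Import structures.
From mathcomp Require Import all_boot all_order all_algebra.
From mathcomp Require Import all_classical all_reals all_analysis.
From mathcomp Require Import measurable_realfun ring lra zify.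

Set Implicit Arguments.
Unset Strict Implicit.
Unset Printing Implicit Defensive.

Import Order.TTheory GRing.Theory Num.Theory.
Import numFieldNormedType.Exports.

Local Open Scope classical_set_scope.
Local Open Scope ring_scope.

(** * Integrals against a probability *)

Section expectation.
Context d (T : measurableType d) (R : realType) (P : probability T R).
Implicit Types (f g : T -> R).

(** The coefficient [varpi] controls [E(g | past)] for one fixed function [g] of the future, whereas
    here the function of the future carries past values as random parameters. Rounding those
    parameters to cells leaves fixed functions only, at a price: in [D] dimensions level [s] costs
    [2^(s D / p)] against increments of size [2^(-s kappa)], whence the requirement [D < kappa p].
    Only the latest time slot is integrated at each step, so the chained parameters of a factor miss
    at least one slot and [D] is at most [(ell - 1) wp]. Laws are compared one group of coordinates
    at a time; as stationarity is given for pairs of times, the groups are chosen to involve at most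
    two times. Finally [alpha, lambda >= 1] makes the sum of [k (varpi k + beta k ^ delta)] finite:
    about [k] index pairs share a gap [k], so the variance of each piece along [X] differs from that
    of its copy by [O(1)], and for a piece of zero slope the variances along the copies even
    converge, which the construction of the primitive requires. *)

Definition Int f := P.-integrable setT (EFin \o f).

Lemma Int_meas f : Int f -> measurable_fun setT f.
Proof. by move=> /measurable_int /measurable_EFinP. Qed.

Lemma Int_ext g f : Int g -> (forall w, f w = g w) -> Int f.
Proof. by move=> ig /funext ->. Qed.

Lemma Int_dom g f : measurable_fun setT f -> Int g ->
  (forall w, `|f w| <= g w) -> Int f.
Proof.
move=> mf ig fg; apply: (le_integrable measurableT _ _ ig).
  exact/measurable_EFinP.
move=> w _ /=; rewrite !lee_fin.
by apply: (le_trans (fg w)); rewrite ler_norm.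
Qed.

Lemma Int_cst c : Int (fun=> c).
Proof. exact: finite_measure_integrable_cst. Qed.

Lemma IntD f g : Int f -> Int g -> Int (fun w => f w + g w).
Proof. by move=> f0 g0; exact: (integrableD measurableT f0 g0). Qed.

Lemma IntB f g : Int f -> Int g -> Int (fun w => f w - g w).
Proof. by move=> f0 g0; exact: (integrableB measurableT f0 g0). Qed.

Lemma IntZ c f : Int f -> Int (fun w => c * f w).
Proof. by move=> f0; exact: (integrableZl measurableT c f0). Qed.

Lemma IntZr c f : Int f -> Int (fun w => f w * c).
Proof.
by move=> /(IntZ c); rewrite (_ : (fun w => _ * c) = fun w => c * f w)//;
  apply/funext => w; rewrite mulrC.
Qed.

Lemma Int_norm f : Int f -> Int (fun w => `|f w|).
Proof. exact: integrable_norm. Qed.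

Lemma Int_sum (I : Type) (s : seq I) (Q : pred I) (F : I -> T -> R) :
  (forall i, Q i -> Int (F i)) -> Int (fun w => \sum_(i <- s | Q i) F i w).
Proof.
move=> iF; elim: s => [|i s IH].
  by apply: (Int_ext (Int_cst 0)) => w; rewrite big_nil.
have H : Int (fun w => (if Q i then F i w else 0) + \sum_(j <- s | Q j) F j w).
  by apply: IntD => //; case: (boolP (Q i)) => [/iF//|_]; exact: Int_cst.
by apply: (Int_ext H) => w; rewrite big_cons; case: ifP; rewrite ?add0r.
Qed.

Lemma ExZ c f : Int f -> \int[P]_w (c * f w) = c * \int[P]_w f w.
Proof. by move=> ?; exact: RintegralZl. Qed.

Lemma ExZr c f : Int f -> \int[P]_w (f w * c) = (\int[P]_w f w) * c.
Proof. by move=> ?; exact: RintegralZr. Qed.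

Lemma ExD f g : Int f -> Int g ->
  \int[P]_w (f w + g w) = \int[P]_w f w + \int[P]_w g w.
Proof. by move=> ? ?; exact: RintegralD. Qed.

Lemma ExB f g : Int f -> Int g ->
  \int[P]_w (f w - g w) = \int[P]_w f w - \int[P]_w g w.
Proof. by move=> ? ?; exact: RintegralB. Qed.

Lemma Ex_cst (c : R) : \int[P]_w c = c.
Proof. by rewrite /Rintegral integral_cst// [X in (_ * X)%E](probability_setT P) mule1. Qed.

Lemma Ex_sum (I : Type) (s : seq I) (Q : pred I) (F : I -> T -> R) :
  (forall i, Q i -> Int (F i)) ->
  \int[P]_w (\sum_(i <- s | Q i) F i w) =
  \sum_(i <- s | Q i) \int[P]_w F i w.
Proof.
move=> iF; elim: s => [|i s IH].
  rewrite big_nil -[RHS]Ex_cst; apply: eq_Rintegral => w _.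
  by rewrite big_nil.
have -> : \int[P]_w (\sum_(j <- i :: s | Q j) F j w) =
  \int[P]_w ((if Q i then F i w else 0) + \sum_(j <- s | Q j) F j w).
  by apply: eq_Rintegral => w _; rewrite big_cons; case: ifP; rewrite ?add0r.
rewrite ExD; last 2 first.
- by case: (boolP (Q i)) => [/iF//|_]; exact: Int_cst.
- exact: Int_sum.
by rewrite big_cons IH; case: ifP; rewrite // Ex_cst add0r.
Qed.

Lemma Ex_ge0 f : (forall w, 0 <= f w) -> 0 <= \int[P]_w f w.
Proof. by move=> f0; exact: Rintegral_ge0. Qed.

Lemma Ex_le f g : Int f -> Int g -> (forall w, f w <= g w) ->
  \int[P]_w f w <= \int[P]_w g w.
Proof. by move=> *; exact: le_Rintegral. Qed.

Lemma Ex_abs f : Int f -> `|\int[P]_w f w| <= \int[P]_w `|f w|.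
Proof. by move=> *; exact: le_normr_Rintegral. Qed.

Lemma Ex_absle f g : Int f -> Int g -> (forall w, `|f w| <= g w) ->
  `|\int[P]_w f w| <= \int[P]_w g w.
Proof.
move=> If Ig fg; apply: (le_trans (Ex_abs If)).
by apply: Ex_le => //; exact: Int_norm.
Qed.

Lemma Ex_dist f g h : Int f -> Int g -> Int h ->
  (forall w, `|f w - g w| <= h w) ->
  `|\int[P]_w f w - \int[P]_w g w| <= \int[P]_w h w.
Proof. by move=> ? ? ? fg; rewrite -ExB//; apply: Ex_absle => //; exact: IntB. Qed.

Lemma integralEFin f : Int f -> (\int[P]_w (f w)%:E)%E = (\int[P]_w f w)%:E.
Proof. by move=> If; rewrite /Rintegral fineK//; exact: integrable_fin_num. Qed.

Lemma ge0_Int_le f c : measurable_fun setT f -> (forall w, 0 <= f w) ->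
  (\int[P]_w (f w)%:E <= c%:E)%E -> Int f /\ \int[P]_w f w <= c.
Proof.
move=> mf f0 fc.
have If : Int f.
  apply/integrableP; split; first exact/measurable_EFinP.
  under eq_integral => w _ do rewrite gee0_abs ?lee_fin//.
  by apply: (le_lt_trans fc); exact: ltry.
by split => //; rewrite -lee_fin -integralEFin.
Qed.

Lemma Ex_indic (A : set T) : measurable A -> \int[P]_w \1_A w = fine (P A).
Proof. by move=> mA; rewrite /Rintegral integral_indic// setIT. Qed.

Lemma Int_indic (A : set T) : measurable A -> Int (fun w => \1_A w).
Proof.
move=> mA; have m1 : measurable_fun setT (\1_A : T -> R).
  exact: measurable_indic.
apply: (Int_dom m1 (Int_cst 1)).
by move=> w; rewrite indicE; case: (_ \in _); rewrite ?normr0 ?normr1.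
Qed.

Lemma Ex_cvg (f : nat -> T -> R) (h g : T -> R) :
  (forall n, measurable_fun setT (f n)) -> Int g ->
  (forall n w, `|f n w| <= g w) ->
  (forall w, f ^~ w @ \oo --> h w) ->
  Int h /\ (fun n => \int[P]_w f n w) @ \oo --> \int[P]_w h w.
Proof.
move=> mf ig fg fh.
have mh : measurable_fun setT h by apply: (measurable_fun_cvg mf) => w _; exact: fh.
have [|||||Ih _ Il] := @dominated_convergence _ _ _ P setT measurableT
  (fun n => EFin \o f n) (EFin \o h) (EFin \o g).
- by move=> n; exact/measurable_EFinP.
- exact/measurable_EFinP.
- by apply/nearW => w _ /=; apply: cvg_EFin; [exact/nearW|exact: fh].
- exact: ig.
- by apply/nearW => w n _ /=; rewrite lee_fin.
split => //.
have /fine_cvgP[_ //] :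
  (fun n => \int[P]_w (f n w)%:E)%E @ \oo --> (\int[P]_w h w)%:E.
by rewrite -(integralEFin Ih); exact: Il.
Qed.

Lemma EFin_Ex_le f g : measurable_fun setT f -> (forall w, 0 <= f w) -> Int g ->
  (forall w, f w <= g w) -> Int f /\ \int[P]_w f w <= \int[P]_w g w.
Proof.
move=> mf f0 ig fg; have If : Int f.
  by apply: (Int_dom mf ig) => w; rewrite ger0_norm.
by split=> //; exact: Ex_le.
Qed.

End expectation.

(** * Dyadic rounding and Hoelder functions *)

Section rounding.
Context {R : realType}.
Implicit Types (S s k : nat) (x y : R).

Definition clip S x : R := Num.max (- 2 ^+ S) (Num.min x (2 ^+ S)).

(* Dyadic rounding at mesh 2^-s of x clipped to [-2^S, 2^S]: [cell S s x] is the
   index of the cell and [node S s k] its left endpoint. *)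
Definition cell S s x : nat := Num.truncn ((clip S x + 2 ^+ S) * 2 ^+ s).
Definition node S s k : R := k%:R / 2 ^+ s - 2 ^+ S.
Definition rnd S s x : R := node S s (cell S s x).
(** The shifted clipped value is at most [2^(S+1)], so at the finest mesh [s = S] the index is at
    most [2^(2S+1)], the right endpoint included. Sizing for the finest mesh lets all levels share
    one finite index type. *)
Definition ncell S : nat := (2 ^ (S + S + 1)).+1.

Lemma exp2_gt0 S : 0 < 2 ^+ S :> R.
Proof. by rewrite exprn_gt0. Qed.

Lemma exp2_ge1 S : 1 <= 2 ^+ S :> R.
Proof. by rewrite exprn_ege1// ler1n. Qed.

Lemma clip_itv S x : - 2 ^+ S <= clip S x <= 2 ^+ S.
Proof.
have h := exp2_gt0 S; rewrite /clip le_max lexx/= ge_max ge_min lexx orbT andbT.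
lra.
Qed.

Lemma clip_le S x : `|clip S x| <= `|x|.
Proof.
have L0 := exp2_gt0 S; rewrite /clip.
have [h1|h1] := leP (2 ^+ S) x.
  by rewrite (max_idPr _) ?ger0_norm; lra.
have [h2|h2//] := leP x (- 2 ^+ S).
by rewrite !ler0_norm; lra.
Qed.

(** Beyond [2^S] one factor [|x|] is traded for [2^-S], which puts the clipping error on the scale
    of the mesh error at the price of quadratic growth. *)
Lemma clip_tail S x : `|x - clip S x| <= x ^+ 2 / 2 ^+ S.
Proof.
have L0 := exp2_gt0 S; rewrite ler_pdivlMr//.
rewrite /clip; set L : R := 2 ^+ S in L0 *.
have [h1|h1] := leP (2 ^+ S) x; rewrite -/L in h1 *.
  rewrite (max_idPr _); last lra.
  by rewrite ger0_norm; nra.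
have [h2|h2] := leP x (- L).
  by rewrite ler0_norm; nra.
by rewrite subrr normr0; nra.
Qed.

Lemma cell_itv S s x :
  node S s (cell S s x) <= clip S x < node S s (cell S s x) + (2 ^+ s)^-1.
Proof.
have /andP[c1 c2] := clip_itv S x; have s0 := exp2_gt0 s.
have /truncn_itv : 0 <= (clip S x + 2 ^+ S) * 2 ^+ s.
  by apply: mulr_ge0; [lra|exact: ltW].
rewrite -/(cell S s x) -(natr1 (cell S s x)) => /andP[h1 h2]; rewrite /node; apply/andP; split.
  by rewrite lerBlDr ler_pdivrMr.
have : clip S x + 2 ^+ S < ((cell S s x)%:R + 1) / 2 ^+ s by rewrite ltr_pdivlMr.
by rewrite mulrDl mul1r; lra.
Qed.

Lemma cell_lt S s x : (s <= S)%N -> (cell S s x < ncell S)%N.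
Proof.
move=> sS; rewrite /ncell ltnS /cell truncn_le_nat.
have /andP[c1 c2] := clip_itv S x; have s0 := exp2_gt0 s.
apply: (@le_lt_trans _ _ (2 ^ (S + S + 1))%:R); last by rewrite ltr_nat.
rewrite natrX !exprD expr1.
have h : 2 ^+ s <= 2 ^+ S :> R by rewrite ler_eXn2l// ltr1n.
have S0 := exp2_gt0 S.
rewrite (_ : _ * _ * 2 = (2 ^+ S + 2 ^+ S) * 2 ^+ S); last by ring.
by apply: ler_pM => //; lra.
Qed.

(** Truncation commutes with halving, so the grids are nested; the telescoping over levels rests on
    this. *)
Lemma cellS S s x : cell S s x = (cell S s.+1 x)./2.
Proof.
have /andP[c1 c2] := clip_itv S x; have s0 := exp2_gt0 s.
rewrite /cell exprSr mulrA; set y := (_ + _) * _.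
have y0 : 0 <= y by apply: mulr_ge0; [lra|exact: ltW].
apply: truncn_def; rewrite -divn2.
have /truncn_itv/andP[] : 0 <= y * 2 by lra.
set k := Num.truncn _; rewrite -(natr1 k) => h1 h2.
have := divn_eq k 2; have := @ltn_pmod k 2 isT.
set u := (k %/ 2)%N; set v := (k %% 2)%N => v2 ke.
have kR : k%:R = u%:R * 2 + v%:R :> R by rewrite ke natrD natrM.
have : (v = 0 \/ v = 1)%N by move: v2; case: (v) => [|[|?]]; auto.
by rewrite -(natr1 u); case=> ve; rewrite ve in kR; apply/andP; split; lra.
Qed.

Lemma node_half S s k : `|node S s.+1 k - node S s k./2| <= (2 ^+ s)^-1.
Proof.
rewrite /node -{1}(odd_double_half k) natrD -muln2 natrM exprSr.
have s0 := exp2_gt0 s.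
rewrite (_ : _ - _ = (odd k)%:R / 2 ^+ s / 2); last first.
  by field; rewrite lt0r_neq0.
rewrite ger0_norm; last by rewrite !mulr_ge0// invr_ge0 ltW.
have i0 : 0 < (2 ^+ s)^-1 :> R by rewrite invr_gt0.
by case: (odd k) => /=; lra.
Qed.

Lemma rnd_dist S s x : `|clip S x - rnd S s x| <= (2 ^+ s)^-1.
Proof.
by have := cell_itv S s x; rewrite -/(rnd S s x) => /andP[h1 h2];
  rewrite ger0_norm; lra.
Qed.

Lemma rnd_le S s x : `|rnd S s x| <= `|x| + 1.
Proof.
have h1 := rnd_dist S s x; have h2 := clip_le S x.
have h3 : (2 ^+ s)^-1 <= 1 :> R by rewrite invf_le1 ?exp2_gt0// exp2_ge1.
have -> : rnd S s x = clip S x - (clip S x - rnd S s x) by ring.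
by apply: (le_trans (ler_normB _ _)); lra.
Qed.

Lemma rnd_err S x : `|x - rnd S S x| <= (1 + `|x|) ^+ 2 * (2 ^+ S)^-1.
Proof.
have h1 := rnd_dist S S x; have h2 := clip_tail S x.
have -> : x - rnd S S x = (x - clip S x) + (clip S x - rnd S S x) by ring.
apply: (le_trans (ler_normD _ _)).
rewrite -(real_normK (num_real x)) in h2.
have i0 : 0 < (2 ^+ S)^-1 :> R by rewrite invr_gt0 exp2_gt0.
have := mulr_ge0 (normr_ge0 x) (ltW i0); nra.
Qed.

Lemma measurable_clip S : measurable_fun setT (clip S).
Proof. by apply: measurable_maxr => //; exact: measurable_minr. Qed.

Lemma measurable_cell S s k : measurable [set x | cell S s x = k].
Proof.
pose y x := (clip S x + 2 ^+ S) * 2 ^+ s.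
have my : measurable_fun setT y.
  apply: measurable_funM => //; apply: measurable_funD => //.
  exact: measurable_clip.
have -> : [set x | cell S s x = k] =
    [set x | k%:R <= y x] `&` [set x | y x < k.+1%:R].
  have y0 x : 0 <= y x.
    have /andP[c1 c2] := clip_itv S x; have s0 := exp2_gt0 s.
    by apply: mulr_ge0; [lra|exact: ltW].
  apply/seteqP; split => x /=.
    by move=> <-; have /andP[] := truncn_itv (y0 x).
  by move=> [h1 h2]; apply: truncn_def; rewrite h1.
have m1 : measurable_fun setT (fun _ : R => k%:R : R) by exact: measurable_cst.
have m2 : measurable_fun setT (fun _ : R => k.+1%:R : R) by exact: measurable_cst.
have mt : measurable [set true] by [].
apply: measurableI.
- by rewrite -[X in measurable X]setTI; exact: (measurable_fun_ler m1 my measurableT mt).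
- by rewrite -[X in measurable X]setTI; exact: (measurable_fun_ltr my m2 measurableT mt).
Qed.

End rounding.

Section hoelder_functions.
Context {R : realType} (kappa : R).
Hypothesis kappa01 : 0 < kappa <= 1.

Definition envN (I : finType) (e : I -> R) : R := 1 + \sum_i `|e i|.

(** The same [K] and [a] serve the growth bound and the Hoelder bound, so that freezing coordinates,
    integrating some of them out and multiplying two such functions stay in the class with explicit
    constants. *)
Definition Hol (I : finType) (K a : R) (g : (I -> R) -> R) :=
  (forall x, `|g x| <= K * envN x `^ a) /\
  (forall x y, `|g x - g y| <=
     K * (envN x + envN y) `^ a * \sum_i `|x i - y i| `^ kappa).

Variable I : finType.
Implicit Types (e x y : I -> R).

Lemma envN_ge1 e : 1 <= envN e.
Proof. by rewrite lerDl sumr_ge0. Qed.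

Lemma envN_gt0 e : 0 < envN e.
Proof. exact: lt_le_trans (envN_ge1 e). Qed.

Lemma envN_coord e i : `|e i| <= envN e.
Proof.
by rewrite /envN (bigD1 i)//= addrCA lerDl addr_ge0// sumr_ge0.
Qed.

Lemma Hol_K_ge0 K a g : @Hol I K a g -> 0 <= K.
Proof.
move=> [/(_ (fun=> 0)) h _].
have : 0 <= K * envN (fun _ : I => 0 : R) `^ a by exact: le_trans h.
by rewrite pmulr_lge0// powR_gt0// envN_gt0.
Qed.

Lemma le_powR (a x y : R) : 0 <= a -> 0 <= x -> x <= y -> x `^ a <= y `^ a.
Proof.
move=> a0 x0 xy; apply: ge0_ler_powR => //; rewrite nnegrE//.
exact: le_trans xy.
Qed.

(** After division by [x + y] this is [z <= z ^ kappa] on [[0, 1]], summed over two fractions that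
    add up to 1. *)
Lemma powR_add_le (x y : R) : 0 <= x -> 0 <= y ->
  (x + y) `^ kappa <= x `^ kappa + y `^ kappa.
Proof.
move=> x0 y0; case/andP: kappa01 => k0 k1.
have [->|xn0] := eqVneq x 0; first by rewrite add0r powR0 ?add0r// gt_eqF.
have s0 : 0 < x + y by rewrite ltr_wpDr// lt0r xn0.
have key z : 0 <= z <= 1 -> z <= z `^ kappa.
  move=> /andP[]; rewrite le_eqVlt => /predU1P[<- _|z0 z1]; first exact: powR_ge0.
  by apply: ger1_powR => //; rewrite z0.
have e1 z : 0 <= z -> z `^ kappa = (z / (x + y)) `^ kappa * (x + y) `^ kappa.
  move=> z0; rewrite -powRM; last 2 first.
  - by rewrite divr_ge0// ltW.
  - exact: ltW.
  by rewrite divfK// gt_eqF.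
rewrite (e1 x)// (e1 y)// -mulrDl -[leLHS]mul1r ler_wpM2r ?powR_ge0//.
have -> : 1 = x / (x + y) + y / (x + y) by rewrite -mulrDl divff// gt_eqF.
have dv z : 0 <= z -> z <= x + y -> 0 <= z / (x + y) <= 1.
  by move=> z0 zs; rewrite ler_pdivrMr// mul1r zs andbT divr_ge0// ltW.
by apply: lerD; apply: key; apply: dv => //; lra.
Qed.

Definition rate S : R := ((2 ^+ S)^-1) `^ kappa.

Lemma rate_ge0 S : 0 <= rate S.
Proof. exact: powR_ge0. Qed.

Lemma rate_exp S : rate S = (2 `^ (- kappa)) ^+ S.
Proof.
have -> : 2 `^ (- kappa) = 2^-1 `^ kappa by rewrite -powR_inv1// -powRrM mulN1r.
rewrite /rate -exprVn; elim: S => [|S IH]; first by rewrite !expr0 powR1.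
by rewrite !exprS powRM ?exprn_ge0 ?invr_ge0// IH.
Qed.

Lemma base_lt1 (u : R) : 0 < u -> 2 `^ (- u) < 1 :> R.
Proof.
move=> u0; rewrite powRN invf_lt1 ?powR_gt0//.
have := @gt0_ltr_powR R u u0 1 2; rewrite powR1; apply; rewrite ?nnegrE//.
exact: ltr1n.
Qed.

Lemma rate_cvg0 : rate @ \oo --> (0 : R).
Proof.
rewrite (_ : rate = fun S => (2 `^ (- kappa)) ^+ S); last first.
  by apply/funext => S; rewrite rate_exp.
apply: cvg_expr; rewrite ger0_norm ?powR_ge0// base_lt1//.
by case/andP: kappa01.
Qed.

Definition rndv S (x : I -> R) : I -> R := fun i => rnd S S (x i).

Lemma envN_rndv S x : envN (rndv S x) <= (1 + #|I|%:R) * envN x.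
Proof.
have h1 : envN (rndv S x) <= envN x + #|I|%:R.
  rewrite /envN -addrA lerD2l.
  apply: (@le_trans _ _ (\sum_i (`|x i| + 1))).
    by apply: ler_sum => i _; exact: rnd_le.
  by rewrite big_split/= sumr_const.
apply: (le_trans h1); rewrite mulrDl mul1r lerD2l.
by rewrite ler_peMr// envN_ge1.
Qed.

(** The exponent grows by 2 because of the quadratic factor in [rnd_err]. *)
Lemma Hol_rnd K a g : 0 <= a -> Hol K a g -> exists C, 0 <= C /\ forall S x,
  `|g x - g (rndv S x)| <= C * envN x `^ (a + 2) * rate S.
Proof.
move=> a0 gH; have K0 := Hol_K_ge0 gH; case: gH => _ gH.
exists (K * (2 + #|I|%:R) `^ a * #|I|%:R); split.
  by rewrite !mulr_ge0// powR_ge0.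
move=> S x; apply: (le_trans (gH _ _)).
have N1 := envN_ge1 x; have N0 := envN_gt0 x.
have I0 : 0 <= #|I|%:R :> R by exact: ler0n.
have -> : K * (2 + #|I|%:R) `^ a * #|I|%:R * envN x `^ (a + 2) * rate S =
   K * ((2 + #|I|%:R) `^ a * envN x `^ a) * (#|I|%:R * (envN x ^+ 2 * rate S)).
  rewrite powRD ?(gt_eqF N0) ?implybT// powR_mulrn ?ltW//; ring.
apply: ler_pM.
- by rewrite mulr_ge0// powR_ge0.
- by apply: sumr_ge0 => i _; exact: powR_ge0.
- rewrite ler_wpM2l// -powRM; [|lra|lra].
  apply: le_powR => //; first by have := envN_gt0 (rndv S x); lra.
  by have := envN_rndv S x; lra.
- rewrite -sum1_card natr_sum mulr_suml; apply: ler_sum => i _; rewrite mul1r.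
  have := rnd_err S (x i); rewrite -/(rndv S x i) => h.
  have h2 : (1 + `|x i|) ^+ 2 <= envN x ^+ 2.
    apply: lerXn2r; [by rewrite nnegrE addr_ge0|by rewrite nnegrE ltW|].
    by rewrite /envN lerD2l (bigD1 i)//= lerDl sumr_ge0.
  apply: (@le_trans _ _ ((envN x ^+ 2 * (2 ^+ S)^-1) `^ kappa)).
    apply: le_powR => //; first by case/andP: kappa01 => /ltW.
    by apply: (le_trans h); rewrite ler_wpM2r// invr_ge0 exprn_ge0.
  rewrite powRM ?invr_ge0 ?exprn_ge0//; last lra.
  rewrite -/(rate S) ler_wpM2r ?rate_ge0//.
  apply: ler1_powR; last by case/andP: kappa01.
  by rewrite exprn_ege1.
Qed.

End hoelder_functions.

Section cell_decomposition.
Context d (T : measurableType d) {R : realType} (I : finType).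
Implicit Types (S s : nat) (zeta : I -> T -> R).

Definition cellset (S s : nat) (zeta : I -> T -> R) (z : {ffun I -> 'I_(ncell S)}) : set T :=
  [set w | forall i, cell S s (zeta i w) = z i].

Definition nodev (S s : nat) (z : {ffun I -> 'I_(ncell S)}) : I -> R :=
  fun i => node S s (z i).

Definition cellz S s (sS : (s <= S)%N) (x : I -> R) : {ffun I -> 'I_(ncell S)} :=
  [ffun i => Ordinal (cell_lt (x i) sS)].

Lemma measurable_cellset S s zeta (z : {ffun I -> 'I_(ncell S)}) : (forall i, measurable_fun setT (zeta i)) ->
  measurable (@cellset S s zeta z).
Proof.
move=> mz.
have -> : @cellset S s zeta z =
    \bigcap_(i in [set: I]) (zeta i @^-1` [set x | cell S s x = z i]).
  by apply/seteqP; split => [w h i _|w h i]; [exact: h|exact: (h i)].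
apply: fin_bigcap_measurable => [|i _]; first exact: finite_finset.
rewrite -[X in measurable X]setTI; apply: mz => //; exact: measurable_cell.
Qed.

Lemma indic_cellset S s (sS : (s <= S)%N) zeta (z : {ffun I -> 'I_(ncell S)}) w :
  \1_(@cellset S s zeta z) w = (z == cellz sS (fun i => zeta i w))%:R :> R.
Proof.
rewrite indicE; congr ((nat_of_bool _)%:R); apply/idP/idP.
  rewrite inE => h; rewrite eq_sym; apply/eqP/ffunP => i; rewrite ffunE.
  by apply: val_inj => /=; exact: h.
by move=> /eqP ->; rewrite inE => i; rewrite ffunE.
Qed.

Lemma sum_cellset S s (sS : (s <= S)%N) zeta (F : {ffun I -> 'I_(ncell S)} -> R) w :
  \sum_z F z * \1_(@cellset S s zeta z) w = F (cellz sS (fun i => zeta i w)).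
Proof.
rewrite (bigD1 (cellz sS (fun i => zeta i w)))//= (indic_cellset sS) eqxx mulr1.
by rewrite big1 ?addr0// => z /negbTE zn; rewrite (indic_cellset sS) zn mulr0.
Qed.

Lemma nodev_cellz S s (sS : (s <= S)%N) x : @nodev S s (cellz sS x) = fun i => rnd S s (x i).
Proof. by apply/funext => i; rewrite /nodev /cellz ffunE. Qed.

Lemma rndv_sum S zeta (g : (I -> R) -> R) w :
  g (rndv S (fun i => zeta i w)) =
  \sum_(z : {ffun I -> 'I_(ncell S)}) g (@nodev S S z) * \1_(@cellset S S zeta z) w.
Proof. by rewrite (sum_cellset (leqnn S)) nodev_cellz. Qed.

Lemma measurable_rndv S zeta (g : (I -> R) -> R) :
  (forall i, measurable_fun setT (zeta i)) ->
  measurable_fun setT (fun w => g (rndv S (fun i => zeta i w))).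
Proof.
move=> mz; rewrite (_ : (fun w => _) = fun w =>
   \sum_(z : {ffun I -> 'I_(ncell S)}) g (@nodev S S z) * \1_(@cellset S S zeta z) w); last first.
  by apply/funext => w; rewrite rndv_sum.
apply: measurable_sum => z; apply: measurable_funM => //.
by apply: measurable_indic; exact: measurable_cellset.
Qed.

Lemma Hol_cvg kappa K a (g : (I -> R) -> R) x : 0 < kappa <= 1 -> 0 <= a ->
  Hol kappa K a g -> (fun S => g (rndv S x)) @ \oo --> g x.
Proof.
move=> k01 a0 /(Hol_rnd k01 a0)[C [C0 gC]].
apply/cvgrPdist_le => e e0.
have : (fun S => C * envN x `^ (a + 2) * rate kappa S) @ \oo --> (0 : R).
  rewrite -[X in _ --> X](mulr0 (C * envN x `^ (a + 2))).
  by apply: cvgMr; exact: rate_cvg0.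
move=> /cvgrPdist_le/(_ _ e0); apply: filterS => S; rewrite sub0r normrN => h.
by apply: (le_trans (gC S x)); apply: le_trans h; exact: ler_norm.
Qed.

(** A pointwise limit of simple functions of the cells. The measurable type is arbitrary, so the
    lemma also applies to [g_sigma_algebraType G] and yields measurability with respect to a
    sub-sigma-algebra. *)
Lemma measurable_Hol kappa K a zeta (g : (I -> R) -> R) : 0 < kappa <= 1 -> 0 <= a ->
  Hol kappa K a g -> (forall i, measurable_fun setT (zeta i)) ->
  measurable_fun setT (fun w => g (fun i => zeta i w)).
Proof.
move=> k01 a0 gH mz.
apply: (@measurable_fun_cvg _ _ _ setT (fun S w => g (rndv S (fun i => zeta i w)))).
  by move=> S; exact: measurable_rndv.
by move=> w _; exact: (Hol_cvg k01 a0 gH).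
Qed.

End cell_decomposition.

Section env_estimates.
Context {R : realType} (I : finType).
Implicit Types (e x y z : I -> R) (a theta : R).

(** Compared through the maximum of 1 and the [|e i|]: it is within a factor [1 + #|I|] of [envN e],
    and its power is 1 or one of the summands. *)
Lemma envN_pow_le theta e : 0 <= theta ->
  envN e `^ theta <= (1 + #|I|%:R) `^ theta * (1 + \sum_i `|e i| `^ theta).
Proof.
move=> t0; pose M := \big[Num.max/1]_i `|e i|.
have M1 : 1 <= M by rewrite /M; exact: bigmax_ge_id.
have I0 : 0 <= #|I|%:R :> R by exact: ler0n.
have S0 : 0 <= \sum_i `|e i| `^ theta.
  by apply: sumr_ge0 => i _; exact: powR_ge0.
have NM : envN e <= (1 + #|I|%:R) * M.
  rewrite mulrDl mul1r lerD// -sum1_card natr_sum mulr_suml.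
  by apply: ler_sum => i _; rewrite mul1r; exact: le_bigmax.
apply: (le_trans (le_powR t0 _ NM)); first exact: ltW (envN_gt0 _).
rewrite powRM; [|lra|lra]; rewrite ler_wpM2l ?powR_ge0//.
rewrite /M; elim/big_ind : _ => [|x y hx hy|i _].
- by rewrite powR1; lra.
- by rewrite /Num.max; case: ifP.
- rewrite (bigD1 i)//=.
  have : 0 <= \sum_(j | j != i) `|e j| `^ theta.
    by apply: sumr_ge0 => j _; exact: powR_ge0.
  lra.
Qed.

(** As [1 + a + b <= (1 + a) (1 + b)], a vector assembled from two others has an envelope bounded by
    the product of theirs; this is how frozen and random coordinates are separated in later
    estimates. *)
Lemma envN_mix x e z : (forall i, x i = e i \/ x i = z i) ->
  envN x <= envN e * envN z.
Proof.
move=> h; have ze := envN_ge1 e; have zz := envN_ge1 z.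
apply: (@le_trans _ _ (1 + (\sum_i `|e i| + \sum_i `|z i|))).
  rewrite lerD2l -big_split; apply: ler_sum => i _.
  by case: (h i) => ->; rewrite ?lerDl ?lerDr.
have : 0 <= \sum_i `|e i| by exact: sumr_ge0.
have : 0 <= \sum_i `|z i| by exact: sumr_ge0.
rewrite /envN; nra.
Qed.

Lemma envN_pow1 a e : 0 <= a -> 1 <= envN e `^ a.
Proof.
by move=> a0; rewrite -(powRr0 (envN e)); apply: ler_powR => //; exact: envN_ge1.
Qed.

Lemma envN_pow_mono a b e : a <= b -> envN e `^ a <= envN e `^ b.
Proof. by move=> ab; apply: ler_powR => //; exact: envN_ge1. Qed.

End env_estimates.

(** * Moments of the envelope and convergence of rounded expectations *)

Section moments.
Context d (T : measurableType d) {R : realType} (P : probability T R).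

(** Bound for the mean of [envN ^ a], [a <= theta], over [n] coordinates whose absolute moments of
    order [theta] are at most [G]. *)
Definition momC (theta G : R) (n : nat) : R :=
  (1 + n%:R) `^ theta * (1 + n%:R * G).

Definition momb (I : Type) (theta G : R) (zeta : I -> T -> R) :=
  forall i, [/\ measurable_fun setT (zeta i),
    Int P (fun w => `|zeta i w| `^ theta) &
    \int[P]_w (`|zeta i w| `^ theta) <= G].

Lemma measurable_normpow (f : T -> R) (a : R) : measurable_fun setT f ->
  measurable_fun setT (fun w => `|f w| `^ a).
Proof.
move=> mf; apply: (measurableT_comp (measurable_powR a)).
exact: measurableT_comp.
Qed.

Lemma measurable_pow (f : T -> R) (a : R) : measurable_fun setT f ->
  measurable_fun setT (fun w => f w `^ a).
Proof. by move=> mf; exact: (measurableT_comp (measurable_powR a)). Qed.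

Variable I : finType.
Implicit Types (zeta eta : I -> T -> R).

Lemma measurable_envN zeta : (forall i, measurable_fun setT (zeta i)) ->
  measurable_fun setT (fun w => envN (fun i => zeta i w)).
Proof.
move=> mz; apply: measurable_funD => //; apply: measurable_sum => i.
exact: measurableT_comp.
Qed.

Lemma envN_mom theta G a zeta : 0 <= a <= theta -> momb theta G zeta ->
  Int P (fun w => envN (fun i => zeta i w) `^ a) /\
  \int[P]_w (envN (fun i => zeta i w) `^ a) <= momC theta G #|I|.
Proof.
move=> /andP[a0 at_] mz; have t0 : 0 <= theta by exact: le_trans at_.
pose h w := (1 + #|I|%:R) `^ theta * (1 + \sum_i `|zeta i w| `^ theta).
have Is : Int P (fun w => 1 + \sum_i `|zeta i w| `^ theta).
  apply: IntD; first exact: Int_cst.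
  by apply: Int_sum => i _; have [] := mz i.
have Ih : Int P h by exact: IntZ.
have [|||If le] := @EFin_Ex_le _ _ _ P (fun w => envN (fun i => zeta i w) `^ a) h _ _ Ih.
- by apply: measurable_pow; apply: measurable_envN => i; have [] := mz i.
- by move=> w; exact: powR_ge0.
- move=> w; apply: le_trans (envN_pow_le _ t0).
  exact: envN_pow_mono.
split => //; apply: (le_trans le); rewrite /h ExZ// /momC ler_wpM2l ?powR_ge0//.
rewrite ExD; [|exact: Int_cst|by apply: Int_sum => i _; have [] := mz i].
rewrite Ex_cst lerD2l Ex_sum; last by move=> i _; have [] := mz i.
rewrite -sum1_card natr_sum mulr_suml; apply: ler_sum => i _; rewrite mul1r.
by have [] := mz i.
Qed.

Variable kappa : R.
Hypothesis kappa01 : 0 < kappa <= 1.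
Variables theta G : R.
Hypothesis G0 : 0 <= G.

Lemma momC_ge1 n : 0 <= theta -> 1 <= momC theta G n.
Proof.
move=> t0; have n0 : 0 <= n%:R :> R by exact: ler0n.
rewrite -[leLHS]mulr1; apply: ler_pM => //.
  have := @ler_powR R (1 + n%:R) _ 0 theta t0; rewrite powRr0; apply; lra.
by rewrite lerDl mulr_ge0.
Qed.

Lemma Int_Hol K a zeta g : 0 <= a <= theta -> momb theta G zeta ->
  Hol kappa K a g -> Int P (fun w => g (fun i => zeta i w)).
Proof.
move=> ath mz gH; have [If _] := envN_mom ath mz; case/andP: ath => a0 _.
apply: (Int_dom _ (IntZ K If)).
  by apply: (measurable_Hol kappa01 a0 gH) => i; have [] := mz i.
by move=> w; case: gH.
Qed.

Lemma Ex_rnd_cvg K a zeta g : 0 <= a <= theta -> momb theta G zeta ->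
  Hol kappa K a g ->
  (fun S => \int[P]_w g (rndv S (fun i => zeta i w))) @ \oo -->
  \int[P]_w g (fun i => zeta i w).
Proof.
move=> ath mz gH; have [If _] := envN_mom ath mz; case/andP: ath => a0 _.
have mzi i : measurable_fun setT (zeta i) by have [] := mz i.
have K0 := Hol_K_ge0 gH.
have [||||//] := @Ex_cvg _ _ _ P
  (fun S w => g (rndv S (fun i => zeta i w)))
  (fun w => g (fun i => zeta i w))
  (fun w => (K * (1 + #|I|%:R) `^ a) * envN (fun i => zeta i w) `^ a).
- by move=> S; exact: measurable_rndv.
- exact: IntZ.
- move=> S w; case: (gH) => + _ => /(_ (rndv S (fun i => zeta i w))) h.
  apply: (le_trans h); rewrite -mulrA ler_wpM2l// -powRM.
  + by apply: le_powR => //; [exact: ltW (envN_gt0 _)|exact: envN_rndv].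
  + by rewrite addr_ge0.
  + exact: ltW (envN_gt0 _).
- by move=> w; exact: (Hol_cvg kappa01 a0 gH).
Qed.

Lemma Ex_rndE zeta g S : (forall i, measurable_fun setT (zeta i)) ->
  \int[P]_w g (rndv S (fun i => zeta i w)) =
  \sum_(z : {ffun I -> 'I_(ncell S)})
     g (@nodev R I S S z) * fine (P (@cellset _ _ R _ S S zeta z)).
Proof.
move=> mz.
under eq_Rintegral => w _ do rewrite rndv_sum.
rewrite Ex_sum; last first.
  by move=> z _; apply: IntZ; apply: Int_indic; exact: measurable_cellset.
apply: eq_bigr => z _; rewrite ExZ ?Ex_indic//.
- exact: measurable_cellset.
- by apply: Int_indic; exact: measurable_cellset.
Qed.

End moments.

(* Box probabilities determine the law, because a Hoelder function is the limit
   of its values at the rounded point. *)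
Lemma box_law d (T : measurableType d) d' (T' : measurableType d') (R : realType)
  (P : probability T R) (P' : probability T' R) (I : finType)
  (kappa K a theta G G' : R) (zeta : I -> T -> R) (zeta' : I -> T' -> R)
  (g : (I -> R) -> R) : 0 < kappa <= 1 ->
  0 <= a <= theta -> momb P theta G zeta -> momb P' theta G' zeta' ->
  Hol kappa K a g ->
  (forall J : I -> set R, (forall i, measurable (J i)) ->
     P [set w | forall i, J i (zeta i w)] =
     P' [set w | forall i, J i (zeta' i w)]) ->
  \int[P]_w g (fun i => zeta i w) = \int[P']_w g (fun i => zeta' i w).
Proof.
move=> k01 ath mz mz' gH PP'.
have c1 := Ex_rnd_cvg k01 ath mz gH.
have c2 := Ex_rnd_cvg k01 ath mz' gH.
rewrite -(cvg_lim (@Rhausdorff R) c1) -(cvg_lim (@Rhausdorff R) c2).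
congr (limn _).
apply/funext => S; rewrite !Ex_rndE; last 2 first.
- by move=> i; have [] := mz' i.
- by move=> i; have [] := mz i.
apply: eq_bigr => z _; congr (_ * fine _).
apply: (PP' (fun i => [set x | cell S S x = z i])) => i.
exact: measurable_cell.
Qed.

(** * Conditional expectations and mixing *)

Section limits_of_expectations.
Context d (T : measurableType d) (R : realType) (P : probability T R).

(** Serves where no dominating function is at hand, so integrability of the limit has to be part of
    the conclusion. *)
Lemma fatou_bound (f : nat -> T -> R) (h : T -> R) (c : R) :
  (forall n, measurable_fun setT (f n)) -> (forall n w, 0 <= f n w) ->
  (forall w, f ^~ w @ \oo --> h w) ->
  (forall n, Int P (f n) /\ \int[P]_w f n w <= c) ->
  Int P h /\ \int[P]_w h w <= c.
Proof.
move=> mf f0 fh fc.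
have mh : measurable_fun setT h by apply: (measurable_fun_cvg mf) => w _; exact: fh.
have h0 w : 0 <= h w.
  rewrite -(cvg_lim (@Rhausdorff R) (fh w)); apply: limr_ge.
    by apply/cvg_ex; exists (h w); exact: fh.
  by apply/nearW.
apply: ge0_Int_le => //.
have hE w : (h w)%:E = limn_einf (fun n => (f n w)%:E).
  have cw : (fun n => (f n w)%:E) @ \oo --> (h w)%:E.
    by apply: cvg_EFin; [exact/nearW|exact: fh].
  by have [-> _] := cvg_limn_einf_sup cw.
under eq_integral => w _ do rewrite hE.
apply: (le_trans (@fatou _ _ _ P setT measurableT (fun n => EFin \o f n) _ _)).
- by move=> n; exact/measurable_EFinP.
- by move=> n w _; rewrite lee_fin.
rewrite limn_einf_lim; apply: lime_le; first exact: is_cvg_einfs.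
apply/nearW => n; have [In le] := fc n.
apply: (@le_trans _ _ (\int[P]_w (f n w)%:E)%E).
  by apply: ereal_inf_lbound; exists n => /=.
by rewrite integralEFin// lee_fin.
Qed.

End limits_of_expectations.

Lemma lim_dist_le (R : realType) (u v : nat -> R) (a b c : R) :
  u @ \oo --> a -> v @ \oo --> b -> (forall n, `|u n - v n| <= c) ->
  `|a - b| <= c.
Proof.
move=> ua vb uv.
have cd : (fun n => `|u n - v n|) @ \oo --> `|a - b|.
  by apply: cvg_norm; exact: cvgB.
rewrite -(cvg_lim (@Rhausdorff R) cd); apply: limr_le; last exact/nearW.
by apply/cvg_ex; eexists; exact: cd.
Qed.

Section young.
Context {R : realType}.

Lemma young (p p' a b : R) : 1 < p -> 1 < p' -> p^-1 + p'^-1 = 1 ->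
  0 <= a -> 0 <= b -> a * b <= a `^ p' + b `^ p.
Proof.
move=> p1 p'1 pp a0 b0.
have p0 : 0 < p by lra.
have p'0 : 0 < p' by lra.
have pp' : p'^-1 + p^-1 = 1 by rewrite addrC.
apply: (le_trans (conjugate_powR a0 b0 p'0 p0 pp')); apply: lerD.
- by rewrite ler_pdivrMr// ler_peMr ?powR_ge0// ltW.
- by rewrite ler_pdivrMr// ler_peMr ?powR_ge0// ltW.
Qed.

Lemma half_sum_le1 (a b x y : R) : a * x <= 1 -> b * y <= 1 ->
  a / 2 * x + b / 2 * y <= 1.
Proof. lra. Qed.

Lemma pow_le_1 (a r s : R) : 0 <= a -> 0 <= r <= s -> a `^ r <= 1 + a `^ s.
Proof.
move=> a0 /andP[r0 rs]; have [a1|a1] := leP 1 a.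
  have := ler_powR a1 rs; lra.
have : a `^ r <= 1 `^ r by apply: le_powR => //; exact: ltW.
by rewrite powR1; have := powR_ge0 a s; lra.
Qed.

End young.

Section conditioning.
Context d (T : measurableType d) (R : realType) (P : probability T R).
Implicit Types (G H : set (set T)) (f g h phi : T -> R).

(** Measurability over the generated type makes the closure properties of [measurable_fun] available
    for a sub-sigma-algebra; [mG_sub] links it to the form used in the definition of conditional
    expectation. *)
Definition mG G f :=
  @measurable_fun _ _ (g_sigma_algebraType G) (measurableTypeR R) setT f.

Lemma mG_sub G f : sigma_algebra setT G -> sub_measurable G f <-> mG G f.
Proof.
move=> sG; have GE A : <<s G >> A = G A by rewrite sigma_algebra_id.
split => [h _ B mB|h B mB].
  by rewrite setTI; change (<<s G >> (f @^-1` B)); rewrite GE; exact: h.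
have := h measurableT B mB; rewrite setTI.
by change (<<s G >> (f @^-1` B) -> G (f @^-1` B)); rewrite GE.
Qed.

Lemma mG_mono G H f : G `<=` H -> mG G f -> mG H f.
Proof.
move=> GH mf mT B mB; have := mf measurableT B mB; rewrite !setTI.
exact: sub_smallest2r GH (f @^-1` B).
Qed.

Lemma mG_measurable G f : sigma_algebra setT G -> G `<=` measurable ->
  mG G f -> measurable_fun setT f.
Proof.
move=> sG Gm mf _ B mB; apply: Gm; have := mf measurableT B mB.
rewrite setTI => h; have : <<s G >> (f @^-1` B) by exact: h.
by rewrite sigma_algebra_id// setTI.
Qed.

Lemma Ex_setE (A : set T) f : \int[P]_w (\1_A w * f w) = \int[P]_(w in A) f w.
Proof.
rewrite [RHS]Rintegral_mkcond; apply: eq_Rintegral => w _.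
by rewrite patch_indic mulrC.
Qed.

(** The definition of conditional expectation tests only indicators of sets of [G]. Rounding [phi]
    to its cells, which lie in [G], gives a finite combination of such indicators, and dominated
    convergence with [|phi u| + |u|] removes the rounding. *)
Lemma condexp_pullout G phi f h : sigma_algebra setT G -> G `<=` measurable ->
  mG G phi -> Int P f -> is_condexp P G f h ->
  Int P (fun w => phi w * f w) -> Int P (fun w => phi w * h w) ->
  \int[P]_w (phi w * f w) = \int[P]_w (phi w * h w).
Proof.
move=> sG Gm mphi If [_ Ih fh] Ipf Iph.
have mphiT := mG_measurable sG Gm mphi.
pose zeta := fun (_ : unit) => phi.
pose r S w := rndv S (fun i => zeta i w) tt.
have rcvg w : r^~ w @ \oo --> phi w.
  have Hid : Hol 1 1 1 (fun e : unit -> R => e tt).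
    split=> [x|x y].
      by rewrite mul1r powRr1; [exact: envN_coord|exact: ltW (envN_gt0 _)].
    have x1 := envN_ge1 x; have y1 := envN_ge1 y.
    rewrite mul1r powRr1; last by lra.
    rewrite (bigD1 tt)//= big1 ?addr0; last by case.
    by rewrite powRr1// ler_peMl//; lra.
  have k1 : (0 < 1 :> R) && (1 <= 1 :> R) by rewrite ltr01 lexx.
  exact: (Hol_cvg k1 ler01 Hid).
have mr S : measurable_fun setT (r S).
  by apply: (@measurable_rndv _ T R unit S zeta (fun e => e tt)).
have rb S w : `|r S w| <= `|phi w| + 1 by exact: rnd_le.
have key (u : T -> R) : Int P u -> Int P (fun w => phi w * u w) ->
    (fun S => \int[P]_w (r S w * u w)) @ \oo --> \int[P]_w (phi w * u w).
  move=> Iu Ipu.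
  have [||||//] := @Ex_cvg _ _ _ P (fun S w => r S w * u w) (fun w => phi w * u w)
    (fun w => `|phi w * u w| + `|u w|).
  - by move=> S; apply: measurable_funM => //; exact: Int_meas Iu.
  - by apply: IntD; exact: Int_norm.
  - move=> S w; rewrite !normrM.
    apply: (@le_trans _ _ ((`|phi w| + 1) * `|u w|)); first exact: ler_wpM2r.
    by rewrite mulrDl mul1r.
  - by move=> w; apply: cvgMl; exact: rcvg.
have eqS S : \int[P]_w (r S w * f w) = \int[P]_w (r S w * h w).
  have E u : Int P u -> \int[P]_w (r S w * u w) =
      \sum_(z : {ffun unit -> 'I_(ncell S)}) @nodev R _ S S z tt *
        \int[P]_(w in @cellset _ T R _ S S zeta z) u w.
    move=> Iu.
    have mc z : measurable (@cellset _ T R _ S S zeta z) by exact: measurable_cellset.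
    have I1 z : Int P (fun w => \1_(@cellset _ T R _ S S zeta z) w * u w).
      apply: (Int_dom _ (Int_norm Iu)).
        apply: measurable_funM; [exact: measurable_indic|exact: Int_meas Iu].
      move=> w; rewrite normrM indicE.
      by case: (_ \in _); rewrite ?normr1 ?mul1r// normr0 mul0r.
    transitivity (\int[P]_w (\sum_(z : {ffun unit -> 'I_(ncell S)})
       @nodev R _ S S z tt * (\1_(@cellset _ T R _ S S zeta z) w * u w))).
      apply: eq_Rintegral => w _; rewrite /r (rndv_sum S zeta (fun e => e tt)).
      by rewrite mulr_suml; apply: eq_bigr => z _; rewrite mulrA.
    rewrite Ex_sum; last by move=> z _; exact: IntZ.
    by apply: eq_bigr => z _; rewrite ExZ// Ex_setE.
  rewrite !E//; apply: eq_bigr => z _; congr (_ * fine _).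
  apply/esym/fh.
  have : <<s G >> (@cellset _ (g_sigma_algebraType G) R _ S S zeta z).
    exact: (@measurable_cellset _ (g_sigma_algebraType G) R _ S S zeta z (fun=> mphi)).
  by rewrite sigma_algebra_id.
rewrite -(cvg_lim (@Rhausdorff R) (key f If Ipf)).
rewrite -(cvg_lim (@Rhausdorff R) (key h Ih Iph)).
by congr (limn _); apply/funext.
Qed.

(** Contraction in [L^theta] by duality: testing against a truncation of [h |h|^(theta - 2)] gives a
    truncated moment of [h] on one side and a product with [f] on the other, to which Young's
    inequality is applied. Fatou's lemma removes the truncation. *)
Lemma condexp_moment G f h (theta : R) : 2 < theta ->
  sigma_algebra setT G -> G `<=` measurable -> Int P f -> is_condexp P G f h ->
  Int P (fun w => `|f w| `^ theta) ->
  Int P (fun w => `|h w| `^ theta) /\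
  \int[P]_w (`|h w| `^ theta) <= \int[P]_w (`|f w| `^ theta).
Proof.
move=> t1 sG Gm If fh If_t; have [mh0 Ih _] := fh.
have mhG : mG G h by apply/mG_sub.
have mh := Int_meas Ih; have mf := Int_meas If.
have mhn : measurable_fun setT (fun w => `|h w|) by exact: measurableT_comp.
pose A n := [set w | `|h w| <= n%:R].
have mA n : measurable (A n).
  rewrite -[X in measurable X]setTI.
  have mt : measurable [set true] by [].
  have mc : measurable_fun setT (fun _ : T => n%:R : R) by exact: measurable_cst.
  exact: (measurable_fun_ler mhn mc measurableT mt).
pose u n w := \1_(A n) w * `|h w| `^ theta.
have u0 n w : 0 <= u n w by rewrite mulr_ge0 ?powR_ge0// indicE ler0n.
have mu n : measurable_fun setT (u n).
  by apply: measurable_funM; [exact: measurable_indic|exact: measurable_normpow].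
have t0 : 0 < theta by lra.
have Abound n w : \1_(A n) w * `|h w| <= n%:R.
  rewrite indicE; case: (boolP (w \in A n)) => [|_]; rewrite ?mul0r ?ler0n//.
  by rewrite inE mul1r.
have ub n w : u n w <= n%:R `^ theta.
  rewrite /u; have := Abound n w; rewrite indicE.
  case: (_ \in _); rewrite ?mul0r ?powR_ge0// !mul1r => hn.
  by apply: le_powR => //; exact: ltW.
have Iu n : Int P (u n).
  apply: (Int_dom (mu n) (Int_cst P (n%:R `^ theta))) => w.
  by rewrite ger0_norm.
pose phi n w := \1_(A n) w * (h w * `|h w| `^ (theta - 2)).
have powh w : `|h w| * `|h w| `^ (theta - 2) = `|h w| `^ (theta - 1).
  rewrite (_ : theta - 2 = (theta - 1) - 1); last by ring.
  by rewrite mulr_powRB1//; lra.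
have sgE w : h w * `|h w| `^ (theta - 2) * h w = `|h w| `^ theta.
  rewrite mulrAC -expr2 -real_normK ?num_real// expr2 -mulrA powh.
  by rewrite mulr_powRB1.
have phih n w : phi n w * h w = u n w by rewrite /phi /u -mulrA sgE.
have phia n w : `|phi n w| <= \1_(A n) w * `|h w| `^ (theta - 1).
  rewrite /phi normrM (ger0_norm (_ : 0 <= \1_(A n) w)); last first.
    by rewrite indicE ler0n.
  rewrite ler_wpM2l// ?indicE ?ler0n// normrM [X in _ * X]ger0_norm ?powR_ge0//.
  by rewrite powh.
have phib n w : `|phi n w| <= n%:R `^ (theta - 1).
  apply: (le_trans (phia n w)); have := Abound n w; rewrite indicE.
  case: (_ \in _); rewrite ?mul0r ?powR_ge0// !mul1r => hn.
  by apply: le_powR => //; lra.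
have mphi n : mG G (phi n).
  have mAG : measurable (A n : set (g_sigma_algebraType G)).
    rewrite -[X in measurable X]setTI.
    have mt : measurable [set true] by [].
    have mc : measurable_fun setT (fun _ : g_sigma_algebraType G => n%:R : R).
      exact: measurable_cst.
    have mhnG : measurable_fun setT (fun w : g_sigma_algebraType G => `|h w|).
      exact: measurableT_comp mhG.
    exact: (measurable_fun_ler mhnG mc measurableT mt).
  apply: measurable_funM; first exact: measurable_indic.
  apply: measurable_funM; first exact: mhG.
  exact: (@measurable_normpow _ (g_sigma_algebraType G)).
have mphiT n := mG_measurable sG Gm (mphi n).
have Iphi g n : Int P g -> Int P (fun w => phi n w * g w).
  move=> Ig; apply: (Int_dom _ (IntZ (n%:R `^ (theta - 1)) (Int_norm Ig))).
    by apply: measurable_funM => //; exact: Int_meas Ig.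
  by move=> w; rewrite normrM ler_wpM2r.
have Eu n : \int[P]_w u n w <= \int[P]_w (`|f w| `^ theta).
  have -> : \int[P]_w u n w = \int[P]_w (phi n w * h w).
    by apply: eq_Rintegral => w _; rewrite phih.
  rewrite -(condexp_pullout sG Gm (mphi n) If fh (Iphi _ n If) (Iphi _ n Ih)).
  have tn0 : theta != 0 by rewrite gt_eqF.
  pose c := theta^-1.
  have c0 : 0 < c by rewrite invr_gt0.
  have step : \int[P]_w (phi n w * f w) <=
      \int[P]_w ((1 - c) * u n w + c * `|f w| `^ theta).
    apply: Ex_le; [exact: Iphi|by apply: IntD; exact: IntZ|move=> w].
    apply: (le_trans (ler_norm _)); rewrite normrM.
    have t1' : 1 < theta by lra.
    have t10 : theta - 1 != 0 by rewrite gt_eqF// subr_gt0.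
    have := phia n w; rewrite /u indicE; case: (_ \in _) => /=; last first.
      rewrite !mul0r normr_le0 => /eqP ->; rewrite normr0 mul0r mulr0 add0r.
      by rewrite mulr_ge0 ?powR_ge0// ltW.
    rewrite !mul1r => ph.
    apply: (@le_trans _ _ (`|h w| `^ (theta - 1) * `|f w|)).
      by rewrite ler_wpM2r.
    have cj : (theta / (theta - 1))^-1 + theta^-1 = 1 by field; rewrite tn0.
    have p0 : 0 < theta / (theta - 1) by rewrite divr_gt0// subr_gt0.
    have := conjugate_powR (powR_ge0 `|h w| (theta - 1)) (normr_ge0 (f w)) p0 t0 cj.
    rewrite -powRrM (_ : (theta - 1) * (theta / (theta - 1)) = theta); last by field.
    rewrite (_ : (theta / (theta - 1))^-1 = 1 - c); last by rewrite /c; field; rewrite tn0.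
    by rewrite [_ * (1 - c)]mulrC [_ / theta]mulrC.
  move: step; rewrite ExD ?ExZ//; [|exact: IntZ|exact: IntZ].
  have -> : \int[P]_w (phi n w * f w) = \int[P]_w u n w.
    rewrite (condexp_pullout sG Gm (mphi n) If fh (Iphi _ n If) (Iphi _ n Ih)).
    by apply: eq_Rintegral => w _; rewrite phih.
  (* The truncated moment is finite because [u n] is bounded, so its share [1 - c] on the right is
     absorbed into the left. *)
  move=> step; rewrite -(ler_pM2l c0); lra.
apply: (fatou_bound mu u0) => // w.
apply/cvgrPdist_le => e e0.
exists (Num.truncn `|h w|).+1 => // n /= hn.
have -> : u n w = `|h w| `^ theta.
  rewrite /u indicE mem_set ?mul1r//= /A/=.
  by apply: le_trans (ltW (truncnS_gt _)) _; rewrite ler_nat.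
by rewrite subrr normr0 ltW.
Qed.

Lemma Int_of_pow f (s : R) : 1 <= s -> measurable_fun setT f ->
  Int P (fun w => `|f w| `^ s) -> Int P f.
Proof.
move=> s1 mf Is; apply: (Int_dom mf (IntD (Int_cst P 1) Is)) => w.
have rs : 0 <= (1 : R) <= s by rewrite ler01.
by have := pow_le_1 (normr_ge0 (f w)) rs; rewrite powRr1.
Qed.

Lemma Lnorm_le f (p c : R) : 0 < p -> 0 <= c -> measurable_fun setT f ->
  ('N[P]_p%:E[EFin \o f] <= c%:E)%E ->
  Int P (fun w => `|f w| `^ p) /\ \int[P]_w (`|f w| `^ p) <= c `^ p.
Proof.
move=> p0 c0 mf Nf; apply: ge0_Int_le.
- exact: measurable_normpow.
- by move=> w; exact: powR_ge0.
have -> : (\int[P]_w (`|f w| `^ p)%:E = 'N[P]_p%:E[EFin \o f] `^ p)%E.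
  by rewrite poweR_Lnorm ?gt_eqF//; apply: eq_integral => w _.
rewrite -poweR_EFin; apply: gt0_ler_poweR => //; first exact: ltW.
- by rewrite in_itv/= Lnorm_ge0 leey.
- by rewrite in_itv/= lee_fin c0 leey.
Qed.

Lemma le_Lnorm f (p c : R) : 0 < p -> 0 <= c -> measurable_fun setT f ->
  Int P (fun w => `|f w| `^ p) -> \int[P]_w (`|f w| `^ p) <= c `^ p ->
  ('N[P]_p%:E[EFin \o f] <= c%:E)%E.
Proof.
move=> p0 c0 mf If le.
have e : ('N[P]_p%:E[EFin \o f] `^ p <= (c `^ p)%:E)%E.
  rewrite poweR_Lnorm ?gt_eqF//.
  have -> : (\int[P]_x `|(EFin \o f) x| `^ p = \int[P]_w (`|f w| `^ p)%:E)%E.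
    by apply: eq_integral => w _.
  by rewrite integralEFin// lee_fin.
have e1 : ('N[P]_p%:E[EFin \o f] = ('N[P]_p%:E[EFin \o f] `^ p) `^ p^-1)%E.
  by rewrite -poweRrM divff ?gt_eqF// poweRe1// Lnorm_ge0.
rewrite e1 (_ : c%:E = ((c `^ p)%:E `^ p^-1)%E); last first.
  by rewrite poweR_EFin -powRrM divff ?gt_eqF// powRr1.
apply: gt0_ler_poweR => //; first by rewrite invr_ge0 ltW.
- by rewrite in_itv/= poweR_ge0 leey.
- by rewrite in_itv/= lee_fin powR_ge0 leey.
Qed.

(** Normalising [g] makes it admissible in the supremum defining [varpi_alg]; the difference is then
    [c] times the mean of [phi] against a centred conditional expectation. Young's inequality,
    instead of Hoelder's, gives an additive bound that can be summed over the terms of a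
    chaining. *)
Lemma mixing_bound (q p p' v : R) G H phi g (c : R) :
  1 < p -> 1 < p' -> p^-1 + p'^-1 = 1 -> 1 <= q -> 0 < v -> 0 < c ->
  sigma_algebra setT G -> G `<=` measurable ->
  sigma_algebra setT H -> H `<=` measurable ->
  (varpi_alg P q p G H <= v%:E)%E ->
  mG G phi -> mG H g ->
  Int P (fun w => `|phi w| `^ p') ->
  Int P (fun w => `|g w| `^ q) -> \int[P]_w (`|g w| `^ q) <= c `^ q ->
  Int P (fun w => phi w * g w) ->
  `|\int[P]_w (phi w * g w) - (\int[P]_w phi w) * (\int[P]_w g w)| <=
  v * (\int[P]_w (`|phi w| `^ p') + c `^ p).
Proof.
move=> p1 p'1 pp q1 v0 c0 sG Gm sH Hm vb mphi mg Iphi Ig gc Ipg.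
have mphiT := mG_measurable sG Gm mphi; have mgT := mG_measurable sH Hm mg.
have cn0 : c != 0 by rewrite gt_eqF.
have If : Int P phi by apply: Int_of_pow mphiT Iphi; exact: ltW.
have Ig1 : Int P g by exact: Int_of_pow Ig.
pose g1 w := c^-1 * g w.
have Ig1' : Int P g1 by exact: IntZ.
have mg1 : mG H g1 by apply: measurable_funM => //; exact: measurable_cst.
have mg1T := mG_measurable sH Hm mg1.
have g1E w : `|g1 w| `^ q = (c `^ q)^-1 * `|g w| `^ q.
  by rewrite /g1 normrM powRM// gtr0_norm ?invr_gt0// -powR_inv1 ?ltW// -powRN
    -powRrM mulN1r.
have Ng1 : ('N[P]_q%:E[EFin \o g1] <= 1%:E)%E.
  apply: le_Lnorm => //; first lra.
    by apply: (Int_ext (IntZ (c `^ q)^-1 Ig)).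
  under eq_Rintegral => w _ do rewrite g1E.
  by rewrite ExZ// powR1 mulrC ler_pdivrMr ?powR_gt0// mul1r.
pose h := condexp P G g1.
have hc : is_condexp P G g1 h.
  rewrite /h /condexp; case: xgetP => [y -> //|].
  have [y hy] := is_condexp_exists sG Gm Ig1'.
  by move=> /(_ y).
have [_ Ih _] := hc.
have mh := Int_meas Ih.
set m := \int[P]_w g1 w.
have mE : 'E_P[g1]%E = m%:E by rewrite unlock integralEFin.
pose k w := h w - m.
have mk : measurable_fun setT k by exact: measurable_funB.
have Nk : ('N[P]_p%:E[EFin \o k] <= v%:E)%E.
  apply: le_trans vb; apply: ereal_sup_ubound; exists g1.
    by split => //; apply/mG_sub.
  by rewrite mE.
have [Ik kv] := Lnorm_le (lt_trans ltr01 p1) (ltW v0) mk Nk.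
have Ipk : Int P (fun w => phi w * k w).
  apply: (Int_dom _ (IntD Iphi Ik)); first exact: measurable_funM.
  by move=> w; rewrite normrM; apply: young.
have Iph : Int P (fun w => phi w * h w).
  apply: (Int_ext (IntD Ipk (IntZ m If))) => w; rewrite /k; ring.
have Ipg1 : Int P (fun w => phi w * g1 w).
  apply: (Int_ext (IntZ c^-1 Ipg)) => w; rewrite /g1; ring.
have e1 : \int[P]_w (phi w * g w) = c * \int[P]_w (phi w * h w).
  rewrite -(condexp_pullout sG Gm mphi Ig1' hc Ipg1 Iph) -ExZ//.
  by apply: eq_Rintegral => w _; rewrite /g1; field.
have e2 : \int[P]_w g w = c * m.
  by rewrite /m -ExZ//; apply: eq_Rintegral => w _; rewrite /g1; field.
have e3 : \int[P]_w (phi w * k w) = \int[P]_w (phi w * h w) - m * \int[P]_w phi w.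
  rewrite -ExZ// -ExB//; last exact: IntZ.
  by apply: eq_Rintegral => w _; rewrite /k; ring.
have -> : \int[P]_w (phi w * g w) - (\int[P]_w phi w) * (\int[P]_w g w) =
    \int[P]_w (c * (phi w * k w)).
  by rewrite ExZ// e3 e1 e2; ring.
(* Young's inequality is applied to [|phi|] and [(c / v) |k|]: this scaling turns the bound [v^p] on
   the [p]-th moment of [k] into [c^p] and leaves one factor [v] in front. *)
pose b := (c / v) `^ p.
have -> : v * (\int[P]_w (`|phi w| `^ p') + c `^ p) =
    \int[P]_w (v * `|phi w| `^ p') + v * (b * v `^ p).
  by rewrite ExZ// -powRM ?divr_ge0 ?ltW// ?divfK ?gt_eqF//; ring.
apply: (@le_trans _ _ (\int[P]_w (v * `|phi w| `^ p' + v * (b * `|k w| `^ p)))).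
  apply: Ex_absle; first exact: IntZ.
    by apply: IntD; apply: IntZ => //; exact: IntZ.
  move=> w; rewrite -mulrDr -powRM ?divr_ge0 ?(ltW c0) ?(ltW v0)//.
  rewrite !normrM (gtr0_norm c0).
  rewrite (_ : c * (`|phi w| * `|k w|) = v * (`|phi w| * (c / v * `|k w|))); last first.
    by field; rewrite gt_eqF.
  rewrite ler_pM2l//; apply: young => //.
  by rewrite mulr_ge0// divr_ge0 ?ltW.
rewrite ExD; [|exact: IntZ|by apply: IntZ; exact: IntZ].
rewrite lerD2l ExZ; last exact: IntZ.
by rewrite ExZ// !ler_pM2l// ?powR_gt0// divr_gt0.
Qed.

(* [v] times Young's inequality for each pair of terms; the moment assumptions
   make the two sums below play the roles of the L^p' and L^p norms. *)
Lemma separated_product_bound (q p p' v : R) G H (I J : finType)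
  (phi g : I -> T -> R) (psi k : J -> T -> R) (c : I -> R) (b : J -> R) :
  1 < p -> 1 < p' -> p^-1 + p'^-1 = 1 -> 1 <= q -> 0 < v ->
  sigma_algebra setT G -> G `<=` measurable ->
  sigma_algebra setT H -> H `<=` measurable ->
  (varpi_alg P q p G H <= v%:E)%E ->
  (forall i, 0 < c i) -> (forall j, 0 < b j) ->
  (forall i, mG G (phi i)) -> (forall j, mG G (psi j)) ->
  (forall i, mG H (g i)) -> (forall j, mG H (k j)) ->
  (forall i, Int P (fun w => `|g i w| `^ (2 * q)) /\
     \int[P]_w (`|g i w| `^ (2 * q)) <= c i `^ (2 * q)) ->
  (forall j, Int P (fun w => `|k j w| `^ (2 * q)) /\
     \int[P]_w (`|k j w| `^ (2 * q)) <= b j `^ (2 * q)) ->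
  (forall i j, Int P (fun w => `|phi i w * psi j w| `^ p')) ->
  (forall i j, Int P (fun w => phi i w * psi j w * (g i w * k j w))) ->
  `|\int[P]_w ((\sum_i phi i w * g i w) * (\sum_j psi j w * k j w)) -
    \sum_i \sum_j (\int[P]_w (phi i w * psi j w)) * (\int[P]_w (g i w * k j w))|
  <= v * (\int[P]_w ((\sum_i `|phi i w| `^ p') * (\sum_j `|psi j w| `^ p')) +
       (\sum_i c i `^ p) * (\sum_j b j `^ p)).
Proof.
move=> p1 p'1 pp q1 v0 sG Gm sH Hm vb c0 b0 mphi mpsi mg mk Ig Ik Ipp Iall.
have E1 : \int[P]_w ((\sum_i phi i w * g i w) * (\sum_j psi j w * k j w)) =
    \sum_i \sum_j \int[P]_w (phi i w * psi j w * (g i w * k j w)).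
  transitivity (\int[P]_w (\sum_i \sum_j phi i w * psi j w * (g i w * k j w))).
    apply: eq_Rintegral => w _; rewrite mulr_suml; apply: eq_bigr => i _.
    by rewrite mulr_sumr; apply: eq_bigr => j _; ring.
  rewrite Ex_sum; last by move=> i _; apply: Int_sum => j _; exact: Iall.
  by apply: eq_bigr => i _; rewrite Ex_sum.
have E2 : \int[P]_w ((\sum_i `|phi i w| `^ p') * (\sum_j `|psi j w| `^ p')) =
    \sum_i \sum_j \int[P]_w (`|phi i w * psi j w| `^ p').
  transitivity (\int[P]_w (\sum_i \sum_j `|phi i w * psi j w| `^ p')).
    apply: eq_Rintegral => w _; rewrite mulr_suml; apply: eq_bigr => i _.
    by rewrite mulr_sumr; apply: eq_bigr => j _; rewrite normrM powRM.
  rewrite Ex_sum; last by move=> i _; apply: Int_sum => j _; exact: Ipp.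
  by apply: eq_bigr => i _; rewrite Ex_sum.
rewrite E1 E2 -sumrB mulr_suml -big_split mulr_sumr /=.
apply: (le_trans (ler_norm_sum _ _ _)); apply: ler_sum => i _.
rewrite -sumrB mulr_sumr -big_split mulr_sumr /=.
apply: (le_trans (ler_norm_sum _ _ _)); apply: ler_sum => j _.
have mgi := mG_measurable sH Hm (mg i); have mkj := mG_measurable sH Hm (mk j).
have [Igi gic] := Ig i; have [Ikj kjb] := Ik j.
have q0 : 0 <= 2 * q by rewrite mulr_ge0// (le_trans _ q1).
have c2 : 0 < c i `^ (2 * q) by rewrite powR_gt0.
have b2 : 0 < b j `^ (2 * q) by rewrite powR_gt0.
have powsq (x : R) : 0 <= x -> x `^ (2 * q) = (x `^ q) ^+ 2.
  by move=> x0; rewrite mulrC powRrM powR_mulrn ?powR_ge0.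
(* Cauchy-Schwarz for the mean of [|g k|^q], in arithmetic-geometric form with each factor
   normalised by its own bound; hence the moments of order [2 q]. *)
pose u w := c i `^ q * b j `^ q *
  ((c i `^ (2 * q))^-1 / 2 * `|g i w| `^ (2 * q) +
   (b j `^ (2 * q))^-1 / 2 * `|k j w| `^ (2 * q)).
have Iu : Int P u by apply: IntZ; apply: IntD; exact: IntZ.
have Eu : \int[P]_w u w <= (c i * b j) `^ q.
  rewrite /u ExZ; last by apply: IntD; exact: IntZ.
  rewrite ExD; [|exact: IntZ|exact: IntZ]; rewrite !ExZ//.
  rewrite powRM ?(ltW (c0 i)) ?(ltW (b0 j))// ler_piMr ?mulr_ge0 ?powR_ge0//.
  have h1 : (c i `^ (2 * q))^-1 * \int[P]_w (`|g i w| `^ (2 * q)) <= 1.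
    by rewrite mulrC ler_pdivrMr// mul1r.
  have h2 : (b j `^ (2 * q))^-1 * \int[P]_w (`|k j w| `^ (2 * q)) <= 1.
    by rewrite mulrC ler_pdivrMr// mul1r.
  move: ((c i `^ (2 * q))^-1) ((b j `^ (2 * q))^-1) h1 h2 => A B h1 h2.
  exact: (half_sum_le1 h1 h2).
have le_u w : `|g i w * k j w| `^ q <= u w.
  rewrite /u normrM powRM// !powsq// ?(ltW (c0 i)) ?(ltW (b0 j))//.
  have cq : 0 < c i `^ q by rewrite powR_gt0.
  have bq : 0 < b j `^ q by rewrite powR_gt0.
  set x := _ `^ q; set y := `|k j w| `^ q.
  set C := c i `^ q in cq *; set B := b j `^ q in bq *.
  have := sqr_ge0 (x / C - y / B).
  have -> : C * B * ((C ^+ 2)^-1 / 2 * x ^+ 2 + (B ^+ 2)^-1 / 2 * y ^+ 2) =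
    x * y + C * B / 2 * (x / C - y / B) ^+ 2.
    by field; rewrite !gt_eqF.
  move=> h; rewrite lerDl; apply: mulr_ge0 => //.
  by rewrite !mulr_ge0 ?invr_ge0 ?(ltW cq) ?(ltW bq).
have [] := EFin_Ex_le (measurable_normpow q (measurable_funM mgi mkj)) _ Iu le_u.
  by move=> w; exact: powR_ge0.
move=> Igk gkle.
rewrite -powRM ?(ltW (c0 i)) ?(ltW (b0 j))//.
apply: (mixing_bound (q := q) (G := G) (H := H)) => //.
- by rewrite mulr_gt0.
- exact: measurable_funM (mphi i) (mpsi j).
- exact: measurable_funM (mg i) (mk j).
- exact: le_trans Eu.
Qed.

End conditioning.

(** * Chaining *)

Section grid_sums.
Context {R : realType}.

(* [t / (1 + |t|)] is a bounded increasing function whose increments dominate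
   the summands of [\sum 2^-s / (1 + |t|)^2]. *)
Definition squash (t : R) : R := t / (1 + `|t|).

Lemma squash_bound t : -1 <= squash t <= 1.
Proof.
have h0 := normr_ge0 t; rewrite -ler_norml /squash normrM normfV.
rewrite [`|1 + _|]ger0_norm; last lra.
by rewrite ler_pdivrMr; lra.
Qed.

(** On either half-line the increment is exactly [h / ((1 + |t|) (1 + |t + h|))], whose second
    factor is at most twice the first as [h <= 1]; a step across the origin is estimated
    directly. *)
Lemma squash_incr t (h : R) : 0 < h <= 1 ->
  h / (1 + `|t|) ^+ 2 <= 2 * (squash (t + h) - squash t).
Proof.
move=> /andP[h0 h1].
have frac (a b : R) : 1 <= a -> 1 <= b -> b <= 2 * a ->
    h / a ^+ 2 <= 2 * ((h / (a * b))).
  move=> a1 b1 ba.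
  have -> : 2 * (h / (a * b)) = h / a ^+ 2 + h * (2 * a - b) / (a ^+ 2 * b).
    by field; apply/andP; split; rewrite gt_eqF//; lra.
  rewrite lerDl divr_ge0// mulr_ge0//; try lra.
    by rewrite exprn_ge0//; lra.
rewrite /squash; have [t0|t0] := leP 0 t.
  rewrite !ger0_norm; try lra.
  apply: (le_trans (frac (1 + t) (1 + (t + h)) _ _ _)); try lra.
  rewrite le_eqVlt; apply/orP; left; apply/eqP.
  by field; apply/andP; split; rewrite gt_eqF//; lra.
have [th|th] := leP (t + h) 0.
  rewrite !ler0_norm; try lra.
  apply: (le_trans (frac (1 - t) (1 - (t + h)) _ _ _)); try lra.
  rewrite le_eqVlt; apply/orP; left; apply/eqP.
  by field; apply/andP; split; rewrite gt_eqF//; lra.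
rewrite (ltr0_norm t0) (gtr0_norm th).
have e1 : h / (1 - t) ^+ 2 <= h.
  rewrite ler_pdivrMr; last by rewrite exprn_gt0//; lra.
  apply: ler_peMr; first exact: ltW.
  by rewrite exprn_ege1//; lra.
have e2 : (t + h) / 2 <= (t + h) / (1 + (t + h)).
  by rewrite ler_pM2l// lef_pV2 ?posrE; lra.
have e3 : - t / 2 <= - (t / (1 - t)).
  by rewrite -mulNr ler_pM2l ?oppr_gt0// lef_pV2 ?posrE; lra.
by move: e2 e3; rewrite !mulrDl mulNr; lra.
Qed.

Lemma node_sum S s n :
  \sum_(k < n) (2 ^+ s)^-1 / (1 + `|node S s k : R|) ^+ 2 <= 4.
Proof.
pose h : R := (2 ^+ s)^-1.
have h01 : 0 < h <= 1.
  by rewrite /h invr_gt0 exp2_gt0/= invf_le1 ?exp2_gt0// exp2_ge1.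
have nodeS k : node S s k.+1 = node S s k + h.
  by rewrite /node -natr1 mulrDl mul1r addrAC.
apply: (@le_trans _ _ (2 * (squash (node S s n) - squash (node S s 0)))).
  elim: n => [|n IH]; first by rewrite big_ord0 subrr mulr0.
  rewrite big_ord_recr/=; apply: (le_trans (lerD IH (squash_incr _ h01))).
  by rewrite -nodeS; lra.
have /andP[? ?] := squash_bound (node S s n).
have /andP[? ?] := squash_bound (node S s 0); lra.
Qed.

(** A Riemann sum for the integral of the product of the [(1 + |x c|)^-2], with the volume of a cell
    as prefactor, hence at most a product of one-dimensional sums. The condition [#|C| <= p] makes
    the weight [envN^(2 p)] dominate that product. *)
Lemma grid_sum (C : finType) S s (p : R) : #|C|%:R <= p ->
  ((2 ^+ s)^-1) ^+ #|C| *
  \sum_(z : {ffun C -> 'I_(ncell S)}) (envN (@nodev R C S s z) `^ (2 * p))^-1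
  <= 4 ^+ #|C|.
Proof.
move=> Cp.
apply: (@le_trans _ _ (\prod_(c : C) \sum_(k < ncell S)
    (2 ^+ s)^-1 / (1 + `|node S s k : R|) ^+ 2)); last first.
  rewrite -prodr_const; apply: ler_prod => c _; rewrite node_sum andbT.
  apply: sumr_ge0 => k _; rewrite divr_ge0 ?invr_ge0 ?exprn_ge0//.
rewrite bigA_distr_bigA/= mulr_sumr; apply: ler_sum => z _.
rewrite big_split/= prodr_const ler_pM2l ?exprn_gt0 ?invr_gt0 ?exp2_gt0//.
rewrite prodfV lef_pV2 ?posrE ?powR_gt0 ?envN_gt0//; last first.
  by apply: prodr_gt0 => i _; rewrite exprn_gt0.
apply: (@le_trans _ _ (envN (@nodev R C S s z) `^ (2 * #|C|%:R))); last first.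
  by apply: envN_pow_mono; lra.
rewrite -natrM powR_mulrn ?(ltW (envN_gt0 _))// exprM -prodr_const.
apply: ler_prod => c _; rewrite exprn_ge0//=.
apply: lerXn2r; [by rewrite nnegrE addr_ge0|by rewrite nnegrE (ltW (envN_gt0 _))|].
by rewrite /envN lerD2l (bigD1 c)//= lerDl sumr_ge0.
Qed.

Lemma geo_sum_le (r : R) n : 0 <= r < 1 -> \sum_(s < n) r ^+ s <= (1 - r)^-1.
Proof.
move=> /andP[r0 r1]; have r1' : 0 < 1 - r by lra.
rewrite -[leRHS]mul1r ler_pdivlMr//.
have := subrX1 r n; have := exprn_ge0 n r0; set u := \sum_(i < n) _; nra.
Qed.

End grid_sums.

Section separated_representation.
Context d (T : measurableType d) (R : realType) (P : probability T R).
Variables (G H : set (set T)) (p p' q : R).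

(* [zeta w w'] is a finite sum of products of a function of [w] and a function
   of [w'], with bounds of l^p' and l^p type on the two families of factors. *)
Definition sep_sum (zeta : T -> T -> R) (M U Q : T -> R) (cc : R) :=
  exists (I : finType) (phi g : I -> T -> R) (c : I -> R),
  [/\ [/\ forall i, mG G (phi i), forall i, mG H (g i) & forall i, 0 < c i],
    forall w w', zeta w w' = \sum_i phi i w * g i w',
    [/\ forall i, Int P (fun w => `|g i w| `^ (2 * q)) /\
        \int[P]_w (`|g i w| `^ (2 * q)) <= c i `^ (2 * q),
      forall w, \sum_i `|phi i w| `^ p' <= M w &
      \sum_i c i `^ p <= cc] &
    (forall i, exists B, forall w, `|phi i w| <= B * U w) /\
    (forall i, exists B, forall w, `|g i w| <= B * Q w)].

Lemma sep_sum_past (Phi : T -> R) (M U : T -> R) : mG G Phi -> 1 <= q ->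
  (forall w, `|Phi w| `^ p' <= M w) -> (forall w, `|Phi w| <= U w) ->
  sep_sum (fun w _ => Phi w) M U (fun=> 1) 1.
Proof.
move=> mPhi q1 PM PU.
exists unit, (fun=> Phi), (fun _ _ => 1), (fun=> 1); split.
- by split => // _; exact: measurable_cst.
- by move=> w w'; rewrite (bigD1 tt)//= big1 ?addr0 ?mulr1//; case.
- split.
  + move=> _; split; first exact: Int_cst.
    by rewrite normr1 powR1 Ex_cst.
  + by move=> w; rewrite (bigD1 tt)//= big1 ?addr0//; case.
  + by rewrite (bigD1 tt)//= big1 ?addr0 ?powR1//; case.
- split=> _; first by exists 1 => w; rewrite mul1r.
  by exists 1 => w; rewrite mul1r normr1.
Qed.

(** [M] and [cc] enter the bound, as sums of [p']-th and [p]-th powers of the factors, whereas the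
    pointwise envelopes [U] and [Q] provide integrability of the individual terms. *)
Lemma sep_sum_decoupling (v : R) zeta zeta' M U Q cc M' U' Q' cc' :
  1 < p -> 1 < p' -> p^-1 + p'^-1 = 1 -> 1 <= q -> 0 < v ->
  sigma_algebra setT G -> G `<=` measurable ->
  sigma_algebra setT H -> H `<=` measurable ->
  (varpi_alg P q p G H <= v%:E)%E ->
  sep_sum zeta M U Q cc -> sep_sum zeta' M' U' Q' cc' ->
  Int P (fun w => M w * M' w) ->
  Int P (fun w => (U w * U' w) * (Q w * Q' w)) ->
  `|\int[P]_w (zeta w w * zeta' w w) -
    \int[P]_w \int[P]_w' (zeta w w' * zeta' w w')| <=
  v * (\int[P]_w (M w * M' w) + cc * cc').
Proof.
move=> p1 p'1 pp q1 v0 sG Gm sH Hm vb.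
move=> [I [phi [g [c [[mphi mg c0] zE [Ig pM cp] [pB gB]]]]]].
move=> [J [psi [k [b [[mpsi mk b0] zE' [Ik pM' cp'] [pB' gB']]]]]].
move=> IMM IUQ.
have mphiT i := mG_measurable sG Gm (mphi i).
have mpsiT i := mG_measurable sG Gm (mpsi i).
have mgT i := mG_measurable sH Hm (mg i).
have mkT i := mG_measurable sH Hm (mk i).
have M0 w : 0 <= M w.
  by apply: le_trans (pM w); apply: sumr_ge0 => i _; exact: powR_ge0.
have M'0 w : 0 <= M' w.
  by apply: le_trans (pM' w); apply: sumr_ge0 => i _; exact: powR_ge0.
have Ipp i j : Int P (fun w => `|phi i w * psi j w| `^ p').
  apply: (Int_dom _ IMM); first exact: measurable_normpow (measurable_funM _ _).
  move=> w; rewrite ger0_norm ?powR_ge0// normrM powRM//; apply: ler_pM.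
  - exact: powR_ge0.
  - exact: powR_ge0.
  - apply: le_trans (pM w); rewrite (bigD1 i)//= lerDl.
    by apply: sumr_ge0 => ? _; exact: powR_ge0.
  - apply: le_trans (pM' w); rewrite (bigD1 j)//= lerDl.
    by apply: sumr_ge0 => ? _; exact: powR_ge0.
have Iall i j : Int P (fun w => phi i w * psi j w * (g i w * k j w)).
  have [B1 h1] := pB i; have [B2 h2] := gB i.
  have [B3 h3] := pB' j; have [B4 h4] := gB' j.
  apply: (Int_dom _ (IntZ ((B1 * B3) * (B2 * B4)) IUQ)).
    by do 2 apply: measurable_funM => //.
  move=> w; rewrite !normrM.
  rewrite (_ : B1 * B3 * _ * _ = (B1 * U w * (B3 * U' w)) * (B2 * Q w * (B4 * Q' w)));
    last by ring.
  by apply: ler_pM; rewrite ?mulr_ge0//; apply: ler_pM.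
have Igk i j : Int P (fun w => g i w * k j w).
  have I1 := (Ig i).1; have I2 := (Ik j).1.
  have : Int P (fun w => 1 + `|g i w| `^ (2 * q) + (1 + `|k j w| `^ (2 * q))).
    by apply: IntD; apply: IntD => //; exact: Int_cst.
  move=> I3; apply: (Int_dom _ I3); first exact: measurable_funM.
  move=> w; rewrite normrM.
  have rs : 0 <= (2 : R) <= 2 * q.
    by rewrite ler0n/= ler_peMr.
  have := pow_le_1 (normr_ge0 (g i w)) rs.
  have := pow_le_1 (normr_ge0 (k j w)) rs.
  rewrite !powR_mulrn//; set x := `|g i w|; set y := `|k j w|.
  have := sqr_ge0 (x - y); have : 0 <= x by exact: normr_ge0.
  have : 0 <= y by exact: normr_ge0.
  by move: (x `^ _) (y `^ _) => ? ? ? ?; nra.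
have Ipsi i j : Int P (fun w => phi i w * psi j w).
  apply: Int_of_pow (Ipp i j); [exact: ltW|exact: measurable_funM].
have := separated_product_bound p1 p'1 pp q1 v0 sG Gm sH Hm vb c0 b0
  mphi mpsi mg mk Ig Ik Ipp Iall.
have -> : \int[P]_w ((\sum_i phi i w * g i w) * (\sum_j psi j w * k j w)) =
    \int[P]_w (zeta w w * zeta' w w).
  by apply: eq_Rintegral => w _; rewrite zE zE'.
have -> : \sum_i \sum_j \int[P]_w (phi i w * psi j w) * \int[P]_w (g i w * k j w) =
    \int[P]_w \int[P]_w' (zeta w w' * zeta' w w').
  transitivity (\int[P]_w \sum_i \sum_j
      (phi i w * psi j w) * \int[P]_w' (g i w' * k j w')).
    rewrite Ex_sum; last by move=> i _; apply: Int_sum => j _; exact: IntZr.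
    apply: eq_bigr => i _; rewrite Ex_sum; last by move=> j _; exact: IntZr.
    by apply: eq_bigr => j _; rewrite ExZr.
  apply: eq_Rintegral => w _.
  transitivity (\int[P]_w' \sum_i \sum_j
      (phi i w * psi j w) * (g i w' * k j w')).
    rewrite Ex_sum; last by move=> i _; apply: Int_sum => j _; exact: IntZ.
    apply: eq_bigr => i _; rewrite Ex_sum; last by move=> j _; exact: IntZ.
    by apply: eq_bigr => j _; rewrite ExZ.
  apply: eq_Rintegral => w' _; rewrite zE zE' mulr_suml; apply: eq_bigr => i _.
  by rewrite mulr_sumr; apply: eq_bigr => j _; ring.
move=> h; apply: (le_trans h); rewrite ler_pM2l//; apply: lerD.
  apply: Ex_le => //.
    apply: (Int_dom _ IMM).
      apply: measurable_funM; apply: measurable_sum => i;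
      exact: measurable_normpow.
    move=> w; rewrite ger0_norm; last first.
      by apply: mulr_ge0; apply: sumr_ge0 => i _; exact: powR_ge0.
    by apply: ler_pM => //; apply: sumr_ge0 => i _; exact: powR_ge0.
  by move=> w; apply: ler_pM => //; apply: sumr_ge0 => i _; exact: powR_ge0.
by apply: ler_pM => //; apply: sumr_ge0 => i _; exact: powR_ge0.
Qed.

End separated_representation.

Section chaining.
Context d (T : measurableType d) (R : realType) (P : probability T R).
Variables (G H : set (set T)) (p p' q kappa iota : R) (C : finType).
Variables (Mq : R) (Q : T -> R).
Hypothesis kappa01 : 0 < kappa <= 1.
Hypothesis iota0 : 0 <= iota.
Hypotheses (p1 : 1 < p) (p'1 : 1 < p') (pp : p^-1 + p'^-1 = 1) (q1 : 1 <= q).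
Hypothesis Cp : #|C|%:R <= p.
Hypothesis Ckappa : 0 < kappa - #|C|%:R / p.
Hypothesis Mq1 : 1 <= Mq.
Hypothesis Q1 : forall w, 1 <= Q w.
Hypothesis IQ : Int P (fun w => Q w `^ (2 * q * iota)).
Hypothesis EQ : \int[P]_w (Q w `^ (2 * q * iota)) <= Mq.
Variables (W : C -> T -> R) (f : (C -> R) -> T -> R).
Hypothesis mW : forall c, mG G (W c).
Hypothesis mf : forall x, mG H (f x).
Hypothesis mfT : forall x, measurable_fun setT (f x).
Hypothesis fb : forall x w, `|f x w| <= (envN x * Q w) `^ iota.
Hypothesis fd : forall x y w, `|f x w - f y w| <=
  ((envN x + envN y) * Q w) `^ iota * \sum_c `|x c - y c| `^ kappa.

(** Increments at level [s] have size [2^(-s kappa)] and there are about [2^(s #|C|)] cells, so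
    level [s] has [l^p] norm about [2^(-s gam) = rho ^ s]; both chaining bounds are geometric series
    in [rho]. *)
Let gam := kappa - #|C|%:R / p.
Let rho : R := 2 `^ (- gam).
Let n1 : R := 1 + #|C|%:R.
Definition chainM (x : R) : R := (1 - rho)^-1 * (n1 * x) `^ ((iota + 2) * p').
Let D0 : R := (1 + n1) `^ iota * (2 * n1).
Definition chainC : R := (D0 * Mq) `^ p * (4 ^+ #|C|) * (1 - rho)^-1.

Let rho01 : 0 <= rho < 1.
Proof. by rewrite powR_ge0/= base_lt1. Qed.

Lemma envN_rnd S s (x : C -> R) : envN (fun c => rnd S s (x c)) <= n1 * envN x.
Proof.
have h1 : envN (fun c => rnd S s (x c)) <= envN x + #|C|%:R.
  rewrite /envN -addrA lerD2l.
  apply: (@le_trans _ _ (\sum_i (`|x i| + 1))).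
    by apply: ler_sum => i _; exact: rnd_le.
  by rewrite big_split/= sumr_const.
apply: (le_trans h1); rewrite /n1 mulrDl mul1r lerD2l.
by rewrite ler_peMr// envN_ge1.
Qed.

Section fixed_scale.
Variable S : nat.
Local Notation cells := {ffun C -> 'I_(ncell S)}.

Let nd s (z : cells) : C -> R := @nodev R C S s z.
Let par s (z : cells) : C -> R := fun c => node S s (z c)./2.

(** Level 0 carries the value at the coarsest node itself, so that no base term is left outside the
    telescoping sum. *)
Definition incr s (z : cells) (w : T) : R :=
  if s is s'.+1 then f (nd s z) w - f (par s' z) w else f (nd s z) w.

(** Weights moved from the increments to the indicators. With exponent [s / p'], the [p']-th powers
    of the weighted indicators and, summed over cells, the [p]-th powers of the rescaled increments
    both decay like [rho ^ s]. In [wt], the exponent [iota] absorbs the growth of [f] and the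
    additional 2 makes the sum over the grid converge: this is the origin of [iota + 2] in
    Assumption (A). *)
Let a (s : nat) : R := rho `^ (s%:R / p').
Let wt s z : R := envN (nd s z) `^ (iota + 2).

Let a_gt0 s : 0 < a s.
Proof. by rewrite powR_gt0// powR_gt0. Qed.

Let wt_gt0 s z : 0 < wt s z.
Proof. by rewrite powR_gt0// envN_gt0. Qed.

Lemma incr_bound s z w :
  `|incr s z w| <= D0 * envN (nd s z) `^ iota * rate kappa s * Q w `^ iota.
Proof.
have N1 := envN_ge1 (nd s z).
have Q0 : 0 <= Q w by exact: le_trans (Q1 w).
have n0 : 0 <= #|C|%:R :> R by exact: ler0n.
have n11 : 1 <= n1 by rewrite /n1 lerDl.
have D1 : 1 <= D0.
  rewrite /D0 -[leLHS]mulr1; apply: ler_pM => //; last by lra.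
  have := @ler_powR R (1 + n1) _ 0 iota iota0; rewrite powRr0; apply; lra.
case: s z N1 => [|s] z N1 /=.
  rewrite /rate expr0 invr1 powR1 mulr1.
  apply: (le_trans (fb _ _)); rewrite powRM//; last by lra.
  by rewrite ler_wpM2r ?powR_ge0// ler_peMl ?powR_ge0.
apply: (le_trans (fd _ _ _)).
have np : envN (par s z) <= n1 * envN (nd s.+1 z).
  apply: (@le_trans _ _ (envN (nd s.+1 z) + #|C|%:R)).
    rewrite /envN -addrA lerD2l.
    apply: (@le_trans _ _ (\sum_i (`|nd s.+1 z i| + 1))); last first.
      by rewrite big_split/= sumr_const.
    apply: ler_sum => c _.
    have h := node_half S s (z c) : `|_| <= _ :> R.
    have h1 : (2 ^+ s)^-1 <= 1 :> R by rewrite invf_le1 ?exp2_gt0// exp2_ge1.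
    have := ler_distD (node S s.+1 (z c) : R) (node S s (z c)./2 : R) 0.
    rewrite !subr0 [`|node S s (z c)./2 - _|]distrC => h2.
    by apply: (le_trans h2); rewrite addrC lerD2l; exact: le_trans h1.
  by rewrite /n1 mulrDl mul1r lerD2l ler_peMr.
rewrite (_ : D0 * _ * _ * _ =
  ((1 + n1) `^ iota * envN (nd s.+1 z) `^ iota * Q w `^ iota) *
  (2 * n1 * rate kappa s.+1)); last by rewrite /D0; ring.
apply: ler_pM.
- exact: powR_ge0.
- by apply: sumr_ge0 => c _; exact: powR_ge0.
- rewrite -!powRM ?mulr_ge0//; try lra.
  apply: le_powR => //.
    have h1 := envN_gt0 (nd s.+1 z); have h2 := envN_gt0 (par s z).
    by apply: mulr_ge0 => //; apply: addr_ge0; exact: ltW.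
  by rewrite ler_wpM2r//; lra.
- apply: (@le_trans _ _ (\sum_(c : C) 2 * rate kappa s.+1)); last first.
    rewrite sumr_const -[_ *+ _]mulr_natr mulrAC ler_wpM2r ?rate_ge0//.
    by rewrite /n1; lra.
  apply: ler_sum => c _.
  case/andP: kappa01 => k0 k1.
  apply: (@le_trans _ _ ((2 * (2 ^+ s.+1)^-1) `^ kappa)).
    apply: le_powR => //; first exact: ltW.
    apply: le_trans (node_half S s (z c)) _.
    by rewrite exprS invfM mulrA mulfV ?mul1r.
  rewrite powRM ?invr_ge0 ?exprn_ge0// -/(rate kappa s.+1) ler_wpM2r ?rate_ge0//.
  by apply: ler1_powR => //; rewrite ler1n.
Qed.

Lemma incr_telescope (x : C -> R) w :
  \sum_(s < S.+1) incr s (cellz (leq_ord s) x) w = f (rndv S x) w.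
Proof.
have E n (nS : (n <= S)%N) : \sum_(s < n.+1)
    incr s [ffun c => inord (cell S s (x c))] w = f (fun c => rnd S n (x c)) w.
  elim: n nS => [|n IH] nS.
    rewrite big_ord_recl big_ord0 addr0 /=; congr (f _ w).
    apply/funext => c; rewrite /nd /nodev ffunE inordK//.
    exact: (cell_lt _ nS).
  rewrite big_ord_recr/= IH ?(ltnW nS)//.
  have -> : nd n.+1 [ffun c => inord (cell S n.+1 (x c))] = fun c => rnd S n.+1 (x c).
    by apply/funext => c; rewrite /nd /nodev ffunE inordK//; exact: (cell_lt _ nS).
  have -> : par n [ffun c => inord (cell S n.+1 (x c))] = fun c => rnd S n (x c).
    apply/funext => c; rewrite /par ffunE inordK; last exact: (cell_lt _ nS).
    by rewrite -cellS.
  by rewrite addrCA subrr addr0.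
rewrite -(E S (leqnn S)); apply: eq_bigr => s _; congr (incr s _ w).
apply/ffunP => c; rewrite !ffunE; apply: val_inj => /=.
by rewrite inordK//; apply: cell_lt; rewrite -ltnS.
Qed.

(** The index of the sum is a level together with a cell: the past factor is a weighted indicator of
    [W] lying in the cell, the future factor an increment between deterministic nodes, hence a fixed
    function to which [varpi] applies. *)
Lemma chain_sep_sum :
  sep_sum P G H p p' q (fun w w' => f (rndv S (fun c => W c w)) w')
    (fun w => chainM (envN (fun c => W c w))) (fun=> 1)
    (fun w => Q w `^ iota) chainC.
Proof.
have rho0 : 0 < rho by rewrite powR_gt0.
have n10 : 0 < n1 by rewrite /n1 ltr_wpDr.
have n110 : 0 < 1 + n1 by rewrite addr_gt0.
have D00 : 0 < D0 by rewrite /D0 !mulr_gt0 ?powR_gt0.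
pose I : finType := ('I_S.+1 * cells)%type.
pose phi (i : I) w := a i.1 * wt i.1 i.2 * \1_(@cellset _ T R C S i.1 W i.2) w.
pose g (i : I) w := (a i.1 * wt i.1 i.2)^-1 * incr i.1 i.2 w.
pose c (i : I) := D0 * Mq * envN (nd i.1 i.2) `^ iota * rate kappa i.1 /
   (a i.1 * wt i.1 i.2).
have aw0 (i : I) : 0 < a i.1 * wt i.1 i.2 by rewrite mulr_gt0.
have rate0 s : 0 < rate kappa s by rewrite powR_gt0// invr_gt0 exp2_gt0.
have Q0 w : 0 <= Q w by exact: le_trans (Q1 w).
have Mq0 : 0 < Mq by exact: lt_le_trans Mq1.
have q0 : 0 < 2 * q by rewrite mulr_gt0// (lt_le_trans ltr01).
have c0 i : 0 < c i.
  by rewrite /c divr_gt0// !mulr_gt0// powR_gt0// envN_gt0.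
have p'0 : p' != 0 by rewrite gt_eqF// (lt_trans ltr01).
(* At a given sample point exactly one cell per level contributes. *)
have sumI w (F : I -> R) :
   \sum_(i : I) F i * \1_(@cellset _ T R C S i.1 W i.2) w =
   \sum_(s < S.+1) F (s, cellz (leq_ord s) (fun c => W c w)).
  transitivity (\sum_(s < S.+1) \sum_(z : cells)
      F (s, z) * \1_(@cellset _ T R C S s W z) w).
    by rewrite pair_bigA; apply: eq_bigr => -[s z] _.
  by apply: eq_bigr => s _; rewrite (sum_cellset (leq_ord s) W (fun z => F (s, z))).
pose B (i : I) := D0 * envN (nd i.1 i.2) `^ iota * rate kappa i.1 / (a i.1 * wt i.1 i.2).
have B0 i : 0 < B i.
  by rewrite /B divr_gt0// !mulr_gt0// powR_gt0// envN_gt0.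
have cB i : c i = B i * Mq by rewrite /c /B; ring.
have gB i w : `|g i w| <= B i * Q w `^ iota.
  rewrite /g normrM gtr0_norm ?invr_gt0// mulrC ler_pdivrMr//.
  apply: (le_trans (incr_bound _ _ _)); rewrite /B.
  have := aw0 i; move: (a _ * wt _ _) => u u0.
  by rewrite -[leRHS]mulrA [Q w `^ iota * u]mulrC mulrA divfK// gt_eqF.
have mi s z : mG H (incr s z).
  by rewrite /incr; case: s => [|s]; [|apply: measurable_funB]; exact: mf.
have miT s z : measurable_fun setT (incr s z).
  by rewrite /incr; case: s => [|s]; [|apply: measurable_funB]; exact: mfT.
exists I, phi, g, c; split.
- split=> //.
  + move=> i; apply: measurable_funM; first exact: measurable_cst.
    apply: measurable_indic.
    exact: (@measurable_cellset _ (g_sigma_algebraType G) R C S _ W).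
  + by move=> i; apply: measurable_funM; [exact: measurable_cst|exact: mi].
- move=> w w'.
  transitivity (\sum_(i : I) incr i.1 i.2 w' * \1_(@cellset _ T R C S i.1 W i.2) w).
    by rewrite (sumI w (fun i => incr i.1 i.2 w'))/= incr_telescope.
  apply: eq_bigr => i _; rewrite /phi /g.
  by have := aw0 i; move: (a _ * wt _ _) => u u0; field; rewrite gt_eqF.
- split.
  + move=> i.
    have gq w : `|g i w| `^ (2 * q) <= B i `^ (2 * q) * Q w `^ (2 * q * iota).
      apply: (@le_trans _ _ ((B i * Q w `^ iota) `^ (2 * q))).
        by apply: le_powR => //; exact: ltW.
      by rewrite powRM ?powR_ge0 ?(ltW (B0 i))// -powRrM [iota * _]mulrC.
    have [||||Ig le] := @EFin_Ex_le _ _ _ P (fun w => `|g i w| `^ (2 * q))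
      (fun w => B i `^ (2 * q) * Q w `^ (2 * q * iota)).
    * apply: measurable_normpow; apply: measurable_funM => //; exact: miT.
    * by move=> w; exact: powR_ge0.
    * exact: IntZ.
    * exact: gq.
    (* As [Mq >= 1] and [2 q >= 1], the moment bound [Mq] is at most its own power of order [2 q],
       which is what the factor [Mq] in [c] produces. *)
    split => //; apply: (le_trans le); rewrite ExZ// cB powRM ?(ltW (B0 i)) ?(ltW Mq0)//.
    rewrite ler_wpM2l ?powR_ge0//; apply: (le_trans EQ).
    apply: le1r_powR => //.
    by rewrite (le_trans q1)// ler_peMl ?ler1n// (le_trans ler01).
  + move=> w; rewrite /chainM.
    have -> : \sum_(i : I) `|phi i w| `^ p' =
        \sum_(i : I) (a i.1 * wt i.1 i.2) `^ p' * \1_(@cellset _ T R C S i.1 W i.2) w.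
      apply: eq_bigr => i _; rewrite /phi normrM gtr0_norm// indicE.
      by case: (_ \in _); rewrite ?normr1 ?mulr1// normr0 !mulr0 powR0.
    rewrite (sumI w (fun i => (a i.1 * wt i.1 i.2) `^ p'))/=.
    apply: (@le_trans _ _ (\sum_(s < S.+1) rho ^+ s *
        (n1 * envN (fun c => W c w)) `^ ((iota + 2) * p'))); last first.
      by rewrite -mulr_suml ler_wpM2r ?powR_ge0// geo_sum_le.
    apply: ler_sum => s _; rewrite powRM ?(ltW (a_gt0 _)) ?(ltW (wt_gt0 _ _))//.
    rewrite {1}/a -powRrM mulfVK// powR_mulrn ?(ltW rho0)//.
    rewrite ler_wpM2l ?exprn_ge0 ?(ltW rho0)// /wt -powRrM.
    have e0 : 0 <= (iota + 2) * p'.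
      by rewrite mulr_ge0 ?addr_ge0// (le_trans ler01)// ltW.
    apply: le_powR => //; first exact: ltW (envN_gt0 _).
    by rewrite /nd nodev_cellz; exact: envN_rnd.
  + have p0 : 0 < p by exact: lt_trans p1.
    have e2n : 2 != 0 :> R by rewrite pnatr_eq0.
    (* After division by the weight, the [p]-th power is [rho ^ s] times the volume of a cell, which
       is the prefactor of [grid_sum]. *)
    have ratea s : (rate kappa s / a s) `^ p = rho ^+ s * ((2 ^+ s)^-1) ^+ #|C|.
      rewrite rate_exp /a /rho -!powR_mulrn ?powR_ge0// -!powRrM.
      rewrite -powRN -powRD ?e2n ?implybT// -powRrM.
      rewrite [X in _ = _ * X](_ : _ = 2 `^ (- (s%:R * #|C|%:R))); last first.
        by rewrite -mulNr powRrM powRN.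
      rewrite -powRD ?e2n ?implybT//; congr (_ `^ _).
      have -> : s%:R / p' = s%:R * (1 - p^-1) by congr (_ * _); rewrite -pp; ring.
      by rewrite /gam; field; rewrite gt_eqF.
    have cp (i : I) : c i `^ p = (D0 * Mq) `^ p * (rho ^+ i.1 *
        (((2 ^+ i.1)^-1) ^+ #|C| * (envN (nd i.1 i.2) `^ (2 * p))^-1)).
      have N0 := envN_gt0 (nd i.1 i.2).
      have -> : c i = (D0 * Mq) * ((rate kappa i.1 / a i.1) *
          envN (nd i.1 i.2) `^ (- 2)).
        rewrite (_ : - 2 = iota - (iota + 2)); last by ring.
        rewrite powRB ?(gt_eqF N0) ?implybT// -/(wt i.1 i.2) /c.
        have := wt_gt0 i.1 i.2; have := a_gt0 i.1.
        move: (a _) (wt _ _) => u v u0 v0.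
        by field; rewrite !gt_eqF.
      have r0 : 0 <= rate kappa i.1 / a i.1 by rewrite divr_ge0 ?ltW.
      have DM0 : 0 <= D0 * Mq by rewrite mulr_ge0 ?(ltW D00) ?(ltW Mq0).
      have rN0 : 0 <= rate kappa i.1 / a i.1 * envN (nd i.1 i.2) `^ (- 2).
        by rewrite mulr_ge0 ?powR_ge0.
      rewrite (powRM p DM0 rN0) (powRM p r0 (powR_ge0 _ _)) ratea -mulrA.
      by rewrite -powRrM mulNr powRN.
    under eq_bigr => i _ do rewrite cp.
    rewrite -mulr_sumr /chainC -!mulrA ler_wpM2l ?powR_ge0//.
    rewrite (_ : \sum_(i : I) _ = \sum_(s < S.+1) \sum_(z : cells)
      rho ^+ s * (((2 ^+ s)^-1) ^+ #|C| * (envN (nd s z) `^ (2 * p))^-1)); last first.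
      by rewrite pair_bigA; apply: eq_bigr => -[s z] _.
    apply: (@le_trans _ _ (\sum_(s < S.+1) rho ^+ s * 4 ^+ #|C|)).
      apply: ler_sum => s _; rewrite -mulr_sumr ler_wpM2l ?exprn_ge0 ?(ltW rho0)//.
      by rewrite -mulr_sumr; exact: grid_sum.
    by rewrite -mulr_suml mulrC ler_wpM2l ?exprn_ge0// geo_sum_le.
- split=> i.
  + exists (a i.1 * wt i.1 i.2) => w; rewrite /phi normrM gtr0_norm//.
    rewrite ler_pM2l// indicE; by case: (_ \in _); rewrite ?normr1 ?normr0.
  + by exists (B i) => w; exact: gB.
Qed.

End fixed_scale.
End chaining.

(** * Decoupling a product of two functions of past and future *)

Section decoupling.
Context d (T : measurableType d) (R : realType) (P : probability T R).
Variables (p p' q kappa iota theta Gam : R).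
Hypothesis kappa01 : 0 < kappa <= 1.
Hypothesis iota0 : 0 < iota.
Hypotheses (p1 : 1 < p) (p'1 : 1 < p') (pp : p^-1 + p'^-1 = 1) (q1 : 1 <= q).
Hypothesis thetap : (2 * iota + 4) * p' <= theta.
Hypothesis thetaq : 2 * q * iota <= theta.
Hypothesis Gam0 : 0 <= Gam.

(** Past coordinates on [B], future ones on [U], frozen values elsewhere; decoupling consists in
    evaluating [x] and [y] at different sample points. *)
Definition mix (I : finType) (B U : {pred I}) (e x y : I -> R) : I -> R :=
  fun i => if i \in B then x i else if i \in U then y i else e i.

Definition chainable (I : finType) (B : {pred I}) : Prop :=
  #|B|%:R <= p /\ 0 < kappa - #|B|%:R / p.

Let pow_iota (N : R) b : R := if b then N `^ iota else 1.

(* [b] tells whether the second argument of [zeta] is the one carrying the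
   growth: [true] for a chained factor, [false] for a factor of the past. *)
Definition sep_approx (G H : set (set T)) (zeta : T -> T -> R) (N : T -> R)
    (cM cc nn : R) (b : bool) :=
  exists z : nat -> T -> T -> R,
  [/\ forall S, sep_sum P G H p p' q (z S) (fun w => cM * N w `^ ((iota + 2) * p'))
        (fun w => pow_iota (N w) (~~ b)) (fun w => pow_iota (N w) b) cc,
    forall w w', z ^~ w ^~ w' @ \oo --> zeta w w',
    forall S w w', `|z S w w'| <= (nn * N w) `^ iota * pow_iota (N w') b &
    forall S w, `|z S w w| <= (nn * N w) `^ iota].

(** Only the coordinates in [B] are chained; frozen and future ones are absorbed into a family of
    fixed functions of the future. The constants precede the sigma-algebras, processes and
    functions, and the normalisation by [K] and the envelope of [e] keeps them independent of
    both. *)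
Lemma approx_chain (I : finType) (B U : {pred I}) : chainable B ->
  exists cM cc nn, [/\ 0 <= cM, 0 <= cc, 0 <= nn &
  forall G H (eta : I -> T -> R) (e : I -> R) f K,
  sigma_algebra setT G -> G `<=` measurable ->
  sigma_algebra setT H -> H `<=` measurable ->
  (forall i, i \in B -> mG G (eta i)) -> (forall i, i \in U -> mG H (eta i)) ->
  momb P theta Gam eta -> 0 < K -> Hol kappa K iota f ->
  sep_approx G H (fun w w' => (K * envN e `^ iota)^-1 *
      f (mix B U e (eta^~ w) (eta^~ w')))
    (fun w => envN (eta^~ w)) cM cc nn true].
Proof.
move=> [Bp Bk].
pose C : finType := {i : I | i \in B}.
have cC : #|C| = #|B| by rewrite card_sig.
have Cp : #|C|%:R <= p by rewrite cC.
have Ck : 0 < kappa - #|C|%:R / p by rewrite cC.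
pose Mq := momC theta Gam #|I|.
have q0 : 0 < 2 * q by rewrite mulr_gt0// (lt_le_trans ltr01).
have t0 : 0 <= theta by apply: le_trans thetaq; rewrite mulr_ge0 ?(ltW iota0) ?(ltW q0).
have Mq1 : 1 <= Mq by exact: momC_ge1.
have rhop : 0 <= (1 - 2 `^ (- (kappa - #|C|%:R / p)))^-1 :> R.
  by rewrite invr_ge0 subr_ge0 ltW// base_lt1.
exists ((1 - 2 `^ (- (kappa - #|C|%:R / p)))^-1 *
   (1 + #|C|%:R) `^ ((iota + 2) * p')).
exists (chainC p kappa iota C Mq), (1 + #|I|%:R); split.
- by rewrite mulr_ge0 ?powR_ge0.
- by rewrite /chainC !mulr_ge0 ?powR_ge0 ?exprn_ge0.
- by rewrite addr_ge0.
move=> G H eta e f K sG Gm sH Hm etaB etaU meta K0 fH.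
have meti i : measurable_fun setT (eta i) by have [] := meta i.
pose N w := envN (eta^~ w).
have N1 w : 1 <= N w by exact: envN_ge1.
have e1 := envN_ge1 e.
have KN0 : 0 < K * envN e `^ iota by rewrite mulr_gt0// powR_gt0// envN_gt0.
(* [mix] reads [ext x] on [B] only; extending by 0 leaves the envelope unchanged. *)
pose ext (x : C -> R) : I -> R := fun i => oapp x 0 (insub i).
have extB (x : C -> R) (c : C) : ext x (val c) = x c by rewrite /ext valK.
have extN (x : C -> R) i : i \notin B -> ext x i = 0.
  by move=> iB; rewrite /ext insubN.
pose F (x : C -> R) (w : T) := (K * envN e `^ iota)^-1 *
   f (mix B U e (ext x) (eta^~ w)).
pose W (c : C) : T -> R := eta (val c).
have sumext (x : C -> R) : \sum_i `|ext x i| = \sum_c `|x c|.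
  rewrite (bigID (mem B))/= [X in _ + X]big1 ?addr0; last first.
    by move=> i iB; rewrite extN// normr0.
  rewrite (big_sub B (fun i => `|ext x i|))/=.
  by apply: eq_bigr => c _; rewrite extB.
have envext x : envN (ext x) = envN x by rewrite /envN sumext.
have mixb x w : envN (mix B U e (ext x) (eta^~ w)) <= envN e * (envN x * N w).
  apply: (@le_trans _ _ (envN e * envN (mix B U (fun=> 0) (ext x) (eta^~ w)))).
    by apply: envN_mix => i; rewrite /mix; case: (i \in B); case: (i \in U); auto.
  rewrite ler_wpM2l ?(le_trans ler01)// -envext.
  apply: (@le_trans _ _ (envN (ext x) * envN (fun i => if i \in U then eta i w else 0))).
    apply: envN_mix => i; rewrite /mix; case: ifP => iB; first by left.
    by right.
  rewrite ler_wpM2l ?(le_trans ler01) ?envN_ge1// /envN lerD2l.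
  by apply: ler_sum => i _; case: ifP; rewrite ?normr0.
have fb x w : `|F x w| <= (envN x * N w) `^ iota.
  rewrite /F normrM gtr0_norm ?invr_gt0// mulrC ler_pdivrMr//.
  case: fH => + _ => /(_ (mix B U e (ext x) (eta^~ w))) h; apply: (le_trans h).
  rewrite mulrCA ler_pM2l// mulrC -powRM ?mulr_ge0 ?(le_trans ler01) ?envN_ge1//.
  apply: le_powR; [exact: ltW|exact: ltW (envN_gt0 _)|exact: mixb].
have fd x y w : `|F x w - F y w| <=
    ((envN x + envN y) * N w) `^ iota * \sum_c `|x c - y c| `^ kappa.
  rewrite /F -mulrBr normrM gtr0_norm ?invr_gt0// mulrC ler_pdivrMr//.
  case: fH => _ /(_ (mix B U e (ext x) (eta^~ w)) (mix B U e (ext y) (eta^~ w))) h.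
  apply: (le_trans h).
  rewrite [leRHS](_ : _ = K * (envN e `^ iota * ((envN x + envN y) * N w) `^ iota) *
    \sum_c `|x c - y c| `^ kappa); last by ring.
  apply: ler_pM.
  - by rewrite mulr_ge0 ?powR_ge0 ?ltW.
  - by apply: sumr_ge0 => i _; exact: powR_ge0.
  - have n2 : 0 <= (envN x + envN y) * N w.
      apply: mulr_ge0; last exact: ltW (envN_gt0 _).
      by apply: addr_ge0; exact: ltW (envN_gt0 _).
    rewrite ler_pM2l// -(powRM _ (ltW (envN_gt0 e)) n2).
    apply: le_powR; first exact: ltW.
      by apply: addr_ge0; exact: ltW (envN_gt0 _).
    by rewrite (mulrDl (envN x)) mulrDr; apply: lerD; exact: mixb.
  - rewrite (bigID (mem B))/= [X in _ + X]big1 ?addr0; last first.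
      move=> i iB; rewrite /mix (negbTE iB) subrr normr0 powR0//.
      by rewrite gt_eqF//; case/andP: kappa01.
    rewrite (big_sub B (fun i => `|mix B U e (ext x) (eta^~ w) i -
      mix B U e (ext y) (eta^~ w) i| `^ kappa))/=.
    by apply: ler_sum => c _; rewrite /mix (valP c) !extB.
have mF x : mG H (F x).
  apply: measurable_funM; first exact: measurable_cst.
  apply: (@measurable_Hol _ (g_sigma_algebraType H) R I kappa K iota
    (fun i w => mix B U e (ext x) (eta^~ w) i) f) => //; first exact: ltW.
  move=> i; rewrite /mix; case: (i \in B); first exact: measurable_cst.
  by case: (boolP (i \in U)) => [iU|_]; [exact: etaU|exact: measurable_cst].
have mW c : mG G (W c) by apply: etaB; exact: (valP c).
have WN w : envN (W^~ w) <= N w.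
  rewrite /N /envN lerD2l /W -(big_sub B (fun i => `|eta i w|)).
  by rewrite [leRHS](bigID (mem B))/= lerDl sumr_ge0.
have [IQ EQ] : Int P (fun w => N w `^ (2 * q * iota)) /\
    \int[P]_w (N w `^ (2 * q * iota)) <= Mq.
  by apply: envN_mom => //; rewrite thetaq mulr_ge0 ?(ltW q0) ?ltW.
have rnb S w : envN (rndv S (W^~ w)) <= (1 + #|I|%:R) * N w.
  apply: (le_trans (envN_rndv _ _)); apply: ler_pM => //.
    exact: ltW (envN_gt0 _).
  by rewrite lerD2l ler_nat cC max_card.
exists (fun S w w' => F (rndv S (W^~ w)) w'); split.
- move=> S.
  have [I0 [phi [g [c [h1 h2 [h3 h4 h5] [h6 h7]]]]]] :=
    chain_sep_sum kappa01 (ltW iota0) p1 p'1 pp q1 Cp Ck Mq1 N1 IQ EQ mW mF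
      (fun x => mG_measurable sH Hm (mF x)) fb fd S.
  exists I0, phi, g, c; split => //=; split => // w.
  apply: (le_trans (h4 w)); rewrite /chainM -mulrA ler_wpM2l//.
  have c0 : 0 <= 1 + #|C|%:R :> R by rewrite addr_ge0.
  rewrite (powRM _ c0 (ltW (envN_gt0 _))) ler_wpM2l ?powR_ge0//.
  apply: le_powR; [|exact: ltW (envN_gt0 _)|exact: WN].
  by rewrite mulr_ge0 ?addr_ge0 ?(ltW iota0)// (le_trans ler01)// ltW.
- move=> w w'.
  have gH : Hol kappa (N w' `^ iota) iota (fun x => F x w').
    split => [x|x y].
      by rewrite mulrC -powRM ?(ltW (envN_gt0 _)).
    have n2 : 0 <= envN x + envN y by apply: addr_ge0; exact: ltW (envN_gt0 _).
    apply: (le_trans (fd x y w')); rewrite (powRM _ n2 (ltW (envN_gt0 _))).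
    by rewrite [_ * N w' `^ iota]mulrC.
  have -> : (K * envN e `^ iota)^-1 * f (mix B U e (eta^~ w) (eta^~ w')) =
      F (W^~ w) w'.
    congr (_ * f _); apply/funext => i; rewrite /mix; case: ifPn => // iB.
    by rewrite (extB (W^~ w) (Sub i iB)).
  exact: (Hol_cvg kappa01 (ltW iota0) gH).
- move=> S w w' /=; apply: (le_trans (fb _ _)).
  rewrite (powRM _ (ltW (envN_gt0 _)) (ltW (envN_gt0 _))) ler_wpM2r ?powR_ge0//.
  by apply: le_powR; [exact: ltW|exact: ltW (envN_gt0 _)|exact: rnb].
- move=> S w; rewrite /F normrM gtr0_norm ?invr_gt0// mulrC ler_pdivrMr//.
  case: fH => + _ => /(_ (mix B U e (ext (rndv S (W^~ w))) (eta^~ w))) h.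
  apply: (le_trans h); rewrite mulrCA ler_pM2l// mulrC -powRM; last 2 first.
  + exact: ltW (envN_gt0 _).
  + by apply: mulr_ge0; [exact: addr_ge0|exact: ltW (envN_gt0 _)].
  apply: le_powR; [exact: ltW|exact: ltW (envN_gt0 _)|].
  apply: (@le_trans _ _ (envN e * envN (mix B U (fun=> 0)
     (ext (rndv S (W^~ w))) (eta^~ w)))).
    by apply: envN_mix => i; rewrite /mix; case: (i \in B); case: (i \in U); auto.
  rewrite ler_wpM2l ?(le_trans ler01)//.
  apply: (@le_trans _ _ (N w + #|I|%:R)); last first.
    rewrite mulrDl mul1r lerD2l; apply: ler_peMr; [exact: ler0n|exact: envN_ge1].
  rewrite /N /envN -addrA lerD2l.
  apply: (@le_trans _ _ (\sum_i (`|eta i w| + 1))); last first.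
    by rewrite big_split/= sumr_const.
  apply: ler_sum => i _; rewrite /mix; case: ifPn => iB.
    by rewrite (extB _ (Sub i iB)); exact: rnd_le.
  by case: ifP => _; rewrite ?normr0 ?addr_ge0// lerDl.
Qed.

(** Without future coordinates the function is a single past factor and nothing is chained, so no
    bound on the number of coordinates arises. This covers factors depending on all slots. *)
Lemma approx_past (I : finType) (B U : {pred I}) G H (eta : I -> T -> R) e f K :
  sigma_algebra setT G -> G `<=` measurable ->
  (forall i, i \in B -> mG G (eta i)) -> (forall i, i \notin U) ->
  0 < K -> Hol kappa K iota f ->
  sep_approx G H (fun w w' => (K * envN e `^ iota)^-1 *
      f (mix B U e (eta^~ w) (eta^~ w')))
    (fun w => envN (eta^~ w)) 1 1 1 false.
Proof.
move=> sG Gm etaB U0 K0 fH.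
pose N w := envN (eta^~ w).
have KN0 : 0 < K * envN e `^ iota by rewrite mulr_gt0// powR_gt0// envN_gt0.
pose Phi w := (K * envN e `^ iota)^-1 * f (mix B U e (eta^~ w) (eta^~ w)).
have PhiE w w' : Phi w = (K * envN e `^ iota)^-1 * f (mix B U e (eta^~ w) (eta^~ w')).
  by congr (_ * f _); apply/funext => i; rewrite /mix (negbTE (U0 i)).
have PhiN w : `|Phi w| <= N w `^ iota.
  rewrite /Phi normrM gtr0_norm ?invr_gt0// mulrC ler_pdivrMr//.
  case: fH => + _ => /(_ (mix B U e (eta^~ w) (eta^~ w))) h.
  apply: (le_trans h); rewrite mulrCA ler_pM2l// mulrC -powRM ?(ltW (envN_gt0 _))//.
  apply: le_powR; [exact: ltW|exact: ltW (envN_gt0 _)|].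
  apply: envN_mix => i; rewrite /mix (negbTE (U0 i)).
  by case: (i \in B); auto.
have mPhi : mG G Phi.
  apply: measurable_funM; first exact: measurable_cst.
  apply: (@measurable_Hol _ (g_sigma_algebraType G) R I kappa K iota
    (fun i w => mix B U e (eta^~ w) (eta^~ w) i) f) => //; first exact: ltW.
  move=> i; rewrite /mix (negbTE (U0 i)); case: (boolP (i \in B)) => [iB|_]; last exact: measurable_cst.
  exact: etaB.
exists (fun _ w _ => Phi w); split.
- move=> S /=; apply: sep_sum_past => // w.
  rewrite mul1r powRrM; apply: le_powR => //; first by rewrite (le_trans ler01)// ltW.
  apply: (le_trans (PhiN w)); apply: envN_pow_mono; lra.
- by move=> w w'; rewrite -PhiE; exact: cvg_cst.
- by move=> S w w' /=; rewrite mulr1 mul1r.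
- by move=> S w; rewrite mul1r.
Qed.

Lemma sep_sum_measurable G H zeta zeta' M U Q cc M' U' Q' cc' :
  sigma_algebra setT G -> G `<=` measurable ->
  sigma_algebra setT H -> H `<=` measurable ->
  sep_sum P G H p p' q zeta M U Q cc ->
  sep_sum P G H p p' q zeta' M' U' Q' cc' ->
  Int P (fun w => Q w * Q' w) ->
  [/\ measurable_fun setT (fun w => zeta w w * zeta' w w),
    forall w, Int P (fun w' => zeta w w' * zeta' w w') &
    measurable_fun setT (fun w => \int[P]_w' (zeta w w' * zeta' w w'))].
Proof.
move=> sG Gm sH Hm [I [phi [g [c [[mphi mg _] zE [_ _ _] [_ gB]]]]]].
move=> [J [psi [k [b [[mpsi mk _] zE' [_ _ _] [_ kB]]]]]] IQ.
have mphiT i := mG_measurable sG Gm (mphi i).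
have mpsiT i := mG_measurable sG Gm (mpsi i).
have mgT i := mG_measurable sH Hm (mg i).
have mkT i := mG_measurable sH Hm (mk i).
have Igk i j : Int P (fun w => g i w * k j w).
  have [B1 h1] := gB i; have [B2 h2] := kB j.
  apply: (Int_dom _ (IntZ (B1 * B2) IQ)); first exact: measurable_funM.
  move=> w; rewrite normrM mulrACA; exact: ler_pM.
have E w w' : zeta w w' * zeta' w w' =
    \sum_i \sum_j (phi i w * psi j w) * (g i w' * k j w').
  rewrite zE zE' mulr_suml; apply: eq_bigr => i _.
  by rewrite mulr_sumr; apply: eq_bigr => j _; ring.
have I1 w : Int P (fun w' => zeta w w' * zeta' w w').
  have h : Int P (fun w' => \sum_i \sum_j (phi i w * psi j w) * (g i w' * k j w')).
    by apply: Int_sum => i _; apply: Int_sum => j _; exact: IntZ.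
  by apply: (Int_ext h) => w'; rewrite E.
split => //.
- rewrite (_ : (fun w => _) = fun w =>
    \sum_i \sum_j (phi i w * psi j w) * (g i w * k j w)); last first.
    by apply/funext => w; rewrite E.
  apply: measurable_sum => i; apply: measurable_sum => j.
  by do 2 apply: measurable_funM => //.
- rewrite (_ : (fun w => _) = fun w =>
    \sum_i \sum_j (phi i w * psi j w) * \int[P]_w' (g i w' * k j w')); last first.
    apply/funext => w.
    transitivity (\int[P]_w' \sum_i \sum_j
        (phi i w * psi j w) * (g i w' * k j w')).
      by apply: eq_Rintegral => w' _; rewrite E.
    rewrite Ex_sum; last by move=> i _; apply: Int_sum => j _; exact: IntZ.
    apply: eq_bigr => i _; rewrite Ex_sum; last by move=> j _; exact: IntZ.
    by apply: eq_bigr => j _; rewrite ExZ.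
  apply: measurable_sum => i; apply: measurable_sum => j.
  by do 2 apply: measurable_funM => //.
Qed.

Lemma pow_mul_le (x y a b : R) : 1 <= x -> 1 <= y -> 0 <= a -> 0 <= b ->
  x `^ a * y `^ b <= x `^ (a + b) + y `^ (a + b).
Proof.
move=> x1 y1 a0 b0; have x0 : 0 < x by lra. have y0 : 0 < y by lra.
have hx : (a + b == 0) ==> (x != 0) by rewrite (gt_eqF x0) implybT.
have hy : (a + b == 0) ==> (y != 0) by rewrite (gt_eqF y0) implybT.
rewrite (powRD hx) (powRD hy).
have [xy|yx] := leP x y.
  apply: (@le_trans _ _ (y `^ a * y `^ b)).
    by rewrite ler_wpM2r ?powR_ge0//; apply: le_powR => //; exact: ltW.
  by rewrite lerDr mulr_ge0 ?powR_ge0.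
apply: (@le_trans _ _ (x `^ a * x `^ b)).
  by rewrite ler_wpM2l ?powR_ge0//; apply: le_powR => //; exact: ltW.
by rewrite lerDl mulr_ge0 ?powR_ge0.
Qed.

Lemma mom_mul (I J : finType) (eta : I -> T -> R) (eta' : J -> T -> R) a b :
  momb P theta Gam eta -> momb P theta Gam eta' ->
  0 <= a -> 0 <= b -> a + b <= theta ->
  Int P (fun w => envN (eta^~ w) `^ a * envN (eta'^~ w) `^ b) /\
  \int[P]_w (envN (eta^~ w) `^ a * envN (eta'^~ w) `^ b) <=
    momC theta Gam #|I| + momC theta Gam #|J|.
Proof.
move=> me me' a0 b0 ab.
have ab0 : 0 <= a + b <= theta by rewrite addr_ge0.
have [I1 E1] := envN_mom ab0 me; have [I2 E2] := envN_mom ab0 me'.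
have [|||I3 E3] := @EFin_Ex_le _ _ _ P
  (fun w => envN (eta^~ w) `^ a * envN (eta'^~ w) `^ b) _ _ _ (IntD I1 I2).
- apply: measurable_funM; apply: measurable_pow; apply: measurable_envN => i.
    by have [] := me i.
  by have [] := me' i.
- by move=> w; rewrite mulr_ge0 ?powR_ge0.
- by move=> w; apply: pow_mul_le => //; exact: envN_ge1.
by split => //; apply: (le_trans E3); rewrite ExD//; exact: lerD.
Qed.

(** The bound for finite sums is uniform in the scale [S]; the diagonal and the iterated integral
    pass to the limit by dominated convergence, the latter once inside and once outside. *)
Lemma approx_decoupling G H v (I J : finType) (eta : I -> T -> R)
    (eta' : J -> T -> R) zeta zeta' cM cc nn cM' cc' nn' b b' :
  sigma_algebra setT G -> G `<=` measurable ->
  sigma_algebra setT H -> H `<=` measurable -> 0 < v ->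
  (varpi_alg P q p G H <= v%:E)%E ->
  momb P theta Gam eta -> momb P theta Gam eta' ->
  0 <= cM -> 0 <= cM' -> 0 <= cc -> 0 <= cc' -> 0 <= nn -> 0 <= nn' ->
  sep_approx G H zeta (fun w => envN (eta^~ w)) cM cc nn b ->
  sep_approx G H zeta' (fun w => envN (eta'^~ w)) cM' cc' nn' b' ->
  `|\int[P]_w (zeta w w * zeta' w w) -
    \int[P]_w \int[P]_w' (zeta w w' * zeta' w w')| <=
  v * (cM * cM' * (momC theta Gam #|I| + momC theta Gam #|J|) + cc * cc').
Proof.
move=> sG Gm sH Hm v0 vb me me' cM0 cM'0 cc0 cc'0 nn0 nn'0.
move=> [z [zs zc zb zd]] [z' [zs' zc' zb' zd']].
set N := fun w => envN (eta^~ w) in zs zb zd *.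
set N' := fun w => envN (eta'^~ w) in zs' zb' zd' *.
have p'0 : 0 <= p' by rewrite (le_trans ler01)// ltW.
have i0 := ltW iota0.
have N0 w : 0 <= N w by exact: ltW (envN_gt0 _).
have N'0 w : 0 <= N' w by exact: ltW (envN_gt0 _).
have th2 : iota + iota <= theta.
  apply: le_trans thetap; apply: (@le_trans _ _ (2 * iota + 4)); first lra.
  by apply: ler_peMr; [lra|exact: ltW].
have IMM : Int P (fun w => cM * N w `^ ((iota + 2) * p') *
     (cM' * N' w `^ ((iota + 2) * p'))) /\
   \int[P]_w (cM * N w `^ ((iota + 2) * p') * (cM' * N' w `^ ((iota + 2) * p')))
   <= cM * cM' * (momC theta Gam #|I| + momC theta Gam #|J|).
  have e0 : 0 <= (iota + 2) * p' by rewrite mulr_ge0// addr_ge0.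
  have e1 : (iota + 2) * p' + (iota + 2) * p' <= theta.
    by apply: le_trans thetap; rewrite -mulrDl; rewrite ler_wpM2r//; lra.
  have [I1 E1] := mom_mul me me' e0 e0 e1.
  split; first by apply: (Int_ext (IntZ (cM * cM') I1)) => w; rewrite mulrACA.
  under eq_Rintegral => w _ do rewrite mulrACA.
  by rewrite ExZ// ler_wpM2l// mulr_ge0.
have [IN _] := mom_mul me me' i0 i0 th2.
have bE w (x : bool) : pow_iota (N w) (~~ x) * pow_iota (N w) x = N w `^ iota.
  by case: x; rewrite /= ?mul1r ?mulr1.
have bE' w (x : bool) : pow_iota (N' w) (~~ x) * pow_iota (N' w) x = N' w `^ iota.
  by case: x; rewrite /= ?mul1r ?mulr1.
have IUQ : Int P (fun w => pow_iota (N w) (~~ b) * pow_iota (N' w) (~~ b') *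
    (pow_iota (N w) b * pow_iota (N' w) b')).
  by apply: (Int_ext IN) => w; rewrite mulrACA bE bE'.
have pN w x : 0 <= pow_iota (N w) x <= N w `^ iota.
  by case: x; rewrite /= ?powR_ge0 ?lexx ?ler01// /N envN_pow1.
have pN' w x : 0 <= pow_iota (N' w) x <= N' w `^ iota.
  by case: x; rewrite /= ?powR_ge0 ?lexx ?ler01// /N' envN_pow1.
have mN : measurable_fun setT N by apply: measurable_envN => i; have [] := me i.
have mN' : measurable_fun setT N' by apply: measurable_envN => i; have [] := me' i.
have mpN x : measurable_fun setT (fun w => pow_iota (N w) x).
  by case: x => //=; exact: measurable_pow.
have mpN' x : measurable_fun setT (fun w => pow_iota (N' w) x).
  by case: x => //=; exact: measurable_pow.
have IQQ : Int P (fun w => pow_iota (N w) b * pow_iota (N' w) b').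
  apply: (Int_dom _ IN); first exact: measurable_funM.
  move=> w; have /andP[? ?] := pN w b; have /andP[? ?] := pN' w b'.
  by rewrite ger0_norm ?mulr_ge0//; apply: ler_pM.
have IDD : Int P (fun w => (nn * N w) `^ iota * (nn' * N' w) `^ iota).
  apply: (Int_ext (IntZ (nn `^ iota * nn' `^ iota) IN)) => w.
  by rewrite !powRM// mulrACA.
have key S := sep_sum_decoupling p1 p'1 pp q1 v0 sG Gm sH Hm vb (zs S) (zs' S)
   IMM.1 IUQ.
have ms S := sep_sum_measurable sG Gm sH Hm (zs S) (zs' S) IQQ.
have cdiag : (fun S => \int[P]_w (z S w w * z' S w w)) @ \oo -->
    \int[P]_w (zeta w w * zeta' w w).
  have [|||//] := @Ex_cvg _ _ _ P (fun S w => z S w w * z' S w w)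
    (fun w => zeta w w * zeta' w w) _ _ IDD.
  - by move=> S; have [] := ms S.
  - by move=> S w; rewrite normrM; apply: ler_pM.
  - by move=> w; apply: cvgM; [exact: zc|exact: zc'].
have cin w : (fun S => \int[P]_w' (z S w w' * z' S w w')) @ \oo -->
    \int[P]_w' (zeta w w' * zeta' w w').
  have [|||//] := @Ex_cvg _ _ _ P (fun S w' => z S w w' * z' S w w')
    (fun w' => zeta w w' * zeta' w w') _ _
    (IntZ ((nn * N w) `^ iota * (nn' * N' w) `^ iota) IQQ).
  - by move=> S; have [_ h _] := ms S; exact: Int_meas (h w).
  - move=> S w'; rewrite normrM mulrACA; apply: ler_pM => //.
  - by move=> w'; apply: cvgM; [exact: zc|exact: zc'].
have cout : (fun S => \int[P]_w \int[P]_w' (z S w w' * z' S w w')) @ \oo -->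
    \int[P]_w \int[P]_w' (zeta w w' * zeta' w w').
  have [|||//] := @Ex_cvg _ _ _ P (fun S w => \int[P]_w' (z S w w' * z' S w w'))
    (fun w => \int[P]_w' (zeta w w' * zeta' w w')) _ _
    (IntZr (\int[P]_w' (pow_iota (N w') b * pow_iota (N' w') b')) IDD).
  - by move=> S; have [] := ms S.
  - move=> S w; have [_ h _] := ms S; rewrite -ExZ//.
    apply: Ex_absle => //; first exact: IntZ.
    by move=> w'; rewrite normrM mulrACA; apply: ler_pM.
  - exact: cin.
apply: (lim_dist_le cdiag cout) => S.
apply: (le_trans (key S)); rewrite ler_pM2l// lerD2r.
exact: IMM.2.
Qed.

End decoupling.

(** * Partial integration *)

Section selection.
Context {R : realType}.

Definition sel (I : Type) (U : {pred I}) (x y : I -> R) : I -> R :=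
  fun i => if i \in U then y i else x i.

Lemma envN_sel (I : finType) (U : {pred I}) (x y : I -> R) :
  envN (sel U x y) <= envN x * envN y.
Proof. by apply: envN_mix => i; rewrite /sel; case: (i \in U); auto. Qed.

Lemma mix_sel (I : finType) (B U : {pred I}) (e x y : I -> R) :
  mix B U e x y = sel [pred i | (i \notin B) && (i \in U)] (sel B e x) y.
Proof.
by apply/funext => i; rewrite /mix /sel inE; case: (i \in B); case: (i \in U).
Qed.

Lemma envN_inl (I J : finType) (x : I + J -> R) : envN (fun i => x (inl i)) <= envN x.
Proof. by rewrite /envN big_sumType/= lerD2l lerDl sumr_ge0. Qed.

Lemma envN_inr (I J : finType) (x : I + J -> R) : envN (fun i => x (inr i)) <= envN x.
Proof. by rewrite /envN big_sumType/= lerD2l lerDr sumr_ge0. Qed.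

(** The factors read disjoint blocks of coordinates, indexed by a sum type, even when both are
    evaluated along one process; a product is then a single function of the class, with growth
    exponent doubled. *)
Lemma Hol_prod (I J : finType) (kappa K K' a : R) (f : (I -> R) -> R)
    (f' : (J -> R) -> R) : 0 <= a ->
  Hol kappa K a f -> Hol kappa K' a f' ->
  Hol kappa (K * K') (2 * a) (fun x : I + J -> R =>
    f (fun i => x (inl i)) * f' (fun j => x (inr j))).
Proof.
move=> a0 fH fH'; have K0 := Hol_K_ge0 fH; have K'0 := Hol_K_ge0 fH'.
case: fH => fb fd; case: fH' => fb' fd'.
have p2 (u : R) : 0 < u -> u `^ (2 * a) = u `^ a * u `^ a.
  move=> u0; rewrite (_ : 2 * a = a + a); last by ring.
  by rewrite powRD// (gt_eqF u0) implybT.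
have mono (u v : R) : 0 < u -> u <= v -> u `^ a <= v `^ a.
  by move=> u0 uv; apply: le_powR => //; exact: ltW.
split=> [x|x y].
  rewrite normrM p2 ?envN_gt0// mulrACA; apply: ler_pM => //.
    apply: (le_trans (fb _)); rewrite ler_wpM2l//.
    by apply: mono; [exact: envN_gt0|exact: envN_inl].
  apply: (le_trans (fb' _)); rewrite ler_wpM2l//.
  by apply: mono; [exact: envN_gt0|exact: envN_inr].
set x1 := fun i => x (inl i); set x2 := fun i => x (inr i).
set y1 := fun i => y (inl i); set y2 := fun i => y (inr i).
set V := (envN x + envN y) `^ a.
have N0 : 0 < envN x + envN y by apply: addr_gt0; exact: envN_gt0.
have V0 : 0 <= V by exact: powR_ge0.
have h1 : `|f x1| <= K * V.
  apply: (le_trans (fb _)); rewrite ler_wpM2l//.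
  apply: mono; first exact: envN_gt0.
  by apply: (le_trans (envN_inl x)); rewrite lerDl ltW ?envN_gt0.
have h2 : `|f' y2| <= K' * V.
  apply: (le_trans (fb' _)); rewrite ler_wpM2l//.
  apply: mono; first exact: envN_gt0.
  by apply: (le_trans (envN_inr y)); rewrite lerDr ltW ?envN_gt0.
have h3 : `|f x1 - f y1| <= K * V * \sum_i `|x1 i - y1 i| `^ kappa.
  apply: (le_trans (fd _ _)); apply: ler_wpM2r.
    by apply: sumr_ge0 => i _; exact: powR_ge0.
  rewrite ler_wpM2l//; apply: mono; first by apply: addr_gt0; exact: envN_gt0.
  by apply: lerD; exact: envN_inl.
have h4 : `|f' x2 - f' y2| <= K' * V * \sum_i `|x2 i - y2 i| `^ kappa.
  apply: (le_trans (fd' _ _)); apply: ler_wpM2r.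
    by apply: sumr_ge0 => i _; exact: powR_ge0.
  rewrite ler_wpM2l//; apply: mono; first by apply: addr_gt0; exact: envN_gt0.
  by apply: lerD; exact: envN_inr.
rewrite big_sumType/= p2// -/V.
have -> : f x1 * f' x2 - f y1 * f' y2 = f x1 * (f' x2 - f' y2) + (f x1 - f y1) * f' y2.
  by ring.
apply: (le_trans (ler_normD _ _)); rewrite !normrM.
apply: (le_trans (lerD (ler_pM _ _ h1 h4) (ler_pM _ _ h3 h2))) => //.
by rewrite le_eqVlt; apply/orP; left; apply/eqP; ring.
Qed.

End selection.

Section partial_integration.
Context d (T : measurableType d) (R : realType) (P : probability T R).
Variables (kappa theta Gam : R).
Hypothesis kappa01 : 0 < kappa <= 1.
Hypothesis Gam0 : 0 <= Gam.

Lemma momb_sel_Int (I : finType) (U : {pred I}) (e : I -> R) (eta : I -> T -> R) K a g :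
  0 <= a <= theta -> momb P theta Gam eta -> Hol kappa K a g ->
  Int P (fun w => g (sel U e (eta^~ w))) /\
  forall w, `|g (sel U e (eta^~ w))| <= K * envN e `^ a * envN (eta^~ w) `^ a.
Proof.
move=> ath me gH; have [I1 _] := envN_mom ath me.
case/andP: ath => a0 _.
have b w : `|g (sel U e (eta^~ w))| <= K * envN e `^ a * envN (eta^~ w) `^ a.
  case: (gH) => + _ => /(_ (sel U e (eta^~ w))) h; apply: (le_trans h).
  rewrite -mulrA ler_wpM2l ?(Hol_K_ge0 gH)// -powRM ?(ltW (envN_gt0 _))//.
  by apply: le_powR => //; [exact: ltW (envN_gt0 _)|exact: envN_sel].
split => //; apply: (Int_dom _ (IntZ (K * envN e `^ a) I1)) => //.
apply: (@measurable_Hol _ T R I kappa K a (fun i w => sel U e (eta^~ w) i)) => //.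
by move=> i; rewrite /sel; case: (i \in U) => //; have [] := me i.
Qed.

(** An average over coordinates with bounded moments multiplies the constant by [momC] and keeps [a]
    and [kappa], so integrations can be iterated. *)
Lemma Hol_int (I : finType) (U : {pred I}) (eta : I -> T -> R) K a g :
  0 <= a <= theta -> momb P theta Gam eta -> Hol kappa K a g ->
  Hol kappa (K * momC theta Gam #|I|) a
    (fun e => \int[P]_w g (sel U e (eta^~ w))).
Proof.
move=> ath me gH; have [I1 E1] := envN_mom ath me; have K0 := Hol_K_ge0 gH.
have sI e := momb_sel_Int U e ath me gH.
case/andP: ath => a0 _.
split=> [e|e e'].
  have [Ie be] := sI e.
  apply: (le_trans (Ex_absle Ie (IntZ _ I1) be)); rewrite ExZ//.
  rewrite [leRHS](_ : _ = K * envN e `^ a * momC theta Gam #|I|); last by ring.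
  by rewrite ler_wpM2l// mulr_ge0 ?powR_ge0.
have [Ie be] := sI e; have [Ie' be'] := sI e'.
set S := \sum_i _; have S0 : 0 <= S by apply: sumr_ge0 => i _; exact: powR_ge0.
have N0 : 0 <= envN e + envN e' by apply: addr_ge0; exact: ltW (envN_gt0 _).
apply: (@le_trans _ _ (\int[P]_w (K * (envN e + envN e') `^ a * S *
   envN (eta^~ w) `^ a))).
  apply: Ex_dist => //; first exact: IntZ.
  move=> w; case: (gH) => _ /(_ (sel U e (eta^~ w)) (sel U e' (eta^~ w))) h.
  apply: (le_trans h); rewrite [leRHS](_ : _ = K * ((envN e + envN e') `^ a *
     envN (eta^~ w) `^ a) * S); last by ring.
  apply: ler_pM; first by rewrite mulr_ge0 ?powR_ge0.
  - by apply: sumr_ge0 => i _; exact: powR_ge0.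
  - rewrite ler_wpM2l// -(powRM _ N0 (ltW (envN_gt0 _))).
    apply: le_powR => //; first by apply: addr_ge0; exact: ltW (envN_gt0 _).
    by rewrite (mulrDl (envN e)); apply: lerD; exact: envN_sel.
  - apply: ler_sum => i _; rewrite /sel; case: (i \in U) => //.
    rewrite subrr normr0 powR0 ?powR_ge0// gt_eqF//.
    by case/andP: kappa01.
rewrite ExZ//.
rewrite [leRHS](_ : _ = K * (envN e + envN e') `^ a * S * momC theta Gam #|I|);
  last by ring.
by rewrite ler_wpM2l// !mulr_ge0// powR_ge0.
Qed.

Lemma mix_Int (I : finType) (B U : {pred I}) (e : I -> R) (eta : I -> T -> R) K a g :
  0 <= a <= theta -> momb P theta Gam eta -> Hol kappa K a g ->
  [/\ Int P (fun w => g (mix B U e (eta^~ w) (eta^~ w))),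
    forall w, Int P (fun w' => g (mix B U e (eta^~ w) (eta^~ w'))) &
    Int P (fun w => \int[P]_w' g (mix B U e (eta^~ w) (eta^~ w')))].
Proof.
move=> ath me gH; split.
- have [I1 _] := momb_sel_Int [pred i | (i \in B) || (i \in U)] e ath me gH.
  apply: (Int_ext I1) => w; congr g; apply/funext => i; rewrite /mix /sel inE.
  by case: (i \in B); case: (i \in U).
- move=> w; have [I1 _] := momb_sel_Int [pred i | (i \notin B) && (i \in U)]
    (sel B e (eta^~ w)) ath me gH.
  by apply: (Int_ext I1) => w'; rewrite mix_sel.
- have H1 := Hol_int [pred i | (i \notin B) && (i \in U)] ath me gH.
  have [I1 _] := momb_sel_Int B e ath me H1.
  by apply: (Int_ext I1) => w; apply: eq_Rintegral => w' _; rewrite mix_sel.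
Qed.

Variables (q delta s' : R).
Hypotheses (q1 : 1 <= q) (delta0 : 0 < delta) (deltak : delta < kappa).
Hypotheses (s'1 : 1 < s') (ss' : (q / delta)^-1 + s'^-1 = 1).

Definition Lqclose (I : Type) (b : R) (zeta eta : I -> T -> R) :=
  forall i, Int P (fun w => `|zeta i w - eta i w| `^ q) /\
    \int[P]_w (`|zeta i w - eta i w| `^ q) <= b `^ q.

Definition closeC (n : nat) : R :=
  n%:R * (2 `^ theta * (momC theta Gam n + momC theta Gam n) + 1).

Lemma closeC_ge0 n : 0 <= theta -> 0 <= closeC n.
Proof.
move=> t0; have m1 := momC_ge1 Gam0 n t0.
by rewrite mulr_ge0// addr_ge0// mulr_ge0 ?powR_ge0// addr_ge0// (le_trans ler01).
Qed.

(** With [D] the distance in one coordinate and [M] the total envelope, [D^kappa <= D^delta M].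
    Young's inequality with exponents [q / delta] and [s'] splits the resulting product into
    [M^theta] and [(D / b)^q]; the scaling by [b] extracts [b^delta]. *)
Lemma Hol_close (I : finType) (U : {pred I}) (zeta eta : I -> T -> R)
  (e : I -> R) (K a b : R) (g : (I -> R) -> R) :
  0 <= a -> (a + 1) * s' <= theta -> 0 < b -> Lqclose b zeta eta ->
  momb P theta Gam zeta -> momb P theta Gam eta -> Hol kappa K a g ->
  `|\int[P]_w g (sel U e (zeta^~ w)) - \int[P]_w g (sel U e (eta^~ w))| <=
  closeC #|I| * K * envN e `^ a * b `^ delta.
Proof.
move=> a0 ath b0 cl mz me gH; have K0 := Hol_K_ge0 gH.
have /andP[k0 k1] := kappa01.
have as' : a + 1 <= (a + 1) * s' by apply: ler_peMr; [exact: addr_ge0|exact: ltW].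
have t0 : 0 <= theta by lra.
have ale : 0 <= a <= theta by rewrite a0/=; lra.
have tt : 0 <= theta <= theta by rewrite lexx andbT.
have [I1 b1] := momb_sel_Int U e ale mz gH; have [I2 b2] := momb_sel_Int U e ale me gH.
have [J1 E1] := envN_mom tt mz; have [J2 E2] := envN_mom tt me.
pose h w := \sum_(i : I) (2 `^ theta * (envN (zeta^~ w) `^ theta +
   envN (eta^~ w) `^ theta) + (b `^ q)^-1 * `|zeta i w - eta i w| `^ q).
have Ih0 : Int P (fun w => 2 `^ theta * (envN (zeta^~ w) `^ theta + envN (eta^~ w) `^ theta)).
  by apply: IntZ; exact: IntD.
have Ihi i : Int P (fun w => (b `^ q)^-1 * `|zeta i w - eta i w| `^ q).
  by apply: IntZ; have [] := cl i.
have Ih : Int P h by apply: Int_sum => i _; exact: IntD.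
have Eh : \int[P]_w h w <= closeC #|I|.
  rewrite /h Ex_sum; last by move=> i _; exact: IntD.
  rewrite /closeC; move: (momC theta Gam #|I|) E1 E2 => m E1 E2.
  rewrite -sum1_card natr_sum mulr_suml; apply: ler_sum => i _.
  rewrite mul1r ExD//; apply: lerD.
    rewrite ExZ; last exact: IntD.
    by rewrite ler_wpM2l ?powR_ge0// ExD//; exact: lerD.
  rewrite ExZ; last by have [] := cl i.
  by rewrite mulrC ler_pdivrMr ?powR_gt0// mul1r; have [] := cl i.
apply: (@le_trans _ _ (\int[P]_w ((K * envN e `^ a * b `^ delta) * h w))); last first.
  rewrite ExZ// [leRHS](_ : _ = K * envN e `^ a * b `^ delta * closeC #|I|);
    last by ring.
  by rewrite ler_wpM2l// !mulr_ge0 ?powR_ge0.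
apply: Ex_dist => //; first exact: IntZ.
move=> w; case: (gH) => _ /(_ (sel U e (zeta^~ w)) (sel U e (eta^~ w))) hh.
apply: (le_trans hh).
set M := envN (zeta^~ w) + envN (eta^~ w).
have z1 := envN_ge1 (zeta^~ w); have e1 := envN_ge1 (eta^~ w).
have M1 : 1 <= M by rewrite /M (le_trans z1)// lerDl (le_trans ler01).
have M0 : 0 < M by exact: lt_le_trans M1.
rewrite [leRHS](_ : _ = K * (envN e `^ a * (b `^ delta * h w))); last by ring.
rewrite -mulrA ler_wpM2l//.
apply: (@le_trans _ _ ((envN e * M) `^ a * \sum_i `|zeta i w - eta i w| `^ kappa)).
  apply: ler_pM; first exact: powR_ge0.
  - by apply: sumr_ge0 => i _; exact: powR_ge0.
  - apply: le_powR => //; first by apply: addr_ge0; exact: ltW (envN_gt0 _).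
    by rewrite /M mulrDr; apply: lerD; exact: envN_sel.
  - apply: ler_sum => i _; rewrite /sel; case: (i \in U) => //.
    by rewrite subrr normr0 powR0 ?powR_ge0// gt_eqF.
rewrite (powRM _ (ltW (envN_gt0 e)) (ltW M0)) -mulrA ler_wpM2l ?powR_ge0//.
rewrite !mulr_sumr; apply: ler_sum => i _.
pose D : R := `|zeta i w - eta i w|; rewrite -/D.
have D0 : 0 <= D by exact: normr_ge0.
have DM : D <= M.
  apply: (le_trans (ler_normB _ _)); apply: lerD; exact: envN_coord.
have Dk : D `^ kappa <= D `^ delta * M.
  have [->|Dn0] := eqVneq D 0; first by rewrite powR0 ?gt_eqF// mulr_ge0 ?powR_ge0 ?ltW.
  rewrite (_ : kappa = delta + (kappa - delta)); last by ring.
  rewrite powRD ?Dn0 ?implybT// ler_wpM2l ?powR_ge0//.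
  apply: (@le_trans _ _ (M `^ (kappa - delta))).
    by apply: le_powR => //; rewrite subr_ge0 ltW.
  have kd : kappa - delta <= 1 by rewrite lerBlDr (le_trans k1)// lerDl ltW.
  by have := ler_powR M1 kd; rewrite powRr1 ?(ltW M0).
have Ma : M `^ a * M = M `^ (a + 1).
  rewrite powRD; last by rewrite (gt_eqF M0) implybT.
  by rewrite powRr1 ?(ltW M0).
apply: (@le_trans _ _ (M `^ (a + 1) * D `^ delta)).
  rewrite -Ma -mulrA [M * _]mulrC; exact: (ler_wpM2l (powR_ge0 _ _) Dk).
have Db : D `^ delta = b `^ delta * (D / b) `^ delta.
  rewrite -powRM ?divr_ge0 ?(ltW b0)//.
  by rewrite mulrC divfK// gt_eqF.
rewrite Db mulrCA ler_wpM2l ?powR_ge0//.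
have s1 : 1 < q / delta.
  by rewrite ltr_pdivlMr// mul1r (lt_le_trans deltak)// (le_trans k1).
apply: (le_trans (young s1 s'1 ss' (powR_ge0 _ _) (powR_ge0 _ _))).
apply: lerD.
  rewrite -powRrM; apply: (@le_trans _ _ (M `^ theta)); first exact: ler_powR.
  have big (x y : R) : 0 <= x -> 0 <= y -> x <= y ->
      (x + y) `^ theta <= 2 `^ theta * (x `^ theta + y `^ theta).
    move=> x0 y0 xy; apply: (@le_trans _ _ ((2 * y) `^ theta)).
      apply: le_powR => //; first exact: addr_ge0.
      by rewrite mulr_natl mulr2n lerD2r.
    by rewrite powRM// ler_wpM2l ?powR_ge0// lerDr powR_ge0.
  rewrite /M; have [h1|h1] := leP (envN (zeta^~ w)) (envN (eta^~ w)).
    by apply: big => //; exact: ltW (envN_gt0 _).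
  rewrite addrC [_ `^ _ + _]addrC.
  by apply: big; [exact: ltW (envN_gt0 _)|exact: ltW (envN_gt0 _)|exact: ltW].
rewrite -powRrM (_ : delta * (q / delta) = q); last by field; rewrite gt_eqF.
rewrite powRM ?invr_ge0 ?(ltW b0)// mulrC ler_wpM2r ?powR_ge0//.
by rewrite -powR_inv1 ?(ltW b0)// -powRrM mulN1r powRN.
Qed.

End partial_integration.

(** * Decoupling coordinates that are only close to measurable ones *)

Section peeling.
Context d (T : measurableType d) (R : realType) (P : probability T R).
Variables (p p' q kappa iota theta Gam delta s' : R).
Hypothesis kappa01 : 0 < kappa <= 1.
Hypothesis iota0 : 0 < iota.
Hypotheses (p1 : 1 < p) (p'1 : 1 < p') (pp : p^-1 + p'^-1 = 1) (q1 : 1 <= q).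
Hypothesis thetap : (2 * iota + 4) * p' <= theta.
Hypothesis thetaq : 2 * q * iota <= theta.
Hypothesis Gam0 : 0 <= Gam.
Hypotheses (delta0 : 0 < delta) (deltak : delta < kappa).
Hypotheses (s'1 : 1 < s') (ss' : (q / delta)^-1 + s'^-1 = 1).
Hypothesis thetas : (2 * iota + 1) * s' <= theta.

Lemma i2th : 0 <= 2 * iota <= theta.
Proof.
rewrite mulr_ge0 ?(ltW iota0)//=; apply: (le_trans _ thetas).
apply: (@le_trans _ _ (2 * iota + 1)); first by rewrite lerDl.
by apply: ler_peMr; [rewrite addr_ge0 ?mulr_ge0 ?(ltW iota0)|exact: ltW].
Qed.

Definition jn (A : Type) (I J : Type) (x : I -> A) (y : J -> A) (s : I + J) : A :=
  match s with inl i => x i | inr j => y j end.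

Lemma mixing_decoupling (I J : finType) (B U : {pred I}) (B' U' : {pred J}) :
  chainable p kappa B -> chainable p kappa B' \/ (forall j, j \notin U') ->
  exists C, 0 <= C /\ forall G H v (eta : I -> T -> R) (eta' : J -> T -> R)
    e e' f f' K K',
  sigma_algebra setT G -> G `<=` measurable ->
  sigma_algebra setT H -> H `<=` measurable -> 0 < v ->
  (varpi_alg P q p G H <= v%:E)%E ->
  momb P theta Gam eta -> momb P theta Gam eta' ->
  (forall i, i \in B -> mG G (eta i)) -> (forall i, i \in U -> mG H (eta i)) ->
  (forall i, i \in B' -> mG G (eta' i)) -> (forall i, i \in U' -> mG H (eta' i)) ->
  0 < K -> 0 < K' -> Hol kappa K iota f -> Hol kappa K' iota f' ->
  `|\int[P]_w (f (mix B U e (eta^~ w) (eta^~ w)) *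
               f' (mix B' U' e' (eta'^~ w) (eta'^~ w))) -
    \int[P]_w \int[P]_w' (f (mix B U e (eta^~ w) (eta^~ w')) *
               f' (mix B' U' e' (eta'^~ w) (eta'^~ w')))| <=
  C * (K * K') * (envN e `^ iota * envN e' `^ iota) * v.
Proof.
move=> cB cB'.
have [cM [cc [nn [cM0 cc0 nn0 ap]]]] := approx_chain P kappa01 iota0 p1 p'1 pp q1 thetaq Gam0 U cB.
have [cM' [cc' [nn' [b' [cM'0 cc'0 nn'0 ap']]]]] : exists cM cc nn b,
  [/\ 0 <= cM, 0 <= cc, 0 <= nn &
  forall G H (eta : J -> T -> R) (e : J -> R) f K,
  sigma_algebra setT G -> G `<=` measurable ->
  sigma_algebra setT H -> H `<=` measurable ->
  (forall i, i \in B' -> mG G (eta i)) -> (forall i, i \in U' -> mG H (eta i)) ->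
  momb P theta Gam eta -> 0 < K -> Hol kappa K iota f ->
  sep_approx P p p' q iota G H (fun w w' => (K * envN e `^ iota)^-1 *
      f (mix B' U' e (eta^~ w) (eta^~ w')))
    (fun w => envN (eta^~ w)) cM cc nn b].
  case: cB' => [/(approx_chain P kappa01 iota0 p1 p'1 pp q1 thetaq Gam0 U')[cM' [cc' [nn' [? ? ? h]]]]|U0].
    by exists cM', cc', nn', true.
  exists 1, 1, 1, false; split=> //.
  move=> G H eta e f K sG Gm _ _ eB _ _ K0 fH.
  exact: (approx_past P p kappa01 iota0 p'1 q1 H e sG Gm eB U0 K0 fH).
exists (cM * cM' * (momC theta Gam #|I| + momC theta Gam #|J|) + cc * cc').
split.
  have t0 : 0 <= theta.
    by apply: le_trans thetaq; rewrite !mulr_ge0 ?(ltW iota0)// (le_trans ler01).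
  have m1 := momC_ge1 Gam0 #|I| t0; have m2 := momC_ge1 Gam0 #|J| t0.
  by rewrite addr_ge0 ?mulr_ge0// addr_ge0// (le_trans ler01).
move=> G H v eta eta' e e' f f' K K' sG Gm sH Hm v0 vb me me' eB eU eB' eU' K0 K'0 fH fH'.
have A1 := ap G H eta e f K sG Gm sH Hm eB eU me K0 fH.
have A2 := ap' G H eta' e' f' K' sG Gm sH Hm eB' eU' me' K'0 fH'.
have := approx_decoupling iota0 p1 p'1 pp q1 thetap sG Gm sH Hm v0 vb me me' cM0 cM'0 cc0 cc'0 nn0 nn'0 A1 A2.
set D := K * envN e `^ iota; set D' := K' * envN e' `^ iota.
have D0 : 0 < D by rewrite mulr_gt0// powR_gt0// envN_gt0.
have D'0 : 0 < D' by rewrite mulr_gt0// powR_gt0// envN_gt0.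
have scal0 (g g' : T -> R) : (fun w => D^-1 * g w * (D'^-1 * g' w)) =
    fun w => (D * D')^-1 * (g w * g' w).
  by apply/funext => w; rewrite mulrACA -invfM.
have scal (g g' : T -> R) : Int P (fun w => g w * g' w) ->
    \int[P]_w (D^-1 * g w * (D'^-1 * g' w)) = (D * D')^-1 * \int[P]_w (g w * g' w).
  by move=> Ig; rewrite scal0 ExZ.
have PsiH := Hol_prod (ltW iota0) fH fH'.
pose eta2 := jn eta eta'.
have me2 : momb P theta Gam eta2 by case=> i; [exact: me|exact: me'].
pose BB : {pred I + J} := fun s => match s with inl i => i \in B | inr j => j \in B' end.
pose UU : {pred I + J} := fun s => match s with inl i => i \in U | inr j => j \in U' end.
pose ee := jn e e'.
pose Psi (x : I + J -> R) := f (fun i => x (inl i)) * f' (fun j => x (inr j)).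
have PsiE w w' : f (mix B U e (eta^~ w) (eta^~ w')) *
    f' (mix B' U' e' (eta'^~ w) (eta'^~ w')) = Psi (mix BB UU ee (eta2^~ w) (eta2^~ w')).
  by [].
have [I1 I2 I3] := mix_Int kappa01 BB UU ee i2th me2 PsiH.
rewrite scal; last exact: I1.
have -> : \int[P]_w \int[P]_w' (D^-1 * f (mix B U e (eta^~ w) (eta^~ w')) *
     (D'^-1 * f' (mix B' U' e' (eta'^~ w) (eta'^~ w')))) =
   (D * D')^-1 * \int[P]_w \int[P]_w' (f (mix B U e (eta^~ w) (eta^~ w')) *
     f' (mix B' U' e' (eta'^~ w) (eta'^~ w'))).
  rewrite -ExZ; last exact: I3.
  by apply: eq_Rintegral => w _; rewrite scal//; exact: I2.
have DD0 : 0 < D * D' by exact: mulr_gt0.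
have DDi0 : 0 < (D * D')^-1 by rewrite invr_gt0.
rewrite -mulrBr normrM (gtr0_norm DDi0) mulrC ler_pdivrMr//.
by move=> h; apply: (le_trans h); rewrite /D /D' le_eqVlt; apply/orP; left; apply/eqP; ring.
Qed.

(** The coordinates [zeta] are only close to variables [eta] measurable with respect to [G] or [H].
    They are replaced by [eta] in the joint integral, decoupled, and restored in the inner integral
    and then in the outer one; each replacement costs [b^delta], the decoupling costs [v]. *)
Lemma peeling (I J : finType) (B U : {pred I}) (B' U' : {pred J}) :
  chainable p kappa B -> chainable p kappa B' \/ (forall j, j \notin U') ->
  exists C, 0 <= C /\ forall G H (v b : R) (zeta eta : I -> T -> R)
    (zeta' eta' : J -> T -> R) e e' f f' (K K' : R),
  sigma_algebra setT G -> G `<=` measurable ->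
  sigma_algebra setT H -> H `<=` measurable -> 0 < v -> 0 < b ->
  (varpi_alg P q p G H <= v%:E)%E ->
  momb P theta Gam zeta -> momb P theta Gam zeta' ->
  momb P theta Gam eta -> momb P theta Gam eta' ->
  Lqclose P q b zeta eta -> Lqclose P q b zeta' eta' ->
  (forall i, i \in B -> mG G (eta i)) -> (forall i, i \in U -> mG H (eta i)) ->
  (forall i, i \in B' -> mG G (eta' i)) -> (forall i, i \in U' -> mG H (eta' i)) ->
  0 < K -> 0 < K' -> Hol kappa K iota f -> Hol kappa K' iota f' ->
  `|\int[P]_w (f (mix B U e (zeta^~ w) (zeta^~ w)) *
               f' (mix B' U' e' (zeta'^~ w) (zeta'^~ w))) -
    \int[P]_w \int[P]_w' (f (mix B U e (zeta^~ w) (zeta^~ w')) *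
               f' (mix B' U' e' (zeta'^~ w) (zeta'^~ w')))| <=
  C * (K * K') * envN (jn e e') `^ (2 * iota) * (v + b `^ delta).
Proof.
move=> cB cB'; have [C0 [C00 hC]] := mixing_decoupling U cB cB'.
have i2 := i2th; have /andP[i20 i2t] := i2; have t0 := le_trans i20 i2t.
pose cl := closeC theta Gam #|{: I + J}|; pose mC := momC theta Gam #|{: I + J}|.
have cl0 : 0 <= cl by exact: closeC_ge0.
have mC1 : 1 <= mC by exact: momC_ge1.
have mC0 : 0 <= mC by exact: le_trans mC1.
exists (C0 + (cl + (cl * mC + cl * mC))); split.
  by rewrite !addr_ge0// mulr_ge0.
move=> G H v b zeta eta zeta' eta' e e' f f' K K' sG Gm sH Hm v0 b0 vb mz mz' me me'
  clo clo' eB eU eB' eU' K0 K'0 fH fH'.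
have PsiH := Hol_prod (ltW iota0) fH fH'.
set Psi := (fun x : I + J -> R => _) in PsiH.
pose BB : {pred I + J} := fun s => match s with inl i => i \in B | inr j => j \in B' end.
pose UU : {pred I + J} := fun s => match s with inl i => i \in U | inr j => j \in U' end.
pose ee := jn e e'; pose z2 := jn zeta zeta'; pose e2 := jn eta eta'.
have mz2 : momb P theta Gam z2 by case=> i; [exact: mz|exact: mz'].
have me2 : momb P theta Gam e2 by case=> i; [exact: me|exact: me'].
have cl2 : Lqclose P q b z2 e2 by case=> i; [exact: clo|exact: clo'].
have cl2' : Lqclose P q b e2 z2.
  move=> i; have [h1 h2] := cl2 i.
  have E w : `|e2 i w - z2 i w| `^ q = `|z2 i w - e2 i w| `^ q by rewrite distrC.
  split; first exact: (Int_ext h1 E).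
  by under eq_Rintegral => w _ do rewrite E.
pose W : R := envN ee `^ (2 * iota).
have W0 : 0 <= W by exact: powR_ge0.
have KK0 : 0 <= K * K' by exact: ltW (mulr_gt0 K0 K'0).
have bd0 : 0 <= b `^ delta by exact: powR_ge0.
have diagE (y : I + J -> T -> R) w : mix BB UU ee (y^~ w) (y^~ w) =
    sel [pred s | (s \in BB) || (s \in UU)] ee (y^~ w).
  by apply/funext => s; rewrite /mix /sel inE; case: (s \in BB); case: (s \in UU).
pose UB : {pred I + J} := [pred s | (s \notin BB) && (s \in UU)].
pose Gz x := \int[P]_w Psi (sel UB x (z2^~ w)).
pose Ge x := \int[P]_w Psi (sel UB x (e2^~ w)).
have GzH : Hol kappa (K * K' * mC) (2 * iota) Gz.
  exact: (Hol_int kappa01 UB i2 mz2 PsiH).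
have GeH : Hol kappa (K * K' * mC) (2 * iota) Ge.
  exact: (Hol_int kappa01 UB i2 me2 PsiH).
have T1 : `|\int[P]_w Psi (mix BB UU ee (z2^~ w) (z2^~ w)) -
    \int[P]_w Psi (mix BB UU ee (e2^~ w) (e2^~ w))| <= cl * (K * K') * W * b `^ delta.
  under eq_Rintegral => w _ do rewrite diagE.
  under [in X in _ - X]eq_Rintegral => w _ do rewrite diagE.
  exact: (Hol_close kappa01 q1 delta0 deltak s'1 ss' _ ee i20 thetas b0 cl2 mz2 me2 PsiH).
have T2 : `|\int[P]_w Psi (mix BB UU ee (e2^~ w) (e2^~ w)) -
    \int[P]_w \int[P]_w' Psi (mix BB UU ee (e2^~ w) (e2^~ w'))| <=
    C0 * (K * K') * W * v.
  have h := hC G H v eta eta' e e' f f' K K' sG Gm sH Hm v0 vb me me' eB eU eB' eU'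
    K0 K'0 fH fH'.
  apply: (le_trans h); rewrite ler_wpM2r ?(ltW v0)// ler_wpM2l//; first exact: mulr_ge0.
  rewrite /W (_ : 2 * iota = iota + iota); last by ring.
  rewrite powRD; last by rewrite (gt_eqF (envN_gt0 _)) implybT.
  by apply: ler_pM; rewrite ?powR_ge0//; apply: le_powR;
    rewrite ?(ltW iota0) ?(ltW (envN_gt0 _))//; [exact: (envN_inl ee)|exact: (envN_inr ee)].
have dblE (y : I + J -> T -> R) : \int[P]_w \int[P]_w' Psi (mix BB UU ee (y^~ w) (y^~ w')) =
    \int[P]_w \int[P]_w' Psi (sel UB (sel BB ee (y^~ w)) (y^~ w')).
  by apply: eq_Rintegral => w _; apply: eq_Rintegral => w' _; rewrite mix_sel.
have T3 : `|\int[P]_w \int[P]_w' Psi (mix BB UU ee (e2^~ w) (e2^~ w')) -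
    \int[P]_w Gz (sel BB ee (e2^~ w))| <= cl * mC * (K * K') * W * b `^ delta.
  rewrite dblE.
  have [I1 _] := momb_sel_Int kappa01 BB ee i2 me2 GeH.
  have [I2 _] := momb_sel_Int kappa01 BB ee i2 me2 GzH.
  have [I3 E3] := envN_mom i2 me2.
  apply: (@le_trans _ _ (\int[P]_w (cl * (K * K') * W * b `^ delta *
     envN (e2^~ w) `^ (2 * iota)))).
    apply: Ex_dist => //; first exact: IntZ.
    move=> w.
    have h := Hol_close kappa01 q1 delta0 deltak s'1 ss' UB (sel BB ee (e2^~ w))
      i20 thetas b0 cl2' me2 mz2 PsiH.
    apply: (le_trans h).
    rewrite [leRHS](_ : _ = cl * (K * K') * (W * envN (e2^~ w) `^ (2 * iota)) * b `^ delta);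
      last by ring.
    apply: ler_wpM2r => //; apply: ler_wpM2l; first exact: mulr_ge0.
    rewrite /W -(powRM _ (ltW (envN_gt0 _)) (ltW (envN_gt0 _))).
    by apply: le_powR => //; [exact: ltW (envN_gt0 _)|exact: envN_sel].
  rewrite ExZ// [leRHS](_ : _ = cl * (K * K') * W * b `^ delta * mC); last by ring.
  by apply: ler_wpM2l => //; do 3 apply: mulr_ge0 => //.
have T4 : `|\int[P]_w Gz (sel BB ee (e2^~ w)) -
    \int[P]_w \int[P]_w' Psi (mix BB UU ee (z2^~ w) (z2^~ w'))| <=
    cl * mC * (K * K') * W * b `^ delta.
  rewrite dblE.
  have h := Hol_close kappa01 q1 delta0 deltak s'1 ss' BB ee
      i20 thetas b0 cl2' me2 mz2 GzH.
  apply: (le_trans h); rewrite -/cl -/W le_eqVlt; apply/orP; left; apply/eqP; ring.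
change (`|\int[P]_w Psi (mix BB UU ee (z2^~ w) (z2^~ w)) -
  \int[P]_w \int[P]_w' Psi (mix BB UU ee (z2^~ w) (z2^~ w'))| <=
  (C0 + (cl + (cl * mC + cl * mC))) * (K * K') * W * (v + b `^ delta)).
apply: (le_trans (ler_distD (\int[P]_w Psi (mix BB UU ee (e2^~ w) (e2^~ w))) _ _)).
apply: (@le_trans _ _ (cl * (K * K') * W * b `^ delta + (C0 * (K * K') * W * v +
   (cl * mC * (K * K') * W * b `^ delta + cl * mC * (K * K') * W * b `^ delta)))).
  apply: lerD => //.
  apply: (le_trans (ler_distD (\int[P]_w \int[P]_w' Psi (mix BB UU ee (e2^~ w) (e2^~ w'))) _ _)).
  apply: lerD => //.
  apply: (le_trans (ler_distD (\int[P]_w Gz (sel BB ee (e2^~ w))) _ _)).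
  exact: (lerD T3 T4).
set X := K * K' * W; have X0 : 0 <= X by exact: mulr_ge0.
rewrite [leRHS](_ : _ = (C0 * X * b `^ delta + (cl + (cl * mC + cl * mC)) * X * v) +
  (cl * (K * K') * W * b `^ delta + (C0 * (K * K') * W * v +
   (cl * mC * (K * K') * W * b `^ delta + cl * mC * (K * K') * W * b `^ delta)))); last first.
  by rewrite /X; ring.
have clm : 0 <= cl * mC by exact: mulr_ge0.
rewrite lerDr; apply: addr_ge0.
  by do 2 apply: mulr_ge0 => //.
apply: mulr_ge0; last exact: ltW.
by apply: mulr_ge0 => //; do 2 apply: addr_ge0 => //.
Qed.

End peeling.

(** * Successive decoupling *)

Section product_expectation.
Context d (T : measurableType d) d' (T' : measurableType d') (R : realType).
Variables (P : probability T R) (P' : probability T' R).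
Implicit Types (h : T * T' -> R).

Definition prodP : probability (T * T')%type R := (P \x P')%E.

Lemma Ex_fubini h (u : T -> R) (u' : T' -> R) :
  measurable_fun setT h -> Int P u -> Int P' u' ->
  (forall w w', `|h (w, w')| <= u w * u' w') ->
  [/\ Int prodP h,
   \int[prodP]_z h z = \int[P]_w \int[P']_w' h (w, w') &
   \int[P]_w \int[P']_w' h (w, w') = \int[P']_w' \int[P]_w h (w, w')].
Proof.
move=> mh Iu Iu' hb.
have mh1 w : measurable_fun setT (fun w' => h (w, w')).
  exact: (measurableT_comp mh (pair1_measurable w)).
have mh2 w' : measurable_fun setT (fun w => h (w, w')).
  exact: (measurableT_comp mh (pair2_measurable w')).
have I1 w : Int P' (fun w' => h (w, w')).
  by apply: (Int_dom _ (IntZ (u w) Iu')) => // w'; exact: hb.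
have I2 w' : Int P (fun w => h (w, w')).
  by apply: (Int_dom _ (IntZr (u' w') Iu)) => // w; exact: hb.
have Ih : Int prodP h.
  apply/integrable12ltyP; first exact/measurable_EFinP.
  apply: (@le_lt_trans _ _ (\int[P]_w (`|u w| * \int[P']_w' `|u' w'|)%:E)%E).
    apply: ge0_le_integral => //.
    - by move=> w _; apply: integral_ge0 => w' _; rewrite abse_ge0.
    - apply: (@measurable_fun_fubini_tonelli_F _ _ T T' R P' (abse \o (EFin \o h))).
        by apply: measurableT_comp => //; exact/measurable_EFinP.
      by move=> z; exact: abse_ge0.
    - by apply/measurable_EFinP; apply: measurable_funM => //;
        apply: measurableT_comp => //; exact: Int_meas Iu.
    - move=> w _.
      apply: (@le_trans _ _ (\int[P']_w' (`|u w| * `|u' w'|)%:E)%E).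
        apply: ge0_le_integral => //.
        + by apply: measurableT_comp => //; exact/measurable_EFinP.
        + apply/measurable_EFinP; apply: measurable_funM => //.
          by apply: measurableT_comp => //; exact: Int_meas Iu'.
        + move=> w' _ /=; rewrite lee_fin -normrM.
          by apply: (le_trans (hb w w')); exact: ler_norm.
      rewrite integralEFin; last by apply: IntZ; exact: Int_norm.
      by rewrite ExZ//; exact: Int_norm.
  rewrite integralEFin ?ltry//.
  by apply: IntZr; exact: Int_norm.
have E1 : (\int[prodP]_z (h z)%:E = \int[P]_w (\int[P']_w' h (w, w'))%:E)%E.
  have := integral12_prod_meas1 Ih; rewrite /fubini_F => <-.
  by apply: eq_integral => w _; rewrite integralEFin.
have E2 : (\int[prodP]_z (h z)%:E = \int[P']_w' (\int[P]_w h (w, w'))%:E)%E.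
  have := integral21_prod_meas1 Ih; rewrite /fubini_G => <-.
  by apply: eq_integral => w _; rewrite integralEFin.
split => //; first by rewrite /Rintegral E1.
by rewrite /Rintegral -E1 -E2.
Qed.

Lemma Ex_fst (f : T -> R) : Int P f ->
  Int prodP (fun z => f z.1) /\ \int[prodP]_z f z.1 = \int[P]_w f w.
Proof.
move=> If.
have [||||I1 E1 _] := @Ex_fubini (fun z => f z.1) (fun w => `|f w|) (fun=> 1).
- by apply: measurableT_comp => //; exact: Int_meas If.
- exact: Int_norm.
- exact: Int_cst.
- by move=> w w' /=; rewrite mulr1.
split => //; rewrite E1; apply: eq_Rintegral => w _ /=.
by rewrite Ex_cst.
Qed.

Lemma Ex_snd (f : T' -> R) : Int P' f ->
  Int prodP (fun z => f z.2) /\ \int[prodP]_z f z.2 = \int[P']_w f w.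
Proof.
move=> If.
have [||||I1 E1 E2] := @Ex_fubini (fun z => f z.2) (fun=> 1) (fun w => `|f w|).
- by apply: measurableT_comp => //; exact: Int_meas If.
- exact: Int_cst.
- exact: Int_norm.
- by move=> w w' /=; rewrite mul1r.
split => //; rewrite E1 /=; exact: Ex_cst.
Qed.

Lemma momb_fst (I : Type) theta G (z : I -> T -> R) : momb P theta G z ->
  momb prodP theta G (fun i w => z i w.1).
Proof.
move=> mz i; have [m1 I1 E1] := mz i; have [I2 E2] := Ex_fst I1; split => //.
- by apply: measurableT_comp m1 _.
- by rewrite E2.
Qed.

Lemma momb_snd (I : Type) theta G (z : I -> T' -> R) : momb P' theta G z ->
  momb prodP theta G (fun i w => z i w.2).
Proof.
move=> mz i; have [m1 I1 E1] := mz i; have [I2 E2] := Ex_snd I1; split => //.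
- by apply: measurableT_comp m1 _.
- by rewrite E2.
Qed.

End product_expectation.

Section successive_decoupling.
Context d (T : measurableType d) (R : realType) (P : probability T R).
Variables (kappa theta Gam a K : R) (J : finType).
Hypothesis kappa01 : 0 < kappa <= 1.
Hypothesis Gam0 : 0 <= Gam.
Hypothesis theta_gt0 : 0 < theta.
Hypothesis ath : 0 <= a <= theta.
Implicit Types (lab : J -> nat) (z : J -> T -> R) (Psi : (J -> R) -> R).

Let mC := momC theta Gam #|J|.
Let theta0 : 0 <= theta. Proof. exact: ltW. Qed.
Let mC1 : 1 <= mC. Proof. exact: momC_ge1. Qed.

Definition lt_lab lab L : {pred J} := [pred s | (lab s < L)%N].
Definition eq_lab lab L : {pred J} := [pred s | lab s == L].

(* [dec] integrates out the coordinates label by label, each label with its own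
   independent copy of the process, [cpl] keeps all labels below [L] on the same
   sample point. *)
Fixpoint dec lab z Psi L (e : J -> R) : R :=
  if L is L'.+1 then \int[P]_w dec lab z Psi L' (sel (eq_lab lab L') e (z^~ w))
  else Psi e.

Definition cpl lab z Psi L (e : J -> R) : R :=
  \int[P]_w Psi (sel (lt_lab lab L) e (z^~ w)).

Lemma Hol_dec lab z Psi L : momb P theta Gam z -> Hol kappa K a Psi ->
  Hol kappa (K * mC ^+ L) a (dec lab z Psi L).
Proof.
move=> mz PH; elim: L => [|L IH] /=; first by rewrite expr0 mulr1.
rewrite exprSr mulrA; exact: (Hol_int kappa01 _ ath mz IH).
Qed.

Lemma Hol_sel (U : {pred J}) (e : J -> R) K' g : Hol kappa K' a g ->
  Hol kappa (K' * envN e `^ a) a (fun x => g (sel U e x)).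
Proof.
move=> gH; have K0 := Hol_K_ge0 gH; have [a0 _] := andP ath.
case: gH => gb gd; split => [x|x y].
  apply: (le_trans (gb _)); rewrite -mulrA ler_wpM2l//.
  rewrite -(powRM _ (ltW (envN_gt0 e)) (ltW (envN_gt0 x))).
  by apply: le_powR => //; [exact: ltW (envN_gt0 _)|exact: envN_sel].
apply: (le_trans (gd _ _)); apply: ler_pM.
- by rewrite mulr_ge0 ?powR_ge0.
- by apply: sumr_ge0 => i _; exact: powR_ge0.
- have n2 : 0 <= envN x + envN y by apply: addr_ge0; exact: ltW (envN_gt0 _).
  rewrite -mulrA ler_wpM2l// -(powRM _ (ltW (envN_gt0 e)) n2).
  apply: le_powR => //; first by apply: addr_ge0; exact: ltW (envN_gt0 _).
  by rewrite mulrDr; apply: lerD; exact: envN_sel.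
- apply: ler_sum => i _; rewrite /sel; case: (i \in U) => //.
  by rewrite subrr normr0 powR0 ?powR_ge0// gt_eqF//; case/andP: kappa01.
Qed.

(** By Fubini the average over label [L] can be taken outermost, where it matches the recursion of
    [dec]. *)
Lemma mix_swap lab z Psi L e : momb P theta Gam z -> Hol kappa K a Psi ->
  \int[P]_w \int[P]_w' Psi (mix (lt_lab lab L) (eq_lab lab L) e (z^~ w) (z^~ w')) =
  \int[P]_w cpl lab z Psi L (sel (eq_lab lab L) e (z^~ w)).
Proof.
move=> mz PH; have [a0 at_] := andP ath.
have [I1 _] := envN_mom ath mz.
have K0 := Hol_K_ge0 PH.
have mixE w w' : mix (lt_lab lab L) (eq_lab lab L) e (z^~ w) (z^~ w') =
    sel (lt_lab lab L) (sel (eq_lab lab L) e (z^~ w')) (z^~ w).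
  apply/funext => s; rewrite /mix /sel !inE.
  by case: ltngtP.
have [||_ _ ->] := @Ex_fubini _ T _ T R P P
  (fun ww => Psi (mix (lt_lab lab L) (eq_lab lab L) e (z^~ ww.1) (z^~ ww.2)))
  (fun w => K * envN e `^ a * envN (z^~ w) `^ a)
  (fun w => envN (z^~ w) `^ a) _ (IntZ _ I1) I1.
- apply: (@measurable_Hol _ _ R J kappa K a (fun s ww =>
    mix (lt_lab lab L) (eq_lab lab L) e (z^~ ww.1) (z^~ ww.2) s)) => //.
  move=> s; have [mzs _ _] := mz s; rewrite /mix.
  case: (s \in lt_lab lab L); first exact: (measurableT_comp mzs).
  by case: (s \in eq_lab lab L) => //; exact: (measurableT_comp mzs).
- move=> w w' /=; case: PH => + _ => /(_ (mix (lt_lab lab L) (eq_lab lab L) e (z^~ w) (z^~ w'))) h.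
  apply: (le_trans h); rewrite -2!mulrA ler_wpM2l//.
  rewrite -(powRM _ (ltW (envN_gt0 _)) (ltW (envN_gt0 _))).
  rewrite -powRM ?mulr_ge0 ?(ltW (envN_gt0 _))//.
  apply: le_powR => //; first exact: ltW (envN_gt0 _).
  rewrite mixE; apply: (le_trans (envN_sel _ _ _)).
  rewrite [envN (z^~ w) * _]mulrC mulrA ler_wpM2r ?(ltW (envN_gt0 _))//.
  exact: envN_sel.
- by apply: eq_Rintegral => w _; apply: eq_Rintegral => w' _; rewrite mixE.
Qed.

(** Peeling one label costs [c]; the error made on lower labels is then averaged over the label just
    peeled, which multiplies it by [mC]. Hence the geometric sum. *)
Lemma cpl_dec lab z Psi (c : R) L : momb P theta Gam z -> Hol kappa K a Psi -> 0 <= c ->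
  (forall k, (k < L)%N -> forall e,
   `|cpl lab z Psi k.+1 e -
     \int[P]_w \int[P]_w' Psi (mix (lt_lab lab k) (eq_lab lab k) e (z^~ w) (z^~ w'))|
   <= c * envN e `^ a) ->
  forall e, `|cpl lab z Psi L e - dec lab z Psi L e| <=
    c * (\sum_(k < L) mC ^+ k) * envN e `^ a.
Proof.
move=> mz PH c0; elim: L => [|L IH] peel e.
  rewrite /cpl /= big_ord0 mulr0 mul0r.
  rewrite (_ : \int[P]_w _ = Psi e) ?subrr ?normr0//.
  rewrite -[RHS](Ex_cst P); apply: eq_Rintegral => w _; congr Psi.
have {}IH := IH (fun k kL => peel k (leqW kL)).
set Sm := \sum_(k < L) mC ^+ k in IH.
have mC0 : 0 <= mC by exact: le_trans mC1.
have Sm0 : 0 <= Sm by apply: sumr_ge0 => k _; rewrite exprn_ge0.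
have := peel L (ltnSn L) e; rewrite mix_swap// => h1.
have cplH : Hol kappa (K * mC) a (cpl lab z Psi L) by exact: Hol_int.
have [I1 _] := momb_sel_Int kappa01 (eq_lab lab L) e ath mz cplH.
have [I2 _] := momb_sel_Int kappa01 (eq_lab lab L) e ath mz (Hol_dec lab L mz PH).
have [I3 E3] := envN_mom ath mz.
have [a0 _] := andP ath.
have h2 : `|\int[P]_w cpl lab z Psi L (sel (eq_lab lab L) e (z^~ w)) -
    dec lab z Psi L.+1 e| <= c * Sm * mC * envN e `^ a.
  apply: (@le_trans _ _ (\int[P]_w (c * Sm * envN e `^ a * envN (z^~ w) `^ a))).
    apply: Ex_dist => //; first exact: IntZ.
    move=> w; apply: (le_trans (IH _)); rewrite -[leRHS]mulrA.
    apply: ler_wpM2l; first exact: mulr_ge0.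
    rewrite -(powRM _ (ltW (envN_gt0 _)) (ltW (envN_gt0 _))).
    by apply: le_powR => //; [exact: ltW (envN_gt0 _)|exact: envN_sel].
  rewrite ExZ// [leRHS]mulrAC ler_wpM2l// mulr_ge0 ?powR_ge0//.
  exact: mulr_ge0.
apply: (le_trans (ler_distD (\int[P]_w cpl lab z Psi L (sel (eq_lab lab L) e (z^~ w))) _ _)).
apply: (le_trans (lerD h1 h2)).
rewrite big_ord_recl expr0.
have -> : \sum_(i < L) mC ^+ lift ord0 i = mC * Sm.
  by rewrite mulr_sumr; apply: eq_bigr => i _; rewrite -exprS.
by rewrite le_eqVlt; apply/orP; left; apply/eqP; ring.
Qed.

(** Distinct labels are integrated independently, so only the joint law inside each label
    matters. *)
Lemma dec_stationary lab z z' Psi L : momb P theta Gam z -> momb P theta Gam z' ->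
  Hol kappa K a Psi ->
  (forall k, (k < L)%N -> forall B : J -> set R, (forall s, measurable (B s)) ->
    P [set w | forall s, lab s = k -> B s (z s w)] =
    P [set w | forall s, lab s = k -> B s (z' s w)]) ->
  forall e, dec lab z Psi L e = dec lab z' Psi L e.
Proof.
move=> mz mz' PH; elim: L => [//|L IH] box e /=.
have {}IH := IH (fun k kL => box k (leqW kL)).
transitivity (\int[P]_w dec lab z' Psi L (sel (eq_lab lab L) e (z^~ w))).
  by apply: eq_Rintegral => w _; rewrite IH.
(* With the other coordinates set to 0, the box hypothesis for the current label determines the law
   of the whole masked vector. *)
pose msk (y : J -> T -> R) s := if lab s == L then y s else fun=> 0.
have mskE (y : J -> T -> R) : \int[P]_w dec lab z' Psi L (sel (eq_lab lab L) e (y^~ w)) =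
    \int[P]_w dec lab z' Psi L (sel (eq_lab lab L) e ((msk y)^~ w)).
  apply: eq_Rintegral => w _; congr (dec _ _ _ _ _); apply/funext => s.
  by rewrite /sel /msk inE; case: ifP.
have mmsk y : momb P theta Gam y -> momb P theta Gam (msk y).
  move=> my s; rewrite /msk; case: ifP => _; first exact: my.
  have tn0 : theta != 0 by rewrite gt_eqF.
  split => //.
  - by rewrite normr0 powR0//; exact: Int_cst.
  - by rewrite normr0 powR0// Ex_cst.
rewrite (mskE z) (mskE z').
have gH := Hol_sel (eq_lab lab L) e (Hol_dec lab L mz' PH).
apply: (box_law kappa01 ath (mmsk _ mz) (mmsk _ mz') gH) => B mB.
have E y : [set w | forall s, B s (msk y s w)] =
    [set w | (forall s, lab s = L -> B s (y s w)) /\ (forall s, lab s <> L -> B s 0)].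
  apply/seteqP; split => w /=.
    move=> h; split => s sL; have := h s; rewrite /msk.
      by move/eqP: sL => ->.
    by move/eqP/negbTE: sL => ->.
  by move=> [h1 h2] s; rewrite /msk; case: eqP => [/h1|/h2].
rewrite !E.
have [h0|h0] := pselect (forall s, lab s <> L -> B s 0).
  rewrite (_ : [set w | _] = [set w | forall s, lab s = L -> B s (z s w)]); last first.
    by apply/seteqP; split => w /= => [[]|].
  rewrite [in RHS](_ : [set w | _] = [set w | forall s, lab s = L -> B s (z' s w)]); last first.
    by apply/seteqP; split => w /= => [[]|].
  exact: box.
rewrite (_ : [set w | _] = set0); last by apply/seteqP; split => w /= => [[]|].
by rewrite [in RHS](_ : [set w | _] = set0)//; apply/seteqP; split => w /= => [[]|].
Qed.

(** The box hypothesis says that the labels up to [k] have a product law, label [k] being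
    distributed as under [P]. Realising this law on the product of [P] and [P'] and applying Fubini
    produces one step of [dec]. *)
Lemma cpl_independent d' (T' : measurableType d') (P' : probability T' R) lab z
    (z' : J -> T' -> R) Psi L : momb P theta Gam z -> momb P' theta Gam z' ->
  Hol kappa K a Psi ->
  (forall k, (k < L)%N -> forall B : J -> set R, (forall s, measurable (B s)) ->
    P' [set w | forall s, (lab s <= k)%N -> B s (z' s w)] =
    (P [set w | forall s, lab s = k -> B s (z s w)] *
     P' [set w | forall s, (lab s < k)%N -> B s (z' s w)])%E) ->
  forall e, \int[P']_w Psi (sel (lt_lab lab L) e (z'^~ w)) = dec lab z Psi L e.
Proof.
move=> mz mz' PH; have [a0 at_] := andP ath; have K0 := Hol_K_ge0 PH.
elim: L => [|L IH] box e.
  by rewrite -[RHS](Ex_cst P'); apply: eq_Rintegral => w _; congr Psi.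
have {}IH := IH (fun k kL => box k (leqW kL)).
pose m1 s : T' -> R := if (lab s <= L)%N then z' s else fun=> 0.
(* Model on the product space: label [L] from the first component, lower labels from the second, 0
   above. *)
pose m2 s : T * T' -> R := if lab s == L then (fun x => z s x.1)
  else if (lab s < L)%N then (fun x => z' s x.2) else fun=> 0.
have tn0 : theta != 0 by rewrite gt_eqF.
have mm1 : momb P' theta Gam m1.
  move=> s; rewrite /m1; case: ifP => _; first exact: mz'.
  split => //; first by rewrite normr0 powR0//; exact: Int_cst.
  by rewrite normr0 powR0// Ex_cst.
have mm2 : momb (prodP P P') theta Gam m2.
  move=> s; rewrite /m2; case: ifP => _; first exact: (momb_fst P' mz).
  case: ifP => _; first exact: (momb_snd P mz').
  split => //; first by rewrite normr0 powR0//; exact: Int_cst.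
  by rewrite normr0 powR0// Ex_cst.
have PHe := Hol_sel (lt_lab lab L.+1) e PH.
transitivity (\int[P']_w Psi (sel (lt_lab lab L.+1) e (m1^~ w))).
  apply: eq_Rintegral => w _; congr Psi; apply/funext => s.
  by rewrite /sel /m1 inE ltnS; case: ifP.
rewrite (box_law kappa01 ath mm1 mm2 PHe); last first.
  move=> B mB.
  have mA : measurable [set w | forall s, lab s = L -> B s (z s w)].
    rewrite (_ : [set w | _] = \bigcap_(s in [set s | lab s = L]) (z s @^-1` B s)).
      apply: fin_bigcap_measurable => [|s _]; first exact: finite_finset.
      rewrite -[X in measurable X]setTI; have [mzs _ _] := mz s.
      by apply: mzs => //; exact: mB.
    by apply/seteqP; split.
  have mA' : measurable [set w | forall s, (lab s < L)%N -> B s (z' s w)].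
    rewrite (_ : [set w | _] = \bigcap_(s in [set s | (lab s < L)%N]) (z' s @^-1` B s)).
      apply: fin_bigcap_measurable => [|s _]; first exact: finite_finset.
      rewrite -[X in measurable X]setTI; have [mzs _ _] := mz' s.
      by apply: mzs => //; exact: mB.
    by apply/seteqP; split.
  have [h0|h0] := pselect (forall s, (L < lab s)%N -> B s 0); last first.
    rewrite (_ : [set w | _] = set0); last first.
      apply/seteqP; split => w //= h; apply: h0 => s sL.
      by have := h s; rewrite /m1 leqNgt sL.
    rewrite [in RHS](_ : [set w | _] = set0) ?measure0//.
    apply/seteqP; split => w //= h; apply: h0 => s sL.
    by have := h s; rewrite /m2 gtn_eqF// ltnNge (ltnW sL).
  rewrite (_ : [set w | _] = [set w | forall s, (lab s <= L)%N -> B s (z' s w)]); last first.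
    apply/seteqP; split => w /= h s; first by move=> sL; have := h s; rewrite /m1 sL.
    by rewrite /m1; case: leqP => [/h|/h0].
  rewrite (box L (ltnSn L) B mB) -product_measure1E//; congr (_ _).
  apply/seteqP; split => -[w w'] /=.
    move=> [h1 h2] s; rewrite /m2 /=; case: ifP => [/eqP/h1//|/negbT ne].
    by case: ifP => [/h2//|/negbT nl]; apply: h0; rewrite ltn_neqAle eq_sym ne leqNgt.
  move=> h; split => s sL; have := h s; rewrite /m2 /=; first by rewrite sL eqxx.
  by rewrite ltn_eqF// sL.
have [I1 _] := envN_mom ath mz; have [I2 _] := envN_mom ath mz'.
have E w w' : sel (lt_lab lab L.+1) e (m2^~ (w, w')) =
    sel (lt_lab lab L) (sel (eq_lab lab L) e (z^~ w)) (z'^~ w').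
  apply/funext => s; rewrite /sel /m2 !inE /= ltnS leq_eqVlt.
  by case: eqP => [->|_]; rewrite ?ltnn//=; case: ltnP.
have [||_ -> _] := @Ex_fubini _ T _ T' R P P'
  (fun ww => Psi (sel (lt_lab lab L.+1) e (m2^~ ww)))
  (fun w => K * envN e `^ a * envN (z^~ w) `^ a)
  (fun w => envN (z'^~ w) `^ a) _ (IntZ _ I1) I2.
- apply: (@measurable_Hol _ _ R J kappa K a (fun s ww =>
    sel (lt_lab lab L.+1) e (m2^~ ww) s)) => //.
  by move=> s; have [mzs _ _] := mm2 s; rewrite /sel; case: (_ \in _).
- move=> w w' /=; rewrite E.
  case: PH => + _ => /(_ (sel (lt_lab lab L) (sel (eq_lab lab L) e (z^~ w)) (z'^~ w'))) h.
  apply: (le_trans h); rewrite -2!mulrA ler_wpM2l//.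
  rewrite -(powRM _ (ltW (envN_gt0 _)) (ltW (envN_gt0 _))).
  rewrite -powRM ?mulr_ge0 ?(ltW (envN_gt0 _))//.
  apply: le_powR => //; first exact: ltW (envN_gt0 _).
  apply: (le_trans (envN_sel _ _ _)).
  rewrite mulrA ler_wpM2r ?(ltW (envN_gt0 _))//; exact: envN_sel.
rewrite [RHS]/=; apply: eq_Rintegral => w _; rewrite -[RHS]IH.
by apply: eq_Rintegral => w' _; rewrite E.
Qed.

End successive_decoupling.

(** * Exponents and series under Assumption (A) *)

Section exponents.
Context (R : realType).

(** The conjugate exponents of [p] and of [q / delta], with the moment orders they demand. The value
    [b = 2] pays for products of two functions of growth [iota], which double the moment orders. *)
Lemma exponents (p q delta m iota : R) :
  1 <= p -> 1 <= q -> 0 < delta -> 0 < m -> 0 < iota ->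
  p^-1 + (iota + 2) / m + delta / q <= 2^-1 ->
  [/\ 1 < p, 1 < (1 - p^-1)^-1, p^-1 + (1 - p^-1)^-1^-1 = 1,
    (2 * iota + 4) * (1 - p^-1)^-1 <= m &
    [/\ 1 < (1 - delta / q)^-1, (q / delta)^-1 + (1 - delta / q)^-1^-1 = 1,
      (2 * iota + 1) * (1 - delta / q)^-1 <= m & 2 < m]].
Proof.
move=> p1 q1 d0 m0 i0; rewrite invf_div !invrK.
have p0 : 0 < p^-1 by rewrite invr_gt0 (lt_le_trans _ p1).
have c0 : 0 < delta / q by rewrite divr_gt0// (lt_le_trans _ q1).
have b0 : 0 < m^-1 by rewrite invr_gt0.
have ib0 : 0 < iota * m^-1 by rewrite mulr_gt0.
move: p0 c0 b0 ib0; set a := p^-1; set c := delta / q; set b := m^-1.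
rewrite mulrDl => a0 c0 b0 ib0 h.
have a1 : 0 < 1 - a by lra.
have c1 : 0 < 1 - c by lra.
have mb : m * b = 1 by rewrite divff// gt_eqF.
have mi : m * (iota * b) = iota by rewrite mulrCA mb mulr1.
split; [| |lra| |split; [|lra| |]].
- rewrite -(invrK p) -/a -[ltLHS]invr1 ltf_pV2 ?posrE//; lra.
- rewrite -[ltLHS]invr1 ltf_pV2 ?posrE//; lra.
- rewrite ler_pdivrMr//.
  rewrite (_ : 2 * iota + 4 = m * (2 * (iota * b) + 4 * b)); last first.
    by rewrite mulrDr mulrCA mi mulrCA mb mulr1.
  by apply: ler_wpM2l; [exact: ltW|lra].
- rewrite -[ltLHS]invr1 ltf_pV2 ?posrE//; lra.
- rewrite ler_pdivrMr//.
  rewrite (_ : 2 * iota + 1 = m * (2 * (iota * b) + b)); last first.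
    by rewrite mulrDr mulrCA mi mb.
  by apply: ler_wpM2l; [exact: ltW|lra].
- rewrite -[ltLHS]mul1r -ltr_pdivlMr//.
  rewrite ltr_pdivlMr// mul1r -(ltr_pM2r b0) mb; lra.
Qed.

Lemma nneseries_fine (u : nat -> \bar R) : (forall n, (1 <= n)%N -> (0 <= u n)%E) ->
  (\sum_(1 <= n <oo) u n < +oo)%E ->
  (forall n, (1 <= n)%N -> (u n < +oo)%E) /\
  exists S : R, forall n, \sum_(1 <= k < n) fine (u k) <= S.
Proof.
move=> u0 us.
have fin n : (1 <= n)%N -> (u n < +oo)%E.
  move=> n1; apply: le_lt_trans us.
  apply: (@le_trans _ _ (\sum_(1 <= i < n.+1) u i)%E); last first.
    by apply: nneseries_lim_ge => k k1 _; exact: u0.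
  rewrite big_nat_recr//= leeDr// big_nat_cond; apply: sume_ge0 => i.
  by rewrite andbT => /andP[/u0].
split => //.
have s0 : (0 <= \sum_(1 <= n <oo) u n)%E.
  apply: le_trans (nneseries_lim_ge 1 _); first by rewrite big_geq.
  by move=> n n1 _; exact: u0.
exists (fine (\sum_(1 <= n <oo) u n)%E) => n.
rewrite -lee_fin fineK; last by rewrite ge0_fin_numE.
apply: le_trans (nneseries_lim_ge n _); last by move=> k k1 _; exact: u0.
rewrite le_eqVlt; apply/orP; left; apply/eqP.
rewrite -sumEFin; apply: eq_big_nat => i /andP[i1 _].
by rewrite fineK// ge0_fin_numE ?fin// u0.
Qed.

Lemma sum_mul_expr_half (n : nat) : \sum_(1 <= k < n) k%:R * (2 ^+ k)^-1 <= 2 :> R.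
Proof.
(* With this remainder the left side is constant in [m]. *)
have h m : \sum_(1 <= k < m.+1) k%:R * (2 ^+ k)^-1 + m.+2%:R * (2 ^+ m)^-1 <= 2 :> R.
  elim: m => [|m IH]; first by rewrite big_geq// expr0 invr1 add0r mulr1.
  rewrite big_nat_recr//=; apply: le_trans IH.
  rewrite -addrA lerD2l exprS invfM.
  rewrite (_ : m.+3%:R = m%:R + 3); last by rewrite -natrD addn3.
  rewrite (_ : m.+2%:R = m%:R + 2); last by rewrite -natrD addn2.
  rewrite -(natr1 m).
  have : 0 <= (2 ^+ m)^-1 :> R by rewrite invr_ge0 exprn_ge0.
  set z := (2 ^+ m)^-1; move=> z0; rewrite le_eqVlt; apply/orP; left; apply/eqP.
  by field.
case: n => [|n]; first by rewrite big_geq.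
by apply: le_trans (h n); rewrite lerDl mulr_ge0// invr_ge0 exprn_ge0.
Qed.

End exponents.

(** * From vectors to real coordinates *)

Section vectors.
Context (R : realType) (wp ell : nat).
Implicit Types x y : wp.-tuple R.

Lemma enorm_ge0 x : 0 <= enorm x. Proof. exact: sqrtr_ge0. Qed.

Lemma coord_le_enorm x c : `|tnth x c| <= enorm x.
Proof.
rewrite -sqrtr_sqr ler_wsqrtr// (bigD1 c)//= lerDl sumr_ge0// => i _.
exact: sqr_ge0.
Qed.

Lemma enorm_le_sum x : enorm x <= \sum_c `|tnth x c|.
Proof.
have s0 : 0 <= \sum_c `|tnth x c| by apply: sumr_ge0.
rewrite -[leRHS](ger0_norm s0) -sqrtr_sqr ler_wsqrtr//.
rewrite expr2 mulr_suml; apply: ler_sum => i _.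
rewrite -real_normK ?num_real// expr2 ler_wpM2l//.
by rewrite (bigD1 i)//= lerDl sumr_ge0.
Qed.

Lemma coord_le_edist x y c : `|tnth x c - tnth y c| <= Defs.edist x y.
Proof. by have := coord_le_enorm [tuple tnth x i - tnth y i | i < wp] c; rewrite tnth_mktuple. Qed.

Lemma edist_le_sum x y : Defs.edist x y <= \sum_c `|tnth x c - tnth y c|.
Proof.
apply: (le_trans (enorm_le_sum _)); apply: ler_sum => c _.
by rewrite tnth_mktuple.
Qed.

Definition tup (e : 'I_ell * 'I_wp -> R) : ell.-tuple (wp.-tuple R) :=
  [tuple [tuple e (i, c) | c < wp] | i < ell].

Lemma powR_sum_le (I : Type) (r : seq I) (a : I -> R) (kappa : R) : 0 < kappa <= 1 ->
  (forall i, 0 <= a i) ->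
  (\sum_(i <- r) a i) `^ kappa <= \sum_(i <- r) a i `^ kappa.
Proof.
move=> k01 a0; elim: r => [|i r IH]; first by rewrite !big_nil powR0// gt_eqF//; case/andP: k01.
rewrite !big_cons; apply: (le_trans (powR_add_le k01 (a0 i) _)); first exact: sumr_ge0.
by rewrite lerD2l.
Qed.

(** Euclidean norms are bounded by sums over coordinates, and subadditivity of [t^kappa] distributes
    the Hoelder modulus over them. *)
Lemma Hol_tup F (K iota kappa : R) : 0 < K -> 0 < iota -> 0 < kappa <= 1 ->
  growth_condition F K iota kappa ->
  Hol kappa (K * (1 + 2 * ell%:R)) iota (fun e => F (tup e)).
Proof.
move=> K0 i0 k01 [h1 h2].
have K0' := ltW K0; have l0 : 0 <= ell%:R :> R by [].
have n1 (e : 'I_ell * 'I_wp -> R) i : enorm (tnth (tup e) i) <= envN e.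
  apply: (le_trans (enorm_le_sum _)); rewrite /envN.
  rewrite (eq_bigr (fun s => `|e (s.1, s.2)|)) => [|[]//].
  rewrite -(pair_bigA _ (fun i c => `|e (i, c)|)) /= (bigD1 i)//= addrCA.
  rewrite tnth_mktuple (eq_bigr (fun c => `|e (i, c)|)); last by move=> c _; rewrite tnth_mktuple.
  rewrite lerDl addr_ge0// sumr_ge0// => j _; exact: sumr_ge0.
have n2 e i : enorm (tnth (tup e) i) `^ iota <= envN e `^ iota.
  by apply: le_powR; [exact: ltW|exact: enorm_ge0|exact: n1].
split => [e|x y].
  apply: (le_trans (h2 _)); rewrite -mulrA ler_wpM2l// mulrDl mul1r.
  apply: lerD; first exact: envN_pow1 (ltW i0).
  apply: (@le_trans _ _ (\sum_(i < ell) envN e `^ iota)); first exact: ler_sum.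
  rewrite sumr_const card_ord -[leLHS]mulr_natl; apply: ler_wpM2r; first exact: powR_ge0.
  lra.
apply: (le_trans (h1 _ _)).
have E0 : 0 <= (envN x + envN y) `^ iota by exact: powR_ge0.
have xy0 : 0 <= envN x + envN y by apply: addr_ge0; exact: ltW (envN_gt0 _).
apply: ler_pM.
- by apply: mulr_ge0 => //; apply: addr_ge0 => //; apply: sumr_ge0 => i _;
    apply: addr_ge0; exact: powR_ge0.
- by apply: sumr_ge0 => i _; exact: powR_ge0.
- rewrite -mulrA ler_wpM2l// mulrDl mul1r; apply: lerD.
    apply: (le_trans (envN_pow1 x (ltW i0))).
    by apply: (le_powR (ltW i0) (ltW (envN_gt0 _))); rewrite lerDl; exact: ltW (envN_gt0 _).
  apply: (@le_trans _ _ (\sum_(i < ell) 2 * (envN x + envN y) `^ iota)).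
    apply: ler_sum => i _; rewrite mulr2n mulrDl mul1r.
    apply: lerD; (apply: le_trans (n2 _ _) _); apply: le_powR;
      rewrite ?(ltW i0) ?(ltW (envN_gt0 _))// ?lerDl ?lerDr (ltW (envN_gt0 _))//.
  by rewrite sumr_const card_ord -[leLHS]mulr_natl mulrA (mulrC 2).
- rewrite [leRHS](eq_bigr (fun s => `|x (s.1, s.2) - y (s.1, s.2)| `^ kappa)) => [|[]//].
  rewrite -(pair_bigA _ (fun i c => `|x (i, c) - y (i, c)| `^ kappa)) /=.
  apply: ler_sum => i _.
  apply: (@le_trans _ _ ((\sum_c `|x (i, c) - y (i, c)|) `^ kappa)); last first.
    by apply: powR_sum_le.
  apply: le_powR; [by case/andP: k01 => /ltW|exact: enorm_ge0|].
  apply: (le_trans (edist_le_sum _ _)); apply: ler_sum => c _.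
  by rewrite !tnth_mktuple.
Qed.

Lemma measurable_enorm d (T : measurableType d) (f : T -> wp.-tuple R) :
  (forall c, measurable_fun setT (fun w => tnth (f w) c)) ->
  measurable_fun setT (fun w => enorm (f w)).
Proof.
move=> mf.
rewrite (_ : (fun w => _) = fun w => (\sum_c tnth (f w) c ^+ 2) `^ 2^-1); last first.
  by apply/funext => w; rewrite powR12_sqrt// sumr_ge0// => c _; exact: sqr_ge0.
apply: measurable_pow; apply: measurable_sum => c; apply: measurable_funX; exact: mf.
Qed.

Lemma measurable_edist d (T : measurableType d) (f g : T -> wp.-tuple R) :
  (forall c, measurable_fun setT (fun w => tnth (f w) c)) ->
  (forall c, measurable_fun setT (fun w => tnth (g w) c)) ->
  measurable_fun setT (fun w => Defs.edist (f w) (g w)).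
Proof.
move=> mf mg; apply: measurable_enorm => c.
rewrite (_ : (fun w => _) = fun w => tnth (f w) c - tnth (g w) c); last first.
  by apply/funext => w; rewrite tnth_mktuple.
exact: measurable_funB.
Qed.

End vectors.

(** * Moments of the process and of its projections *)

Section process.
Context d (T : measurableType d) (R : realType) (P : probability T R).
Context (wp : nat) (X : nat -> {RV P >-> wp.-tuple R}).
Variable FF : \bar int -> \bar int -> set (set T).
Hypothesis FFfam : sigma_algebra_family FF.

Definition xcoord n (c : 'I_wp) (w : T) : R := tnth (X n w) c.

Lemma measurable_xcoord n c : measurable_fun setT (xcoord n c).
Proof. exact: (measurableT_comp (measurable_tnth c) (measurable_funPT (X n))). Qed.

(** The variable lives on an arbitrary space, so that one constant serves the process and its
    independent copies. *)
Lemma law_moment theta : 0 < theta -> (gamma_ X theta < +oo)%E ->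
  exists2 Gam, 0 <= Gam &
  forall d' (T' : measurableType d') (P' : probability T' R)
    (Z : {RV P' >-> wp.-tuple R}),
  (forall A, measurable A -> P' (Z @^-1` A) = P (X 0%N @^-1` A)) ->
  momb P' theta Gam (fun c w => tnth (Z w) c).
Proof.
move=> t0 gfin; pose g := fine (gamma_ X theta).
have gE : gamma_ X theta = g%:E by rewrite fineK// ge0_fin_numE// Lnorm_ge0.
have g0 : 0 <= g by rewrite -lee_fin -gE Lnorm_ge0.
have me : measurable_fun setT (@enorm R wp).
  by apply: (@measurable_enorm _ _ _ _ id) => c; exact: measurable_tnth.
have [|I0 E0] := @Lnorm_le _ _ R (mu0 X) (@enorm R wp) theta g t0 g0 me.
  by rewrite -gE.
exists (g `^ theta); first exact: powR_ge0.
move=> d' T' P' Z ZX c.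
have men : measurable_fun setT (fun w => `|enorm (Z w)| `^ theta).
  by apply: measurable_normpow; exact: (measurableT_comp me (measurable_funPT Z)).
have In : (\int[P']_w (`|enorm (Z w)| `^ theta)%:E <= (g `^ theta)%:E)%E.
  have -> : (\int[P']_w (`|enorm (Z w)| `^ theta)%:E =
      \int[mu0 X]_x (`|enorm x| `^ theta)%:E)%E.
    transitivity (\int[distribution P' Z]_x (`|enorm x| `^ theta)%:E)%E.
      rewrite ge0_integral_pushforward//.
      by apply/measurable_EFinP; exact: measurable_normpow.
    by apply: eq_measure_integral => A mA _; exact: ZX.
  by rewrite integralEFin// lee_fin.
have [J1 J2] := ge0_Int_le men (fun w => powR_ge0 _ _) In.
have mc : measurable_fun setT (fun w => tnth (Z w) c).
  exact: (measurableT_comp (measurable_tnth c) (measurable_funPT Z)).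
have [J3 J4] := @EFin_Ex_le _ _ R P' (fun w => `|tnth (Z w) c| `^ theta) _
  (measurable_normpow theta mc) (fun w => powR_ge0 _ _) J1
  (fun w => le_powR (ltW t0) (normr_ge0 _) (le_trans (coord_le_enorm _ _) (ler_norm _))).
split; [exact: mc|exact: J3|exact: (le_trans J4 J2)].
Qed.

Lemma condexp_spec G f : sigma_algebra setT G -> G `<=` measurable -> Int P f ->
  is_condexp P G f (condexp P G f).
Proof. by move=> sG Gm If; apply: xgetPex; exact: is_condexp_exists. Qed.

Definition xproj (r n : nat) (c : 'I_wp) : T -> R :=
  condexp P (FF (n%:Z - r%:Z)%R%:E (n%:Z + r%:Z)%R%:E) (xcoord n c).

Lemma FF_sigma k l : (k <= l)%E -> sigma_algebra setT (FF k l).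
Proof. by move=> /(proj1 FFfam)[]. Qed.

Lemma FF_measurable k l : (k <= l)%E -> FF k l `<=` measurable.
Proof. by move=> /(proj1 FFfam)[]. Qed.

Let win (r n : nat) : ((n%:Z - r%:Z)%R%:E <= (n%:Z + r%:Z)%R%:E)%E.
Proof. by rewrite lee_fin lerD2l; apply: (@le_trans _ _ (0 : int)); rewrite ?oppr_le0. Qed.

Section moments.
Variables (theta Gam : R).
Hypothesis theta2 : 2 < theta.
Hypothesis mz : forall n, momb P theta Gam (xcoord n).

Let Int_xcoord n c : Int P (xcoord n c).
Proof.
have [m1 I1 _] := mz n c; apply: (Int_of_pow _ m1 I1).
by apply: le_trans (ltW theta2); rewrite ler1n.
Qed.

Let xproj_spec r n c := condexp_spec (FF_sigma (win r n)) (@FF_measurable _ _ (win r n))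
  (Int_xcoord n c).

Lemma xproj_mG r n c k l : (k <= (n%:Z - r%:Z)%R%:E)%E -> ((n%:Z + r%:Z)%R%:E <= l)%E ->
  mG (FF k l) (xproj r n c).
Proof.
move=> kn nl; have [h _ _] := xproj_spec r n c.
apply: (@mG_mono _ _ R (FF (n%:Z - r%:Z)%R%:E (n%:Z + r%:Z)%R%:E)).
  exact: (proj2 FFfam).
by apply/mG_sub => //; exact: FF_sigma.
Qed.

Lemma xproj_momb r n : momb P theta Gam (xproj r n).
Proof.
move=> c; have [m1 I1 E1] := mz n c.
have [I2 E2] := condexp_moment theta2 (FF_sigma (win r n)) (@FF_measurable _ _ (win r n))
  (Int_xcoord n c) (xproj_spec r n c) I1.
split; [|exact: I2|exact: (le_trans E2 E1)].
apply: (@mG_measurable _ _ R _ _ (FF_sigma (win r n)) (@FF_measurable _ _ (win r n))).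
exact: xproj_mG.
Qed.

Lemma xproj_close q b r n : 1 <= q -> 0 <= b -> (beta_coef P X FF q r <= b%:E)%E ->
  Lqclose P q b (xcoord n) (xproj r n).
Proof.
move=> q1 b0 hb c.
pose pv w := condexp_vec P (FF (n%:Z - r%:Z)%R%:E (n%:Z + r%:Z)%R%:E) (X n) w.
have pE w k : tnth (pv w) k = xproj r n k w by rewrite tnth_mktuple.
have mp k : measurable_fun setT (xproj r n k) by have [] := xproj_momb r n k.
have mpv k : measurable_fun setT (fun w => tnth (pv w) k).
  by rewrite (_ : (fun w => _) = xproj r n k)//; apply/funext => w.
have me := measurable_edist (measurable_xcoord n) mpv.
have q0 : 0 < q by exact: lt_le_trans q1.
have [J1 J2] := @Lnorm_le _ _ R P (fun w => Defs.edist (X n w) (pv w)) q b q0 b0 me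
  (le_trans (ereal_sup_ubound (ex_intro2 _ _ n I erefl)) hb).
have le_ed w : `|xcoord n c w - xproj r n c w| `^ q <= `|Defs.edist (X n w) (pv w)| `^ q.
  apply: (le_powR (ltW q0)) => //; apply: le_trans (ler_norm _).
  by rewrite -pE; exact: coord_le_edist.
have [J3 J4] := @EFin_Ex_le _ _ R P (fun w => `|xcoord n c w - xproj r n c w| `^ q) _
  (measurable_normpow q (measurable_funB (measurable_xcoord n c) (mp c)))
  (fun w => powR_ge0 _ _) J1 le_ed.
split; [exact: J3|exact: (le_trans J4 J2)].
Qed.

End moments.
End process.

(** * Hoeffding pieces along the process *)

Section rates.
Context d (T : measurableType d) (R : realType) (P : probability T R).
Context (wp : nat) (X : nat -> {RV P >-> wp.-tuple R}).
Variable FF : \bar int -> \bar int -> set (set T).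
Hypothesis FFfam : sigma_algebra_family FF.
Variables (q p : R).
Hypothesis q1 : 1 <= q.

Let future (k : nat) : (k%:Z%:E <= +oo :> \bar int)%E. Proof. exact: leey. Qed.

Lemma varpi_ge0 n : (0 <= varpi P FF q p n)%E.
Proof.
apply: (@le_trans _ _ (varpi_alg P q p (FF -oo%E 0%:E) (FF n%:Z%:E +oo%E))); last first.
  by apply: ereal_sup_ubound; exists 0%N.
apply: (@le_trans _ _ _ _ _ (Lnorm_ge0 P p%:E _)); last first.
  apply: ereal_sup_ubound; exists (cst 0) => //; split.
    apply/mG_sub; first exact: (proj1 (proj1 FFfam _ _ (future n))).
    exact: measurable_cst.
  have -> : EFin \o cst (0 : R) = cst 0%E by [].
  by rewrite Lnorm0// eqe gt_eqF// (lt_le_trans _ q1).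
Qed.

Lemma beta_ge0 r : (0 <= beta_coef P X FF q r)%E.
Proof.
by apply: le_trans (Lnorm_ge0 P q%:E _) (ereal_sup_ubound _); exists 0%N.
Qed.

Lemma mixing_rates (alpha lambda delta : R) : 1 <= alpha -> 1 <= lambda ->
  0 < delta -> delta < 1 ->
  (\sum_(1 <= n <oo) ((n%:R `^ alpha)%:E * varpi P FF q p n) < +oo)%E ->
  (\sum_(1 <= r <oo)
     ((r%:R `^ lambda)%:E * beta_coef P X FF q r `^ delta) < +oo)%E ->
  exists v b : nat -> R, [/\ forall r, (1 <= r)%N -> 0 < v r /\ 0 < b r,
    forall r k, (1 <= r)%N -> (varpi_alg P q p (FF -oo k%:Z%:E)
        (FF (k + r)%N%:Z%:E +oo) <= (v r)%:E)%E,
    forall r, (1 <= r)%N -> (beta_coef P X FF q r <= (b r)%:E)%E &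
    exists S, forall n, \sum_(1 <= k < n) k%:R * (v k + b k `^ delta) <= S].
Proof.
move=> al la d0 d1 s1 s2.
have [n n1|f1 [S1 h1]] := nneseries_fine _ s1.
  by apply: mule_ge0; [rewrite lee_fin powR_ge0|exact: varpi_ge0].
have [n n1|f2 [S2 h2]] := nneseries_fine _ s2.
  by apply: mule_ge0; [rewrite lee_fin powR_ge0|exact: poweR_ge0].
have pw (n : nat) (a : R) : (1 <= n)%N -> 1 <= a -> n%:R <= n%:R `^ a :> R.
  move=> n1 a1; rewrite -[leLHS]powRr1//; apply: ler_powR => //.
  by rewrite ler1n.
have pw0 (n : nat) (a : R) : (1 <= n)%N -> 0 < n%:R `^ a :> R.
  by move=> n1; rewrite powR_gt0// ltr0n.
have vfin n : (1 <= n)%N -> varpi P FF q p n \is a fin_num.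
  move=> n1; rewrite ge0_fin_numE ?varpi_ge0//; have := f1 n n1.
  case: (varpi P FF q p n) (varpi_ge0 n) => // [x _ _|_]; first exact: ltry.
  by rewrite gt0_muley ?lte_fin ?pw0.
have bfin n : (1 <= n)%N -> beta_coef P X FF q n \is a fin_num.
  move=> n1; rewrite ge0_fin_numE ?beta_ge0//; have := f2 n n1.
  case: (beta_coef P X FF q n) (beta_ge0 n) => // [x _ _|_]; first exact: ltry.
  by rewrite poweRyr ?gt_eqF// gt0_muley ?lte_fin ?pw0.
(* Young's inequality divides by [v] and [b], so the coefficients are made strictly positive. The
   added terms have weighted sums at most 2; the exponent [1 / delta] turns the second one into
   [2^-n] under the power [delta]. *)
pose v n := fine (varpi P FF q p n) + (2 ^+ n)^-1.
pose b n := fine (beta_coef P X FF q n) + ((2 ^+ n)^-1) `^ delta^-1.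
have e0 n : 0 < (2 ^+ n)^-1 :> R by rewrite invr_gt0 exprn_gt0.
have v0 n : 0 <= fine (varpi P FF q p n) by rewrite fine_ge0 ?varpi_ge0.
have b0 n : 0 <= fine (beta_coef P X FF q n) by rewrite fine_ge0 ?beta_ge0.
exists v, b; split.
- by move=> r r1; rewrite /v /b; split; apply: ltr_wpDl => //; exact: powR_gt0.
- move=> r k r1; apply: (@le_trans _ _ (varpi P FF q p r)).
    by apply: ereal_sup_ubound; exists k.
  by rewrite -(fineK (vfin _ r1)) lee_fin lerDl ltW.
- by move=> r r1; rewrite -(fineK (bfin _ r1)) lee_fin lerDl powR_ge0.
exists (S1 + S2 + (2 + 2)) => n.
apply: (@le_trans _ _ (\sum_(1 <= k < n) (
   fine ((k%:R `^ alpha)%:E * varpi P FF q p k)%E +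
   fine ((k%:R `^ lambda)%:E * beta_coef P X FF q k `^ delta)%E +
   (k%:R * (2 ^+ k)^-1 + k%:R * (2 ^+ k)^-1)))); last first.
  rewrite !big_split/=; apply: lerD; first exact: lerD.
  by apply: lerD; exact: sum_mul_expr_half.
apply: ler_sum_nat => k /andP[k1 _].
rewrite fineM ?vfin// fineM ?fin_num_poweR ?bfin//= fine_poweR.
have Hb : b k `^ delta <= fine (beta_coef P X FF q k) `^ delta + (2 ^+ k)^-1.
  have d01 : 0 < delta <= 1 by rewrite d0 ltW.
  apply: (le_trans (powR_add_le d01 (b0 k) (powR_ge0 _ _))).
  by rewrite -powRrM mulVf ?gt_eqF// powRr1// ltW.
have k0 : 0 <= k%:R :> R by [].
apply: (@le_trans _ _ (k%:R * (fine (varpi P FF q p k) + (2 ^+ k)^-1 +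
  (fine (beta_coef P X FF q k) `^ delta + (2 ^+ k)^-1)))).
  by rewrite ler_wpM2l// lerD2l.
rewrite (_ : k%:R * _ = k%:R * fine (varpi P FF q p k) +
   k%:R * fine (beta_coef P X FF q k) `^ delta +
   (k%:R * (2 ^+ k)^-1 + k%:R * (2 ^+ k)^-1)); last by ring.
rewrite lerD2r; apply: lerD; apply: ler_wpM2r; rewrite ?powR_ge0//; exact: pw.
Qed.

End rates.

Lemma dec_ext d (T : measurableType d) (R : realType) (P : probability T R)
    (J : finType) (lab : J -> nat) z Psi L (e e' : J -> R) :
  (forall s, (L <= lab s)%N -> e s = e' s) ->
  dec P lab z Psi L e = dec P lab z Psi L e'.
Proof.
elim: L e e' => [|L IH] e e' ee'; first by congr Psi; apply/funext => s; exact: ee'.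
apply: eq_Rintegral => w _; apply: IH => s Ls; rewrite /sel inE.
by case: eqP => // /eqP ne; apply: ee'; rewrite ltn_neqAle eq_sym ne.
Qed.

Lemma Hol_sub (R : realType) (kappa : R) (I : finType) (K K' a : R) (f g : (I -> R) -> R) :
  Hol kappa K a f -> Hol kappa K' a g -> Hol kappa (K + K') a (fun x => f x - g x).
Proof.
move=> [f1 f2] [g1 g2]; split => [x|x y].
  by rewrite mulrDl; apply: (le_trans (ler_normB _ _)); exact: lerD.
rewrite 2!mulrDl (_ : _ - _ = (f x - f y) - (g x - g y)); last by ring.
by apply: (le_trans (ler_normB _ _)); exact: lerD.
Qed.

Lemma Hol_mono (R : realType) (kappa : R) (I : finType) (K K' a : R) (f : (I -> R) -> R) :
  K <= K' -> Hol kappa K a f -> Hol kappa K' a f.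
Proof.
move=> KK' [f1 f2]; split => [x|x y].
  by apply: (le_trans (f1 x)); rewrite ler_wpM2r ?powR_ge0.
apply: (le_trans (f2 x y)); apply: ler_wpM2r; first by apply: sumr_ge0 => i _; exact: powR_ge0.
by rewrite ler_wpM2r ?powR_ge0.
Qed.

Section process_decoupling.
Context d (T : measurableType d) (R : realType) (P : probability T R).
Context (wp ell : nat) (X : nat -> {RV P >-> wp.-tuple R}).
Variable FF : \bar int -> \bar int -> set (set T).
Hypothesis FFfam : sigma_algebra_family FF.
Variables (p p' q kappa iota theta Gam delta s' : R).
Hypothesis kappa01 : 0 < kappa <= 1.
Hypothesis iota0 : 0 < iota.
Hypotheses (p1 : 1 < p) (p'1 : 1 < p') (pp : p^-1 + p'^-1 = 1) (q1 : 1 <= q).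
Hypothesis thetap : (2 * iota + 4) * p' <= theta.
Hypothesis thetaq : 2 * q * iota <= theta.
Hypothesis Gam0 : 0 <= Gam.
Hypotheses (delta0 : 0 < delta) (deltak : delta < kappa).
Hypotheses (s'1 : 1 < s') (ss' : (q / delta)^-1 + s'^-1 = 1).
Hypothesis thetas : (2 * iota + 1) * s' <= theta.
Hypothesis theta2 : 2 < theta.
Hypothesis mz : forall n, momb P theta Gam (xcoord X n).
Variables v b : nat -> R.
Hypothesis vb0 : forall r, (1 <= r)%N -> 0 < v r /\ 0 < b r.
Hypothesis varpi_v : forall r k, (1 <= r)%N -> (varpi_alg P q p (FF -oo k%:Z%:E)
        (FF (k + r)%N%:Z%:E +oo) <= (v r)%:E)%E.
Hypothesis beta_b : forall r, (1 <= r)%N -> (beta_coef P X FF q r <= (b r)%:E)%E.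

Local Notation I := ('I_ell * 'I_wp)%type.
Implicit Types (tau : 'I_ell -> nat) (f : (I -> R) -> R).

Definition slots tau (s : I) : T -> R := xcoord X (tau s.1) s.2.

Lemma slots_momb tau : momb P theta Gam (slots tau).
Proof. by move=> s; exact: mz. Qed.

Definition gap r : R := v r + b r `^ delta.

(** The gap [3 r] is shared out: [r] for the conditioning window around past times, [r] for the one
    around future times, and [r] between the two sigma-algebras, where [varpi] acts. *)
Lemma slots_peeling (B U B' U' : {pred I}) :
  chainable p kappa B -> chainable p kappa B' \/ (forall j, j \notin U') ->
  exists C, 0 <= C /\ forall r t tau tau' e e' f f' (K K' : R), (1 <= r)%N ->
  (forall s, s \in B -> (tau s.1 <= t)%N) -> (forall s, s \in U -> (t + 3 * r <= tau s.1)%N) ->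
  (forall s, s \in B' -> (tau' s.1 <= t)%N) -> (forall s, s \in U' -> (t + 3 * r <= tau' s.1)%N) ->
  0 < K -> 0 < K' -> Hol kappa K iota f -> Hol kappa K' iota f' ->
  `|\int[P]_w (f (mix B U e ((slots tau)^~ w) ((slots tau)^~ w)) *
               f' (mix B' U' e' ((slots tau')^~ w) ((slots tau')^~ w))) -
    \int[P]_w \int[P]_w' (f (mix B U e ((slots tau)^~ w) ((slots tau)^~ w')) *
               f' (mix B' U' e' ((slots tau')^~ w) ((slots tau')^~ w')))| <=
  C * (K * K') * envN (jn e e') `^ (2 * iota) * gap r.
Proof.
move=> cB cB'.
have [C [C0 hC]] := peeling P kappa01 iota0 p1 p'1 pp q1 thetap thetaq Gam0 delta0 deltak
  s'1 ss' thetas U cB cB'.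
exists C; split => // r t tau tau' e e' f f' K K' r1 hB hU hB' hU' K0 K'0 fH fH'.
have [v0 b0] := vb0 r1.
have pl : (-oo <= (t + r)%N%:Z%:E :> \bar int)%E by exact: leNye.
have fl : ((t + r + r)%N%:Z%:E <= +oo :> \bar int)%E by exact: leey.
have := (hC (FF -oo%E (t + r)%N%:Z%:E) (FF (t + r + r)%N%:Z%:E +oo%E) (v r) (b r)
  (slots tau) (fun s : I => xproj X FF r (tau s.1) s.2)
  (slots tau') (fun s : I => xproj X FF r (tau' s.1) s.2)
  e e' f f' K K' (FF_sigma FFfam pl) (@FF_measurable _ _ _ FFfam _ _ pl)
  (FF_sigma FFfam fl) (@FF_measurable _ _ _ FFfam _ _ fl) v0 b0 (varpi_v _ r1)
  (slots_momb _) (slots_momb _)) => h; apply: h => //.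
- by move=> s; exact: (xproj_momb FFfam theta2 mz).
- by move=> s; exact: (xproj_momb FFfam theta2 mz).
- by move=> s; exact: (xproj_close FFfam theta2 mz _ q1 (ltW b0) (beta_b r1)).
- by move=> s; exact: (xproj_close FFfam theta2 mz _ q1 (ltW b0) (beta_b r1)).
- move=> s /hB h; apply: (xproj_mG FFfam theta2 mz); first exact: leNye.
  by rewrite lee_fin -PoszD lez_nat leq_add2r.
- move=> s /hU h; apply: (xproj_mG FFfam theta2 mz); last exact: leey.
  by rewrite lee_fin lerBrDr -PoszD lez_nat (leq_trans _ h)// !mulSn mul0n addn0 !addnA.
- move=> s /hB' h; apply: (xproj_mG FFfam theta2 mz); first exact: leNye.
  by rewrite lee_fin -PoszD lez_nat leq_add2r.
- move=> s /hU' h; apply: (xproj_mG FFfam theta2 mz); last exact: leey.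
  by rewrite lee_fin lerBrDr -PoszD lez_nat (leq_trans _ h)// !mulSn mul0n addn0 !addnA.
Qed.

Lemma slots_cpl_dec (lab : I + I -> nat) L :
  (forall k, (k < L)%N -> chainable p kappa [pred s : I | (lab (inl s) < k)%N]) ->
  (forall k, (k < L)%N -> chainable p kappa [pred s : I | (lab (inr s) < k)%N]) ->
  exists C, 0 <= C /\ forall r tau tau' f f' (K K' : R), (1 <= r)%N ->
  (forall k, (k < L)%N -> exists t, forall s,
    [/\ (lab (inl s) < k -> tau s.1 <= t)%N, (lab (inr s) < k -> tau' s.1 <= t)%N,
      (lab (inl s) = k -> t + 3 * r <= tau s.1)%N &
      (lab (inr s) = k -> t + 3 * r <= tau' s.1)%N]) ->
  0 < K -> 0 < K' -> Hol kappa K iota f -> Hol kappa K' iota f' -> forall e,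
  `|cpl P lab (jn (slots tau) (slots tau'))
      (fun x => f (fun i => x (inl i)) * f' (fun j => x (inr j))) L e -
    dec P lab (jn (slots tau) (slots tau'))
      (fun x => f (fun i => x (inl i)) * f' (fun j => x (inr j))) L e| <=
  C * (K * K') * gap r * envN e `^ (2 * iota).
Proof.
move=> ch1 ch2.
(* One constant for all labels, obtained by adding those of the finitely many peelings. *)
have [C [C0 hC]] : exists C, 0 <= C /\ forall k, (k < L)%N ->
  forall r t tau tau' e e' f f' (K K' : R), (1 <= r)%N ->
  (forall s, (lab (inl s) < k)%N -> (tau s.1 <= t)%N) ->
  (forall s, lab (inl s) = k -> (t + 3 * r <= tau s.1)%N) ->
  (forall s, (lab (inr s) < k)%N -> (tau' s.1 <= t)%N) ->
  (forall s, lab (inr s) = k -> (t + 3 * r <= tau' s.1)%N) ->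
  0 < K -> 0 < K' -> Hol kappa K iota f -> Hol kappa K' iota f' ->
  `|\int[P]_w (f (mix [pred s : I | (lab (inl s) < k)%N] [pred s : I | lab (inl s) == k]
         e ((slots tau)^~ w) ((slots tau)^~ w)) *
      f' (mix [pred s : I | (lab (inr s) < k)%N] [pred s : I | lab (inr s) == k]
         e' ((slots tau')^~ w) ((slots tau')^~ w))) -
    \int[P]_w \int[P]_w' (f (mix [pred s : I | (lab (inl s) < k)%N]
         [pred s : I | lab (inl s) == k] e ((slots tau)^~ w) ((slots tau)^~ w')) *
      f' (mix [pred s : I | (lab (inr s) < k)%N] [pred s : I | lab (inr s) == k]
         e' ((slots tau')^~ w) ((slots tau')^~ w')))| <=
  C * (K * K') * envN (jn e e') `^ (2 * iota) * gap r.
  elim: L ch1 ch2 => [|L IH] ch1 ch2; first by exists 0.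
  have [||C [C0 hC]] := IH.
  - by move=> k kL; apply: ch1; rewrite ltnW.
  - by move=> k kL; apply: ch2; rewrite ltnW.
  have [C' [C'0 hC']] := @slots_peeling [pred s : I | (lab (inl s) < L)%N]
    [pred s : I | lab (inl s) == L] [pred s : I | (lab (inr s) < L)%N]
    [pred s : I | lab (inr s) == L] (ch1 L (ltnSn L)) (or_introl (ch2 L (ltnSn L))).
  exists (C + C'); split; first exact: addr_ge0.
  move=> k; rewrite ltnS leq_eqVlt => kL r t tau tau' e e' f f' K K' r1 h1 h2 h3 h4 K0 K'0 fH fH'.
  have [v0 b0] := vb0 r1.
  have g0 : 0 <= gap r by rewrite addr_ge0 ?(ltW v0) ?powR_ge0.
  have X0 : 0 <= (K * K') * envN (jn e e') `^ (2 * iota) * gap r.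
    by do 2 apply: mulr_ge0 => //; [exact: ltW (mulr_gt0 _ _)|exact: powR_ge0].
  rewrite -2!mulrA (mulrA (K * K')) mulrDl.
  have [/eqP kE|kN] := boolP (k == L).
    subst k; apply: (@le_trans _ _ (C' * (K * K' * envN (jn e e') `^ (2 * iota) * gap r))).
      rewrite !mulrA -(mulrA C'); apply: (hC' r t) => //.
      - by move=> s; rewrite inE => /eqP/h2.
      - by move=> s; rewrite inE => /eqP/h4.
    by rewrite lerDr mulr_ge0.
  rewrite (negbTE kN) in kL.
  apply: (@le_trans _ _ (C * (K * K' * envN (jn e e') `^ (2 * iota) * gap r))).
    by rewrite !mulrA -(mulrA C); apply: (hC k kL r t).
  by rewrite lerDl mulr_ge0.
set S0 := \sum_(k < L) momC theta Gam #|{: I + I}| ^+ k.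
have i2 : 0 <= 2 * iota <= theta by exact: (i2th iota0 s'1 thetas).
have t0 : 0 <= theta by case/andP: i2 => /le_trans; apply.
have m1 := momC_ge1 Gam0 #|{: I + I}| t0.
have S00 : 0 <= S0 by apply: sumr_ge0 => k _; rewrite exprn_ge0// (le_trans _ m1).
exists (C * S0); split; first exact: mulr_ge0.
move=> r tau tau' f f' K K' r1 times K0 K'0 fH fH' e.
have [v0 b0] := vb0 r1.
have g0 : 0 <= gap r by rewrite addr_ge0 ?(ltW v0) ?powR_ge0.
have KK0 : 0 <= K * K' by exact: ltW (mulr_gt0 _ _).
have mzz : momb P theta Gam (jn (slots tau) (slots tau')).
  by case=> s; exact: slots_momb.
have PH := Hol_prod (ltW iota0) fH fH'.
have tgt0 : 0 < theta by exact: lt_trans theta2.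
have := @cpl_dec _ _ _ P kappa theta Gam (2 * iota) (K * K') _ kappa01 Gam0 tgt0 i2 lab
  (jn (slots tau) (slots tau')) _ (C * (K * K') * gap r) L mzz PH.
move=> h; apply: (le_trans (h _ _ e)).
- by do 2 apply: mulr_ge0 => //.
- move=> k kL e1; have [t ht] := times k kL.
  have -> : C * (K * K') * gap r * envN e1 `^ (2 * iota) =
    C * (K * K') * envN (jn (fun i => e1 (inl i)) (fun i => e1 (inr i))) `^ (2 * iota) * gap r.
    rewrite (_ : jn _ _ = e1); last by apply/funext => -[].
    ring.
  have := hC k kL r t tau tau' (fun i => e1 (inl i)) (fun i => e1 (inr i)) f f' K K' r1.
  move=> /(_ (fun s => let: And4 a _ _ _ := ht s in a) (fun s => let: And4 _ _ a _ := ht s in a)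
    (fun s => let: And4 _ a _ _ := ht s in a) (fun s => let: And4 _ _ _ a := ht s in a) K0 K'0 fH fH').
  apply: le_trans; rewrite /cpl le_eqVlt; apply/orP; left; apply/eqP; congr (`|_ - _|).
  apply: eq_Rintegral => w _; congr (f _ * f' _); apply/funext => s;
    by rewrite /sel /mix !inE ltnS leq_eqVlt; case: eqP => [->|]; rewrite ?ltnn//; case: ifP.
rewrite le_eqVlt; apply/orP; left; apply/eqP; rewrite /S0; ring.
Qed.

Hypothesis dimP : delta < kappa - (ell.-1 * wp)%:R / p.
Hypothesis Xst : stationary_pairs X.

(** A block missing one slot has at most [(ell - 1) wp] coordinates: this is the dimension in
    Assumption (A). Since [delta > 0] and [kappa <= 1], the same inequality bounds the number of
    coordinates by [p]. *)
Lemma avoid_slot_chainable (i : 'I_ell) (B : {pred I}) :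
  (forall s, s \in B -> s.1 != i) -> chainable p kappa B.
Proof.
move=> Bi; have p0 : 0 < p by exact: lt_trans p1.
have cB : (#|B| <= ell.-1 * wp)%N.
  have -> : (ell.-1 * wp)%N = #|[predX predC1 i & predT : {pred 'I_wp}]|.
    by rewrite cardX cardC1 card_ord cardT size_enum_ord.
  by apply: subset_leq_card; apply/fintype.subsetP => s /Bi; rewrite !inE andbT.
have cB' : #|B|%:R / p <= (ell.-1 * wp)%:R / p.
  by rewrite ler_wpM2r ?invr_ge0 ?(ltW p0)// ler_nat.
have [_ k1] := andP kappa01.
split; last by move: dimP delta0; lra.
rewrite -[leRHS]mul1r -ler_pdivrMr//; move: dimP delta0; lra.
Qed.

(** Stationarity of pairs covers two times, so the coordinates of a box must all be read at [n] or
    [n'], and correspondingly at [m] or [m']. The labellings below group coordinates accordingly. *)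
Lemma stationary_box (J : finType) (S S' : J -> nat) (c : J -> 'I_wp) (Q : J -> Prop)
    (B : J -> set R) (n n' m m' : nat) : (forall s, measurable (B s)) ->
  (forall s, Q s -> (S s = n /\ S' s = m) \/ (S s = n' /\ S' s = m')) ->
  n%:Z - n'%:Z = m%:Z - m'%:Z ->
  P [set w | forall s, Q s -> B s (xcoord X (S s) (c s) w)] =
  P [set w | forall s, Q s -> B s (xcoord X (S' s) (c s) w)].
Proof.
move=> mB QS nm.
pose A (x : wp.-tuple R * wp.-tuple R) := forall s, Q s ->
  (S s = n /\ S' s = m -> B s (tnth x.1 (c s))) /\
  (S s = n' /\ S' s = m' -> B s (tnth x.2 (c s))).
have mA : measurable A.
  rewrite (_ : A =
    (\bigcap_(s in [set s | Q s /\ S s = n /\ S' s = m])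
      ((fun x : wp.-tuple R * wp.-tuple R => tnth x.1 (c s)) @^-1` B s)) `&`
    (\bigcap_(s in [set s | Q s /\ S s = n' /\ S' s = m'])
      ((fun x : wp.-tuple R * wp.-tuple R => tnth x.2 (c s)) @^-1` B s))); last first.
    apply/seteqP; split => x.
      by move=> h; split => s [Qs e]; have [h1 h2] := h s Qs; [exact: h1|exact: h2].
    by move=> [h1 h2] s Qs; split => e; [exact: h1|exact: h2].
  apply: measurableI; apply: fin_bigcap_measurable => [|s _]; try exact: finite_finset.
    rewrite -[X in measurable X]setTI.
    by apply: (measurableT_comp (measurable_tnth (c s)) measurable_fst) => //; exact: mB.
  rewrite -[X in measurable X]setTI.
  by apply: (measurableT_comp (measurable_tnth (c s)) measurable_snd) => //; exact: mB.
transitivity (P [set w | A (X n w, X n' w)]).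
  congr (P _); apply/seteqP; split => w /= h s Qs.
    by have := h s Qs; rewrite /xcoord; split => -[e _]; rewrite -e.
  have [h1 h2] := h s Qs.
  by have [e|e] := QS s Qs; rewrite /xcoord (proj1 e); [exact: h1|exact: h2].
rewrite (proj2 Xst _ _ _ _ nm _ mA).
congr (P _); apply/seteqP; split => w /= h s Qs.
  have [h1 h2] := h s Qs.
  by have [e|e] := QS s Qs; rewrite /xcoord (proj2 e); [exact: h1|exact: h2].
by have := h s Qs; rewrite /xcoord; split => -[_ e]; rewrite -e.
Qed.

Variables (K0 : R) (F0 : (I -> R) -> R).
Hypotheses (K0_gt0 : 0 < K0) (F0H : Hol kappa K0 iota F0).

Let it : 0 <= iota <= theta.
Proof.
have /andP[_ h] := i2th iota0 s'1 thetas.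
by rewrite (ltW iota0)/= (le_trans _ h)// mulr2n mulrDl !mul1r lerDl ltW.
Qed.

Let tgt0 : 0 < theta. Proof. exact: lt_trans theta2. Qed.

(** Reversed, because [dec] integrates label 0 innermost. *)
Definition rlab (s : I) : nat := rev_ord s.1.

(* [averaged L] integrates the last [L] arguments, the last one first, against the law of [X 0]. *)
Definition averaged L := dec P rlab (slots (fun=> 0%N)) F0 L.

(* The Hoeffding decomposition of [F0]. *)
Definition piece (i : 'I_ell) (e : I -> R) := averaged (rev_ord i) e - averaged (rev_ord i).+1 e.

Lemma sum_piece e : \sum_i piece i e = F0 e - averaged ell e.
Proof.
rewrite (reindex_inj rev_ord_inj)/=.
under eq_bigr => i _ do rewrite /piece rev_ordK.
rewrite -(big_mkord xpredT (fun k => averaged k e - averaged k.+1 e)).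
rewrite -[LHS]opprK -sumrN (eq_bigr (fun k => averaged k.+1 e - averaged k e)).
  by rewrite telescope_sumr// opprB.
by move=> k _; rewrite opprB.
Qed.

Lemma le_rlab (i : 'I_ell) (s : I) : (rev_ord i <= rlab s)%N = (s.1 <= i)%N.
Proof. by rewrite /rlab/= leq_sub2lE// ltnS. Qed.

Lemma piece_ext (i : 'I_ell) (e e' : I -> R) : (forall s : I, (s.1 <= i)%N -> e s = e' s) -> piece i e = piece i e'.
Proof.
move=> ee'; rewrite /piece; congr (_ - _); apply: dec_ext => s.
  by rewrite le_rlab; exact: ee'.
by move/ltnW; rewrite le_rlab; exact: ee'.
Qed.

Definition KP : R := (2 * K0) * momC theta Gam #|{: I}| ^+ ell.

Let mC1 : 1 <= momC theta Gam #|{: I}|. Proof. exact: momC_ge1 (ltW tgt0). Qed.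

Lemma KP_gt0 : 0 < KP.
Proof. by rewrite !mulr_gt0// exprn_gt0// (lt_le_trans _ mC1). Qed.

Lemma Hol_piece i : Hol kappa KP iota (piece i).
Proof.
have h L : (L <= ell)%N -> Hol kappa (K0 * momC theta Gam #|{: I}| ^+ ell) iota (averaged L).
  move=> Ll; apply: (@Hol_mono _ _ _ (K0 * momC theta Gam #|{: I}| ^+ L)).
    by rewrite ler_pM2l// ler_weXn2l.
  exact: (Hol_dec kappa01 it rlab L (slots_momb (fun=> 0%N)) F0H).
rewrite /KP mulr2n mulrDl mul1r mulrDl; apply: Hol_sub; apply: h; first exact: ltnW.
exact: ltn_ord.
Qed.

Definition slot (i : 'I_ell) : {pred I} := [pred s | s.1 == i].

(** Integrating slot [i] out of the first average yields the second one, at whatever time the slot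
    is read, by stationarity. *)
Lemma piece_centered i tau e :
  \int[P]_w piece i (sel (slot i) e ((slots tau)^~ w)) = 0.
Proof.
have eqslot : eq_lab rlab (rev_ord i) = slot i.
  apply/funext => s.
  exact: (inj_eq (inj_comp (@ord_inj ell) (@rev_ord_inj ell))).
have Hav L : Hol kappa (K0 * momC theta Gam #|{: I}| ^+ L) iota (averaged L).
  exact: (Hol_dec kappa01 it rlab L (slots_momb (fun=> 0%N)) F0H).
have [I1 _] := momb_sel_Int kappa01 (slot i) e it (slots_momb tau) (Hav (rev_ord i)).
rewrite /piece ExB//; last first.
  by have [] := momb_sel_Int kappa01 (slot i) e it (slots_momb tau) (Hav (rev_ord i).+1).
apply/eqP; rewrite subr_eq0; apply/eqP.
transitivity (averaged (rev_ord i).+1 e); last first.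
  rewrite -[LHS](Ex_cst P); apply: eq_Rintegral => w _; apply: dec_ext => s.
  rewrite -eqslot /sel inE => h; by rewrite gtn_eqF.
(* With label 0 on slot [i] alone, one step of [dec] integrates exactly that slot, and the
   comparison of laws involves a single time. *)
pose lab (s : I) : nat := if s.1 == i then 0%N else 1%N.
have labE : eq_lab lab 0 = slot i by apply/funext => s; rewrite /slot /eq_lab /= /lab; case: (s.1 == i).
have := @dec_stationary _ _ _ P kappa theta Gam iota _ _ kappa01 Gam0 tgt0 it lab
  (slots tau) (slots (fun=> 0%N)) _ 1 (slots_momb _) (slots_momb _) (Hav (rev_ord i)).
rewrite /= labE -eqslot => -> // k k1 B mB.
apply: (@stationary_box _ (fun s => tau s.1) (fun=> 0%N) snd _ _ (tau i) (tau i) 0 0) => //.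
  move=> s; rewrite /lab; case: eqP => [-> _|_ ks]; first by left.
  by rewrite ltnS leqn0 in k1; rewrite -ks in k1.
by rewrite !subrr.
Qed.

Definition at_time n (i : 'I_ell) : nat := (i.+1 * n)%N.

Definition cov i j n m : R :=
  \int[P]_w (piece i ((slots (at_time n))^~ w) * piece j ((slots (at_time m))^~ w)).

Let z00 (J : finType) : envN (fun _ : J => 0 : R) `^ (2 * iota) = 1.
Proof. by rewrite /envN big1 ?addr0 ?powR1// => i _; rewrite normr0. Qed.

(** The latest time [(i+1) n] is read by slot [i] of the first factor alone; peeling it off leaves
    an inner integral that vanishes because the piece is centred in that slot. The second factor
    lies entirely in the past, so it is not chained and may depend on all slots. *)
Lemma piece_mixing (i j : 'I_ell) : exists C, 0 <= C /\ forall r n m f' (K' : R),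
  (1 <= r)%N -> (3 * r <= n)%N -> (j.+1 * m + 3 * r <= i.+1 * n)%N -> 0 < K' ->
  Hol kappa K' iota f' -> (forall e e' : I -> R, (forall s : I, (s.1 <= j)%N -> e s = e' s) ->
    f' e = f' e') ->
  `|\int[P]_w (piece i ((slots (at_time n))^~ w) * f' ((slots (at_time m))^~ w))| <=
  C * K' * gap r.
Proof.
pose B : {pred I} := [pred s : I | (s.1 < i)%N].
pose B' : {pred I} := [pred s : I | (s.1 <= j)%N].
have cB : chainable p kappa B.
  by apply: (@avoid_slot_chainable i) => s; rewrite inE; apply: contraTN => /eqP ->; rewrite ltnn.
have [C [C0 hC]] := @slots_peeling B (slot i) B' pred0 cB (or_intror (fun=> erefl)).
exists (C * KP); split; first exact: mulr_ge0 (ltW KP_gt0).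
move=> r n m f' K' r1 rn rnm K'0 fH fext.
pose z := slots (at_time n); pose z' := slots (at_time m).
have := hC r (maxn (i * n) (j.+1 * m)) (at_time n) (at_time m) (fun=> 0) (fun=> 0)
  (piece i) f' KP K' r1.
rewrite (_ : jn _ _ = fun=> 0); last by apply/funext => -[].
rewrite z00.
rewrite mulr1.
have -> : \int[P]_w \int[P]_w'
   (piece i (mix B (slot i) (fun=> 0) (z^~ w) (z^~ w')) *
    f' (mix B' pred0 (fun=> 0) (z'^~ w) (z'^~ w'))) = 0.
  rewrite -[RHS](Ex_cst P 0); apply: eq_Rintegral => w _.
  have [I1 _] := momb_sel_Int kappa01 (slot i) (z^~ w) it (slots_momb (at_time n)) (Hol_piece i).
  transitivity (\int[P]_w' (piece i (sel (slot i) (z^~ w) (z^~ w')) *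
      f' (mix B' pred0 (fun=> 0) (z'^~ w) (z'^~ w)))); last first.
    by rewrite ExZr// piece_centered mul0r.
  apply: eq_Rintegral => w' _; congr (_ * _).
  apply: piece_ext => s si; rewrite /mix /sel !inE.
  have [->|ne] := eqVneq s.1 i; first by rewrite ltnn.
  have -> // : (s.1 < i)%N by rewrite ltn_neqAle si andbT; exact: ne.
rewrite subr0 mulrA => h; apply: le_trans (h _ _ _ _ _ K'0 _ fH).
- rewrite le_eqVlt; apply/orP; left; apply/eqP; congr (`|_|).
  apply: eq_Rintegral => w _; congr (_ * _).
    apply: piece_ext => s si; rewrite /mix !inE.
    have [->|ne] := eqVneq s.1 i; first by rewrite ltnn.
    by have -> // : (s.1 < i)%N by rewrite ltn_neqAle si andbT; exact: ne.
  by apply: fext => s si; rewrite /mix inE si.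
- by move=> s; rewrite inE => si; rewrite leq_max leq_mul2r si orbT.
- move=> s; rewrite inE => /eqP ->; rewrite addn_maxl geq_max rnm andbT.
  by rewrite /at_time mulSn addnC leq_add2r.
- by move=> s; rewrite inE => si; rewrite leq_max leq_mul2r ltnS si !orbT.
- by [].
- exact: KP_gt0.
- exact: Hol_piece.
Qed.

Lemma cov_mixing : exists C, 0 <= C /\ forall (i j : 'I_ell) r n m, (1 <= r)%N -> (3 * r <= n)%N ->
  (j.+1 * m + 3 * r <= i.+1 * n)%N -> `|cov i j n m| <= C * gap r.
Proof.
have /choice[c hc] (ij : 'I_ell * 'I_ell) := piece_mixing ij.1 ij.2.
exists (\sum_ij c ij * KP); split.
  apply: sumr_ge0 => ij _; apply: mulr_ge0; first exact: (proj1 (hc ij)).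
  exact: ltW KP_gt0.
move=> i j r n m r1 rn rnm.
have g0 : 0 <= gap r by have [v0 b0] := vb0 r1; rewrite addr_ge0 ?(ltW v0) ?powR_ge0.
have := proj2 (hc (i, j)) r n m (piece j) KP r1 rn rnm KP_gt0 (Hol_piece j) (@piece_ext j).
move=> h; apply: (le_trans h); apply: ler_wpM2r => //.
rewrite (bigD1 (i, j))//= lerDl; apply: sumr_ge0 => ij _; apply: mulr_ge0.
  exact: (proj1 (hc ij)).
exact: ltW KP_gt0.
Qed.

Lemma mean_piece_mixing : exists C, 0 <= C /\ forall (i : 'I_ell) r n, (1 <= r)%N -> (3 * r <= n)%N ->
  `|\int[P]_w piece i ((slots (at_time n))^~ w)| <= C * gap r.
Proof.
have /choice[c hc] (i : 'I_ell) := piece_mixing i i.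
exists (\sum_i c i); split.
  by apply: sumr_ge0 => i _; exact: (proj1 (hc i)).
move=> i r n r1 rn.
have g0 : 0 <= gap r by have [v0 b0] := vb0 r1; rewrite addr_ge0 ?(ltW v0) ?powR_ge0.
have H1 : Hol kappa 1 iota (fun _ : I -> R => 1).
  split=> [x|x y]; first by rewrite normr1 mul1r; exact: envN_pow1 (ltW iota0).
  rewrite subrr normr0; apply: mulr_ge0; first by rewrite mul1r powR_ge0.
  by apply: sumr_ge0 => s _; exact: powR_ge0.
have := proj2 (hc i) r n 0%N _ 1 r1 rn _ ltr01 H1 (fun _ _ _ => erefl).
rewrite muln0 add0n => h.
have -> : \int[P]_w piece i ((slots (at_time n))^~ w) =
    \int[P]_w (piece i ((slots (at_time n))^~ w) * 1).
  by apply: eq_Rintegral => w _; rewrite mulr1.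
apply: (le_trans (h _)); first by rewrite (leq_trans rn)// leq_pmull.
rewrite mulr1; apply: ler_wpM2r => //.
by rewrite (bigD1 i)//= lerDl; apply: sumr_ge0 => k _; exact: (proj1 (hc k)).
Qed.

(** A slot has the same label in both factors, since both read it from the same independent copy. *)
Definition diag_lab (s : I + I) : nat := match s with inl s => s.1 | inr s => s.1 end.

(* The covariance of [piece i] along the sequence of independent copies. *)
Definition rho (i : 'I_ell) n m : R :=
  dec P diag_lab (jn (slots (at_time n)) (slots (at_time m)))
    (fun x => piece i (fun s => x (inl s)) * piece i (fun s => x (inr s))) i.+1 (fun=> 0).

(** Slot [k] is read at times [(k+1) n] and [(k+1) m], earlier slots at times up to [k max(n, m)];
    the hypotheses keep these groups [3 r] apart although [n] and [m] differ. *)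
Lemma cov_rho : exists C, 0 <= C /\ forall (i : 'I_ell) r n m, (1 <= r)%N ->
  (3 * r + ell * (n - m) <= m)%N -> (3 * r + ell * (m - n) <= n)%N ->
  `|cov i i n m - rho i n m| <= C * gap r.
Proof.
have lt_ch (i : 'I_ell) k : (k < i.+1)%N -> chainable p kappa [pred s : I | (s.1 < k)%N].
  move=> ki; apply: (@avoid_slot_chainable i) => s; rewrite inE => sk.
  by apply: contraTN sk => /eqP ->; rewrite -leqNgt.
have /choice[c hc] (i : 'I_ell) := @slots_cpl_dec diag_lab i.+1 (lt_ch i) (lt_ch i).
exists (\sum_i c i * (KP * KP)); split.
  apply: sumr_ge0 => i _; apply: mulr_ge0; first exact: (proj1 (hc i)).
  exact: ltW (mulr_gt0 KP_gt0 KP_gt0).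
move=> i r n m r1 nm mn.
have g0 : 0 <= gap r by have [v0 b0] := vb0 r1; rewrite addr_ge0 ?(ltW v0) ?powR_ge0.
have far k n1 m1 : (k < i.+1)%N -> (3 * r + ell * (m1 - n1) <= n1)%N ->
    (k * maxn n1 m1 + 3 * r <= k.+1 * n1)%N.
  move=> ki h; rewrite maxnE mulnDr mulSn -addnA [X in (_ <= X)%N]addnC leq_add2l addnC.
  by rewrite (leq_trans _ h)// leq_add2l leq_mul2r (leq_trans _ (ltn_ord i)) ?orbT// ltnW.
have := proj2 (hc i) r (at_time n) (at_time m) _ _ KP KP r1 _ KP_gt0 KP_gt0
  (Hol_piece i) (Hol_piece i) (fun=> 0).
rewrite z00 mulr1 => h; apply: (@le_trans _ _ (c i * (KP * KP) * gap r)); last first.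
  rewrite ler_wpM2r// (bigD1 i)//= lerDl; apply: sumr_ge0 => k _.
  apply: mulr_ge0; first exact: (proj1 (hc k)).
  exact: ltW (mulr_gt0 KP_gt0 KP_gt0).
have E : cpl P diag_lab (jn (slots (at_time n)) (slots (at_time m)))
    (fun x => piece i (fun s => x (inl s)) * piece i (fun s => x (inr s))) i.+1 (fun=> 0) =
    cov i i n m.
  by apply: eq_Rintegral => w _; congr (_ * _); apply: piece_ext => s si;
    rewrite /sel inE /= ltnS si.
rewrite E in h; apply: h => {E hc g0} k ki.
exists (k * maxn n m)%N => s; split => /= sk.
- by rewrite leq_mul// leq_maxl.
- by rewrite leq_mul// leq_maxr.
- by rewrite /at_time sk; exact: far.
- by rewrite /at_time sk maxnC; exact: far.
Qed.

Let PsiH i j : Hol kappa (KP * KP) (2 * iota) (fun x : I + I -> R =>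
  piece i (fun s => x (inl s)) * piece j (fun s => x (inr s))).
Proof. exact: (Hol_prod (ltW iota0) (Hol_piece i) (Hol_piece j)). Qed.

Let i2 : 0 <= 2 * iota <= theta. Proof. exact: (i2th iota0 s'1 thetas). Qed.

Let jn_momb tau tau' : momb P theta Gam (jn (slots tau) (slots tau')).
Proof. by case=> s; exact: slots_momb. Qed.

Lemma jn_slots tau tau' s : jn (slots tau) (slots tau') s =
  xcoord X (jn (fun s => tau s.1) (fun s => tau' s.1) s)
    (jn (fun s : I => s.2) (fun s : I => s.2) s).
Proof. by case: s. Qed.

Lemma rho_stationary i n m k : rho i (n + k) (m + k) = rho i n m.
Proof.
apply: (dec_stationary kappa01 Gam0 tgt0 i2 (jn_momb _ _) (jn_momb _ _) (PsiH i i)).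
move=> l _ B mB.
under [in LHS]eq_set => w do under eq_forall => s do rewrite jn_slots.
under [in RHS]eq_set => w do under eq_forall => s do rewrite jn_slots.
apply: (@stationary_box _ _ _ _ _ _ (l.+1 * (n + k)) (l.+1 * (m + k)) (l.+1 * n) (l.+1 * m)) => //.
  by case=> s /= <-; [left|right].
by rewrite !mulnDr !PoszD opprD addrACA subrr addr0.
Qed.

(** As [t] grows, slot [s] of the first factor moves at speed [(s+1)(j+1)] and slot [s] of the
    second at speed [(s+1)(i+1)]. Labelling by speed groups at most one time from each factor, at a
    distance not depending on [t], and separates the groups for large [t]. Both times of a group
    shift equally, so by pair stationarity the decoupled integral [D] does not depend on [t]. *)
Lemma cov_ray (i j : 'I_ell) : exists C, 0 <= C /\ forall n0 m0, exists D : R,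
  forall r t, (1 <= r)%N -> (3 * r + ell * (n0 + m0) <= t)%N ->
  `|cov i j (n0 + j.+1 * t) (m0 + i.+1 * t) - D| <= C * gap r.
Proof.
(* The largest speed is that of slot [i] in the first factor and slot [j] in the second; slots that
   the pieces do not read get the label [L] and stay frozen. *)
pose L := (i.+1 * j.+1).+1.
pose lab (s : I + I) : nat := match s with
  | inl s => if (s.1 <= i)%N then (s.1.+1 * j.+1)%N else L
  | inr s => if (s.1 <= j)%N then (s.1.+1 * i.+1)%N else L end.
have ch1 k : (k < L)%N -> chainable p kappa [pred s : I | (lab (inl s) < k)%N].
  move=> kL; apply: (@avoid_slot_chainable i) => s; rewrite inE /lab.
  case: ifP => _ h; last by have := ltn_trans h kL; rewrite ltnn.
  by apply: contraTN h => /eqP ->; rewrite -leqNgt.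
have ch2 k : (k < L)%N -> chainable p kappa [pred s : I | (lab (inr s) < k)%N].
  move=> kL; apply: (@avoid_slot_chainable j) => s; rewrite inE /lab.
  case: ifP => _ h; last by have := ltn_trans h kL; rewrite ltnn.
  by apply: contraTN h => /eqP ->; rewrite -leqNgt mulnC.
have [C [C0 hC]] := @slots_cpl_dec lab L ch1 ch2.
exists (C * (KP * KP)); split; first by apply: mulr_ge0 => //; exact: ltW (mulr_gt0 KP_gt0 KP_gt0).
move=> n0 m0.
pose D t := dec P lab (jn (slots (at_time (n0 + j.+1 * t))) (slots (at_time (m0 + i.+1 * t))))
    (fun x => piece i (fun s => x (inl s)) * piece j (fun s => x (inr s))) L (fun=> 0).
have DE t : D t = D 0%N.
  apply: (dec_stationary kappa01 Gam0 tgt0 i2 (jn_momb _ _) (jn_momb _ _) (PsiH i j)).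
  move=> k kL B mB.
  under [in LHS]eq_set => w do under eq_forall => s do rewrite jn_slots.
  under [in RHS]eq_set => w do under eq_forall => s do rewrite jn_slots.
  pose ta t := (k %/ j.+1 * (n0 + j.+1 * t))%N; pose tb t := (k %/ i.+1 * (m0 + i.+1 * t))%N.
  have la s u : lab (inl s) = k -> at_time (n0 + j.+1 * u) s.1 = ta u /\ (j.+1 %| k)%N.
    rewrite /lab; case: ifP => _ e; last by rewrite e ltnn in kL.
    by rewrite /ta -e mulnK// dvdn_mull.
  have lb s u : lab (inr s) = k -> at_time (m0 + i.+1 * u) s.1 = tb u /\ (i.+1 %| k)%N.
    rewrite /lab; case: ifP => _ e; last by rewrite e ltnn in kL.
    by rewrite /tb -e mulnK// dvdn_mull.
  (* The first factor has slots of speed [k] only if [j + 1] divides [k], the second only if [i + 1]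
     does. *)
  have [jk|jk] := boolP (j.+1 %| k)%N; have [ik|ik] := boolP (i.+1 %| k)%N.
  - apply: (@stationary_box _ _ _ _ _ _ (ta t) (tb t) (ta 0%N) (tb 0%N)) => //.
      by case=> s sk; [left; split; exact: (proj1 (la s _ sk))
        |right; split; exact: (proj1 (lb s _ sk))].
    have Ea u : ta u = (k %/ j.+1 * n0 + k * u)%N by rewrite /ta mulnDr mulnA (divnK jk).
    have Eb u : tb u = (k %/ i.+1 * m0 + k * u)%N by rewrite /tb mulnDr mulnA (divnK ik).
    by rewrite !Ea !Eb !PoszD !opprD !(addrACA _ _ (- _)) !subrr.
  - apply: (@stationary_box _ _ _ _ _ _ (ta t) (ta t) (ta 0%N) (ta 0%N)) => //.
      case=> s sk; last by have [_] := lb s 0%N sk; rewrite (negbTE ik).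
      by left; split; exact: (proj1 (la s _ sk)).
    by rewrite !subrr.
  - apply: (@stationary_box _ _ _ _ _ _ (tb t) (tb t) (tb 0%N) (tb 0%N)) => //.
      case=> s sk; first by have [_] := la s 0%N sk; rewrite (negbTE jk).
      by left; split; exact: (proj1 (lb s _ sk)).
    by rewrite !subrr.
  - apply: (@stationary_box _ _ _ _ _ _ 0 0 0 0) => //.
    case=> s sk; first by have [_] := la s 0%N sk; rewrite (negbTE jk).
    by have [_] := lb s 0%N sk; rewrite (negbTE ik).
exists (D 0%N) => r t r1 rt; rewrite -(DE t).
have := hC r (at_time (n0 + j.+1 * t)) (at_time (m0 + i.+1 * t)) _ _ KP KP r1 _ KP_gt0 KP_gt0
  (Hol_piece i) (Hol_piece j) (fun=> 0).
rewrite z00 mulr1 => h; have E : cpl P lab (jn (slots (at_time (n0 + j.+1 * t))) (slots (at_time (m0 + i.+1 * t))))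
    (fun x => piece i (fun s => x (inl s)) * piece j (fun s => x (inr s))) L (fun=> 0) =
    cov i j (n0 + j.+1 * t) (m0 + i.+1 * t).
  apply: eq_Rintegral => w _; congr (_ * _); apply: piece_ext => s si; rewrite /sel inE /= si.
    by rewrite /L ltnS leq_mul2r ltnS si orbT.
  by rewrite /L ltnS mulnC leq_mul2l ltnS si orbT.
rewrite E in h; apply: h => {E hC DE D}.
have off (s : 'I_ell) : (s.+1 * n0 <= ell * (n0 + m0))%N /\ (s.+1 * m0 <= ell * (n0 + m0))%N.
  by split; apply: leq_mul; rewrite ?ltn_ord ?leq_addr ?leq_addl.
move=> k kL; exists (k.-1 * t + ell * (n0 + m0))%N => s.
have far : (0 < k)%N -> (k.-1 * t + ell * (n0 + m0) + 3 * r <= k * t)%N.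
  by case: k {kL} => // k _; rewrite -addnA mulSn addnC leq_add2r addnC.
split; rewrite /lab; case: ifP => _ h; try by [have := ltn_trans h kL; rewrite ltnn | rewrite h ltnn in kL].
- rewrite /at_time mulnDr mulnA addnC leq_add ?(proj1 (off _))//.
  by case: k h {kL far} => // k; rewrite ltnS => h; rewrite leq_mul2r h orbT.
- rewrite /at_time mulnDr mulnA addnC leq_add ?(proj2 (off _))//.
  by case: k h {kL far} => // k; rewrite ltnS => h; rewrite leq_mul2r h orbT.
- rewrite /at_time [leqRHS]mulnDr [in leqRHS]mulnA h (leq_trans (far _)) ?leq_addl//.
  by rewrite -h muln_gt0.
- rewrite /at_time [leqRHS]mulnDr [in leqRHS]mulnA h (leq_trans (far _)) ?leq_addl//.
  by rewrite -h muln_gt0.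
Qed.

Lemma cov_bounded : exists C, forall i j n m, `|cov i j n m| <= C.
Proof.
exists (KP * KP * momC theta Gam #|{: I + I}|) => i j n m.
have [J1 J2] := envN_mom i2 (jn_momb (at_time n) (at_time m)).
have KK0 : 0 <= KP * KP by exact: ltW (mulr_gt0 KP_gt0 KP_gt0).
apply: (@le_trans _ _ (\int[P]_w (KP * KP *
   envN (fun s => jn (slots (at_time n)) (slots (at_time m)) s w) `^ (2 * iota)))).
  apply: Ex_absle; [exact: (Int_Hol kappa01 i2 (jn_momb (at_time n) (at_time m)) (PsiH i j))
    |exact: IntZ|].
  by move=> w; exact: (proj1 (PsiH i j) (fun s => jn (slots (at_time n)) (slots (at_time m)) s w)).
by rewrite ExZ// ler_wpM2l.
Qed.

(** * Covariances along the independent copies *)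

Context d' (T' : measurableType d') (P' : probability T' R).
Variable Y : 'I_ell -> nat -> {RV P' >-> wp.-tuple R}.
Hypothesis Yc : independent_copies X Y.
Hypothesis mY : forall i n, momb P' theta Gam (fun c w => tnth (Y i n w) c).

Definition copies n (s : I) (w : T') : R := tnth (Y s.1 (at_time n s.1) w) s.2.

Lemma copies_momb n m : momb P' theta Gam (jn (copies n) (copies m)).
Proof. by case=> s; exact: mY. Qed.

Definition slot_of (s : I + I) : 'I_ell := match s with inl s => s.1 | inr s => s.1 end.

Section boxes.
Variables (B : I + I -> set R) (n m : nat).
Hypothesis mB : forall s, measurable (B s).

(** Independence takes one event for every slot; the switch [ev] supplies the whole space for slots
    left out. *)
Definition slot_box i (ev : Prop) : set T' :=
  [set w | ev -> forall s, slot_of s = i -> B s (jn (copies n) (copies m) s w)].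

Lemma slot_box_sigma i ev : process_sigma (Y i) (slot_box i ev).
Proof.
have [hb|nb] := pselect ev; last first.
  rewrite (_ : slot_box i ev = setT); last by apply/seteqP; split => // w _ /nb.
  exact: (@measurableT _ (g_sigma_algebraType
    (\bigcup_n preimage_set_system setT (Y i n) measurable))).
rewrite (_ : slot_box i ev =
  \bigcap_(s in [set s | slot_of s = i]) (jn (copies n) (copies m) s @^-1` B s)); last first.
  by apply/seteqP; split => w h; [move=> s; exact: h|move=> _ s; exact: h].
apply: (@fin_bigcap_measurable _ (g_sigma_algebraType
    (\bigcup_n preimage_set_system setT (Y i n) measurable))); first exact: finite_finset.
have gen t c (A : set R) : measurable A -> process_sigma (Y i) ((fun w => tnth (Y i t w) c) @^-1` A).
  move=> mA; apply: sub_gen_smallest; exists t => //.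
  exists ((fun x : wp.-tuple R => tnth x c) @^-1` A); last by rewrite setTI.
  by rewrite -[X in measurable X]setTI; exact: measurable_tnth.
by case=> s /= e; subst i; [exact: (gen (at_time n s.1) s.2 _ (mB (inl s)))
  |exact: (gen (at_time m s.1) s.2 _ (mB (inr s)))].
Qed.

Lemma slot_box_prod (ev : 'I_ell -> Prop) :
  P' (\bigcap_i slot_box i (ev i)) = (\prod_(i < ell) P' (slot_box i (ev i)))%E.
Proof. by apply: (proj2 Yc) => i; exact: slot_box_sigma. Qed.

Lemma slot_box_false i (ev : Prop) : ~ ev -> P' (slot_box i ev) = 1%E.
Proof.
move=> nb; rewrite (_ : slot_box i ev = setT) ?probability_setT//.
by apply/seteqP; split => // w _ /nb.
Qed.

Lemma slot_box_law i : P' (slot_box i True) =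
  P [set w | forall s, slot_of s = i ->
    B s (jn (slots (at_time n)) (slots (at_time m)) s w)].
Proof.
pose t := [tuple at_time n i; at_time m i].
pose u (s : I + I) : 'I_2 := match s with inl _ => ord0 | inr _ => lift ord0 ord0 end.
pose cc (s : I + I) : 'I_wp := match s with inl s => s.2 | inr s => s.2 end.
pose A (x : 2.-tuple (wp.-tuple R)) := forall s, slot_of s = i -> B s (tnth (tnth x (u s)) (cc s)).
have mA : measurable A.
  rewrite (_ : A = \bigcap_(s in [set s | slot_of s = i])
    ((fun x : 2.-tuple (wp.-tuple R) => tnth (tnth x (u s)) (cc s)) @^-1` B s)); last first.
    by apply/seteqP; split.
  apply: fin_bigcap_measurable => [|s _]; first exact: finite_finset.
  rewrite -[X in measurable X]setTI.
  by apply: (measurableT_comp (measurable_tnth (cc s)) (measurable_tnth (u s))) => //; exact: mB.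
have tE s : tnth t (u s) = jn (fun=> at_time n i) (fun=> at_time m i) s by case: s.
have E1 : slot_box i True = [set w | A [tuple Y i (tnth t j) w | j < 2]].
  apply/seteqP; split => w h.
    by move=> s si; have := h Logic.I s si; rewrite /A tnth_mktuple tE; case: s si => s /= <-.
  by move=> _ s si; have := h s si; rewrite /A tnth_mktuple tE; case: s si => s /= <-.
rewrite E1 (proj1 Yc i _ t _ mA); congr (P _); apply/seteqP; split => w h s si.
  by have := h s si; rewrite /A tnth_mktuple tE; case: s si => s /= <-.
by have := h s si; rewrite tnth_mktuple tE; case: s si => s /= <-.
Qed.

(** Any injective order of the slots is allowed: the natural one yields the covariances of the
    copies, another one their orthogonality. *)
Lemma copies_box (g : 'I_ell -> nat) k : injective g ->
  P' [set w | forall s, (g (slot_of s) <= k)%N -> B s (jn (copies n) (copies m) s w)] =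
  (P [set w | forall s, g (slot_of s) = k ->
      B s (jn (slots (at_time n)) (slots (at_time m)) s w)] *
   P' [set w | forall s, (g (slot_of s) < k)%N -> B s (jn (copies n) (copies m) s w)])%E.
Proof.
move=> gi.
have cap (ev : nat -> Prop) : [set w | forall s, ev (g (slot_of s)) -> B s (jn (copies n) (copies m) s w)] =
    \bigcap_i slot_box i (ev (g i)).
  apply/seteqP; split => w h; first by move=> i _ bi s si; apply: h; rewrite si.
  by move=> s bs; exact: (h (slot_of s)).
rewrite (cap (fun l => (l <= k)%N)) (cap (fun l => (l < k)%N)) !slot_box_prod.
have -> : P [set w | forall s, g (slot_of s) = k ->
      B s (jn (slots (at_time n)) (slots (at_time m)) s w)] =
    (\prod_(i < ell) P' (slot_box i (g i = k)))%E.
  have [[i gik]|ne] := pselect (exists i, g i = k).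
    rewrite (bigD1 i)//= big1 ?mule1; last first.
      by move=> j ji; apply: slot_box_false => gj; case/eqP: ji; apply: gi; rewrite gj.
    have -> : slot_box i (g i = k) = slot_box i True.
      by apply/seteqP; split => w h; [move=> _; exact: h|move=> _; exact: h Logic.I].
    rewrite slot_box_law; congr (P _); apply/seteqP; split => w h s si; apply: h.
      by rewrite si.
    by apply: gi; rewrite si.
  rewrite big1; last by move=> j _; apply: slot_box_false => gj; apply: ne; exists j.
  rewrite (_ : [set w | _] = setT) ?probability_setT//.
  by apply/seteqP; split => // w _ s gs; case: ne; exists (slot_of s).
rewrite -big_split/=; apply: eq_bigr => i _.
have [lt|gt|eq] := ltngtP (g i) k.
- have -> : P' (slot_box i (g i = k)) = 1%E.
    by apply: slot_box_false => e; rewrite e ltnn in lt.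
  rewrite mul1e.
  by congr (P' _); apply/seteqP; split => w h _; apply: h.
- have -> : P' (slot_box i (g i = k)) = 1%E.
    by apply: slot_box_false => e; rewrite e ltnn in gt.
  by rewrite !slot_box_false ?mul1e// => h; have := leq_trans gt h.
- rewrite [X in (_ * X)%E]slot_box_false ?mule1//.
  by congr (P' _); apply/seteqP; split => w h _; apply: h.
Qed.

End boxes.

Lemma copies_rho i n m :
  \int[P']_w (piece i ((copies n)^~ w) * piece i ((copies m)^~ w)) = rho i n m.
Proof.
have labE s : diag_lab s = nat_of_ord (slot_of s) by case: s.
rewrite /rho.
have <- := @cpl_independent _ _ _ P kappa theta Gam _ _ _ kappa01 Gam0 tgt0 i2 _ T' P'
  diag_lab _ (jn (copies n) (copies m)) _ i.+1 (jn_momb (at_time n) (at_time m))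
  (copies_momb n m) (PsiH i i) _ (fun=> 0).
  apply: eq_Rintegral => w _; congr (_ * _); apply: piece_ext => s si;
    by rewrite /sel inE /= ltnS si.
move=> k _ B mB.
have := copies_box n m mB k (@ord_inj ell).
have E : diag_lab = fun s => nat_of_ord (slot_of s) by apply/funext.
by rewrite E.
Qed.

(* Integrating out the top argument first uses that [piece j] is centered in it. *)
Lemma copies_orthogonal (j : 'I_ell) f (K' : R) n m : 0 < K' -> Hol kappa K' iota f ->
  (forall e e' : I -> R, (forall s : I, (s.1 < j)%N -> e s = e' s) -> f e = f e') ->
  \int[P']_w (f ((copies n)^~ w) * piece j ((copies m)^~ w)) = 0.
Proof.
move=> K'0 fH fext.
(* Slots up to [j] in reverse order, so that slot [j] gets label 0 and is integrated innermost;
   later slots get labels outside the range of integration. *)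
pose g (i : 'I_ell) : nat := if (i <= j)%N then (j - i)%N else (ell + i)%N.
have gi : injective g.
  move=> i i' /eqP; rewrite /g; case: leqP => ij; case: leqP => ij'.
  - by move=> /eqP e; apply: ord_inj; rewrite -(subKn ij) e subKn.
  - by rewrite ltn_eqF// (leq_ltn_trans (leq_subr _ _))// (leq_trans (ltn_ord j))// leq_addr.
  - by rewrite gtn_eqF// (leq_ltn_trans (leq_subr _ _))// (leq_trans (ltn_ord j))// leq_addr.
  - by rewrite eqn_add2l => /eqP/ord_inj.
pose lab (s : I + I) := g (slot_of s).
pose Psi (x : I + I -> R) := f (fun s => x (inl s)) * piece j (fun s => x (inr s)).
have PH : Hol kappa (K' * KP) (2 * iota) Psi.
  exact: (Hol_prod (ltW iota0) fH (Hol_piece j)).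
have E := @cpl_independent _ _ _ P kappa theta Gam _ _ _ kappa01 Gam0 tgt0 i2 _ T' P'
  lab _ (jn (copies n) (copies m)) Psi j.+1 (jn_momb (at_time n) (at_time m))
  (copies_momb n m) PH (fun k _ B mB => copies_box n m mB k gi) (fun=> 0).
transitivity (\int[P']_w Psi (sel (lt_lab lab j.+1) (fun=> 0) ((jn (copies n) (copies m))^~ w))).
  have lt_j (i : 'I_ell) : (i <= j)%N -> (g i < j.+1)%N by rewrite /g => ->; rewrite ltnS leq_subr.
  apply: eq_Rintegral => w _; congr (_ * _).
    by apply: fext => s sj; rewrite /sel inE /= lt_j// ltnW.
  by apply: piece_ext => s sj; rewrite /sel inE /= lt_j.
rewrite E {E}.
have D0 L e : dec P lab (jn (slots (at_time n)) (slots (at_time m))) Psi L.+1 e = 0.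
  elim: L e => [|L IH] e; last first.
    by rewrite -[RHS](Ex_cst P 0); apply: eq_Rintegral => w _; exact: IH.
  have [I1 _] := momb_sel_Int kappa01 (slot j) (fun s => e (inr s)) it
    (slots_momb (at_time m)) (Hol_piece j).
  rewrite /=; transitivity (f (fun s => e (inl s)) * \int[P]_w
      piece j (sel (slot j) (fun s => e (inr s)) ((slots (at_time m))^~ w))); last first.
    by rewrite piece_centered mulr0.
  rewrite -ExZ; last exact: I1.
  apply: eq_Rintegral => w _; rewrite /Psi; congr (_ * _).
    apply: fext => s sj; rewrite /sel inE /lab /g /= (ltnW sj) subn_eq0 leqNgt sj//.
  congr piece; apply/funext => s; rewrite /sel !inE /lab /g /=; case: leqP => h.
    rewrite subn_eq0; case: leqP => h'.
      by rewrite (_ : s.1 = j) ?eqxx//; apply: ord_inj; apply/eqP; rewrite eqn_leq h.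
    by rewrite (_ : (s.1 == j) = false)//; apply/negbTE; rewrite neq_ltn h'.
  rewrite (_ : (ell + s.1 == 0)%N = false); last first.
    by apply/negbTE; rewrite -lt0n addn_gt0 (leq_ltn_trans _ (ltn_ord j)).
  by rewrite (_ : (s.1 == j) = false)//; apply/negbTE; rewrite neq_ltn h orbT.
exact: D0.
Qed.

(** Induction on the number [n] of integrals left, the first [k] arguments being frozen in [e]. The
    outermost integral left is over slot [k], which carries the largest reversed label still to be
    averaged. *)
Lemma iter_averaged k n (G : n.-tuple (wp.-tuple R) -> \bar R) e : (k + n = ell)%N ->
  (forall t : n.-tuple (wp.-tuple R), G t = (F0 (fun s => if (s.1 < k)%N then e s
    else tnth (nth (nseq_tuple wp 0) t (s.1 - k)) s.2))%:E) ->
  iter_integral (mu0 X) G = (averaged n e)%:E.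
Proof.
elim: n k G e => [|n IH] k G e kn hG /=.
  rewrite hG; congr (F0 _)%:E; apply/funext => s.
  by rewrite addn0 in kn; rewrite kn ltn_ord.
have kl : (k < ell)%N by rewrite -kn -[ltnLHS]addn0 ltn_add2l.
pose ek (x : wp.-tuple R) := sel (slot (Ordinal kl)) e (fun s => tnth x s.2).
have step x : iter_integral (mu0 X) (fun t => G [tuple of x :: t]) = (averaged n (ek x))%:E.
  apply: (IH k.+1) => [|t]; first by rewrite addSnnS.
  rewrite hG; congr (F0 _)%:E; apply/funext => s /=; rewrite /ek /sel inE ltnS.
  rewrite -(inj_eq (@ord_inj ell)) /=.
  case: ltngtP => // [ks|->]; last by rewrite subnn.
  by rewrite -(subnSK ks).
under eq_integral => x _ do rewrite step.
have key a : (a < ell)%N -> ((ell - a.+1)%N == n) = (a == k).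
  move=> al; rewrite -(eqn_add2r a.+1) subnK// -kn !addnS eqSS addnC eqn_add2l.
  exact: eq_sym.
have eqslot : eq_lab rlab n = slot (Ordinal kl).
  apply/funext => s; rewrite /eq_lab /slot /rlab /= -(inj_eq (@ord_inj ell)) /=.
  exact: key (ltn_ord s.1).
have Hav := Hol_dec kappa01 it rlab n (slots_momb (fun=> 0%N)) F0H.
have [I1 _] := momb_sel_Int kappa01 (slot (Ordinal kl)) e it (slots_momb (fun=> 0%N)) Hav.
rewrite integral_pushforward//.
- by rewrite /averaged /= eqslot -integralEFin.
- apply/measurable_EFinP.
  apply: (@measurable_Hol _ _ R I kappa _ iota (fun s x => ek x s) _ kappa01 (ltW iota0) Hav) => s.
  by rewrite /ek /sel; case: (s \in _) => //; exact: measurable_tnth.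
Qed.

End process_decoupling.

(** * Decay of covariances *)

Section rates_of_decay.
Context (R : realType) (ell : nat).
Local Notation slot_ix := 'I_ell.
Variables (c : slot_ix -> slot_ix -> nat -> nat -> R) (rho : slot_ix -> nat -> nat -> R).
Variables (ex : slot_ix -> nat -> R) (g : nat -> R) (C0 C1 C2 C3 S : R).
Hypothesis C0b : forall i j n m, `|c i j n m| <= C0.
Hypothesis ex0b : forall i n, `|ex i n| <= C0.
Hypothesis C1_ge0 : 0 <= C1.
Hypothesis C2_ge0 : 0 <= C2.
Hypothesis C3_ge0 : 0 <= C3.
Hypothesis g_ge0 : forall r, (1 <= r)%N -> 0 <= g r.
Hypothesis gS : forall n, \sum_(1 <= k < n) k%:R * g k <= S.
Hypothesis cmix : forall (i j : slot_ix) r n m, (1 <= r)%N -> (3 * r <= n)%N ->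
  (j.+1 * m + 3 * r <= i.+1 * n)%N -> `|c i j n m| <= C1 * g r.
Hypothesis crho : forall i r n m, (1 <= r)%N ->
  (3 * r + ell * (n - m) <= m)%N -> (3 * r + ell * (m - n) <= n)%N ->
  `|c i i n m - rho i n m| <= C2 * g r.
Hypothesis rho_shift : forall i n m k, rho i (n + k)%N (m + k)%N = rho i n m.
Hypothesis exmix : forall i r n, (1 <= r)%N -> (3 * r <= n)%N -> `|ex i n| <= C3 * g r.

(** Otherwise the weighted partial sums would grow at least linearly. *)
Lemma small_rate (e : R) : 0 < e -> exists2 r, (1 <= r)%N & g r <= e.
Proof.
move=> e0; apply: contrapT => h.
have ge r : (1 <= r)%N -> e <= g r.
  by move=> r1; rewrite leNgt; apply/negP => gr; apply: h; exists r => //; exact: ltW.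
have [k kS] : exists k : nat, S < e * k%:R.
  exists (Num.bound (S / e)); rewrite mulrC -ltr_pdivrMr//.
  by apply: archi_boundP; apply: divr_ge0; [have := gS 0; rewrite big_geq|exact: ltW].
have := gS k.+1; rewrite leNgt => /negP; apply; apply: (lt_le_trans kS).
rewrite mulr_natr -[X in _ *+ X](subn1 k.+1).
rewrite -sumr_const_nat; apply: ler_sum_nat => i /andP[i1 _].
by apply: (le_trans (ge i i1)); apply: ler_peMl; [exact: g_ge0|rewrite ler1n].
Qed.

Let rate_bound := C0 + C0 + C0 + (C1 + C2 + C3).
(** The mixing estimates with parameter [r] need a gap [3 r], so a gap [k] allows [r = k %/ 3];
    below 3 only the uniform bound is available. *)
Definition decay k : R := rate_bound * (if (k < 3)%N then 1 else g (k %/ 3)).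

Let C00 : 0 <= C0 -> 0 <= rate_bound.
Proof. by move=> ?; rewrite !addr_ge0. Qed.

Lemma rate_cases k (x : R) : 0 <= C0 -> `|x| <= C0 + C0 + C0 ->
  ((3 <= k)%N -> `|x| <= (C1 + C2 + C3) * g (k %/ 3)) -> `|x| <= decay k.
Proof.
move=> c0 x0 xk; rewrite /decay; case: ltnP => k3.
  by rewrite mulr1; apply: (le_trans x0); rewrite lerDl !addr_ge0.
have k1 : (1 <= k %/ 3)%N by rewrite divn_gt0.
by apply: (le_trans (xk k3)); apply: ler_wpM2r; [exact: g_ge0|rewrite lerDr !addr_ge0].
Qed.

Lemma decay_ge0 k : 0 <= C0 -> 0 <= decay k.
Proof.
move=> c0; apply: mulr_ge0; first exact: C00.
by case: ltnP => // k3; apply: g_ge0; rewrite divn_gt0.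
Qed.

(** Blocks of three: the indices with [k %/ 3 = r >= 1] carry total weight [9 r + 6 <= 15 r], the
    initial block 1 + 2 + 3 = 6. *)
Lemma decay_sum : 0 <= C0 -> exists S', forall n, \sum_(0 <= k < n) k.+1%:R * decay k <= S'.
Proof.
move=> c0; have rb := C00 c0.
exists (rate_bound * (6 + 15 * S)) => n.
have S0 : 0 <= S by have := gS 0; rewrite big_geq.
have d0 k : 0 <= k.+1%:R * decay k by apply: mulr_ge0 => //; exact: decay_ge0.
apply: (@le_trans _ _ (\sum_(0 <= k < n.+1 * 3) k.+1%:R * decay k)).
  rewrite [leRHS](big_cat_nat (n := n))//=; last by rewrite (leq_trans (leqnSn n))// leq_pmulr.
  by rewrite lerDl; apply: sumr_ge0.
apply: (@le_trans _ _ (rate_bound * (6 + 15 * \sum_(1 <= k < n.+1) k%:R * g k))); last first.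
  by rewrite ler_wpM2l// lerD2l ler_wpM2l.
elim: n => [|n IH].
  rewrite mul1n [in leLHS]big_ltn// [in leLHS]big_ltn// [in leLHS]big_ltn// !big_geq//.
  rewrite /decay /= !mulr1 mulr0.
  by rewrite le_eqVlt; apply/orP; left; apply/eqP; ring.
rewrite (_ : (n.+2 * 3)%N = (n.+1 * 3).+3); last by lia.
rewrite (big_nat_recr (n.+1 * 3).+2)//= (big_nat_recr (n.+1 * 3).+1)//= (big_nat_recr (n.+1 * 3))//=.
rewrite [in leRHS]big_nat_recr//=.
have dE a : (a < 3)%N -> decay (n.+1 * 3 + a) = rate_bound * g n.+1.
  move=> a3; rewrite /decay ltnNge (leq_trans _ (leq_addr _ _)) ?leq_pmull//=.
  by rewrite divnMDl// divn_small// addn0.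
have := dE 0%N isT; have := dE 1%N isT; have := dE 2%N isT.
rewrite addn0 addn1 addn2 => -> -> ->.
apply: (@le_trans _ _ (rate_bound * (6 + 15 * \sum_(1 <= k < n.+1) k%:R * g k) +
   (n.+1 * 3).+1%:R * (rate_bound * g n.+1) + (n.+1 * 3).+2%:R * (rate_bound * g n.+1) +
   (n.+1 * 3).+3%:R * (rate_bound * g n.+1))).
  by rewrite !lerD2r.
have g0 : 0 <= rate_bound * g n.+1 by apply: mulr_ge0 => //; exact: g_ge0.
have n0 : 0 <= n%:R :> R by [].
rewrite (_ : (n.+1 * 3).+1%:R = 3 * n%:R + 4 :> R); last first.
  rewrite (_ : (n.+1 * 3).+1 = (3 * n + 4)%N); last by lia.
  by rewrite natrD natrM.
rewrite (_ : (n.+1 * 3).+2%:R = 3 * n%:R + 5 :> R); last first.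
  rewrite (_ : (n.+1 * 3).+2 = (3 * n + 5)%N); last by lia.
  by rewrite natrD natrM.
rewrite (_ : (n.+1 * 3).+3%:R = 3 * n%:R + 6 :> R); last first.
  rewrite (_ : (n.+1 * 3).+3 = (3 * n + 6)%N); last by lia.
  by rewrite natrD natrM.
rewrite -(natr1 n).
rewrite -subr_ge0 (_ : _ - _ = (6 * n%:R) * (rate_bound * g n.+1)); last by ring.
by apply: mulr_ge0 => //; apply: mulr_ge0.
Qed.

Let g_sum r : (1 <= r)%N -> [/\ C1 * g r <= (C1 + C2 + C3) * g r,
  C2 * g r <= (C1 + C2 + C3) * g r & C3 * g r <= (C1 + C2 + C3) * g r].
Proof.
move=> r1; have g0 := g_ge0 r1.
by split; apply: ler_wpM2r => //; [rewrite -addrA lerDl addr_ge0|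
  rewrite [C1 + _]addrC -addrA lerDl addr_ge0|rewrite lerDr addr_ge0].
Qed.

Lemma cov_decay (i j : slot_ix) n m : (j.+1 * m <= i.+1 * n)%N ->
  `|c i j n m| <= decay (minn n (i.+1 * n - j.+1 * m)).
Proof.
move=> nm; have c0 : 0 <= C0 by exact: le_trans (C0b i j 0 0).
apply: rate_cases => //; first by apply: (le_trans (C0b _ _ _ _)); rewrite -addrA lerDl addr_ge0.
set k := minn _ _ => k3.
have k1 : (1 <= k %/ 3)%N by rewrite divn_gt0.
have k2 : (3 * (k %/ 3) <= k)%N by rewrite mulnC leq_trunc_div.
have [h _ _] := g_sum k1; apply: le_trans h; apply: cmix => //.
  by rewrite (leq_trans k2)// geq_minl.
have := geq_minr n (i.+1 * n - j.+1 * m); rewrite -/k.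
move: nm k2; set a := (j.+1 * m)%N; set a' := (i.+1 * n)%N; lia.
Qed.

Lemma ex_decay (i : slot_ix) n : `|ex i n| <= decay n.
Proof.
have c0 : 0 <= C0 by exact: le_trans (ex0b i 0).
apply: rate_cases => //; first by apply: (le_trans (ex0b _ _)); rewrite -addrA lerDl addr_ge0.
move=> k3; have k1 : (1 <= n %/ 3)%N by rewrite divn_gt0.
have [_ _ h] := g_sum k1; apply: le_trans h; apply: exmix => //.
by rewrite mulnC leq_trunc_div.
Qed.

(* [rho] is the limit of the covariances along a diagonal, whence it inherits their bounds. *)
Lemma rho_close (i : slot_ix) m k (e : R) : 0 < e -> exists t0, forall t, (t0 <= t)%N ->
  `|c i i (m + k + t) (m + t) - rho i (m + k) m| <= e.
Proof.
move=> e0; have C2' : 0 < C2 + 1 by apply: ltr_wpDl.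
have [r r1 gr] := small_rate (divr_gt0 e0 C2').
exists (3 * r + ell * k)%N => t ht; rewrite -(rho_shift i _ _ t).
have h : `|c i i (m + k + t) (m + t) - rho i (m + k + t) (m + t)| <= C2 * g r.
  apply: crho => //.
    by rewrite (_ : (m + k + t - (m + t))%N = k); lia.
  by rewrite (_ : (m + t - (m + k + t))%N = 0%N); lia.
apply: (le_trans h); apply: (@le_trans _ _ ((C2 + 1) * g r)).
  by apply: ler_wpM2r; [exact: g_ge0|rewrite lerDl].
by rewrite mulrC -ler_pdivlMr.
Qed.

Lemma rho_le (i : slot_ix) m k (x : R) : (exists t0, forall t, (t0 <= t)%N ->
  `|c i i (m + k + t) (m + t)| <= x) -> `|rho i (m + k) m| <= x.
Proof.
move=> [t0 ht0]; apply/ler_addgt0Pr => e e0.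
have [t1 ht1] := rho_close i m k e0.
have h0 := ht0 _ (leq_maxl t0 t1); have h1 := ht1 _ (leq_maxr t0 t1).
rewrite distrC in h1.
by apply: le_trans (lerD h0 h1); rewrite addrC -{1}(subrK (c i i (m + k + maxn t0 t1) (m + maxn t0 t1))
  (rho i (m + k) m)); exact: ler_normD.
Qed.

Lemma rho_bound (i : slot_ix) m k : `|rho i (m + k) m| <= C0.
Proof. by apply: rho_le; exists 0%N => t _; exact: C0b. Qed.

Lemma rho_decay (i : slot_ix) m k : `|rho i (m + k) m| <= decay k.
Proof.
have c0 : 0 <= C0 by exact: le_trans (C0b i i 0 0).
apply: rate_cases => //; first by apply: (le_trans (rho_bound _ _ _)); rewrite -addrA lerDl addr_ge0.
move=> k3; have k1 : (1 <= k %/ 3)%N by rewrite divn_gt0.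
have k2 : (3 * (k %/ 3) <= k)%N by rewrite mulnC leq_trunc_div.
apply: rho_le; exists 0%N => t _.
have [h _ _] := g_sum k1; apply: le_trans h; apply: cmix => //.
  lia.
rewrite [(m + k + t)%N]addnAC [leqRHS]mulnDr leq_add2l; apply: leq_trans k2 _.
by rewrite leq_pmull. 
Qed.

Lemma cov_rho_decay (i : slot_ix) m k : (ell * k <= m)%N ->
  `|c i i (m + k) m - rho i (m + k) m| <= decay (m - ell * k).
Proof.
move=> km; have c0 : 0 <= C0 by exact: le_trans (C0b i i 0 0).
apply: rate_cases => //.
  apply: (le_trans (ler_normB _ _)); apply: (@le_trans _ _ (C0 + C0)); last by rewrite lerDl.
  by apply: lerD => //; exact: rho_bound.
set l := (m - _)%N => l3; have l1 : (1 <= l %/ 3)%N by rewrite divn_gt0.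
have l2 : (3 * (l %/ 3) <= l)%N by rewrite mulnC leq_trunc_div.
have [_ h _] := g_sum l1; apply: le_trans h; apply: crho => //.
  by rewrite addKn; lia.
rewrite (_ : (m - (m + k))%N = 0%N); lia.
Qed.

End rates_of_decay.

(** * Counting index pairs with a given gap *)

Section counting.
Context (R : realType) (h : nat -> R) (S : R).
Hypothesis h_ge0 : forall k, 0 <= h k.
Hypothesis hS : forall n, \sum_(0 <= k < n) k.+1%:R * h k <= S.

Lemma counting_bound (I : eqType) (r : seq I) (Q : pred I) (phi psi : I -> nat) W : uniq r ->
  (forall x, x \in r -> Q x -> (psi x <= W * phi x)%N) ->
  (forall x y, x \in r -> y \in r -> Q x -> Q y -> phi x = phi y -> psi x = psi y -> x = y) ->
  \sum_(x <- r | Q x) h (phi x) <= W.+1%:R * S.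
Proof.
move=> ur hW hinj; rewrite -big_filter.
set r' := [seq x <- r | Q x]; have ur' : uniq r' by exact: filter_uniq.
pose M := (\max_(x <- r') phi x).+1.
have phiM x : x \in r' -> (phi x < M)%N.
  by move=> xr; rewrite ltnS; exact: leq_bigmax_seq.
rewrite big_seq (eq_bigr (fun x => \sum_(0 <= k < M) (phi x == k)%:R * h k)); last first.
  move=> x /phiM xM; rewrite (bigD1_seq (phi x)) ?iota_uniq ?mem_index_iota//=.
  rewrite eqxx mul1r big1 ?addr0// => k kn.
  by rewrite eq_sym (negbTE kn) mul0r.
rewrite -big_seq exchange_big/=.
apply: (@le_trans _ _ (\sum_(0 <= k < M) W.+1%:R * (k.+1%:R * h k))); last first.
  by rewrite -mulr_sumr ler_wpM2l.
apply: ler_sum => k _; rewrite -mulr_suml mulrA; apply: ler_wpM2r => //.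
have -> : \sum_(i <- r') (phi i == k)%:R = (count (fun i => phi i == k) r')%:R :> R.
  by rewrite -sum1_count natr_sum [RHS]big_mkcond; apply: eq_bigr => i _; case: eqP.
rewrite -natrM ler_nat.
rewrite -size_filter -(size_map psi).
apply: (@leq_trans (size (iota 0 (W * k).+1))); last first.
  by rewrite size_iota; nia.
apply: uniq_leq_size.
  rewrite map_inj_in_uniq ?filter_uniq// => x y.
  rewrite !mem_filter => /andP[/eqP px /andP[qx xr]] /andP[/eqP py /andP[qy yr]].
  by apply: hinj => //; rewrite px py.
move=> l /mapP[x]; rewrite !mem_filter => /andP[/eqP px /andP[qx xr]] ->.
by rewrite mem_iota /= add0n ltnS -px hW.
Qed.

Lemma counting2 N (Q : nat -> nat -> bool) (phi psi : nat -> nat -> nat) W :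
  (forall n m, (1 <= n <= N)%N -> (1 <= m <= N)%N -> Q n m -> (psi n m <= W * phi n m)%N) ->
  (forall n m n' m', (1 <= n <= N)%N -> (1 <= m <= N)%N -> (1 <= n' <= N)%N -> (1 <= m' <= N)%N ->
    Q n m -> Q n' m' -> phi n m = phi n' m' -> psi n m = psi n' m' -> n = n' /\ m = m') ->
  \sum_(1 <= n < N.+1) \sum_(1 <= m < N.+1 | Q n m) h (phi n m) <= W.+1%:R * S.
Proof.
move=> hW hinj.
pose r := [seq (n, m) | n <- index_iota 1 N.+1, m <- index_iota 1 N.+1].
have rP x : x \in r -> (1 <= x.1 <= N)%N /\ (1 <= x.2 <= N)%N.
  by case/allpairsP => -[n m] /= [+ + ->]; rewrite !mem_index_iota !ltnS.
apply: le_trans (@counting_bound _ r (fun x => Q x.1 x.2) (fun x => phi x.1 x.2)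
  (fun x => psi x.1 x.2) W _ _ _).
- rewrite le_eqVlt; apply/orP; left; apply/eqP.
  rewrite [RHS]big_mkcond /r big_allpairs; apply: eq_bigr => n _.
  by rewrite [LHS]big_mkcond/=.
- by apply: allpairs_uniq => //; try exact: iota_uniq; move=> [? ?] [? ?].
- by move=> x /rP[]; exact: hW.
- move=> [n m] [n' m'] /rP[/= a1 a2] /rP[/= b1 b2] q q' e1 e2.
  by have [-> ->] := hinj n m n' m' a1 a2 b1 b2 q q' e1 e2.
Qed.

End counting.

(** * Sublinear sequences and sums over lattice points *)

Section sublinear.
Context (R : realType).
Implicit Types x y : nat -> R.

Definition sublinear x := forall e : R, 0 < e -> exists C : R, forall N, `|x N| <= e * N%:R + C.

Lemma sublinear_bounded x C : (forall N, `|x N| <= C) -> sublinear x.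
Proof.
move=> xC e e0; exists C => N; apply: (le_trans (xC N)).
by rewrite lerDr mulr_ge0// ltW.
Qed.

Lemma sublinearD x y : sublinear x -> sublinear y -> sublinear (fun N => x N + y N).
Proof.
move=> hx hy e e0; have e20 : 0 < e / 2 by rewrite divr_gt0.
have [C hC] := hx _ e20; have [C' hC'] := hy _ e20.
exists (C + C') => N; apply: (le_trans (ler_normD _ _)).
apply: (le_trans (lerD (hC N) (hC' N))).
by rewrite le_eqVlt; apply/orP; left; apply/eqP; field.
Qed.

Lemma sublinear_ext x y : (forall N, x N = y N) -> sublinear x -> sublinear y.
Proof. by move=> xy hx e e0; have [C hC] := hx e e0; exists C => N; rewrite -xy. Qed.

Lemma sublinear_sum (I : Type) (s : seq I) (f : I -> nat -> R) :
  (forall i, sublinear (f i)) -> sublinear (fun N => \sum_(i <- s) f i N).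
Proof.
move=> hf; elim: s => [|i s IH].
  by apply: (@sublinear_bounded _ 0) => N; rewrite big_nil normr0.
apply: (@sublinear_ext (fun N => f i N + \sum_(j <- s) f j N)); last exact: sublinearD.
by move=> N; rewrite big_cons.
Qed.

Lemma sublinear_mean x : sublinear x -> (fun N => N%:R^-1 * x N) @ \oo --> 0.
Proof.
move=> hx; apply/cvgrPdist_le => e e0.
have e20 : 0 < e / 2 by rewrite divr_gt0.
have [C hC] := hx _ e20.
near=> N.
have N0 : (0 : R) < N%:R by rewrite ltr0n; near: N; exists 1%N.
rewrite sub0r normrN normrM ger0_norm ?invr_ge0 ?ler0n// mulrC ler_pdivrMr//.
apply: (le_trans (hC N)).
have : C <= e / 2 * N%:R.
  rewrite mulrC -ler_pdivrMr//; apply: le_trans (ler_norm _) _.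
  near: N; exists (Num.bound (`|C / (e / 2)|)).+1 => // n /= hn.
  apply: ltW; apply: (@lt_trans _ _ (Num.bound (`|C / (e / 2)|))%:R); last by rewrite ltr_nat.
  exact: archi_boundP.
move=> hN; apply: (le_trans (lerD (lexx _) hN)).
by rewrite le_eqVlt; apply/orP; left; apply/eqP; field.
Unshelve. all: by end_near. Qed.

Lemma sublinear_slope x L : sublinear (fun N => x N - N%:R * L) ->
  (fun N => N%:R^-1 * x N) @ \oo --> L.
Proof.
move=> /sublinear_mean/(cvgD (cvg_cst L)); rewrite addr0.
apply: cvg_trans; apply: near_eq_cvg; exists 1%N => // N /= N1.
rewrite [LHS]/(_ + _ * _) mulrBr mulrA mulVf ?mul1r ?pnatr_eq0 -?lt0n//.
exact: subrKC.
Qed.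

Lemma sublinear_cvg_sum x (l : R) : x @ \oo --> l ->
  sublinear (fun N => \sum_(0 <= n < N) x n - N%:R * l).
Proof.
move=> xl e e0; have /cvgrPdist_le /(_ e e0)[n0 _ hn0] := xl.
exists (\sum_(0 <= n < n0) `|x n - l|) => N.
have -> : \sum_(0 <= n < N) x n - N%:R * l = \sum_(0 <= n < N) (x n - l).
  by rewrite sumrB sumr_const_nat subn0 mulr_natl.
apply: (le_trans (ler_norm_sum _ _ _)).
elim: N => [|N IH].
  by rewrite big_geq// mulr0 add0r; apply: sumr_ge0 => n _; exact: normr_ge0.
rewrite big_nat_recr//=; have [nN|Nn] := leqP n0 N.
  have h := hn0 N nN; rewrite distrC in h.
  by apply: (le_trans (lerD IH h)); rewrite -(natr1 N) mulrDr mulr1 addrAC.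
rewrite -(@big_nat_recr _ _ _ N 0 (fun n => `|x n - l|))//=.
rewrite -[leLHS]add0r; apply: lerD; first by rewrite mulr_ge0// ltW.
by rewrite [leRHS](big_cat_nat (n := N.+1))//= lerDl sumr_ge0.
Qed.

Lemma convergent_bounded x (l : R) : x @ \oo --> l -> exists C : R, forall n, `|x n| <= C.
Proof.
move=> xl; have /cvgrPdist_le /(_ 1 ltr01)[n0 _ hn0] := xl.
exists (\sum_(0 <= n < n0) `|x n| + (1 + `|l|)) => n; have [nn|nn] := leqP n0 n.
  apply: (@le_trans _ _ (1 + `|l|)); last by rewrite lerDr sumr_ge0.
  have h := hn0 n nn; rewrite distrC in h.
  by rewrite -(subrK l (x n)) (le_trans (ler_normD _ _))// lerD2r.
rewrite (bigD1_seq n) ?iota_uniq ?mem_index_iota//= -addrA lerDl.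
by rewrite addr_ge0// ?sumr_ge0// addr_ge0.
Qed.

Lemma real_cauchy x : (forall e : R, 0 < e -> exists n0, forall n m, (n0 <= n)%N ->
  (n0 <= m)%N -> `|x n - x m| <= e) -> exists l : R, x @ \oo --> l.
Proof.
move=> hx; apply/cvg_ex/cauchy_cvgP/cauchy_exP => e e0.
have [n0 h] := hx (e / 2) (divr_gt0 e0 (ltr0Sn R 1)).
exists (x n0); exists n0 => // n nn /=.
apply: (le_lt_trans (h n0 n (leqnn _) nn)).
by rewrite ltr_pdivrMr// mulr2n mulrDr mulr1 ltrDl.
Qed.

Lemma cvg_rsum (I : Type) (s : seq I) (Q : pred I) (f : I -> nat -> R) (l : I -> R) :
  (forall i, Q i -> f i @ \oo --> l i) ->
  (fun n => \sum_(i <- s | Q i) f i n) @ \oo --> \sum_(i <- s | Q i) l i.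
Proof.
move=> hf; elim: s => [|i s IH].
  rewrite big_nil (_ : (fun n => _) = fun=> 0); first exact: cvg_cst.
  by apply/funext => n; rewrite big_nil.
rewrite big_cons; case: ifP => Qi; last first.
  by rewrite (_ : (fun n => _) = fun n => \sum_(j <- s | Q j) f j n)//;
    apply/funext => n; rewrite big_cons Qi.
rewrite (_ : (fun n => _) = fun n => f i n + \sum_(j <- s | Q j) f j n); last first.
  by apply/funext => n; rewrite big_cons Qi.
by apply: cvgD => //; exact: hf.
Qed.

(** The sums over complete blocks of [j + 1] consecutive indices converge, hence have a Cesaro mean;
    an incomplete last block contributes a bounded error. *)
Lemma sublinear_residues x j : (forall n0, cvgn (fun t => x (n0 + j.+1 * t)%N)) ->
  exists L : R, sublinear (fun N => \sum_(0 <= n < N) x n - N%:R * L).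
Proof.
move=> hx; pose y t := \sum_(0 <= n0 < j.+1) x (n0 + j.+1 * t)%N.
have [Y yY] : exists Y : R, y @ \oo --> Y.
  exists (\sum_(0 <= n0 < j.+1) limn (fun t => x (n0 + j.+1 * t)%N)).
  by apply: cvg_rsum => n0 _; exact: hx.
have /choice[B hB] (n0 : nat) : exists B : R, forall t, `|x (n0 + j.+1 * t)%N| <= B.
  exact: convergent_bounded (hx n0).
pose L := Y / j.+1%:R; exists L.
have blk T : \sum_(0 <= n < j.+1 * T) x n = \sum_(0 <= t < T) y t.
  elim: T => [|T IH]; first by rewrite muln0 !big_geq.
  rewrite [RHS]big_nat_recr//= -IH mulnS addnC (big_cat_nat (n := (j.+1 * T)%N))//= ?leq_addr//.
  congr (_ + _); rewrite -{1}[(j.+1 * T)%N]add0n big_addn addKn.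
  by apply: eq_bigr => n0 _.
have h1 := sublinear_cvg_sum yY.
have Bx n : `|x n| <= \sum_(0 <= n0 < j.+1) `|B n0|.
  have nj : (n %% j.+1 < j.+1)%N by rewrite ltn_mod.
  rewrite (bigD1_seq (n %% j.+1)%N) ?iota_uniq ?mem_index_iota//=.
  rewrite {1}(divn_eq n j.+1) addnC [(_ %/ _ * _)%N]mulnC.
  apply: (le_trans (hB _ _)); apply: (le_trans (ler_norm _)).
  by rewrite lerDl sumr_ge0.
set BB := \sum_(0 <= n0 < j.+1) `|B n0| in Bx.
move=> e e0; have [C hC] := h1 e e0.
exists (C + (j.+1%:R * (BB + `|L|))) => N.
pose T := (N %/ j.+1)%N.
have TN : (j.+1 * T <= N)%N by rewrite mulnC leq_trunc_div.
have -> : \sum_(0 <= n < N) x n - N%:R * L = (\sum_(0 <= t < T) y t - T%:R * Y) +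
    \sum_(j.+1 * T <= n < N) (x n - L).
  rewrite (big_cat_nat (n := (j.+1 * T)%N))//= blk sumrB sumr_const_nat.
  rewrite -[L *+ _]mulr_natl natrB// mulrBl natrM /L.
  have j0 : j.+1%:R != 0 :> R by rewrite pnatr_eq0.
  rewrite (_ : j.+1%:R * T%:R * (Y / j.+1%:R) = T%:R * Y); last by field.
  ring.
apply: (le_trans (ler_normD _ _)); rewrite addrA; apply: lerD.
  apply: (le_trans (hC T)); rewrite lerD2r ler_wpM2l ?(ltW e0)// ler_nat.
  exact: leq_div.
apply: (le_trans (ler_norm_sum _ _ _)).
apply: (@le_trans _ _ (\sum_(j.+1 * T <= n < N) (BB + `|L|))).
  by apply: ler_sum => n _; apply: (le_trans (ler_normB _ _)); rewrite lerD2r.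
have BL0 : 0 <= BB + `|L| by rewrite addr_ge0// (le_trans _ (Bx 0%N)).
rewrite sumr_const_nat -[leLHS]mulr_natl ler_wpM2r// ler_nat leq_subLR.
by rewrite {1}(divn_eq N j.+1) mulnC leq_add2l ltnW// ltn_mod.
Qed.

(** Slopes that are correct up to [e] and [e'] differ by at most [e + e'], as large [N] shows; they
    form a Cauchy sequence whose limit is an exact slope. *)
Lemma sublinear_approx x : (forall e : R, 0 < e -> exists L C : R, forall N,
    `|x N - N%:R * L| <= e * N%:R + C) ->
  exists L : R, sublinear (fun N => x N - N%:R * L).
Proof.
move=> hx.
have e_gt0 k : 0 < k.+1%:R^-1 :> R by rewrite invr_gt0.
have /choice[L /choice[C hC]] (k : nat) := hx _ (e_gt0 k).
have LL k l : `|L k - L l| <= k.+1%:R^-1 + l.+1%:R^-1.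
  set a : R := leRHS; rewrite leNgt; apply/negP => ha.
  pose D := `|L k - L l| - a; have D0 : 0 < D by rewrite subr_gt0.
  have c0 m : 0 <= C m by have := hC m 0%N; rewrite mulr0 add0r; exact: le_trans.
  have CD0 : 0 <= (C k + C l) / D by apply: divr_ge0; [exact: addr_ge0|exact: ltW].
  have hN := archi_boundP CD0; set N := Num.bound _ in hN.
  rewrite ltr_pdivrMr// in hN.
  have : N%:R * `|L k - L l| <= N%:R * a + (C k + C l).
    rewrite -[X in X * _](ger0_norm (ler0n R N)) -normrM.
    rewrite (_ : N%:R * (L k - L l) = (x N - N%:R * L l) - (x N - N%:R * L k)); last by ring.
    apply: (le_trans (ler_normB _ _)); apply: (le_trans (lerD (hC l N) (hC k N))).
    by rewrite le_eqVlt; apply/orP; left; apply/eqP; rewrite /a; ring.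
  by rewrite -lerBlDl -mulrBr -/D => /(lt_le_trans hN); rewrite ltxx.
have inv_small (e : R) : 0 < e -> exists n0, forall k, (n0 <= k)%N -> k.+1%:R^-1 <= e.
  move=> e0; have e0' : 0 <= e^-1 by rewrite invr_ge0 ltW.
  exists (Num.bound e^-1) => k hk; rewrite -[leRHS]invrK lef_pV2 ?posrE ?invr_gt0//.
  apply: (le_trans (ltW (archi_boundP e0'))); by rewrite ler_nat ltnW// ltnS.
have [l Ll] : exists l : R, L @ \oo --> l.
  apply: real_cauchy => e e0; have e20 : 0 < e / 2 by rewrite divr_gt0.
  have [n0 hn0] := inv_small _ e20; exists n0 => k m kn mn.
  apply: (le_trans (LL k m)); apply: (le_trans (lerD (hn0 k kn) (hn0 m mn))).
  by rewrite le_eqVlt; apply/orP; left; apply/eqP; field.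
exists l => e e0; have e20 : 0 < e / 2 by rewrite divr_gt0.
have [n0 hn0] := inv_small _ e20.
have /cvgrPdist_le /(_ _ e20)[n1 _ hn1] := Ll.
pose k := maxn n0 n1.
have h0 := hn0 k (leq_maxl _ _); have h1 := hn1 k (leq_maxr _ _).
exists (C k) => N.
rewrite (_ : _ - _ = (x N - N%:R * L k) - N%:R * (l - L k)); last by ring.
apply: (le_trans (ler_normB _ _)).
have h2 : `|N%:R * (l - L k)| <= e / 2 * N%:R.
  by rewrite normrM (ger0_norm (ler0n R N)) mulrC ler_wpM2r.
apply: (le_trans (lerD (hC k N) h2)).
have h3 : k.+1%:R^-1 * N%:R <= e / 2 * N%:R by rewrite ler_wpM2r.
rewrite addrAC lerD2r; apply: (le_trans (lerD h3 (lexx _))).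
by rewrite le_eqVlt; apply/orP; left; apply/eqP; field.
Qed.

End sublinear.

(** * Variances of sums of a stationary sequence *)

Section stationary_sums.
Context (R : realType) (h : nat -> R) (S : R).
Hypothesis h_ge0 : forall k, 0 <= h k.
Hypothesis hS : forall n, \sum_(0 <= k < n) k.+1%:R * h k <= S.

(** The indices are distinct and at least [k], so each is weighted by at least [k + 1] in the sum
    bounded by [S]. *)
Lemma tail_sum (I : eqType) (s : seq I) (Q : pred I) (phi : I -> nat) k : uniq s ->
  (forall x, x \in s -> Q x -> (k <= phi x)%N) ->
  (forall x y, x \in s -> y \in s -> Q x -> Q y -> phi x = phi y -> x = y) ->
  \sum_(x <- s | Q x) h (phi x) <= S / k.+1%:R.
Proof.
move=> us kphi inj_phi; rewrite -big_filter -(big_map phi xpredT h).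
set r := [seq phi x | x <- _].
have ur : uniq r.
  rewrite map_inj_in_uniq ?filter_uniq// => x y.
  by rewrite !mem_filter => /andP[qx xs] /andP[qy ys]; exact: inj_phi.
have rk x : x \in r -> (k <= x)%N.
  by case/mapP => y; rewrite mem_filter => /andP[qy ys] ->; exact: kphi.
pose M := (\max_(x <- r) x).+1.
have pr : perm_eq r [seq x <- iota 0 M | x \in r].
  apply: uniq_perm; rewrite ?filter_uniq ?iota_uniq// => x.
  rewrite mem_filter mem_iota /= add0n; case xr: (x \in r) => //=.
  by rewrite ltnS; apply/esym; exact: (@leq_bigmax_seq _ _ _ id).
rewrite ler_pdivlMr// mulrC; apply: le_trans (hS M).
have -> : \sum_(i <- r) h i = \sum_(i <- [seq x <- iota 0 M | x \in r]) h i.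
  exact: perm_big.
rewrite big_filter big_mkcond mulr_sumr /index_iota subn0.
apply: ler_sum => x _; case: ifP => [/rk kx|_]; first by rewrite ler_wpM2r// ler_nat.
by rewrite mulr0 mulr_ge0.
Qed.

Lemma partial_le n : \sum_(1 <= k < n) h k <= S.
Proof.
have := @tail_sum nat (index_iota 1 n) xpredT id 0 (iota_uniq _ _) _ _.
by rewrite divr1; apply.
Qed.

Variable r : nat -> R.
Hypothesis rh : forall k, `|r k| <= h k.

Definition adist (n m : nat) : nat := (n - m + (m - n))%N.

(** Second moment of the sum of [N] terms of a sequence with stationary second moments [r]. *)
Definition toeplitz N := \sum_(1 <= n < N.+1) \sum_(1 <= m < N.+1) r (adist n m).

Definition toeplitz_incr k := r 0 + 2 * \sum_(1 <= l < k.+1) r l.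

Lemma toeplitz_step N : toeplitz N.+1 = toeplitz N + toeplitz_incr N.
Proof.
have E : \sum_(1 <= n < N.+1) r (adist n N.+1) = \sum_(1 <= l < N.+1) r l.
  rewrite [RHS]big_nat_rev; apply: eq_big_nat => n /andP[n1 nN].
  by congr r; rewrite /adist; lia.
have E' : \sum_(1 <= n < N.+1) r (adist N.+1 n) = \sum_(1 <= l < N.+1) r l.
  by rewrite -E; apply: eq_bigr => n _; rewrite /adist addnC.
rewrite /toeplitz big_nat_recr//= [X in _ + X]big_nat_recr//= E'.
rewrite (eq_bigr (fun n => \sum_(1 <= m < N.+1) r (adist n m) + r (adist n N.+1))); last first.
  by move=> n _; rewrite big_nat_recr.
rewrite big_split/= E /toeplitz_incr /adist subnn addn0 mulr2n mulrDl mul1r.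
by rewrite -!addrA; congr (_ + _); rewrite [RHS]addrC -addrA.
Qed.

Lemma toeplitzE N : toeplitz N = \sum_(0 <= k < N) toeplitz_incr k.
Proof.
elim: N => [|N IH]; first by rewrite /toeplitz !big_geq.
by rewrite toeplitz_step big_nat_recr//= IH.
Qed.

Lemma toeplitz_incr_dist k n : (k <= n)%N ->
  `|toeplitz_incr k - toeplitz_incr n| <= 2 * \sum_(k.+1 <= l < n.+1) h l.
Proof.
move=> kn; rewrite /toeplitz_incr (big_cat_nat (n := k.+1) _ (p := n.+1))//=.
set a := \sum_(1 <= l < k.+1) _; set b := \sum_(k.+1 <= l < n.+1) r l.
rewrite (_ : _ - _ = - (2 * b)); last by ring.
rewrite normrN normrM ger0_norm// ler_wpM2l//.
by apply: (le_trans (ler_norm_sum _ _ _)); exact: ler_sum.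
Qed.

(** The increments tend to [s] with error at most twice a tail of [h], and these tails are summable
    because [l h(l)] is. Convergence, beyond boundedness, is what recentring the partial sums will
    use. *)
Lemma toeplitz_cvg : exists s d : R, (fun N => toeplitz N - N%:R * s) @ \oo --> d.
Proof.
have S0 : 0 <= S by have := hS 0; rewrite big_geq.
have tl k n : \sum_(k.+1 <= l < n.+1) h l <= S / k.+2%:R.
  by apply: (@tail_sum nat (index_iota k.+1 n.+1) xpredT id k.+1 (iota_uniq _ _)) => // x;
    rewrite mem_index_iota => /andP[].
have [s us] : exists s : R, toeplitz_incr @ \oo --> s.
  apply: real_cauchy => e e0.
  have b0 : 0 <= 2 * S / e by apply: divr_ge0; [exact: mulr_ge0|exact: ltW].
  have sm k n : (Num.bound (2 * S / e) <= k)%N -> (k <= n)%N ->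
      `|toeplitz_incr k - toeplitz_incr n| <= e.
    move=> hk kn; apply: (le_trans (toeplitz_incr_dist kn)).
    apply: (@le_trans _ _ (2 * (S / k.+2%:R))); first by rewrite ler_wpM2l.
    rewrite mulrA ler_pdivrMr// [leRHS]mulrC -ler_pdivrMr//.
    apply: (le_trans (ltW (archi_boundP b0))); rewrite ler_nat.
    by apply: (leq_trans hk); rewrite -addn2 leq_addr.
  exists (Num.bound (2 * S / e)) => n m nn mm; have [nm|/ltnW mn] := leqP n m; first exact: sm.
  by rewrite distrC; exact: sm.
exists s.
pose H n := \sum_(1 <= l < n.+1) h l.
have Hsplit k n : (k <= n)%N -> H n = H k + \sum_(k.+1 <= l < n.+1) h l.
  by move=> kn; rewrite /H [LHS](big_cat_nat (n := k.+1)).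
have [Hoo HH] : exists Hoo : R, H @ \oo --> Hoo.
  apply: real_cauchy => e e0.
  have b0 : 0 <= S / e by apply: divr_ge0 => //; exact: ltW.
  have sm k n : (Num.bound (S / e) <= k)%N -> (k <= n)%N -> `|H k - H n| <= e.
    move=> hk kn; rewrite /H (big_cat_nat (n := k.+1) _ (p := n.+1))//= opprD addrA subrr add0r normrN.
    rewrite ger0_norm ?sumr_ge0//; apply: (le_trans (tl _ _)).
    rewrite ler_pdivrMr// [leRHS]mulrC -ler_pdivrMr//.
    apply: (le_trans (ltW (archi_boundP b0))); rewrite ler_nat.
    by apply: (leq_trans hk); rewrite -addn2 leq_addr.
  exists (Num.bound (S / e)) => n m nn mm; have [nm|/ltnW mn] := leqP n m; first exact: sm.
  by rewrite distrC; exact: sm.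
have diff k : `|toeplitz_incr k - s| <= 2 * (Hoo - H k).
  apply/ler_addgt0Pr => e e0; have e30 : 0 < e / 3 by rewrite divr_gt0.
  have /cvgrPdist_le/(_ _ e30)[n1 _ h1] := us.
  have /cvgrPdist_le/(_ _ e30)[n2 _ h2] := HH.
  pose n := maxn k (maxn n1 n2).
  have kn : (k <= n)%N by exact: leq_maxl.
  have g1 := h1 n (leq_trans (leq_maxl _ _) (leq_maxr _ _)).
  have g2 := h2 n (leq_trans (leq_maxr _ _) (leq_maxr _ _)).
  have g3 : `|toeplitz_incr k - toeplitz_incr n| <= 2 * (H n - H k).
    have -> : H n - H k = \sum_(k.+1 <= l < n.+1) h l.
      by rewrite (Hsplit _ _ kn) addrC addKr.
    exact: toeplitz_incr_dist.
  have g4 : H n - Hoo <= e / 3 by rewrite distrC in g2; exact: le_trans (ler_norm _) g2.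
  rewrite distrC in g1.
  apply: (le_trans (ler_distD (toeplitz_incr n) _ _)).
  apply: (le_trans (lerD g3 g1)); move: g4; lra.
have Hle k : 0 <= Hoo - H k by have := le_trans (normr_ge0 _) (diff k); lra.
pose w k := 2 * (Hoo - H k).
have wsum N : \sum_(0 <= k < N) w k <= 4 * S + 2 * Hoo.
  (* Summation by parts: the sum of tails becomes a weighted sum of [h] plus a boundary term, each
     at most [S]. *)
  have abel : \sum_(0 <= k < N.+1) (Hoo - H k) = N.+1%:R * (Hoo - H N) + \sum_(0 <= l < N.+1) l%:R * h l.
    elim: N => [|N IH]; first by rewrite !big_nat1 mul1r mul0r addr0.
    have HS : H N.+1 = H N + h N.+1 by rewrite /H big_nat_recr.
    rewrite [LHS]big_nat_recr//= IH [in RHS]big_nat_recr//= HS -(natr1 N.+1); ring.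
  have HN : N.+1%:R * (Hoo - H N) <= S.
    rewrite mulrC -ler_pdivlMr// lerBlDl.
    have {1}<- : limn H = Hoo by exact: cvg_lim HH.
    apply: limr_le; first by apply/cvg_ex; exists Hoo.
    exists N => // n /= Nn; rewrite (Hsplit _ _ Nn) lerD2l.
    apply: (le_trans (tl _ _)); rewrite ler_wpM2l// lef_pV2 ?posrE// ler_nat.
    exact: leqnSn.
  have Hl : \sum_(0 <= l < N.+1) l%:R * h l <= S.
    by apply: le_trans (hS N.+1); apply: ler_sum => l _; rewrite ler_wpM2r// ler_nat.
  have H0 : 0 <= Hoo by have := Hle 0%N; rewrite /H big_geq// subr0.
  apply: (@le_trans _ _ (\sum_(0 <= k < N.+1) w k)).
    by rewrite [leRHS]big_nat_recr//= lerDl; apply: mulr_ge0.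
  rewrite -mulr_sumr abel; lra.
have cw : cvgn (series w).
  apply: nondecreasing_is_cvgn.
    apply/nondecreasing_seqP => n; rewrite !seriesEnat /= big_nat_recr//= lerDl.
    exact: mulr_ge0.
  by exists (4 * S + 2 * Hoo) => _ [n _ <-]; rewrite seriesEnat; exact: wsum.
have cu : cvgn (series (fun k => toeplitz_incr k - s)).
  apply: normed_cvg; apply: (series_le_cvg _ _ _ cw) => k /=; rewrite ?normr_ge0//.
  exact: mulr_ge0.
have /cvg_ex[d hd] := cu; exists d.
rewrite (_ : (fun N => _) = series (fun k => toeplitz_incr k - s))//.
apply/funext => N; rewrite seriesEnat /= toeplitzE sumrB sumr_const_nat subn0.
by rewrite mulr_natl.
Qed.

End stationary_sums.

Lemma leq_pmul2_cancel j m m' : (j.+1 * m = j.+1 * m')%N -> m = m'.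
Proof. by move/eqP; rewrite eqn_pmul2l// => /eqP. Qed.

Lemma subn_inj a x y : (x <= a)%N -> (y <= a)%N -> (a - x = a - y)%N -> x = y.
Proof. lia. Qed.

Lemma subn_injr a x y : (a <= x)%N -> (a <= y)%N -> (x - a = y - a)%N -> x = y.
Proof. lia. Qed.

Lemma diag_psi ell n m : (1 <= ell)%N -> (m <= n)%N -> (2 * ell * (n - m) <= m)%N ->
  (n - m <= 1 * (m - ell * (n - m)))%N.
Proof.
move=> l1 mn; set x := (n - m)%N => h.
have : (x <= ell * x)%N by rewrite leq_pmull.
rewrite -mulnA in h; move: h; set y := (ell * x)%N; lia.
Qed.

Lemma above_ray i j n m : (i < j)%N -> (n < m)%N ->
  (i.+1 * n <= j.+1 * m)%N /\ (n <= j.+1 * m - i.+1 * n)%N.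
Proof.
move=> ij nm.
have h1 : (i.+2 * m <= j.+1 * m)%N by rewrite leq_mul2r ltnS ij orbT.
have h2 : (i.+2 * n <= i.+2 * m)%N by rewrite leq_mul2l ltnW ?orbT.
have := leq_trans h2 h1; rewrite [(i.+2 * n)%N]mulSn.
by set a := (i.+1 * n)%N; set b := (j.+1 * m)%N; lia.
Qed.

Lemma near_range i j n W m X : (i < j)%N -> (i.+1 * n = W.+1 + j.+1 * X)%N ->
  forall w, (w <= W)%N -> (w <= n)%N ->
  (i.+1 * n <= j.+1 * m + w)%N -> (j.+1 * m <= i.+1 * n + w)%N ->
  [/\ 1 <= m, m <= n, X <= m & m < X + (W + w).+2]%N.
Proof.
move=> ij nX w wW wn h1 h2.
have Xm : (X < m)%N.
  rewrite -(@ltn_pmul2l j.+1)//; move: h1; rewrite nX.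
  by set a := (j.+1 * X)%N; set a' := (j.+1 * m)%N; lia.
split; [exact: leq_ltn_trans Xm| |exact: ltnW|].
  rewrite -(@leq_pmul2l j.+1)//; apply: (leq_trans h2).
  apply: (@leq_trans (i.+2 * n)%N); last by rewrite leq_mul2r ltnS ij orbT.
  by rewrite [leqRHS]mulSn addnC leq_add2r.
rewrite -(@ltn_pmul2l j.+1)//; apply: (leq_ltn_trans h2); rewrite nX mulnDr.
have : ((W + w).+2 <= j.+1 * (W + w).+2)%N by rewrite leq_pmull.
by set a := (j.+1 * X)%N; set a' := (j.+1 * (W + w).+2)%N; lia.
Qed.

Lemma big_nat_supp (R : nmodType) (a b b' : nat) (Q : nat -> bool) (F : nat -> R) :
  (forall m, Q m -> (a <= m < b)%N) -> (b <= b')%N ->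
  \sum_(0 <= m < b' | Q m) F m = \sum_(a <= m < b | Q m) F m.
Proof.
move=> Qab bb'; rewrite [RHS](big_nat_widen _ _ b')// [RHS](big_nat_widenl _ 0)//.
apply: eq_bigl => m; case Qm: (Q m) => //=.
by have /andP[-> ->] := Qab m Qm.
Qed.

(** * Sums of covariances over pairs of indices *)

Section covariance_sums.
Context (R : realType) (ell : nat) (h : nat -> R) (S : R).
Hypothesis h_ge0 : forall k, 0 <= h k.
Hypothesis hS : forall n, \sum_(0 <= k < n) k.+1%:R * h k <= S.
Variables (c : 'I_ell -> 'I_ell -> nat -> nat -> R) (r : 'I_ell -> nat -> R).
Hypothesis csym : forall i j n m, c i j n m = c j i m n.
Hypothesis cd : forall (i j : 'I_ell) n m, (j.+1 * m <= i.+1 * n)%N ->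
  `|c i j n m| <= h (minn n (i.+1 * n - j.+1 * m)).
Hypothesis rd : forall i k, `|r i k| <= h k.
Hypothesis crd : forall (i : 'I_ell) m k, (ell * k <= m)%N ->
  `|c i i (m + k)%N m - r i k| <= h (m - ell * k).
Hypothesis ray : forall (i j : 'I_ell) n0 m0,
  cvgn (fun t => c i j (n0 + j.+1 * t)%N (m0 + i.+1 * t)%N).

Definition psum N (Q : nat -> nat -> bool) (f : nat -> nat -> R) : R :=
  \sum_(1 <= n < N.+1) \sum_(1 <= m < N.+1 | Q n m) f n m.

Lemma psum_le N (Q : nat -> nat -> bool) (f g : nat -> nat -> R) : (forall n m, (1 <= n <= N)%N -> (1 <= m <= N)%N -> Q n m ->
  f n m <= g n m) -> psum N Q f <= psum N Q g.
Proof.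
move=> fg; apply: ler_sum_nat => n hn; rewrite big_nat_cond [leRHS]big_nat_cond.
by apply: ler_sum => m /andP[hm qm]; exact: fg.
Qed.

Lemma psumD N Q f g : psum N Q (fun n m => f n m + g n m) = psum N Q f + psum N Q g.
Proof. by rewrite /psum -big_split; apply: eq_bigr => n _; rewrite big_split. Qed.

Lemma psum_norm N Q f : `|psum N Q f| <= psum N Q (fun n m => `|f n m|).
Proof.
apply: (le_trans (ler_norm_sum _ _ _)); apply: ler_sum => n _.
exact: ler_norm_sum.
Qed.

Lemma psum_split N Q Q' f : psum N Q f =
  psum N (fun n m => Q n m && Q' n m) f + psum N (fun n m => Q n m && ~~ Q' n m) f.
Proof.
by rewrite /psum -big_split; apply: eq_bigr => n _; rewrite (bigID (Q' n)).
Qed.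

Lemma psum_sym N Q f : psum N Q f = psum N (fun n m => Q m n) (fun n m => f m n).
Proof.
rewrite /psum; under eq_bigr => n _ do rewrite big_mkcond.
by rewrite exchange_big; apply: eq_bigr => n _; rewrite [RHS]big_mkcond.
Qed.

Lemma h_min a b : h (minn a b) <= h a + h b.
Proof. by rewrite /minn; case: ifP; rewrite ?lerDl ?lerDr. Qed.

Lemma cd2 (i j : 'I_ell) n m : (j.+1 * m <= i.+1 * n)%N ->
  `|c i j n m| <= h n + h (i.+1 * n - j.+1 * m).
Proof. by move=> /cd/le_trans; apply; exact: h_min. Qed.

(** Near the diagonal, [2 ell (n - m) <= m], the comparison with the copies applies with gap
    [m - ell (n - m) >= n - m]. Elsewhere [m < 2 ell (n - m)] and the two covariances are small
    separately. In each region the argument of [h] controls a counting index linearly. *)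
Lemma diag_error : exists D, forall i N,
  psum N (fun _ _ => true) (fun n m => `|c i i n m - r i (adist n m)|) <= D.
Proof.
pose D1 := 2 * S + (2 * S + ((2 * ell).+1%:R * S + (2 * ell).+1%:R * S)).
exists (D1 + D1) => i N.
have l1 : (1 <= ell)%N by exact: leq_ltn_trans (ltn_ord i).
pose d n m := `|c i i n m - r i (adist n m)|.
have dsym n m : d n m = d m n by rewrite /d csym /adist addnC.
have d0 n m : 0 <= d n m by exact: normr_ge0.
rewrite (psum_split N _ (fun n m => (m <= n)%N)) /=.
have half : psum N (fun n m => (m <= n)%N) d <= D1.
  rewrite (psum_split N _ (fun n m => (2 * ell * (n - m) <= m)%N)).
  apply: lerD.
    apply: le_trans (@counting2 _ h S h_ge0 hS N
      (fun n m => (m <= n)%N && (2 * ell * (n - m) <= m)%N) (fun n m => m - ell * (n - m))%N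
      (fun n m => n - m)%N 1 _ _).
    - apply: psum_le => n m _ _ /andP[mn km]; rewrite /d.
      have km' : (ell * (n - m) <= m)%N.
        by apply: leq_trans km; rewrite leq_mul2r leq_pmull// orbT.
      by have := crd i km'; rewrite subnKC// /adist (eqP (mn : (m - n == 0)%N)) addn0.
    - by move=> n m _ _ /andP[mn km]; exact: diag_psi.
    - move=> n m n' m' _ _ _ _ /andP[mn km] /andP[mn' km'].
      have := diag_psi l1 mn km; have := diag_psi l1 mn' km'.
      move=> + + + e; rewrite -e.
      have : (ell * (n - m) <= m)%N by apply: leq_trans km; rewrite leq_mul2r leq_pmull// orbT.
      have : (ell * (n' - m') <= m')%N by apply: leq_trans km'; rewrite leq_mul2r leq_pmull// orbT.
      rewrite -e; set y := (ell * _)%N => h1 h2 _ _ h3.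
      have E : m = m' by exact: (subn_injr h2 h1 h3).
      by subst m'; split => //; exact: (subn_injr mn mn' e).
  apply: (@le_trans _ _ (psum N (fun n m => (m <= n)%N && ~~ (2 * ell * (n - m) <= m)%N)
     (fun n m => h n + (h (i.+1 * (n - m)) + h (n - m))))).
    apply: psum_le => n m _ _ /andP[mn _]; rewrite /d.
    apply: (le_trans (ler_normB _ _)); rewrite addrA; apply: lerD.
      by rewrite mulnBr; apply: cd2; rewrite leq_mul2l mn orbT.
    by rewrite /adist (eqP (mn : (m - n == 0)%N)) addn0.
  rewrite !psumD; apply: lerD; [|apply: lerD].
  - apply: (@counting2 _ h S h_ge0 hS N _ (fun n m => n) (fun n m => m) 1) => //.
    by move=> n m _ _ /andP[mn _]; rewrite mul1n.
  - apply: (@counting2 _ h S h_ge0 hS N _ (fun n m => i.+1 * (n - m))%N (fun n m => m) (2 * ell)).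
      move=> n m _ _ /andP[mn]; rewrite -ltnNge => /ltnW/leq_trans; apply.
      by rewrite leq_mul2l leq_pmull ?orbT.
    move=> n m n' m' _ _ _ _ /andP[mn _] /andP[mn' _] /leq_pmul2_cancel e e'; subst m'.
    by split => //; exact: (subn_injr mn mn' e).
  - apply: (@counting2 _ h S h_ge0 hS N _ (fun n m => n - m)%N (fun n m => m) (2 * ell)).
      by move=> n m _ _ /andP[mn]; rewrite -ltnNge => /ltnW.
    move=> n m n' m' _ _ _ _ /andP[mn _] /andP[mn' _] e e'; subst m'.
    by split => //; exact: (subn_injr mn mn' e).
apply: lerD => //; apply: le_trans half.
rewrite psum_sym; apply: (@le_trans _ _ (psum N (fun n m => ~~ (n <= m)%N) d)).
  by apply: psum_le => n m _ _ _; rewrite -/(d m n) dsym.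
apply: ler_sum_nat => n _; rewrite big_mkcond [leRHS]big_mkcond.
by apply: ler_sum => m _; rewrite -ltnNge; case: ltngtP.
Qed.

(** As [i < j] and [n < m], the gap [(j+1) m - (i+1) n] is at least [n], so [n] can serve as the
    counting index. *)
Lemma above_ray_sum (i j : 'I_ell) N : (i < j)%N ->
  psum N (fun n m => (n < m)%N) (fun n m => `|c i j n m|) <= 2 * S + 2 * S.
Proof.
move=> ij; apply: (@le_trans _ _ (psum N (fun n m => (n < m)%N)
    (fun n m => h m + h (j.+1 * m - i.+1 * n)))).
  apply: psum_le => n m _ _ nm; rewrite csym; apply: cd2.
  exact: (proj1 (above_ray ij nm)).
rewrite psumD; apply: lerD.
  apply: (@counting2 _ h S h_ge0 hS N _ (fun n m => m) (fun n m => n) 1) => //.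
  by move=> n m _ _ nm; rewrite mul1n ltnW.
apply: (@counting2 _ h S h_ge0 hS N _ (fun n m => j.+1 * m - i.+1 * n)%N (fun n m => n) 1).
  by move=> n m _ _ nm; rewrite mul1n; exact: (proj2 (above_ray ij nm)).
move=> n m n' m' _ _ _ _ nm nm' e e'; subst n'; split => //.
apply: (@leq_pmul2_cancel j).
exact: (subn_injr (proj1 (above_ray ij nm)) (proj1 (above_ray ij nm')) e).
Qed.

Lemma ex_sum (ex : nat -> R) N : (forall n, `|ex n| <= h n) ->
  `|\sum_(1 <= n < N.+1) ex n| <= S.
Proof.
move=> exh; apply: (le_trans (ler_norm_sum _ _ _)).
by apply: (@le_trans _ _ (\sum_(1 <= n < N.+1) h n)); [exact: ler_sum|exact: partial_le].
Qed.

(** By the choice of [N1], every time [(i+1) n] with [n > N1] lies beyond all times [(j+1) m] with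
    [m <= N], by a margin of at least [(i+1) (n - N1)]. *)
Lemma cross_lower (i j : 'I_ell) N N1 : (j < i)%N -> (N1 <= N)%N -> (i * N <= i.+1 * N1)%N ->
  psum N (fun n m => (N1 < n)%N) (fun n m => `|c i j n m|) <= 3 * S + 2 * S.
Proof.
move=> ji N1N NN.
have below n m : (N1 < n)%N -> (m <= N)%N ->
    (j.+1 * m + i.+1 * (n - N1) <= i.+1 * n)%N.
  move=> Nn mN.
  have h1 : (j.+1 * m <= i * N)%N by rewrite leq_mul.
  rewrite mulnBr; have h2 : (i.+1 * N1 < i.+1 * n)%N by rewrite ltn_pmul2l.
  by move: h1 h2 NN; lia.
apply: (@le_trans _ _ (psum N (fun n m => (N1 < n)%N)
    (fun n m => h n + h (i.+1 * n - j.+1 * m)))).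
  apply: psum_le => n m _ /andP[_ mN] nm; apply: cd2.
  exact: leq_trans (leq_addr _ _) (below n m nm mN).
rewrite psumD; apply: lerD.
  apply: (@counting2 _ h S h_ge0 hS N _ (fun n m => n) (fun n m => m) 2) => //.
  move=> n m _ /andP[_ mN] nm; apply: (leq_trans mN).
  have i0 : (0 < i)%N by exact: leq_ltn_trans ji.
  rewrite -(leq_pmul2l i0); apply: (leq_trans NN).
  apply: (@leq_trans (i.+1 * n)%N); first by rewrite leq_mul2l ltnW ?orbT.
  by rewrite mulnA leq_mul2r muln2 -addnn -addn1 leq_add2l i0 orbT.
apply: (@counting2 _ h S h_ge0 hS N _ (fun n m => i.+1 * n - j.+1 * m)%N (fun n m => n - N1)%N 1).
  move=> n m _ /andP[_ mN] nm; rewrite mul1n; have := below n m nm mN.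
  have : (n - N1 <= i.+1 * (n - N1))%N by rewrite leq_pmull.
  by set a := (i.+1 * (n - N1))%N; set b := (i.+1 * n)%N; lia.
move=> n m n' m' _ /andP[_ mN] _ /andP[_ mN'] nm nm' e e'.
have E : n = n' by exact: (subn_injr (ltnW nm) (ltnW nm') e').
subst n'; split => //; apply: (@leq_pmul2_cancel j).
apply: (subn_inj _ _ e); [exact: leq_trans (leq_addr _ _) (below n m nm mN)
  |exact: leq_trans (leq_addr _ _) (below n m' nm mN')].
Qed.

Lemma cross_diag (i : 'I_ell) N N1 :
  psum N (fun n m => (m <= N1)%N && (N1 < n)%N) (fun n m => `|c i i n m|) <= 2 * S + 2 * S.
Proof.
apply: (@le_trans _ _ (psum N (fun n m => (m <= N1)%N && (N1 < n)%N)
    (fun n m => h n + h (i.+1 * (n - m))))).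
  apply: psum_le => n m _ _ /andP[mN Nn]; rewrite mulnBr; apply: cd2.
  by rewrite leq_mul2l (leq_trans mN (ltnW Nn)) orbT.
rewrite psumD; apply: lerD.
  apply: (@counting2 _ h S h_ge0 hS N _ (fun n m => n) (fun n m => m) 1) => //.
  by move=> n m _ _ /andP[mN Nn]; rewrite mul1n (leq_trans mN (ltnW Nn)).
apply: (@counting2 _ h S h_ge0 hS N _ (fun n m => i.+1 * (n - m))%N (fun n m => n - N1)%N 1).
  move=> n m _ _ /andP[mN Nn]; rewrite mul1n (@leq_trans (n - m)%N) ?leq_pmull//.
  exact: leq_sub2l.
move=> n m n' m' _ _ _ _ /andP[mN Nn] /andP[mN' Nn'] /leq_pmul2_cancel e e'.
have E : n = n' by exact: (subn_injr (ltnW Nn) (ltnW Nn') e').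
by subst n'; split => //; apply: (subn_inj _ _ e);
  [exact: leq_trans mN (ltnW Nn)|exact: leq_trans mN' (ltnW Nn)].
Qed.

Definition window (i j : 'I_ell) w n m :=
  (i.+1 * n <= j.+1 * m + w)%N && (j.+1 * m <= i.+1 * n + w)%N.

(** Advancing [n] by [j + 1] shifts the window by [i + 1], so within a residue class the window
    keeps its shape and each of its finitely many entries converges along the ray. *)
Lemma window_mean (i j : 'I_ell) w : (i < j)%N -> exists L, sublinear (fun N =>
  psum N (fun n m => (m <= n)%N && window i j w n m) (c i j) - N%:R * L).
Proof.
move=> ij; pose x n := \sum_(1 <= m < n.+2 | window i j w n.+1 m) c i j n.+1 m.
have [n0|L hL] := @sublinear_residues R x j.
  (* The delay by [w] puts the whole window inside [1 <= m <= n]; the successor is there because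
     sums start at 1. *)
  pose n1 t := (n0 + j.+1 * (t + w)).+1.
  pose X t := (i.+1 * t)%N; pose A := (i.+1 * (n0 + j.+1 * w).+1)%N.
  have A0 : (0 < A)%N by [].
  have wA : (w <= A.-1)%N.
    rewrite -ltnS prednK// /A mulnS; apply: (@leq_ltn_trans (i.+1 * (j.+1 * w))%N).
      by rewrite mulnA leq_pmull.
    by rewrite mulnDr addnCA; lia.
  have nE t : (i.+1 * n1 t)%N = (A.-1.+1 + j.+1 * X t)%N.
    have E1 : n1 t = ((n0 + j.+1 * w).+1 + j.+1 * t)%N by rewrite /n1 mulnDr; lia.
    by rewrite prednK// /A /X E1 mulnDr; congr (_ + _)%N; rewrite mulnCA.
  have wn t : (w <= n1 t)%N by rewrite /n1 mulnDr; have : (w <= j.+1 * w)%N; [rewrite leq_pmull|lia].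
  have xE t : x (n0 + j.+1 * (t + w))%N =
     \sum_(0 <= m < (A.-1 + w).+2 | window i j w (n1 0%N) m) c i j (n1 0 + j.+1 * t)%N (m + i.+1 * t)%N.
    rewrite /x -/(n1 t).
    have rng m : window i j w (n1 t) m ->
        [/\ 1 <= m, m <= n1 t, X t <= m & m < X t + (A.-1 + w).+2]%N.
      by move=> /andP[h1 h2]; exact: (near_range ij (nE t) wA (wn t) h1 h2).
    pose K := ((n1 t).+1 + (X t + (A.-1 + w).+2))%N.
    rewrite -(@big_nat_supp _ 1 (n1 t).+1 K); [|by move=> m /rng[-> + _ _]|exact: leq_addr].
    rewrite (@big_nat_supp _ (X t) (X t + (A.-1 + w).+2) K); [|by move=> m /rng[_ _ -> ->]|exact: leq_addl].
    rewrite -{1}[X t]add0n big_addn addKn.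
    have E1 : (n1 0 + j.+1 * t)%N = n1 t by rewrite /n1 add0n mulnDr; lia.
    apply: eq_big => [m|m _]; last by rewrite E1.
    have E2 : (i.+1 * n1 t = i.+1 * n1 0 + j.+1 * X t)%N by rewrite (nE t) (nE 0%N) /X muln0 muln0 addn0.
    rewrite /window E2 mulnDr; set a := (j.+1 * X t)%N.
    by set a1 := (j.+1 * m)%N; set a2 := (i.+1 * n1 0)%N; congr (_ && _); lia.
  have /cvg_ex[l hl] : cvgn (fun t => x (n0 + j.+1 * (t + w))%N).
    rewrite (_ : (fun t => _) = (fun t => \sum_(0 <= m < (A.-1 + w).+2 | window i j w (n1 0%N) m)
      c i j (n1 0 + j.+1 * t)%N (m + i.+1 * t)%N)); last exact/funext.
    apply/cvg_ex; eexists; apply: cvg_rsum => m _; exact: ray.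
  by apply/cvg_ex; exists l; rewrite -(cvg_shiftn w).
exists L; apply: sublinear_ext hL => N; congr (_ - _).
rewrite /psum big_add1 /=; apply: eq_big_nat => n /andP[_ nN].
rewrite /x [LHS](big_nat_widen _ _ N.+1)//.
by apply: eq_bigl => m; rewrite ltnS andbC.
Qed.

(** A window of width [w] has an exact slope. Outside it, up to terms of bounded total, the sum at
    each index is at most a tail [S / (w + 1)] on either side of the ray; [sublinear_approx] then
    lets [w] grow. *)
Lemma ray_mean (i j : 'I_ell) : (i < j)%N -> exists L, sublinear (fun N =>
  psum N (fun _ _ => true) (c i j) - N%:R * L).
Proof.
move=> ij; have S0 : 0 <= S by have := hS 0; rewrite big_geq.
apply: sublinear_approx => e e0.
have e40 : 0 < e / 4 by rewrite divr_gt0.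
pose w := Num.bound (S / (e / 4)).
have Sw : S / w.+1%:R <= e / 4.
  rewrite ler_pdivrMr// mulrC -ler_pdivrMr//.
  apply: (le_trans (ltW (archi_boundP _))); first by apply: divr_ge0 => //; exact: ltW.
  by rewrite ler_nat.
have [L hL] := window_mean w ij.
have [C hC] := hL _ (divr_gt0 e0 (ltr0Sn R 1)).
exists L; exists (C + ((2 * S + 2 * S) + (2 * S + j.+2%:R * S))) => N.
pose far n m := (m <= n)%N && ~~ window i j w n m.
have -> : psum N (fun _ _ => true) (c i j) - N%:R * L =
  (psum N (fun n m => (m <= n)%N && window i j w n m) (c i j) - N%:R * L) +
  (psum N (fun n m => (n < m)%N) (c i j) + psum N far (c i j)).
  rewrite (psum_split N _ (fun n m => (m <= n)%N)) (psum_split N _ (window i j w)) /=.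
  rewrite (_ : psum N (fun n m => ~~ (m <= n)%N) (c i j) = psum N (fun n m => (n < m)%N) (c i j)).
    by rewrite /far; ring.
  by apply: eq_bigr => n _; apply: eq_bigl => m; rewrite ltnNge.
apply: (le_trans (ler_normD _ _)).
have T1 : `|psum N (fun n m => (n < m)%N) (c i j)| <= 2 * S + 2 * S.
  exact: le_trans (psum_norm _ _ _) (above_ray_sum N ij).
have perN (Q : nat -> nat -> bool) (phi : nat -> nat -> nat) :
  (forall n m, Q n m -> (w <= phi n m)%N) ->
  (forall n m m', Q n m -> Q n m' -> phi n m = phi n m' -> m = m') ->
  psum N Q (fun n m => h (phi n m)) <= N%:R * (e / 4).
  move=> wphi inj_phi; rewrite mulr_natl -[X in _ *+ X](subn1 N.+1) -sumr_const_nat.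
  apply: ler_sum => n _; apply: le_trans Sw.
  apply: (@tail_sum _ h S h_ge0 hS nat _ (Q n) (phi n) w) => [|m _|m m' _ _].
  - exact: iota_uniq.
  - exact: wphi.
  - exact: inj_phi.
have T2 : `|psum N far (c i j)| <= 2 * S + j.+2%:R * S + (N%:R * (e / 4) + N%:R * (e / 4)).
  apply: (le_trans (psum_norm _ _ _)).
  pose lo n m := far n m && (j.+1 * m <= i.+1 * n)%N.
  pose hi n m := far n m && ~~ (j.+1 * m <= i.+1 * n)%N.
  rewrite (psum_split N _ (fun n m => (j.+1 * m <= i.+1 * n)%N)) -/lo -/hi addrACA.
  apply: lerD.
    apply: (@le_trans _ _ (psum N lo (fun n m => h n + h (i.+1 * n - j.+1 * m)))).
      by apply: psum_le => n m _ _ /andP[_]; exact: cd2.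
    rewrite psumD; apply: lerD.
      apply: (@counting2 _ h S h_ge0 hS N _ (fun n m => n) (fun n m => m) 1) => //.
      by move=> n m _ _ /andP[/andP[mn _] _]; rewrite mul1n.
    apply: perN => [n m /andP[/andP[_ nw] mn]|n m m' /andP[_ mn] /andP[_ mn'] e1].
      by move: nw; rewrite /window; lia.
    exact: (leq_pmul2_cancel (subn_inj mn mn' e1)).
  apply: (@le_trans _ _ (psum N hi (fun n m => h m + h (j.+1 * m - i.+1 * n)))).
    by apply: psum_le => n m _ _ /andP[_]; rewrite -ltnNge csym => /ltnW; exact: cd2.
  rewrite psumD; apply: lerD.
    apply: (@counting2 _ h S h_ge0 hS N _ (fun n m => m) (fun n m => n) j.+1) => //.
    move=> n m _ _ /andP[_]; rewrite -ltnNge => /ltnW; apply: leq_trans.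
    by rewrite leq_pmull.
  apply: perN => [n m /andP[/andP[_ nw] mn]|n m m' /andP[_ mn] /andP[_ mn'] e1].
    by move: nw mn; rewrite /window; lia.
  rewrite -ltnNge in mn; rewrite -ltnNge in mn'.
  exact: (leq_pmul2_cancel (subn_injr (ltnW mn) (ltnW mn') e1)).
apply: (le_trans (lerD (hC N) (ler_normD _ _))).
apply: (le_trans (lerD (lexx _) (lerD T1 T2))).
by rewrite le_eqVlt; apply/orP; left; apply/eqP; field.
Qed.

End covariance_sums.

(** * Square integrable variables *)

Lemma amgm (R : realType) (t x : R) : 0 < t -> x <= 2^-1 * t^-1 + 2^-1 * t * x ^+ 2.
Proof.
move=> t0; rewrite -subr_ge0 (_ : _ - _ = 2^-1 * t^-1 * (t * x - 1) ^+ 2).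
  by apply: mulr_ge0; [apply: mulr_ge0 => //; rewrite invr_ge0 ltW|exact: sqr_ge0].
by field; rewrite gt_eqF.
Qed.

Section square_integrable.
Context d (T : measurableType d) (R : realType) (P : probability T R).
Implicit Types (x y : T -> R).

Definition L2 x := measurable_fun setT x /\ Int P (fun w => x w ^+ 2).

Lemma L2_mul x y : L2 x -> L2 y -> Int P (fun w => x w * y w).
Proof.
move=> [mx Ix] [my Iy]; apply: (Int_dom _ (IntD Ix Iy)).
  exact: measurable_funM.
move=> w; rewrite normrM -(real_normK (num_real (x w))) -(real_normK (num_real (y w))).
have a0 := normr_ge0 (x w); have b0 := normr_ge0 (y w).
move: a0 b0; set a := `|x w|; set b := `|y w| => a0 b0.
have := sqr_ge0 (a - b); have := mulr_ge0 a0 b0; have := sqr_ge0 a; have := sqr_ge0 b.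
rewrite !expr2; nra.
Qed.

Lemma L2_Int x : L2 x -> Int P x.
Proof.
move=> [mx Ix]; apply: (Int_dom mx (IntD (Int_cst P 1) Ix)) => w.
rewrite -(real_normK (num_real (x w))); have := sqr_ge0 (`|x w| - 1).
rewrite !expr2; have := normr_ge0 (x w); set a := `|x w|; nra.
Qed.

Lemma L2_0 : L2 (fun=> 0).
Proof. by split; [exact: measurable_cst|rewrite expr0n/=; exact: Int_cst]. Qed.

Lemma L2D x y : L2 x -> L2 y -> L2 (fun w => x w + y w).
Proof.
move=> hx hy; have [mx Ix] := hx; have [my Iy] := hy; split; first exact: measurable_funD.
apply: (Int_ext (IntD (IntD Ix Iy) (IntZ 2 (L2_mul hx hy)))) => w; ring.
Qed.

Lemma L2Z a x : L2 x -> L2 (fun w => a * x w).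
Proof.
move=> [mx Ix]; split; first exact: measurable_funM.
by apply: (Int_ext (IntZ (a ^+ 2) Ix)) => w; rewrite exprMn.
Qed.

Lemma L2B x y : L2 x -> L2 y -> L2 (fun w => x w - y w).
Proof.
move=> hx hy; have := L2D hx (L2Z (-1) hy).
by rewrite (_ : (fun w => x w + _) = fun w => x w - y w)//; apply/funext => w; rewrite mulN1r.
Qed.

Lemma L2_sum (I : Type) (s : seq I) (Q : pred I) (f : I -> T -> R) :
  (forall i, L2 (f i)) -> L2 (fun w => \sum_(i <- s | Q i) f i w).
Proof.
move=> hf; elim: s => [|i s IH].
  by rewrite (_ : (fun w => _) = fun=> 0); [exact: L2_0|apply/funext => w; rewrite big_nil].
case Qi: (Q i).
  rewrite (_ : (fun w => _) = fun w => f i w + \sum_(j <- s | Q j) f j w); first exact: L2D.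
  by apply/funext => w; rewrite big_cons Qi.
rewrite (_ : (fun w => _) = fun w => \sum_(j <- s | Q j) f j w)//.
by apply/funext => w; rewrite big_cons Qi.
Qed.

Lemma Ex_mul_sum (I J : Type) (s : seq I) (t : seq J) (Q : pred I) (Q' : pred J)
    (f : I -> T -> R) (g : J -> T -> R) :
  (forall i, L2 (f i)) -> (forall j, L2 (g j)) ->
  \int[P]_w ((\sum_(i <- s | Q i) f i w) * (\sum_(j <- t | Q' j) g j w)) =
  \sum_(i <- s | Q i) \sum_(j <- t | Q' j) \int[P]_w (f i w * g j w).
Proof.
move=> hf hg.
transitivity (\int[P]_w \sum_(i <- s | Q i) \sum_(j <- t | Q' j) (f i w * g j w)).
  by apply: eq_Rintegral => w _; rewrite mulr_suml; apply: eq_bigr => i _; rewrite mulr_sumr.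
rewrite Ex_sum.
  by apply: eq_bigr => i _; rewrite Ex_sum// => j _; exact: L2_mul.
by move=> i _; apply: Int_sum => j _; exact: L2_mul.
Qed.

Lemma covariance_Ex x y : L2 x -> L2 y ->
  covariance P x y = (\int[P]_w (x w * y w) - \int[P]_w x w * \int[P]_w y w)%:E.
Proof.
move=> hx hy; have Ix := L2_Int hx; have Iy := L2_Int hy; have Ixy := L2_mul hx hy.
rewrite unlock; rewrite unlock /=.
rewrite !(integralEFin Ix) !(integralEFin Iy) /=.
set a := \int[P]_w x w; set b := \int[P]_w y w.
have Ic : Int P (fun w => (x w - a) * (y w - b)).
  apply: (Int_ext (IntB Ixy (IntD (IntZ b Ix) (IntZ a (IntB Iy (Int_cst P b)))))) => w; ring.
rewrite (integralEFin Ic); congr (_%:E).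
transitivity (\int[P]_w (x w * y w - (b * x w + a * (y w - b)))).
  by apply: eq_Rintegral => w _; ring.
rewrite ExB//; last by apply: IntD; apply: IntZ => //; apply: IntB => //; exact: Int_cst.
rewrite ExD; [|exact: IntZ|by apply: IntZ; apply: IntB => //; exact: Int_cst].
rewrite !ExZ//; last by apply: IntB => //; exact: Int_cst.
rewrite ExB//; last exact: Int_cst.
rewrite Ex_cst -/a -/b; ring.
Qed.

Lemma variance_Ex x : L2 x ->
  'V_P[x]%E = (\int[P]_w (x w ^+ 2) - (\int[P]_w x w) ^+ 2)%:E.
Proof. by move=> hx; rewrite /variance covariance_Ex// expr2. Qed.

Lemma L2_Lfun x : L2 x -> x \in Lfun P 2%:E.
Proof.
move=> [mx Ix]; rewrite inE; apply/andP; rewrite !inE; split => //=.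
rewrite /finite_norm; apply: (le_lt_trans _ (ltry (1 + \int[P]_w (x w ^+ 2)))).
have Ix' : Int P (fun w => `|x w| `^ 2).
  by apply: (Int_ext Ix) => w; rewrite powR_mulrn// real_normK// num_real.
apply: le_Lnorm => //; first by rewrite addr_ge0// Ex_ge0// => w; exact: sqr_ge0.
have I0 : 0 <= \int[P]_w (x w ^+ 2) by rewrite Ex_ge0// => w; exact: sqr_ge0.
rewrite (_ : \int[P]_w (`|x w| `^ 2) = \int[P]_w (x w ^+ 2)); last first.
  by apply: eq_Rintegral => w _; rewrite powR_mulrn// real_normK// num_real.
by rewrite powR_mulrn ?addr_ge0// expr2; nra.
Qed.

Lemma Lfun_L2 x : x \in Lfun P 2%:E -> L2 x.
Proof.
rewrite inE => /andP[]; rewrite !inE /= => mx fx; split => //.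
have [c cE] : exists c : R, 0 <= c /\ ('N[P]_2%:E[EFin \o x] <= c%:E)%E.
  move: fx; rewrite /finite_norm => fx; exists (fine 'N[P]_2%:E[EFin \o x]%E).
  have fN : 'N[P]_2%:E[EFin \o x]%E \is a fin_num by rewrite ge0_fin_numE// Lnorm_ge0.
  by rewrite fineK// fine_ge0// Lnorm_ge0.
have [Ix _] := @Lnorm_le _ _ R P x 2 c (ltr0Sn R 1) (proj1 cE) mx (proj2 cE).
by apply: (Int_ext Ix) => w; rewrite powR_mulrn// real_normK// num_real.
Qed.

Lemma Ex_null (E : set T) x : measurable E -> P (~` E) = 0%E -> measurable_fun setT x ->
  \int[P]_w (\1_(~` E) w * x w) = 0.
Proof.
move=> mE PE mx; rewrite Ex_setE /Rintegral null_set_integral//.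
  exact: measurableC.
by apply/measurable_EFinP; exact: measurable_funS mx.
Qed.

(** Along a subsequence with increments of mean square at most [4^-k] the series of increments
    converges absolutely almost everywhere; Fatou's lemma then gives convergence in mean square. *)
Lemma L2_complete (a : nat -> T -> R) : (forall k, L2 (a k)) ->
  (forall e : R, 0 < e -> exists k0, forall k l, (k0 <= k)%N -> (k0 <= l)%N ->
    \int[P]_w ((a k w - a l w) ^+ 2) <= e) ->
  exists2 A, L2 A & (fun k => \int[P]_w ((A w - a k w) ^+ 2)) @ \oo --> 0.
Proof.
move=> ha hc.
have eps k : (0 : R) < (4 ^+ k)^-1 by rewrite invr_gt0 exprn_gt0.
have /choice[M hM] (k : nat) := hc _ (eps k).
pose N k := (\sum_(0 <= j < k.+1) M j + k)%N.
have MN k l : (k <= l)%N -> (M k <= N l)%N.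
  move=> kl; rewrite /N (bigD1_seq k) ?iota_uniq ?mem_index_iota ?ltnS//=.
  by rewrite -addnA leq_addr.
pose b k := a (N k).
have hb k : L2 (b k) by exact: ha.
have bc k l : (k <= l)%N -> \int[P]_w ((b l w - b k w) ^+ 2) <= (4 ^+ k)^-1.
  by move=> kl; apply: hM; exact: MN.
pose D k w := `|b k.+1 w - b k w|.
have L2d k l : L2 (fun w => b l w - b k w) by exact: L2B.
have ID k : Int P (D k) by apply: Int_norm; exact: L2_Int.
have ED k : \int[P]_w D k w <= (2 ^+ k)^-1.
  have t0 : 0 < 2 ^+ k :> R by rewrite exprn_gt0.
  have I2 := (L2d k k.+1).2.
  (* The weight [2^k] in the arithmetic-geometric inequality converts the bound [4^-k] on squares
     into [2^-k] on absolute values. *)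
  apply: (@le_trans _ _ (\int[P]_w (2^-1 * (2 ^+ k)^-1 + 2^-1 * 2 ^+ k * (b k.+1 w - b k w) ^+ 2))).
    apply: Ex_le => //; first by apply: IntD; [exact: Int_cst|exact: IntZ].
    move=> w; rewrite -(real_normK (num_real (b k.+1 w - b k w))) -/(D k w).
    exact: amgm.
  rewrite ExD; [|exact: Int_cst|exact: IntZ].
  rewrite Ex_cst ExZ//.
  have h := bc k k.+1 (leqnSn k).
  have h2 : 2^-1 * 2 ^+ k * \int[P]_w ((b k.+1 w - b k w) ^+ 2) <= 2^-1 * 2 ^+ k * (4 ^+ k)^-1.
    by rewrite ler_wpM2l// mulr_ge0// ltW.
  apply: (le_trans (lerD (lexx _) h2)).
  rewrite (_ : (4 : R) = 2 * 2); last by ring.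
  rewrite exprMn; move: t0; set t := 2 ^+ k => t0.
  by rewrite le_eqVlt; apply/orP; left; apply/eqP; field; rewrite gt_eqF.
pose g w := (\sum_(k <oo) (D k w)%:E)%E.
have mD k : measurable_fun setT (EFin \o D k) by apply/measurable_EFinP; exact: Int_meas (ID k).
have mg : measurable_fun setT g.
  rewrite (_ : g = fun w => (\sum_(k <oo | k \in xpredT) (D k w)%:E)%E).
    apply: (@ge0_emeasurable_sum _ T R setT (fun k w => (D k w)%:E)) => [k w _ _|k _].
      by rewrite lee_fin normr_ge0.
    exact: mD.
  by apply/funext => w; congr (limn _); apply/funext => n; exact: eq_bigl.
have gfin : (\int[P]_w g w <= 2%:E)%E.
  rewrite integral_nneseries//; last by move=> k w _; rewrite lee_fin normr_ge0.
  apply: lime_le.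
    by apply: is_cvg_ereal_nneg_natsum => k _; apply: integral_ge0 => w _; rewrite lee_fin normr_ge0.
  apply: nearW => n.
  apply: (@le_trans _ _ (\sum_(0 <= k < n) ((2 ^+ k)^-1 : R)%:E)%E).
    by apply: lee_sum => k _; rewrite (integralEFin (ID k)) lee_fin; exact: ED.
  rewrite sumEFin lee_fin.
  have geo m : \sum_(0 <= k < m) (2 ^+ k)^-1 + 2 * (2 ^+ m)^-1 <= 2 :> R.
    elim: m => [|m IH]; first by rewrite big_geq// expr0 invr1 add0r mulr1.
    rewrite big_nat_recr//=; apply: le_trans IH; rewrite -addrA lerD2l exprS invfM.
    by rewrite le_eqVlt; apply/orP; left; apply/eqP; field; rewrite gt_eqF// exprn_gt0.
  by apply: le_trans (geo n); rewrite lerDl mulr_ge0// invr_ge0 exprn_ge0.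
have g0 w : (0 <= g w)%E by apply: nneseries_ge0 => k _ _; rewrite lee_fin normr_ge0.
have Ig : P.-integrable setT g.
  apply/integrableP; split => //; apply: (@le_lt_trans _ _ 2%:E); last exact: ltry.
  by under eq_integral => w _ do rewrite gee0_abs//.
pose E := [set w | g w \is a fin_num].
have mE : measurable E.
  by have := emeasurable_fin_num measurableT mg; rewrite setTI.
have PE : P (~` E) = 0%E.
  have [F [mF PF hF]] := integrable_ae measurableT Ig.
  apply/eqP; rewrite eq_le measure_ge0 andbT -PF le_measure ?inE//; first exact: measurableC.
  by move=> w /= nw; apply: hF => /= /(_ Logic.I).
have cb w : E w -> exists l : R, b ^~ w @ \oo --> l.
  move=> Ew; pose G := fine (g w).
  have bound n : \sum_(0 <= k < n) D k w <= G.
    rewrite -lee_fin /G fineK// -sumEFin.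
    by apply: nneseries_lim_ge => k _ _; rewrite lee_fin normr_ge0.
  have cs : cvgn (series (fun k => b k.+1 w - b k w)).
    apply: normed_cvg; change (cvgn (series (fun k => D k w))); apply: nondecreasing_is_cvgn.
      apply/nondecreasing_seqP => n; rewrite seriesEnat /= big_nat_recr//= lerDl.
      exact: normr_ge0.
    by exists G => _ [n _ <-]; rewrite seriesEnat; exact: bound.
  have /cvg_ex[l hl] := cs; exists (l + b 0%N w).
  rewrite (_ : b ^~ w = fun n => series (fun k => b k.+1 w - b k w) n + b 0%N w); last first.
    by apply/funext => n; rewrite seriesEnat /= telescope_sumr// subrK.
  by apply: cvgD => //; exact: cvg_cst.
(* Set to 0 off [E], so that the limit exists at every point, as [fatou_bound] demands. *)
pose b' k w := \1_E w * b k w.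
have /choice[A hA] (w : T) : exists l : R, b' ^~ w @ \oo --> l.
  have [Ew|nE] := pselect (E w).
    have [l hl] := cb w Ew; exists l; rewrite (_ : b' ^~ w = b ^~ w)//.
    by apply/funext => k; rewrite /b' indicE mem_set// mul1r.
  exists 0; rewrite (_ : b' ^~ w = fun=> 0); first exact: cvg_cst.
  by apply/funext => k; rewrite /b' indicE memNset// mul0r.
have mb' k : measurable_fun setT (b' k).
  by apply: measurable_funM; [exact: measurable_indic|exact: (hb k).1].
have mA : measurable_fun setT A by apply: (measurable_fun_cvg mb') => w _; exact: hA.
have b'c k l : (k <= l)%N -> Int P (fun w => (b' l w - b' k w) ^+ 2) /\
    \int[P]_w ((b' l w - b' k w) ^+ 2) <= (4 ^+ k)^-1.
  move=> kl; have le_b w : (b' l w - b' k w) ^+ 2 <= (b l w - b k w) ^+ 2.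
    rewrite /b' indicE; case: (w \in E); first by rewrite !mul1r.
    by rewrite !mul0r subrr expr0n/= sqr_ge0.
  have [J1 J2] := @EFin_Ex_le _ _ R P (fun w => (b' l w - b' k w) ^+ 2) _
    (measurable_funX 2 (measurable_funB (mb' l) (mb' k))) (fun w => sqr_ge0 _) (L2d k l).2 le_b.
  by split => //; exact: le_trans (bc k l kl).
have Ab' k : Int P (fun w => (A w - b' k w) ^+ 2) /\
    \int[P]_w ((A w - b' k w) ^+ 2) <= (4 ^+ k)^-1.
  apply: (@fatou_bound _ T R P (fun l w => (b' (l + k)%N w - b' k w) ^+ 2)).
  - by move=> l; apply: measurable_funX; exact: measurable_funB.
  - by move=> l w; exact: sqr_ge0.
  - move=> w; have hAk : (fun l => b' (l + k)%N w) @ \oo --> A w by rewrite (cvg_shiftn k (b' ^~ w)).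
    have hs : (fun l => b' (l + k)%N w - b' k w) @ \oo --> A w - b' k w.
      by apply: cvgB => //; exact: cvg_cst.
    by rewrite expr2; under eq_fun do rewrite expr2; exact: cvgM.
  - by move=> l; apply: b'c; rewrite leq_addl.
have Ab k : Int P (fun w => (A w - b k w) ^+ 2) /\
    \int[P]_w ((A w - b k w) ^+ 2) <= (4 ^+ k)^-1.
  have mb2 : measurable_fun setT (fun w => b k w ^+ 2) by exact: Int_meas (hb k).2.
  have I3 : Int P (fun w => \1_(~` E) w * b k w ^+ 2).
    apply: (Int_dom _ (hb k).2).
      by apply: measurable_funM => //; apply: measurable_indic; exact: measurableC.
    move=> w; rewrite normrM [`|b k w ^+ 2|]ger0_norm ?sqr_ge0// ler_piMl ?sqr_ge0//.
    by rewrite indicE; case: (w \in _); rewrite ?normr1 ?normr0.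
  have E1 w : (A w - b k w) ^+ 2 = (A w - b' k w) ^+ 2 + \1_(~` E) w * b k w ^+ 2.
    have [Ew|nE] := pselect (E w).
      by rewrite /b' !indicE mem_set// memNset ?mul1r ?mul0r ?addr0// => /(_ Ew).
    have A0 : A w = 0.
      have b'0 : b' ^~ w = fun=> 0.
        by apply/funext => j; rewrite /b' indicE memNset// mul0r.
      by rewrite -(cvg_lim (@Rhausdorff R) (hA w)) b'0 lim_cst.
    by rewrite /b' A0 !indicE memNset// mem_set// /=; ring.
  have [J1 J2] := Ab' k; split; first exact: (Int_ext (IntD J1 I3) E1).
  rewrite (_ : \int[P]_w _ = \int[P]_w ((A w - b' k w) ^+ 2 + \1_(~` E) w * b k w ^+ 2)); last first.
    by apply: eq_Rintegral => w _; exact: E1.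
  by rewrite ExD// Ex_null// addr0.
have L2A : L2 A.
  have h : L2 (fun w => A w - b 0%N w).
    by split; [exact: measurable_funB mA (hb 0%N).1|exact: (Ab 0%N).1].
  have := L2D h (hb 0%N); rewrite (_ : (fun w => _) = A)//.
  by apply/funext => w; rewrite subrK.
exists A => //; apply/cvgrPdist_le => e e0.
have e40 : 0 < e / 4 by rewrite divr_gt0.
have [k0 hk0] := hc _ e40.
have [k1 hk1] : exists k1, (4 ^+ k1)^-1 <= e / 4.
  exists (Num.bound (e / 4)^-1); rewrite -[leRHS]invrK lef_pV2 ?posrE ?invr_gt0 ?exprn_gt0//.
  have i0 : 0 <= (e / 4)^-1 by rewrite invr_ge0 ltW.
  apply: (le_trans (ltW (archi_boundP i0))).
  by rewrite -natrX ler_nat ltnW// ltn_expl.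
exists k0 => // n /= kn; rewrite sub0r normrN ger0_norm; last first.
  by apply: Ex_ge0 => w; exact: sqr_ge0.
pose k := (k1 + k0)%N.
have [J1 J2] := Ab k.
have kN : (k0 <= N k)%N by rewrite (leq_trans _ (leq_addl _ _))// leq_addl.
have J3 := hk0 (N k) n kN kn.
have J4 : (4 ^+ k)^-1 <= e / 4.
  apply: le_trans hk1; rewrite lef_pV2 ?posrE ?exprn_gt0// ler_weXn2l// ?leq_addr//.
  by rewrite ler1n.
have I4 : Int P (fun w => (b k w - a n w) ^+ 2) by exact: (L2B (hb k) (ha n)).2.
apply: (@le_trans _ _ (\int[P]_w (2 * (A w - b k w) ^+ 2 + 2 * (b k w - a n w) ^+ 2))).
  apply: Ex_le; [exact: (L2B L2A (ha n)).2|by apply: IntD; exact: IntZ|].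
  move=> w; rewrite -subr_ge0 (_ : _ - _ = (A w - 2 * b k w + a n w) ^+ 2); last by ring.
  exact: sqr_ge0.
rewrite ExD; [|exact: IntZ|exact: IntZ].
rewrite !ExZ//; move: (le_trans J2 J4) J3; rewrite /b; lra.
Qed.

End square_integrable.

(** * A stationary primitive when the variances of partial sums converge *)

Section stationary_primitive.
Context d (T : measurableType d) (R : realType) (P : probability T R).

Lemma L2_cvg (A : T -> R) (a : nat -> T -> R) (Y : T -> R) :
  L2 P A -> (forall k, L2 P (a k)) -> L2 P Y ->
  (fun k => \int[P]_w ((A w - a k w) ^+ 2)) @ \oo --> 0 ->
  (fun k => \int[P]_w (a k w * Y w)) @ \oo --> \int[P]_w (A w * Y w).
Proof.
move=> hA ha hY h0; apply/cvgrPdist_le => e e0; pose y := \int[P]_w (Y w ^+ 2).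
have y0 : 0 <= y by apply: Ex_ge0 => w; exact: sqr_ge0.
pose t := (y + 1) / e; have t0 : 0 < t by rewrite divr_gt0// ltr_wpDl.
have et0 : 0 < e / t by rewrite divr_gt0.
have /cvgrPdist_le/(_ _ et0)[n0 _ hn0] := h0.
exists n0 => // k /= kn; have := hn0 k kn.
rewrite sub0r normrN ger0_norm; last by apply: Ex_ge0 => w; exact: sqr_ge0.
move=> hk; rewrite -ExB; [|exact: L2_mul|exact: L2_mul].
have hB := L2B hA (ha k).
apply: (@le_trans _ _ (\int[P]_w (2^-1 * t^-1 * Y w ^+ 2 + 2^-1 * t * (A w - a k w) ^+ 2))).
  apply: Ex_absle.
  - by apply: IntB; exact: L2_mul.
  - by apply: IntD; apply: IntZ; [exact: hY.2|exact: hB.2].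
  move=> w; rewrite -mulrBl ler_norml; apply/andP; split.
    rewrite -subr_ge0 (_ : _ - _ = 2^-1 * t^-1 * (t * (A w - a k w) + Y w) ^+ 2).
      by apply: mulr_ge0; [apply: mulr_ge0 => //; rewrite invr_ge0 ltW|exact: sqr_ge0].
    by field; rewrite gt_eqF.
  rewrite -subr_ge0 (_ : _ - _ = 2^-1 * t^-1 * (t * (A w - a k w) - Y w) ^+ 2).
    by apply: mulr_ge0; [apply: mulr_ge0 => //; rewrite invr_ge0 ltW|exact: sqr_ge0].
  by field; rewrite gt_eqF.
rewrite ExD; [|by apply: IntZ; exact: hY.2|by apply: IntZ; exact: hB.2].
rewrite !ExZ; [|exact: hB.2|exact: hY.2].
have h1 : 2^-1 * t^-1 * y <= 2^-1 * e.
  rewrite -mulrA ler_wpM2l// mulrC ler_pdivrMr// /t mulrCA divff ?gt_eqF//; lra.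
have h2 : 2^-1 * t * \int[P]_w ((A w - a k w) ^+ 2) <= 2^-1 * e.
  rewrite -mulrA ler_wpM2l//; apply: (@le_trans _ _ (t * (e / t))).
    by rewrite ler_wpM2l// ltW.
  by rewrite mulrCA divff ?mulr1// gt_eqF.
apply: (le_trans (lerD h1 h2)); lra.
Qed.

Variables (Z : nat -> T -> R) (r : nat -> R) (vinf : R).
Hypothesis LZ : forall n, L2 P (Z n).
Hypothesis EZ : forall n, \int[P]_w Z n w = 0.
Hypothesis EZZ : forall n m, \int[P]_w (Z n w * Z m w) = r (adist n m).
Hypothesis vlim : toeplitz r @ \oo --> vinf.

Definition partial k w := \sum_(0 <= n < k) Z n w.

Let v := toeplitz r.

Lemma L2_partial k : L2 P (partial k).
Proof. by apply: L2_sum => n; exact: LZ. Qed.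

Lemma Ex_partial k : \int[P]_w partial k w = 0.
Proof.
rewrite /partial Ex_sum; last by move=> n _; exact: L2_Int (LZ n).
by rewrite big1// => n _; exact: EZ.
Qed.

Lemma partial_incr a b : (a <= b)%N ->
  \int[P]_w ((partial b w - partial a w) ^+ 2) = v (b - a)%N.
Proof.
move=> ab; transitivity (\int[P]_w ((\sum_(a <= n < b) Z n w) * (\sum_(a <= n < b) Z n w))).
  have E w : partial b w = partial a w + \sum_(a <= n < b) Z n w.
    by rewrite /partial (big_cat_nat (n := a) _ (p := b)).
  by apply: eq_Rintegral => w _; rewrite E addrC addKr expr2.
rewrite Ex_mul_sum// /v /toeplitz.
rewrite -{1}[a]add0n big_addn [RHS]big_add1 /=; apply: eq_bigr => n _.
rewrite -{1}[a]add0n big_addn [RHS]big_add1 /=; apply: eq_bigr => m _.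
by rewrite EZZ; congr r; rewrite /adist !subSS !subnDr.
Qed.

(** Polarisation, the mean square of an increment of the partial sums depending only on its
    length. *)
Lemma partial_cov a b :
  \int[P]_w (partial a w * partial b w) = 2^-1 * (v a + v b - v (adist a b)).
Proof.
wlog ab : a b / (a <= b)%N => [h|].
  have [/h//|/ltnW/h h'] := leqP a b.
  rewrite (_ : adist a b = adist b a); last by rewrite /adist addnC.
  rewrite (addrC (v a)) -h'.
  by apply: eq_Rintegral => w _; rewrite mulrC.
have := partial_incr ab.
have va k : \int[P]_w (partial k w ^+ 2) = v k.
  rewrite -[RHS](congr1 v (subn0 k)) -(partial_incr (leq0n k)); apply: eq_Rintegral => w _.
  by rewrite /(partial 0) big_geq// subr0.
have -> : adist a b = (b - a)%N by rewrite /adist (eqP (ab : (a - b == 0)%N)).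
have hab := L2_mul (L2_partial a) (L2_partial b).
have [_ ha] := L2_partial a; have [_ hb] := L2_partial b.
have -> : \int[P]_w ((partial b w - partial a w) ^+ 2) =
    \int[P]_w (partial b w ^+ 2 + (partial a w ^+ 2 - 2 * (partial a w * partial b w))).
  by apply: eq_Rintegral => w _; ring.
rewrite ExD//; last by apply: IntB => //; exact: IntZ.
rewrite ExB//; last exact: IntZ.
by rewrite ExZ// !va => <-; field.
Qed.

Let delta k := `|v k - vinf|.
Let Dl n := \sum_(0 <= k < n) delta k.

Let delta_ge0 k : 0 <= delta k. Proof. exact: normr_ge0. Qed.

Let Dl_mono a b : (a <= b)%N -> Dl a <= Dl b.
Proof.
by move=> ab; rewrite /Dl [leRHS](big_cat_nat (n := a))//= lerDl sumr_ge0.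
Qed.

Lemma sum_delta_adist n M : (n <= M)%N ->
  \sum_(0 <= a < M.+1) delta (adist a n) <= Dl M.+1 + Dl M.+1.
Proof.
move=> nM; rewrite (big_cat_nat (n := n.+1))//=; apply: lerD.
  apply: le_trans (Dl_mono (_ : n.+1 <= M.+1)%N); last by [].
  rewrite /Dl big_nat_rev /= le_eqVlt; apply/orP; left; apply/eqP.
  by apply: eq_big_nat => a /andP[_ an]; congr delta; rewrite /adist; lia.
apply: le_trans (Dl_mono (_ : M.+1 - n <= M.+1)%N); last exact: leq_subr.
rewrite /Dl; apply: (@le_trans _ _ (\sum_(1 <= k < M.+1 - n) delta k)).
  rewrite -{1}[n.+1]add1n big_addn le_eqVlt; apply/orP; left; apply/eqP.
  by apply: eq_bigr => a _; congr delta; rewrite /adist; lia.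
have [h|h] := leqP (M.+1 - n) 0; first by rewrite !big_geq// (leq_trans h).
by rewrite [leRHS]big_ltn// lerDr.
Qed.

Definition averages M w := M.+1%:R^-1 * \sum_(0 <= k < M.+1) partial k w.

Let mu M := M.+1%:R^-1 * Dl M.+1.

Lemma mu_small (e : R) : 0 < e -> exists n0, forall M, (n0 <= M)%N -> mu M <= e.
Proof.
move=> e0.
have h : sublinear Dl.
  have d0 : delta @ \oo --> 0.
    have := vlim => /cvgrPdist_le hv; apply/cvgrPdist_le => e1 e10.
    have [n0 _ hn0] := hv e1 e10; exists n0 => // n nn /=.
    by rewrite sub0r normrN normr_id distrC; exact: hn0.
  by apply: sublinear_ext (sublinear_cvg_sum d0) => N; rewrite mulr0 subr0.
have /cvgrPdist_le/(_ e e0)[n0 _ hn0] := sublinear_mean h.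
exists n0 => M nM; have := hn0 M.+1 (leqW nM); rewrite /= sub0r normrN.
by apply: le_trans; exact: ler_norm.
Qed.

Lemma L2_averages M : L2 P (averages M).
Proof. by apply: L2Z; apply: L2_sum => k; exact: L2_partial. Qed.

Let Minv M : M.+1%:R^-1 * M.+1%:R = 1 :> R. Proof. by rewrite mulVf. Qed.
Let Mi0 M : 0 <= M.+1%:R^-1 :> R. Proof. by rewrite invr_ge0. Qed.

Let avg_cst M (x : R) : M.+1%:R^-1 * \sum_(0 <= a < M.+1) x = x.
Proof. by rewrite sumr_const_nat subn0 -[x *+ _]mulr_natl mulrA Minv mul1r. Qed.

(** On average over [a], both [v a] and [v |a - n|] are close to [vinf] and cancel, leaving half of
    [v n] up to the Cesaro mean [mu M] of the deviations. *)
Lemma averages_partial n M : (n <= M)%N ->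
  `|\int[P]_w (averages M w * partial n w) - 2^-1 * v n| <= 2 * mu M.
Proof.
move=> nM.
have -> : \int[P]_w (averages M w * partial n w) =
    M.+1%:R^-1 * \sum_(0 <= a < M.+1) 2^-1 * (v a + v n - v (adist a n)).
  transitivity (\int[P]_w (M.+1%:R^-1 * \sum_(0 <= a < M.+1) (partial a w * partial n w))).
    by apply: eq_Rintegral => w _; rewrite /averages -mulrA mulr_suml.
  have Iap a : Int P (fun w => partial a w * partial n w) by apply: L2_mul; exact: L2_partial.
  rewrite ExZ; last by apply: Int_sum => a _.
  by congr (_ * _); rewrite Ex_sum//; apply: eq_bigr => a _; exact: partial_cov.
have -> : 2^-1 * v n = M.+1%:R^-1 * \sum_(0 <= a < M.+1) 2^-1 * v n.
  by rewrite avg_cst.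
rewrite -mulrBr -sumrB normrM (ger0_norm (Mi0 M)) /mu mulrCA ler_wpM2l//.
apply: (le_trans (ler_norm_sum _ _ _)).
apply: (@le_trans _ _ (\sum_(0 <= a < M.+1) 2^-1 * (delta a + delta (adist a n)))).
  apply: ler_sum => a _.
  rewrite (_ : _ - _ = 2^-1 * ((v a - vinf) - (v (adist a n) - vinf))); last by ring.
  by rewrite normrM ger0_norm// ler_wpM2l// (le_trans (ler_normB _ _)).
rewrite -mulr_sumr big_split/=.
have := sum_delta_adist nM; have D0 : 0 <= Dl M.+1 by apply: sumr_ge0.
rewrite -/(Dl M.+1); lra.
Qed.

Lemma averages_cov M N : (M <= N)%N ->
  `|\int[P]_w (averages M w * averages N w) - 2^-1 * vinf| <= 3 * (mu M + mu N).
Proof.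
move=> MN.
have -> : \int[P]_w (averages M w * averages N w) =
    M.+1%:R^-1 * \sum_(0 <= a < M.+1) \int[P]_w (averages N w * partial a w).
  transitivity (\int[P]_w (M.+1%:R^-1 * \sum_(0 <= a < M.+1) (averages N w * partial a w))).
    apply: eq_Rintegral => w _; rewrite {1}/averages -mulrA mulr_suml; congr (_ * _).
    by apply: eq_bigr => a _; rewrite mulrC.
  have Iap a : Int P (fun w => averages N w * partial a w).
    by apply: L2_mul; [exact: L2_averages|exact: L2_partial].
  by rewrite ExZ; [rewrite Ex_sum|apply: Int_sum => a _].
have -> : 2^-1 * vinf = M.+1%:R^-1 * \sum_(0 <= a < M.+1) 2^-1 * vinf.
  by rewrite avg_cst.
rewrite -mulrBr -sumrB normrM (ger0_norm (Mi0 M)).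
have mu0 K : 0 <= mu K by apply: mulr_ge0 => //; exact: sumr_ge0.
apply: (@le_trans _ _ (M.+1%:R^-1 * \sum_(0 <= a < M.+1) (2 * mu N + 2^-1 * delta a))).
  rewrite ler_wpM2l//; apply: (le_trans (ler_norm_sum _ _ _)).
  apply: ler_sum_nat => a /andP[_ aM].
  have aN : (a <= N)%N by apply: leq_trans MN; rewrite -ltnS.
  rewrite (_ : _ - _ = (\int[P]_w (averages N w * partial a w) - 2^-1 * v a) +
    2^-1 * (v a - vinf)); last by ring.
  apply: (le_trans (ler_normD _ _)); apply: lerD; first exact: averages_partial.
  by rewrite normrM ger0_norm.
rewrite big_split/= mulrDr avg_cst.
rewrite -mulr_sumr [M.+1%:R^-1 * (2^-1 * _)]mulrCA -/(Dl M.+1) -/(mu M).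
have := mu0 M; have := mu0 N; lra.
Qed.

(* The primitive is the partial sum recentred by the L2 limit of the Cesaro means
   of the partial sums. *)
Lemma stationary_primitive : exists V, L2_weakly_stationary P V /\
  forall n w, Z n w = V n.+1 w - V n w.
Proof.
have [A hA cA] : exists2 A, L2 P A &
    (fun k => \int[P]_w ((A w - averages k w) ^+ 2)) @ \oo --> 0.
  apply: L2_complete; first exact: L2_averages.
  (* Expanding the square produces 12 times [mu k] and 12 times [mu l], hence the fraction
     [e / 24]. *)
  move=> e e0; have [n0 hn0] := mu_small (divr_gt0 e0 (ltr0Sn R 23)).
  exists n0 => k l kn ln.
  wlog kl : k l kn ln / (k <= l)%N => [h|].
    have [/h|/ltnW/h h'] := leqP k l; first exact.
    rewrite (_ : \int[P]_w _ = \int[P]_w ((averages l w - averages k w) ^+ 2)).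
      exact: h'.
    by apply: eq_Rintegral => w _; ring.
  have [_ Ik] := L2_averages k; have [_ Il] := L2_averages l.
  have Ikl := L2_mul (L2_averages k) (L2_averages l).
  have -> : \int[P]_w ((averages k w - averages l w) ^+ 2) =
      \int[P]_w (averages k w * averages k w + (averages l w * averages l w -
        2 * (averages k w * averages l w))).
    by apply: eq_Rintegral => w _; ring.
  have Ik' := L2_mul (L2_averages k) (L2_averages k).
  have Il' := L2_mul (L2_averages l) (L2_averages l).
  rewrite ExD//; last by apply: IntB => //; exact: IntZ.
  rewrite ExB//; last exact: IntZ.
  rewrite ExZ//.
  have := averages_cov (leqnn k); have := averages_cov (leqnn l); have := averages_cov kl.
  rewrite !ler_norml => /andP[a1 a2] /andP[b1 b2] /andP[c1 c2].
  have := hn0 k kn; have := hn0 l ln; lra.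
have closed (u : nat -> R) (a b e : R) : u @ \oo --> a ->
    (exists n0, forall l, (n0 <= l)%N -> `|u l - b| <= e) -> `|a - b| <= e.
  move=> ua [n0 hn0]; apply: (@lim_dist_le R (fun l => u (l + n0)%N) (fun=> b) a b e).
  - by rewrite (cvg_shiftn n0).
  - exact: cvg_cst.
  - by move=> l; apply: hn0; rewrite leq_addl.
have EAS n : \int[P]_w (A w * partial n w) = 2^-1 * v n.
  apply/eqP; rewrite -subr_eq0 -normr_le0; apply/ler_addgt0Pr => e e0; rewrite add0r.
  have [n0 hn0] := mu_small (divr_gt0 e0 (ltr0Sn R 1)).
  apply: (closed _ _ _ _ (L2_cvg hA L2_averages (L2_partial n) cA)).
  exists (maxn n n0) => M; rewrite geq_max => /andP[nM n0M].
  by apply: (le_trans (averages_partial nM)); have := hn0 M n0M; lra.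
have EAA : \int[P]_w (A w * A w) = 2^-1 * vinf.
  apply/eqP; rewrite -subr_eq0 -normr_le0; apply/ler_addgt0Pr => e e0; rewrite add0r.
  have [n0 hn0] := mu_small (divr_gt0 e0 (ltr0Sn R 5)).
  apply: (closed _ _ _ _ (L2_cvg hA L2_averages hA cA)); exists n0 => k kn.
  have -> : \int[P]_w (averages k w * A w) = \int[P]_w (A w * averages k w).
    by apply: eq_Rintegral => w _; rewrite mulrC.
  apply: (closed _ _ _ _ (L2_cvg hA L2_averages (L2_averages k) cA)); exists n0 => l ln.
  have hk := hn0 k kn; have hl := hn0 l ln.
  have [kl|/ltnW lk] := leqP k l; last by apply: (le_trans (averages_cov lk)); lra.
  have -> : \int[P]_w (averages l w * averages k w) = \int[P]_w (averages k w * averages l w).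
    by apply: eq_Rintegral => w _; rewrite mulrC.
  by apply: (le_trans (averages_cov kl)); lra.
have EA : \int[P]_w A w = 0.
  have L21 : L2 P (fun=> 1).
    by split; [exact: measurable_cst|rewrite expr1n; exact: Int_cst].
  have h := L2_cvg hA L2_averages L21 cA.
  apply/eqP; rewrite -normr_le0 -[X in `|X|]subr0.
  apply: (closed (fun k => \int[P]_w (averages k w * 1))).
    by under [X in _ --> X]eq_Rintegral => w _ do rewrite -[A w]mulr1.
  exists 0%N => l _; rewrite subr0.
  rewrite (_ : \int[P]_w _ = 0) ?normr0//.
  transitivity (\int[P]_w (l.+1%:R^-1 * \sum_(0 <= k < l.+1) partial k w)).
    by apply: eq_Rintegral => w _; rewrite mulr1.
  have Ip k : Int P (partial k) by exact: L2_Int (L2_partial k).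
  rewrite ExZ; last by apply: Int_sum.
  by rewrite Ex_sum// big1 ?mulr0// => k _; exact: Ex_partial.
pose V n w := partial n w - A w.
have LV n : L2 P (V n) by apply: L2B; [exact: L2_partial|exact: hA].
have EV n : \int[P]_w V n w = 0.
  by rewrite /V ExB; [rewrite Ex_partial EA subrr|exact: L2_Int (L2_partial n)|exact: L2_Int hA].
(* The terms [v n] and [v m] cancel; what remains depends only on the distance of the indices, which
   is wide-sense stationarity of the centred process. *)
have EVV n m : \int[P]_w (V n w * V m w) = 2^-1 * (vinf - v (adist n m)).
  transitivity (\int[P]_w (partial n w * partial m w - (A w * partial n w +
      (A w * partial m w - A w * A w)))).
    by apply: eq_Rintegral => w _; rewrite /V; ring.
  have Ln := L2_partial n; have Lm := L2_partial m.
  have I1 := L2_mul hA Ln; have I2 := L2_mul hA Lm; have I3 := L2_mul hA hA.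
  have I4 := L2_mul Ln Lm.
  have I5 : Int P (fun w => A w * partial m w - A w * A w) by exact: IntB.
  rewrite ExB//; last exact: IntD.
  by rewrite ExD// ExB// !EAS EAA partial_cov; field.
exists V; split; last first.
  by move=> n w; rewrite /V /partial big_nat_recr//=; ring.
split.
- by move=> n; exact: L2_Lfun.
- by move=> n; rewrite unlock !(integralEFin (L2_Int (LV _))) !EV.
- move=> n m k; rewrite !covariance_Ex// !EV !EVV; congr ((2^-1 * (_ - v _) - _)%:E).
  by rewrite /adist !subnDr.
Qed.

End stationary_primitive.

(** * Growth of the variances *)

Lemma window_length (i N N1 : nat) : (N1 <= N)%N -> (i.+1 * N1 <= i * N + i)%N ->
  (N <= (N - N1).+1 * i.+1)%N.
Proof. nia. Qed.

Section variance_growth.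
Context (R : realType) d (T : measurableType d) (P : probability T R).
Context d' (T' : measurableType d') (P' : probability T' R) (ell : nat).
Variables (f : 'I_ell -> nat -> T -> R) (f' : 'I_ell -> nat -> T' -> R).
Variables (r : 'I_ell -> nat -> R) (h : nat -> R) (S : R).
Hypothesis h_ge0 : forall k, 0 <= h k.
Hypothesis hS : forall n, \sum_(0 <= k < n) k.+1%:R * h k <= S.
Hypothesis Lf : forall i n, L2 P (f i n).
Hypothesis Lf' : forall i n, L2 P' (f' i n).

Definition fcov i j n m := \int[P]_w (f i n w * f j m w).

Hypothesis cd : forall (i j : 'I_ell) n m, (j.+1 * m <= i.+1 * n)%N ->
  `|fcov i j n m| <= h (minn n (i.+1 * n - j.+1 * m)).
Hypothesis rd : forall i k, `|r i k| <= h k.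
Hypothesis crd : forall (i : 'I_ell) m k, (ell * k <= m)%N ->
  `|fcov i i (m + k)%N m - r i k| <= h (m - ell * k).
Hypothesis ray : forall (i j : 'I_ell) n0 m0,
  cvgn (fun t => fcov i j (n0 + j.+1 * t)%N (m0 + i.+1 * t)%N).
Hypothesis exd : forall i n, `|\int[P]_w f i n w| <= h n.
Hypothesis Ef' : forall i n, \int[P']_w f' i n w = 0.
Hypothesis Eff' : forall i j n m, \int[P']_w (f' i n w * f' j m w) =
  if i == j then r i (adist n m) else 0.

Let csym i j n m : fcov i j n m = fcov j i m n.
Proof. by apply: eq_Rintegral => w _; rewrite mulrC. Qed.

Definition slotsum i N w := \sum_(1 <= n < N.+1) f i n w.
Definition pieces_sum N w := \sum_(1 <= n < N.+1) \sum_i f i n w.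
Definition copies_sum N w := \sum_(1 <= n < N.+1) \sum_i f' i n w.

Let allp : nat -> nat -> bool := fun _ _ => true.

Lemma L2_slotsum i N : L2 P (slotsum i N).
Proof. by apply: L2_sum => n; exact: Lf. Qed.

Lemma pieces_sumE N w : pieces_sum N w = \sum_i slotsum i N w.
Proof. by rewrite /pieces_sum exchange_big. Qed.

Lemma L2_pieces_sum N : L2 P (pieces_sum N).
Proof. by apply: L2_sum => n; apply: L2_sum => i; exact: Lf. Qed.

Lemma L2_copies_sum N : L2 P' (copies_sum N).
Proof. by apply: L2_sum => n; apply: L2_sum => i; exact: Lf'. Qed.

Lemma slotsum_cov i j N : \int[P]_w (slotsum i N w * slotsum j N w) = psum N allp (fcov i j).
Proof. by rewrite Ex_mul_sum. Qed.

Lemma pieces_sum_square N : \int[P]_w (pieces_sum N w ^+ 2) = \sum_i \sum_j psum N allp (fcov i j).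
Proof.
transitivity (\int[P]_w ((\sum_i slotsum i N w) * (\sum_i slotsum i N w))).
  by apply: eq_Rintegral => w _; rewrite pieces_sumE expr2.
rewrite Ex_mul_sum; [|by move=> i; exact: L2_slotsum|by move=> i; exact: L2_slotsum].
by apply: eq_bigr => i _; apply: eq_bigr => j _; exact: slotsum_cov.
Qed.

Lemma sum_copies_cov n m : \int[P']_w ((\sum_i f' i n w) * (\sum_i f' i m w)) =
  \sum_i r i (adist n m).
Proof.
rewrite Ex_mul_sum//; apply: eq_bigr => i _.
rewrite (bigD1 i)//= Eff' eqxx big1 ?addr0// => j ji.
by rewrite Eff' eq_sym (negbTE ji).
Qed.

Lemma copies_sum_square N : \int[P']_w (copies_sum N w ^+ 2) = \sum_i toeplitz (r i) N.
Proof.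
transitivity (\int[P']_w (copies_sum N w * copies_sum N w)).
  by apply: eq_Rintegral => w _; rewrite expr2.
rewrite Ex_mul_sum; [|by move=> n; apply: L2_sum|by move=> n; apply: L2_sum].
rewrite /toeplitz [RHS]exchange_big; apply: eq_bigr => n _.
by rewrite [RHS]exchange_big; apply: eq_bigr => m _; exact: sum_copies_cov.
Qed.

Lemma copies_sum_mean N : \int[P']_w copies_sum N w = 0.
Proof.
rewrite /copies_sum Ex_sum; last by move=> n _; apply: Int_sum => i _; exact: L2_Int.
rewrite big1// => n _; rewrite Ex_sum; last by move=> i _; exact: L2_Int.
by rewrite big1.
Qed.

Lemma pieces_sum_mean N : `|\int[P]_w pieces_sum N w| <= ell%:R * S.
Proof.
rewrite (_ : \int[P]_w _ = \int[P]_w \sum_i slotsum i N w); last first.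
  by apply: eq_Rintegral => w _; rewrite pieces_sumE.
rewrite Ex_sum; last by move=> i _; exact: L2_Int (L2_slotsum i N).
apply: (le_trans (ler_norm_sum _ _ _)).
apply: (@le_trans _ _ (\sum_(i < ell) S)); last by rewrite sumr_const card_ord mulr_natl.
apply: ler_sum => i _; rewrite /slotsum Ex_sum; last by move=> n _; exact: L2_Int.
exact: (ex_sum h_ge0 hS).
Qed.

Lemma toeplitz_ge0 i N : 0 <= toeplitz (r i) N.
Proof.
have -> : toeplitz (r i) N = \int[P']_w ((\sum_(1 <= n < N.+1) f' i n w) *
    (\sum_(1 <= n < N.+1) f' i n w)).
  rewrite Ex_mul_sum//; apply: eq_bigr => n _; apply: eq_bigr => m _.
  by rewrite Eff' eqxx.
by apply: Ex_ge0 => w; rewrite -expr2 sqr_ge0.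
Qed.

Lemma linear_ge (a b C : R) : (forall N, N%:R * a <= N%:R * b + C) -> a <= b.
Proof.
move=> hN; rewrite leNgt; apply/negP => ba.
have ab0 : 0 < a - b by rewrite subr_gt0.
have C0 : 0 <= C by have := hN 0%N; rewrite !mul0r add0r.
have hB := archi_boundP (divr_ge0 C0 (ltW ab0)).
rewrite ltr_pdivrMr// in hB; have := hN (Num.bound (C / (a - b))).
rewrite mulrBr in hB; lra.
Qed.

Lemma sqr_sum_le (Q : pred 'I_ell) (x : 'I_ell -> R) :
  (\sum_(i | Q i) x i) ^+ 2 <= ell%:R * \sum_(i | Q i) x i ^+ 2.
Proof.
rewrite expr2 mulr_suml.
have h1 (i : 'I_ell) : x i * (\sum_(j | Q j) x j) <=
    2^-1 * (ell%:R * x i ^+ 2 + \sum_(j | Q j) x j ^+ 2).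
  rewrite mulr_sumr.
  apply: (@le_trans _ _ (\sum_(j | Q j) 2^-1 * (x i ^+ 2 + x j ^+ 2))).
    apply: ler_sum => j _; rewrite -subr_ge0.
    rewrite (_ : _ - _ = 2^-1 * (x i - x j) ^+ 2); last by field.
    by apply: mulr_ge0 => //; exact: sqr_ge0.
  rewrite -mulr_sumr ler_wpM2l// big_split/= lerD2r sumr_const -[x i ^+ 2 *+ _]mulr_natl.
  rewrite ler_wpM2r ?sqr_ge0// ler_nat -[leqRHS](card_ord ell).
  exact: max_card.
apply: (le_trans (ler_sum _ (fun i _ => h1 i))).
rewrite -mulr_sumr big_split/= sumr_const -mulr_sumr.
set A := \sum_(i | Q i) _; have A0 : 0 <= A by apply: sumr_ge0 => i _; exact: sqr_ge0.
have : A *+ #|[pred i | Q i]| <= ell%:R * A.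
  rewrite -[A *+ _]mulr_natl ler_wpM2r// ler_nat -[leqRHS](card_ord ell); exact: max_card.
lra.
Qed.

Lemma slotsum_toeplitz : exists D, forall i N,
  `|psum N allp (fcov i i) - toeplitz (r i) N| <= D.
Proof.
have [D hD] := diag_error h_ge0 hS csym cd rd crd.
exists D => i N; apply: le_trans (hD i N).
rewrite /psum /toeplitz -sumrB; apply: (le_trans (ler_norm_sum _ _ _)).
apply: ler_sum => n _; rewrite -sumrB; exact: ler_norm_sum.
Qed.

Section slope.
Variables (s : 'I_ell -> R) (B : R).
Hypothesis sB : forall i N, `|toeplitz (r i) N - N%:R * s i| <= B.

Lemma slope_ge0 i : 0 <= s i.
Proof.
apply: (@linear_ge 0 (s i) B) => N; rewrite mulr0.
have := sB i N; have := toeplitz_ge0 i N; rewrite ler_norml => ? /andP[]; lra.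
Qed.

(** Second moments along [X] differ from the Toeplitz sums by a bounded amount, and these are
    bounded at zero slope; Cauchy-Schwarz combines the slots. *)
Lemma flat_slots (Q : pred 'I_ell) : (forall i, Q i -> s i = 0) -> exists C, forall N,
  \int[P]_w ((\sum_(i | Q i) slotsum i N w) ^+ 2) <= C.
Proof.
move=> Q0; have [D hD] := slotsum_toeplitz.
exists (ell%:R * \sum_(i | Q i) (B + D)) => N.
have L i := L2_slotsum i N.
apply: (@le_trans _ _ (\int[P]_w (ell%:R * \sum_(i | Q i) slotsum i N w ^+ 2))).
  apply: Ex_le; [exact: (L2_sum _ _ L).2|by apply: IntZ; apply: Int_sum => i _; exact: (L i).2|].
  by move=> w; exact: sqr_sum_le.
rewrite ExZ; last by apply: Int_sum => i _; exact: (L i).2.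
rewrite ler_wpM2l// Ex_sum; last by move=> i _; exact: (L i).2.
apply: ler_sum => i Qi.
rewrite (_ : \int[P]_w _ = psum N allp (fcov i i)); last first.
  by rewrite -slotsum_cov; apply: eq_Rintegral => w _; rewrite expr2.
have := hD i N; have := sB i N; rewrite (Q0 i Qi) mulr0 subr0.
by rewrite !ler_norml => /andP[_ ?] /andP[_ ?]; lra.
Qed.

(* Beyond time [i N / (i + 1)] the piece [i] looks past the whole range seen by
   the lower pieces, hence is almost uncorrelated with them. *)
Lemma steep_slot (i : 'I_ell) : (forall j : 'I_ell, (i < j)%N -> s j = 0) ->
  exists C, forall N, N%:R * (2^-1 * (s i / i.+1%:R)) <= \int[P]_w (pieces_sum N w ^+ 2) + C.
Proof.
move=> top; have [D hD] := diag_error h_ge0 hS csym cd rd crd.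
have [C hC] := flat_slots top.
have s0 := slope_ge0 i.
exists ((2 * S + 2 * S) + \sum_(j < ell | (j < i)%N) (3 * S + 2 * S) +
  2^-1 * (B + D + s i) + C) => N.
(* The least integer not below [i N / (i + 1)]. *)
pose N1 := ((i * N + i) %/ i.+1)%N.
have N1b : (i * N <= i.+1 * N1)%N /\ (i.+1 * N1 <= i * N + i)%N.
  have := divn_eq (i * N + i) i.+1; rewrite -/N1 [(N1 * _)%N]mulnC.
  have : ((i * N + i) %% i.+1 < i.+1)%N by rewrite ltn_mod.
  by set a := (i.+1 * N1)%N; set b := (i * N)%N; set c := (_ %% _)%N; lia.
have N1N : (N1 <= N)%N.
  rewrite -ltnS -(@ltn_pmul2l i.+1)//; apply: (leq_ltn_trans N1b.2).
  by rewrite mulnS mulSn; lia.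
pose Bw w := \sum_(N1.+1 <= n < N.+1) f i n w.
pose A1 w := \sum_(1 <= n < N1.+1) f i n w.
pose A2 w := \sum_(j < ell | (j < i)%N) slotsum j N w.
pose Dw w := \sum_(j < ell | (i < j)%N) slotsum j N w.
have LB : L2 P Bw by apply: L2_sum.
have LA1 : L2 P A1 by apply: L2_sum.
have LA2 : L2 P A2 by apply: L2_sum => j; exact: L2_slotsum.
have LD : L2 P Dw by apply: L2_sum => j; exact: L2_slotsum.
have tE w : pieces_sum N w = A2 w + (A1 w + Bw w) + Dw w.
  rewrite pieces_sumE (bigID (fun j : 'I_ell => (j < i)%N))/= -addrA; congr (_ + _).
  rewrite (bigD1 i) ?ltnn//=; congr (_ + _).
    by rewrite /slotsum (big_cat_nat (n := N1.+1))//=.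
  apply: eq_bigl => j; rewrite -leqNgt ltn_neqAle andbC; congr (_ && _).
  by rewrite eq_sym.
have BE (F : nat -> R) : \sum_(N1.+1 <= n < N.+1) F n = \sum_(1 <= n < N.+1 | (N1 < n)%N) F n.
  by rewrite (big_nat_widenl _ 1).
have AE (F : nat -> R) : \sum_(1 <= n < N1.+1) F n = \sum_(1 <= n < N.+1 | (n <= N1)%N) F n.
  by rewrite (big_nat_widen _ _ N.+1)//; apply: eq_bigl => n; rewrite ltnS.
have SH (F : nat -> R) : \sum_(N1.+1 <= n < N.+1) F n = \sum_(1 <= n < (N - N1).+1) F (n + N1)%N.
  by rewrite -[N1.+1]add1n big_addn subSn.
have T1 : `|\int[P]_w (Bw w * A1 w)| <= 2 * S + 2 * S.
  apply: le_trans (cross_diag h_ge0 hS cd i N N1).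
  rewrite Ex_mul_sum// BE; apply: (le_trans (ler_norm_sum _ _ _)).
  rewrite /psum big_mkcond; apply: ler_sum => n _; case: ifP => nN; last exact: sumr_ge0.
  rewrite AE; apply: (le_trans (ler_norm_sum _ _ _)).
  by rewrite le_eqVlt; apply/orP; left; apply/eqP; apply: eq_bigl => m; rewrite andbT.
have T2 : `|\int[P]_w (Bw w * A2 w)| <= \sum_(j < ell | (j < i)%N) (3 * S + 2 * S).
  have -> : \int[P]_w (Bw w * A2 w) = \sum_(j < ell | (j < i)%N) \int[P]_w (Bw w * slotsum j N w).
    rewrite -Ex_sum; last by move=> j _; apply: L2_mul => //; exact: L2_slotsum.
    by apply: eq_Rintegral => w _; rewrite mulr_sumr.
  apply: (le_trans (ler_norm_sum _ _ _)); apply: ler_sum => j ji.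
  apply: le_trans (cross_lower h_ge0 hS cd ji N1N N1b.1).
  rewrite Ex_mul_sum// BE; apply: (le_trans (ler_norm_sum _ _ _)).
  rewrite /psum big_mkcond; apply: ler_sum => n _; case: ifP => nN; last exact: sumr_ge0.
  exact: ler_norm_sum.
have T3 : toeplitz (r i) (N - N1) - D <= \int[P]_w (Bw w * Bw w).
  have -> : toeplitz (r i) (N - N1) = \sum_(N1.+1 <= n < N.+1) \sum_(N1.+1 <= m < N.+1) r i (adist n m).
    rewrite /toeplitz SH; apply: eq_bigr => n _; rewrite SH; apply: eq_bigr => m _.
    by congr r; rewrite /adist !subnDr.
  rewrite Ex_mul_sum// lerBlDr -lerBlDl -sumrB -/(fcov i i).
  apply: le_trans (hD i N); rewrite BE.
  apply: (@le_trans _ _ (\sum_(1 <= n < N.+1 | (N1 < n)%N) \sum_(N1.+1 <= m < N.+1)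
     `|fcov i i n m - r i (adist n m)|)).
    apply: ler_sum => n _; rewrite -sumrB; apply: ler_sum => m _.
    by rewrite -normrN opprB; exact: ler_norm.
  rewrite /psum big_mkcond; apply: ler_sum => n _; case: ifP => nN; last exact: sumr_ge0.
  rewrite BE big_mkcond; apply: ler_sum => m _; case: ifP => mN //.
have T4 := hC N; rewrite -/Dw in T4.
have IBB := L2_mul LB LB; have IB1 := L2_mul LB LA1; have IB2 := L2_mul LB LA2.
have ID2 := LD.2.
(* With [A = A1 + A2], the square of [A + B + D] exceeds [B A + B^2 / 2 - D^2] by half a sum of two
   squares, so [A] enters only through its correlation with [B]. *)
have low : \int[P]_w (Bw w * A2 w + Bw w * A1 w + 2^-1 * (Bw w * Bw w) - Dw w ^+ 2) <=
    \int[P]_w (pieces_sum N w ^+ 2).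
  apply: Ex_le; [|exact: (L2_pieces_sum N).2|].
    by apply: IntB => //; apply: IntD; [exact: IntD|exact: IntZ].
  move=> w; rewrite tE -subr_ge0.
  rewrite (_ : _ - _ = 2^-1 * ((A2 w + (A1 w + Bw w) + 2 * Dw w) ^+ 2 + (A1 w + A2 w) ^+ 2)).
    by apply: mulr_ge0 => //; apply: addr_ge0; exact: sqr_ge0.
  by field.
rewrite ExB// in low; last by apply: IntD; [exact: IntD|exact: IntZ].
rewrite ExD// in low; [|exact: IntD|exact: IntZ].
rewrite ExD// ExZ// in low.
have K1 : N%:R * (s i / i.+1%:R) <= (N - N1)%:R * s i + s i.
  rewrite mulrA ler_pdivrMr// [leRHS](_ : _ = ((N - N1).+1 * i.+1)%:R * s i); last first.
    by rewrite natrM -(natr1 (N - N1)); ring.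
  rewrite ler_wpM2r// ler_nat; exact: window_length N1N N1b.2.
have K2 := sB i (N - N1); rewrite ler_norml in K2; have /andP[K3 _] := K2.
rewrite !ler_norml in T1 T2; have /andP[T1' _] := T1; have /andP[T2' _] := T2.
have K4 : N%:R * (2^-1 * (s i / i.+1%:R)) <= 2^-1 * ((N - N1)%:R * s i + s i).
  by rewrite mulrCA ler_wpM2l.
apply: (le_trans K4); move: low T1' T2' T3 T4 K3; lra.
Qed.

(** Pairs of distinct pieces have a slope by convergence along their ray, equal ones by comparison
    with the copies. *)
Lemma pieces_sum_slope : exists Lam : R,
  sublinear (fun N => \int[P]_w (pieces_sum N w ^+ 2) - N%:R * Lam).
Proof.
have pair (i j : 'I_ell) : exists L : R, sublinear (fun N => psum N allp (fcov i j) - N%:R * L).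
  case: (ltngtP i j) => ij.
  - exact: (ray_mean h_ge0 hS csym cd ray ij).
  - have [L hL] := ray_mean h_ge0 hS csym cd ray ij.
    exists L; apply: sublinear_ext hL => N; rewrite psum_sym; congr (_ - _).
    by apply: eq_bigr => n _; apply: eq_bigr => m _; exact: csym.
  - have {ij}<- : i = j by exact: val_inj.
    have [D hD] := slotsum_toeplitz; exists (s i).
    apply: (@sublinear_bounded _ _ (D + B)) => N.
    by apply: le_trans (lerD (hD i N) (sB i N)); apply: le_trans (ler_normD _ _); rewrite subrKA.
pose L i j := sval (cid (pair i j)); have hL i j := svalP (cid (pair i j)).
exists (\sum_i \sum_j L i j).
apply: sublinear_ext (sublinear_sum _ (fun i => sublinear_sum _ (fun j => hL i j))) => N /=.
rewrite pieces_sum_square mulr_sumr -sumrB; apply: eq_bigr => i _.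
by rewrite mulr_sumr -sumrB.
Qed.

Lemma copies_sum_slope N : `|\int[P']_w (copies_sum N w ^+ 2) - N%:R * \sum_i s i| <= ell%:R * B.
Proof.
rewrite copies_sum_square mulr_sumr -sumrB; apply: (le_trans (ler_norm_sum _ _ _)).
apply: (@le_trans _ _ (\sum_(i < ell) B)); last by rewrite sumr_const card_ord mulr_natl.
by apply: ler_sum => i _.
Qed.

Lemma copies_sum_mean_square :
  N%:R^-1 * \int[P']_w (copies_sum N w ^+ 2) @[N --> \oo] --> \sum_i s i.
Proof.
exact: sublinear_slope (sublinear_bounded copies_sum_slope).
Qed.

Lemma slopes_eq0 : \sum_i s i = 0 -> forall i, s i = 0.
Proof.
move=> /eqP s0 i; move: s0; rewrite psumr_eq0 => [/allP/(_ i)|j _].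
  by rewrite mem_index_enum => /(_ isT)/eqP.
exact: slope_ge0.
Qed.

Lemma flat_pieces_sum : \sum_i s i = 0 -> exists C, forall N, \int[P]_w (pieces_sum N w ^+ 2) <= C.
Proof.
move=> s0; have z (i : 'I_ell) : true -> s i = 0 by move=> _; exact: slopes_eq0.
have [C hC] := flat_slots z; exists C => N; apply: le_trans (hC N).
by rewrite le_eqVlt; apply/orP; left; apply/eqP; apply: eq_Rintegral => w _; rewrite pieces_sumE.
Qed.

Lemma bounded_copies_sum : \sum_i s i = 0 <-> exists M, forall N, \int[P']_w (copies_sum N w ^+ 2) <= M.
Proof.
split=> [s0|[M hM]].
  exists (ell%:R * B) => N; have := copies_sum_slope N.
  by rewrite s0 mulr0 subr0; apply: le_trans; exact: ler_norm.
apply/eqP; rewrite eq_le sumr_ge0 ?andbT; last by move=> i _; exact: slope_ge0.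
apply: (@linear_ge _ 0 (M + ell%:R * B)) => N; rewrite mulr0 add0r.
have := copies_sum_slope N; have := hM N; rewrite ler_norml => ? /andP[]; lra.
Qed.

Lemma pieces_sum_variance_slope (Lam : R) :
  sublinear (fun N => \int[P]_w (pieces_sum N w ^+ 2) - N%:R * Lam) ->
  N%:R^-1 * (\int[P]_w (pieces_sum N w ^+ 2) - (\int[P]_w pieces_sum N w) ^+ 2) @[N --> \oo] --> Lam.
Proof.
move=> hL; apply: sublinear_slope.
have hb N : `|- (\int[P]_w pieces_sum N w) ^+ 2| <= (ell%:R * S) ^+ 2.
  rewrite normrN normrX; have := pieces_sum_mean N.
  by rewrite -[in X in X -> _](normr_id (\int[P]_w _)); move/(lerXn2r 2); rewrite !nnegrE normr_id;
    apply; rewrite // (le_trans _ (pieces_sum_mean N)).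
by apply: sublinear_ext (sublinearD hL (sublinear_bounded hb)) => N; rewrite addrAC.
Qed.

(** If all slopes vanish, the second moments are bounded and [Lam] cannot be positive; otherwise the
    largest index of positive slope forces linear growth through [steep_slot]. *)
Lemma slope_pos (Lam : R) :
  sublinear (fun N => \int[P]_w (pieces_sum N w ^+ 2) - N%:R * Lam) ->
  0 < Lam <-> 0 < \sum_i s i.
Proof.
move=> hL; split=> [L0|].
  rewrite lt_neqAle sumr_ge0 ?andbT; last by move=> i _; exact: slope_ge0.
  apply/eqP => s0; have [C hC] := flat_pieces_sum (esym s0).
  have h2 : 0 < 2^-1 * Lam by rewrite mulr_gt0.
  have [D hD] := hL _ h2.
  have : Lam <= 2^-1 * Lam; last by lra.
  apply: (@linear_ge _ _ (C + D)) => N.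
  have := hC N; have := hD N; rewrite ler_norml => /andP[]; lra.
move=> s0; have [i0 si0] : exists i : 'I_ell, 0 < s i.
  apply/not_existsP => ns; move: s0; rewrite big1 ?ltxx// => i _.
  by apply/eqP; rewrite eq_le slope_ge0 andbT leNgt; apply/negP; exact: ns.
case: (@arg_maxnP _ i0 (fun i => 0 < s i) (fun i : 'I_ell => val i) si0) => i si imax.
have [C hC] : exists C, forall N, N%:R * (2^-1 * (s i / i.+1%:R)) <= \int[P]_w (pieces_sum N w ^+ 2) + C.
  apply: steep_slot => j ij; apply/eqP; rewrite eq_le slope_ge0 andbT leNgt.
  by apply/negP => /imax/=; rewrite leqNgt ij.
set a := 2^-1 * _ in hC; have a0 : 0 < a by rewrite mulr_gt0 ?divr_gt0.
have h2 : 0 < 2^-1 * a by rewrite mulr_gt0.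
have [D hD] := hL _ h2.
apply: (lt_le_trans h2); suff : a <= 2^-1 * a + Lam by lra.
apply: (@linear_ge _ _ (C + D)) => N.
have := hC N; have := hD N; rewrite ler_norml => /andP[_]; lra.
Qed.

(** The sums telescope to a difference of two values of [V], whose second moments do not depend on
    time. *)
Lemma coboundary_bounded (V : nat -> T' -> R) : L2_weakly_stationary P' V ->
  coboundary P' (fun n w => \sum_i f' i n w) V ->
  exists M, forall N, \int[P']_w (copies_sum N w ^+ 2) <= M.
Proof.
move=> [VL VE Vcov] VZ.
have LV n := Lfun_L2 (VL n).
have V2 n : \int[P']_w (V n w ^+ 2) = \int[P']_w (V 0%N w ^+ 2).
  have := Vcov 0%N 0%N n; rewrite !add0n !covariance_Ex// => -[].
  have := VE n; rewrite unlock !integralEFin; [|exact: L2_Int..].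
  move=> [->] /addIr e; rewrite (_ : \int[P']_w (V n w ^+ 2) = \int[P']_w (V n w * V n w)).
    by rewrite e; apply: eq_Rintegral => w _; rewrite expr2.
  by apply: eq_Rintegral => w _; rewrite expr2.
exists (4 * \int[P']_w (V 0%N w ^+ 2)) => N.
have ae : {ae P', forall w, copies_sum N w = V N.+1 w - V 1%N w}.
  have : {ae P', forall w, forall n, \sum_i f' i n w = V n.+1 w - V n w}.
    exact/ae_foralln.
  apply: filterS => w hw; rewrite /copies_sum (eq_bigr (fun n => V n.+1 w - V n w))//.
  by rewrite telescope_sumr.
have LW : L2 P' (fun w => V N.+1 w - V 1%N w) by exact: L2B.
have -> : \int[P']_w (copies_sum N w ^+ 2) = \int[P']_w ((V N.+1 w - V 1%N w) ^+ 2).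
  congr fine; apply: ae_eq_integral => //.
  - by apply/measurable_EFinP; exact: Int_meas (L2_copies_sum N).2.
  - by apply/measurable_EFinP; exact: Int_meas LW.2.
  - by apply: filterS ae => w /= -> _.
apply: (@le_trans _ _ (\int[P']_w (2 * V N.+1 w ^+ 2 + 2 * V 1%N w ^+ 2))).
  apply: Ex_le; [exact: LW.2|by apply: IntD; apply: IntZ; exact: (LV _).2|].
  move=> w; rewrite -subr_ge0 (_ : _ - _ = (V N.+1 w + V 1%N w) ^+ 2); first exact: sqr_ge0.
  by ring.
have I1 n : Int P' (fun w => V n w ^+ 2) := (LV n).2.
rewrite ExD; [|exact: IntZ..].
rewrite !ExZ// !V2; lra.
Qed.

Lemma flat_coboundary (d0 : 'I_ell -> R) :
  (forall i, toeplitz (r i) N @[N --> \oo] --> d0 i) ->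
  exists V, L2_weakly_stationary P' V /\
    coboundary P' (fun n w => \sum_i f' i n w) V.
Proof.
move=> hd.
have [|||V [V1 V2]] := @stationary_primitive _ _ _ P' (fun n w => \sum_i f' i n w)
  (fun k => \sum_i r i k) (\sum_i d0 i) _ _ sum_copies_cov.
- by move=> n; apply: L2_sum.
- move=> n; rewrite Ex_sum; last by move=> i _; exact: L2_Int.
  by rewrite big1.
- have := cvg_rsum (s := index_enum 'I_ell) (fun i (_ : xpredT i) => hd i).
  apply: cvg_trans; apply: near_eq_cvg; exists 0%N => // N _ /=.
  rewrite /toeplitz exchange_big; apply: eq_bigr => n _.
  by rewrite exchange_big.
exists V; split=> // n; apply: aeW => w; exact: V2.
Qed.

End slope.

End variance_growth.

Lemma adist_shift (A : Type) (x : nat -> nat -> A) : (forall n m, x n m = x m n) ->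
  (forall n m k, x (n + k)%N (m + k)%N = x n m) -> forall n m, x n m = x (adist n m) 0%N.
Proof.
move=> xs xk n m; wlog nm : n m / (n <= m)%N.
  by move=> h; case/orP: (leq_total n m) => nm; [exact: h|rewrite xs (h _ _ nm) /adist addnC].
by rewrite xs /adist (eqP nm) add0n -(xk _ 0%N n) subnK.
Qed.

Lemma L2_mean_le d (T : measurableType d) (R : realType) (P : probability T R) (x : T -> R) :
  L2 P x -> `|\int[P]_w x w| <= 1 + \int[P]_w (x w * x w).
Proof.
move=> Lx; have I2 := L2_mul Lx Lx.
rewrite -[X in X + _](Ex_cst P) -ExD//; last exact: Int_cst.
apply: Ex_absle; [exact: L2_Int|by apply: IntD => //; exact: Int_cst|].
by move=> w; move: (x w) => y; rewrite ler_norml; apply/andP; split; nra.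
Qed.

Lemma L2_Hol d (T : measurableType d) (R : realType) (P : probability T R) (I : finType) (kappa K a theta Gam : R) (zeta : I -> T -> R) g :
  0 < kappa <= 1 -> 0 <= a -> 0 <= Gam -> 2 * a <= theta -> momb P theta Gam zeta ->
  Hol kappa K a g -> L2 P (fun w => g (zeta^~ w)).
Proof.
move=> k01 a0 G0 ath mz gH; split.
  by apply: (measurable_Hol k01 a0 gH) => i; have [] := mz i.
have mz2 : momb P theta Gam (jn zeta zeta) by case=> i; exact: mz.
have ai : 0 <= 2 * a <= theta by rewrite mulr_ge0.
by apply: Int_ext (Int_Hol k01 ai mz2 (Hol_prod a0 gH gH)) _ => w; rewrite expr2.
Qed.

(** * The decomposition in the setting of the theorem *)

Section setting.
Context d (T : measurableType d) (R : realType) (P : probability T R).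
Context (wp ell : nat) (X : nat -> {RV P >-> wp.-tuple R}).
Variable FF : \bar int -> \bar int -> set (set T).
Hypothesis FF_family : sigma_algebra_family FF.
Hypothesis X_stationary : stationary_pairs X.
Variables (F : ell.-tuple (wp.-tuple R) -> R) (K iota kappa : R).
Hypotheses (K_gt0 : 0 < K) (iota_gt0 : 0 < iota) (kappa01 : 0 < kappa <= 1).
Hypothesis F_growth : growth_condition F K iota kappa.
Hypothesis F_centered : iter_integral (mu0 X) (EFin \o F) = 0%E.
Variables alpha lambda : R.
Hypotheses (alpha_ge1 : 1 <= alpha) (lambda_ge1 : 1 <= lambda).
Hypothesis HA : assumption_A ell X FF iota kappa 2 alpha lambda.
Context d' (T' : measurableType d') (P' : probability T' R).
Variable Y : 'I_ell -> nat -> {RV P' >-> wp.-tuple R}.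
Hypothesis Y_copies : independent_copies X Y.

(** Interface between probability and arithmetic: it reduces the setting to square integrable pieces
    whose covariances are controlled by the limits [r], the rays and a single summable rate [h]. *)
Lemma hoeffding_decomposition :
  exists (f : 'I_ell -> nat -> T -> R) (f' : 'I_ell -> nat -> T' -> R)
    (r : 'I_ell -> nat -> R) (h : nat -> R) (S : R),
  [/\ [/\ forall n w, F [tuple X (i.+1 * n)%N w | i < ell] = \sum_i f i n w &
          forall n w, Z_ F Y n w = \sum_i f' i n w],
      [/\ forall k, 0 <= h k, forall n, \sum_(0 <= k < n) k.+1%:R * h k <= S &
          (forall i n, L2 P (f i n)) /\ (forall i n, L2 P' (f' i n))],
      [/\ forall (i j : 'I_ell) n m, (j.+1 * m <= i.+1 * n)%N ->
            `|fcov P f i j n m| <= h (minn n (i.+1 * n - j.+1 * m)),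
          forall i k, `|r i k| <= h k &
          forall (i : 'I_ell) m k, (ell * k <= m)%N ->
            `|fcov P f i i (m + k)%N m - r i k| <= h (m - ell * k)%N],
      (forall (i j : 'I_ell) n0 m0,
        cvgn (fun t => fcov P f i j (n0 + j.+1 * t)%N (m0 + i.+1 * t)%N)) /\
      (forall i n, `|\int[P]_w f i n w| <= h n) &
      (forall i n, \int[P']_w f' i n w = 0) /\
      (forall i j n m, \int[P']_w (f' i n w * f' j m w) =
        if i == j then r i (adist n m) else 0)].
Proof.
have [_ _ _ [p [q [delta [m [[p1 q1 delta0 m0] dimP [sumv sumb] [gm gq] expo]]]]]] := HA.
have [p1' p'1 pp th1 [s'1 ss' th2 m2]] := exponents p1 q1 delta0 m0 iota_gt0 expo.
have deltak : delta < kappa.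
  apply: (lt_le_trans dimP); rewrite gerBl divr_ge0//; exact: le_trans p1.
have delta1 : delta < 1 by apply: (lt_le_trans deltak); case/andP: kappa01.
(* Assumption (A) gives moments of orders [m] and [b q iota] with [b = 2]; the larger order serves
   all estimates. *)
pose theta := Num.max m (2 * q * iota).
have mth : m <= theta by rewrite le_max lexx.
have thetap := le_trans th1 mth; have thetas := le_trans th2 mth.
have theta2 := lt_le_trans m2 mth.
have thetaq : 2 * q * iota <= theta by rewrite le_max lexx orbT.
have theta0 : 0 < theta by exact: lt_trans theta2.
have gth : (gamma_ X theta < +oo)%E by rewrite /theta maxEle; case: ifP.
have [Gam Gam0 hmom] := law_moment theta0 gth.
have mz n : momb P theta Gam (xcoord X n) := hmom _ _ _ (X n) (X_stationary.1 n).
have mY i n : momb P' theta Gam (fun c w => tnth (Y i n w) c).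
  apply: hmom => A mA; rewrite -(X_stationary.1 n A mA).
  have mA1 : measurable ((fun t : 1.-tuple (wp.-tuple R) => tnth t ord0) @^-1` A).
    by rewrite -[X in measurable X]setTI; exact: measurable_tnth.
  have := Y_copies.1 i 1%N [tuple n] _ mA1.
  rewrite /preimage/=; under eq_set do rewrite tnth_mktuple.
  by under [X in P X]eq_set do rewrite tnth_mktuple.
have [v [b [vb0 varpi_v beta_b [S gS]]]] :=
  mixing_rates FF_family q1 alpha_ge1 lambda_ge1 delta0 delta1 sumv sumb.
pose F0 (e : 'I_ell * 'I_wp -> R) := F (tup e).
have F0H := Hol_tup K_gt0 iota_gt0 kappa01 F_growth.
have K0_gt0 : 0 < K * (1 + 2 * ell%:R).
  by rewrite mulr_gt0// ltr_pwDl// mulr_ge0.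
pose g := gap delta v b.
have g_ge0 r : (0 < r)%N -> 0 <= g r.
  by move=> /vb0[v0 _]; rewrite addr_ge0 ?powR_ge0// ltW.
have {}gS n : \sum_(1 <= k < n) k%:R * g k <= S := gS n.
have [Cb hCb] := cov_bounded kappa01 iota_gt0 Gam0 s'1 thetas theta2 mz K0_gt0 F0H.
have [C1 [C1_ge0 cmix]] := cov_mixing FF_family kappa01 iota_gt0 p1' p'1 pp q1 thetap thetaq
  Gam0 delta0 deltak s'1 ss' thetas theta2 mz vb0 varpi_v beta_b dimP X_stationary K0_gt0 F0H.
have [C2 [C2_ge0 crho]] := cov_rho FF_family kappa01 iota_gt0 p1' p'1 pp q1 thetap thetaq
  Gam0 delta0 deltak s'1 ss' thetas theta2 mz vb0 varpi_v beta_b dimP K0_gt0 F0H.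
have [C3 [C3_ge0 exmix]] := mean_piece_mixing FF_family kappa01 iota_gt0 p1' p'1 pp q1 thetap
  thetaq Gam0 delta0 deltak s'1 ss' thetas theta2 mz vb0 varpi_v beta_b dimP X_stationary
  K0_gt0 F0H.
have cray := cov_ray FF_family kappa01 iota_gt0 p1' p'1 pp q1 thetap thetaq
  Gam0 delta0 deltak s'1 ss' thetas theta2 mz vb0 varpi_v beta_b dimP X_stationary K0_gt0 F0H.
have rsh := rho_stationary kappa01 iota_gt0 Gam0 s'1 thetas theta2 mz X_stationary K0_gt0 F0H.
have crs := copies_rho kappa01 iota_gt0 Gam0 s'1 thetas theta2 mz K0_gt0 F0H Y_copies mY.
have orth := copies_orthogonal kappa01 iota_gt0 Gam0 s'1 thetas theta2 mz X_stationary K0_gt0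
  F0H Y_copies mY.
have PH := Hol_piece kappa01 iota_gt0 Gam0 s'1 thetas theta2 mz K0_gt0 F0H.
have KP0 (i : 'I_ell) : 0 < KP wp ell theta Gam (K * (1 + 2 * ell%:R)) + 1.
  by rewrite ltr_wpDl// (Hol_K_ge0 (PH i)).
pose f (i : 'I_ell) n w := piece X F0 i ((slots X (at_time n))^~ w).
pose f' (i : 'I_ell) n w := piece X F0 i ((copies Y n)^~ w).
have i2 : 2 * iota <= theta.
  apply: le_trans thetas; apply: (@le_trans _ _ (2 * iota + 1)); first by rewrite lerDl.
  by apply: ler_peMr; rewrite ?(ltW s'1)// addr_ge0// mulr_ge0// ltW.
have Lf i n : L2 P (f i n).
  apply: (L2_Hol kappa01 (ltW iota_gt0) Gam0 i2 _ (PH i)); by move=> s; exact: mz.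
have Lf' i n : L2 P' (f' i n).
  apply: (L2_Hol kappa01 (ltW iota_gt0) Gam0 i2 _ (PH i)); by move=> s; exact: mY.
(* A common bound for the covariances and, through [|x| <= 1 + x^2], for the means. *)
have C0b i j n k : `|cov X F0 i j n k| <= 1 + `|Cb|.
  by apply: (le_trans (hCb i j n k)); rewrite (le_trans (ler_norm _))// lerDr.
have ex0b i n : `|\int[P]_w f i n w| <= 1 + `|Cb|.
  apply: (le_trans (L2_mean_le (Lf i n))); rewrite lerD2l.
  apply: le_trans (ler_norm Cb); apply: le_trans (hCb i i n n); exact: ler_norm.
have CC0 : 0 <= 1 + `|Cb| by rewrite addr_ge0.
have [S' hS] := decay_sum C1_ge0 C2_ge0 C3_ge0 g_ge0 gS CC0.
exists f, f', (fun i k => rho X F0 i k 0%N), (decay g (1 + `|Cb|) C1 C2 C3), S'.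
split.
(* Averaging all slots gives the iterated integral of [F], which vanishes, so the pieces add up to
   [F] itself. *)
- have avg0 e : averaged X F0 ell e = 0.
    apply: EFin_inj.
    rewrite -(@iter_averaged _ _ _ P wp ell X kappa iota theta Gam _ kappa01 iota_gt0 s'1
      thetas mz _ F0 F0H 0%N ell (EFin \o F) e) ?F_centered// => t /=.
    congr (F _)%:E; apply/eq_from_tnth => i; rewrite tnth_mktuple.
    by apply/eq_from_tnth => c; rewrite tnth_mktuple subn0 (tnth_nth (nseq_tuple wp 0)).
  split=> n w.
    rewrite sum_piece avg0 subr0 /F0; congr F; apply/eq_from_tnth => i.
    by rewrite !tnth_mktuple; apply/eq_from_tnth => c; rewrite tnth_mktuple.
  rewrite sum_piece avg0 subr0 /F0 /Z_; congr F; apply/eq_from_tnth => i.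
  by rewrite !tnth_mktuple; apply/eq_from_tnth => c; rewrite tnth_mktuple.
- by split=> // k; exact: decay_ge0.
- split.
  + exact: (cov_decay C0b C1_ge0 C2_ge0 C3_ge0 g_ge0 cmix).
  + move=> i k; exact: (rho_decay C0b C1_ge0 C2_ge0 C3_ge0 g_ge0 gS cmix crho rsh i 0 k).
  + move=> i n k nk; rewrite -(rsh i k 0%N n) add0n [(k + n)%N]addnC.
    exact: (cov_rho_decay C0b C1_ge0 C2_ge0 C3_ge0 g_ge0 gS crho rsh i nk).
- split; last exact: (ex_decay ex0b C1_ge0 C2_ge0 C3_ge0 g_ge0 exmix).
  move=> i j n0 m0'; have [C [C_ge0 hC]] := cray i j.
  have [D hD] := hC n0 m0'; apply/cvg_ex; exists D.
  apply/cvgrPdist_le => e e0.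
  have eC : 0 < e / (C + 1) by rewrite divr_gt0// ltr_wpDl.
  have [r r1 gr] := small_rate g_ge0 gS eC.
  exists (3 * r + ell * (n0 + m0'))%N => // t /= ht.
  rewrite distrC; apply: (le_trans (hD r t r1 ht)).
  apply: (@le_trans _ _ ((C + 1) * g r)); first by rewrite ler_wpM2r ?g_ge0// lerDl.
  by rewrite mulrC -ler_pdivlMr// ltr_wpDl.
split=> [i n|i j n k].
  rewrite -[RHS](orth i (fun=> 1) 1 n n ltr01 _ _)//.
    by apply: eq_Rintegral => w _; rewrite mul1r.
  split=> [e|e e']; last by rewrite subrr normr0 !mulr_ge0 ?powR_ge0// sumr_ge0.
  rewrite normr1 mul1r -[leLHS](powRr0 (envN e)); apply: ler_powR; [exact: envN_ge1|exact: ltW].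
case: (ltngtP i j) => ij.
- rewrite ifF; last by apply/eqP => e; rewrite e ltnn in ij.
  apply: (orth _ _ _ _ _ (KP0 i)).
    by apply: Hol_mono (PH i); rewrite lerDl.
  by move=> e e' he; apply: piece_ext => s si; apply: he; exact: leq_ltn_trans ij.
- rewrite ifF; last by apply/eqP => e; rewrite e ltnn in ij.
  rewrite (_ : \int[P']_w _ = \int[P']_w (f' j k w * f' i n w)); last first.
    by apply: eq_Rintegral => w _; rewrite mulrC.
  apply: (orth _ _ _ _ _ (KP0 i)).
    by apply: Hol_mono (PH j); rewrite lerDl.
  by move=> e e' he; apply: piece_ext => s si; apply: he; exact: leq_ltn_trans ij.
have {ij}<- : i = j by exact: val_inj.
rewrite eqxx crs; apply: (adist_shift (x := rho X F0 i)); last exact: rsh.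
move=> a c; rewrite -!crs; apply: eq_Rintegral => w _; exact: mulrC.
Qed.

End setting.

Theorem theorem2p3 (R : realType) (d : measure_display) (T : measurableType d)
  (P : probability T R) (wp ell : nat) (wp_ge1 : (1 <= wp)%N)
  (ell_ge1 : (1 <= ell)%N)
  (X : nat -> {RV P >-> wp.-tuple R})
  (FF : \bar int -> \bar int -> set (set T)) (FF_family : sigma_algebra_family FF)
  (X_stationary : stationary_pairs X)
  (F : ell.-tuple (wp.-tuple R) -> R) (K iota kappa : R)
  (K_gt0 : 0 < K) (iota_gt0 : 0 < iota) (kappa_gt0 : 0 < kappa)
  (kappa_le1 : kappa <= 1)
  (F_growth : growth_condition F K iota kappa)
  (F_centered : iter_integral (mu0 X) (EFin \o F) = 0%E)
  (HA : exists alpha lambda : R,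
    [/\ 1 <= alpha, 1 <= lambda &
        assumption_A ell X FF iota kappa 2 alpha lambda])
  (d' : measure_display) (T' : measurableType d') (P' : probability T' R)
  (Y : 'I_ell -> nat -> {RV P' >-> wp.-tuple R})
  (Y_copies : independent_copies X Y) :
  let sigma2 := limn (fun N => 'V_P[xi F X N]%E) in
  exists s2 : R,
    [/\ ((n%:R^-1)%:E * 'V_P'[Sigma_ F Y n])%E @[n --> \oo] --> s2%:E,
        (0 < sigma2)%E <-> 0 < s2,
        0 < s2 <->
          ~ (exists V : nat -> T' -> R,
               L2_weakly_stationary P' V /\ coboundary P' (Z_ F Y) V),
        s2 = 0 <->
          (exists M : R, forall N : nat, ('V_P'[Sigma_ F Y N] <= M%:E)%E) &
        s2 = 0 ->
          exists C : R, 0 < C /\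
            forall N : nat, (2 <= N)%N ->
              ('V_P[xi F X N] <= (C * N%:R^-1 * ln (N%:R) ^+ 2)%:E)%E].
Proof.
move=> sigma2.
have kappa01 : 0 < kappa <= 1 by rewrite kappa_gt0.
have [alpha [lambda [al_ge1 la_ge1 HA']]] := HA.
have [f [f' [r [h [S [[FE ZE] [h0 hS [Lf Lf']] [cd rd crd] [ray exd] [Ef' Eff']]]]]]] :=
  hoeffding_decomposition FF_family X_stationary K_gt0 iota_gt0 kappa01 F_growth F_centered
    al_ge1 la_ge1 HA' Y_copies.
(* Besides the slopes [s], the limits [d0] are kept: at zero slope they are the limits of the
   variances from which the coboundary is built. *)
pose tc i := cid (toeplitz_cvg h0 hS (rd i)); pose s i := sval (tc i).
pose tc' i := cid (svalP (tc i)); pose d0 i := sval (tc' i).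
have hs i : (fun N => toeplitz (r i) N - N%:R * s i) @ \oo --> d0 i := svalP (tc' i).
have [B sB] : exists B, forall i N, `|toeplitz (r i) N - N%:R * s i| <= B.
  pose b i := cid (convergent_bounded (hs i)).
  exists (\sum_i `|sval (b i)|) => i N; apply: (le_trans (svalP (b i) N)).
  by rewrite (bigD1 i)//= (le_trans (ler_norm _))// lerDl sumr_ge0.
have [Lam hLam] := pieces_sum_slope h0 hS Lf cd rd crd ray sB.
have s_ge0 := slope_ge0 Lf' Eff' sB.
have bnd := bounded_copies_sum Lf' Eff' sB.
have LT := L2_pieces_sum Lf; have LT' := L2_copies_sum Lf'.
have ZE' : Z_ F Y = fun n w => \sum_i f' i n w by apply/funext => n; apply/funext => w.
have VS N : 'V_P'[Sigma_ F Y N]%E = (\int[P']_w (copies_sum f' N w ^+ 2))%:E.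
  have -> : Sigma_ F Y N = copies_sum f' N.
    by apply/funext => w; rewrite /Sigma_ ZE'.
  by rewrite variance_Ex// (copies_sum_mean Lf' Ef') expr0n subr0.
have VX N : 'V_P[xi F X N]%E =
    (N%:R^-1 * (\int[P]_w (pieces_sum f N w ^+ 2) - (\int[P]_w pieces_sum f N w) ^+ 2))%:E.
  have -> : xi F X N = fun w => (Num.sqrt N%:R)^-1 * pieces_sum f N w.
    by apply/funext => w; rewrite /xi; congr (_ * _); apply: eq_bigr => n _; exact: FE.
  rewrite variance_Ex; last exact: L2Z.
  have -> : \int[P]_w (((Num.sqrt N%:R)^-1 * pieces_sum f N w) ^+ 2) =
      \int[P]_w (N%:R^-1 * pieces_sum f N w ^+ 2).
    by apply: eq_Rintegral => w _; rewrite exprMn exprVn sqr_sqrtr.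
  rewrite !ExZ; [|by [exact: L2_Int|exact: (LT N).2]..].
  by rewrite exprMn exprVn sqr_sqrtr// mulrBr.
(* The limit exists and is the slope of the second moments, the squared means being bounded. *)
have sigma2E : sigma2 = Lam%:E.
  rewrite /sigma2 (funext VX); apply: cvg_lim => //.
  apply: cvg_EFin; first exact: nearW.
  exact: (pieces_sum_variance_slope h0 hS Lf exd hLam).
exists (\sum_i s i); split.
- rewrite (_ : (fun n => _) = fun n => (n%:R^-1 * \int[P']_w (copies_sum f' n w ^+ 2))%:E).
    apply: cvg_EFin; first exact: nearW.
    exact: (copies_sum_mean_square Lf' Eff' sB).
  by apply/funext => n; rewrite VS.
- by rewrite sigma2E lte_fin; exact: (slope_pos h0 hS Lf Lf' cd rd crd Eff' sB hLam).
- split=> [s2 [V [VL VZ]]|noV].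
    rewrite ZE' in VZ; have /bnd s0 := coboundary_bounded Lf' VL VZ.
    by rewrite s0 ltxx in s2.
  rewrite lt_neqAle sumr_ge0 ?andbT; last by move=> i _.
  apply/eqP => s0; apply: noV; rewrite ZE'.
  apply: (flat_coboundary Lf' Ef' Eff' (d0 := d0)) => i.
  have := hs i; rewrite (slopes_eq0 Lf' Eff' sB (esym s0) i).
  by under eq_fun do rewrite mulr0 subr0.
- rewrite bnd; split=> -[M hM]; exists M => N; have := hM N; by rewrite VS lee_fin.
move=> s0; have [C hC] := flat_pieces_sum h0 hS Lf Lf' cd rd crd Eff' sB s0.
have l2 : 0 < ln (2 : R) by rewrite ln_gt0// ltr1n.
(* [N] times the variance is at most [|C| + 1], and [ln N / ln 2 >= 1] for [N >= 2] supplies the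
   logarithmic factor. *)
exists ((`|C| + 1) / ln 2 ^+ 2); split=> [|N N2]; first by rewrite divr_gt0 ?ltr_wpDl ?exprn_gt0.
have lN : ln (2 : R) ^+ 2 <= ln (N%:R : R) ^+ 2.
  by rewrite lerXn2r ?nnegrE ?ler_ln ?posrE ?ltr0n ?ler_nat ?ln_ge0 ?ler1n// (leq_trans _ N2).
rewrite VX lee_fin [leRHS](_ : _ = N%:R^-1 * ((`|C| + 1) * (ln N%:R ^+ 2 / ln 2 ^+ 2))); last by ring.
rewrite ler_wpM2l ?invr_ge0//.
apply: (@le_trans _ _ (`|C| + 1)).
  by have := hC N; have := ler_norm C; have := sqr_ge0 (\int[P]_w pieces_sum f N w); lra.
by rewrite ler_peMr ?addr_ge0// ler_pdivlMr ?exprn_gt0// mul1r.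
Qed.
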